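(* Let $(S,\nabla^\mu)$ be $k$-perturbed harmonic in $\underline{\mathbb{C}}^6$. Fix $\nu\in\mathbb{C}^\times\setminus S^1$ and let $W\leq\underline{\mathbb{C}}^4$ be a $\nabla^\nu$-parallel subbundle such that $W\oplus jW=\underline{\mathbb{C}}^4$. Define $\mu_0,\mu_1\in\mathbb{C}^\times$ by $$\mu_0=i\,\frac{\nu+1}{\nu-1},\qquad \mu_1=i\,\frac{\nu^*+1}{\nu^*-1},$$ define $X\in\Gamma\mathfrak{gl}(\underline{\mathbb{H}}^2)$ by $X=\mu_0$ on $W$ and $X=\mu_1$ on $jW$, and set $T=X-S\in\Gamma\mathfrak{gl}(\underline{\mathbb{H}}^2)$. Then $P_{\nu,\wedge^2W}$ is an untwisted dressing gauge for $(S,\nabla^\mu)$ on the open set on which $T$ is an isomorphism, and there the untwisted dressing transform of $S$ by $P_{\nu,\wedge^2W}$ is given by $$\hat S=TST^{-1}.$$ In particular, $\hat S$ is $k$-perturbed harmonic. Moreover, when $S$ is the central sphere congruence of a constrained Willmore surface $L$ with multiplier $q$, the untwisted dressing transform of $L$ by $P_{\nu,\wedge^2W}$, together with its multiplier, is given by $$\hat L=TL,\qquad \hat q=TqT^{-1}.$$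
   Context: Setting. $\Sigma$ is a Riemann surface; underlining denotes trivial bundles over $\Sigma$, $d$ is the trivial connection, $\nu^*=1/\bar\nu$, $g\cdot\nabla=g\circ\nabla\circ g^{-1}$. Quaternionic formalism. $\mathbb{C}^4$ carries a quaternionic structure $j$ (anti-linear, $j^2=-1$), so $\mathbb{H}^2=(\mathbb{C}^4,j)$, and $\det\in\wedge^4(\mathbb{C}^4)^*$ with $j^*\det=\overline{\det}$ and $\det(v_1\wedge v_2\wedge jv_1\wedge jv_2)>0$ when non-zero. $\mathbb{C}^6:=\wedge^2\mathbb{C}^4$ has real structure $\overline{v_1\wedge v_2}=jv_1\wedge jv_2$ and inner product $(\xi,\eta)=\det(\xi\wedge\eta)$, of signature $(5,1)$ on the real points $\mathbb{R}^{5,1}$. $\mathfrak{gl}(\mathbb{H}^2)$, $\mathrm{SL}(\mathbb{H}^2)$ and $\mathfrak{sl}(\mathbb{H}^2)$ denote the elements of $\mathfrak{gl}(\mathbb{C}^4)$, $\mathrm{SL}(\mathbb{C}^4)$, $\mathfrak{sl}(\mathbb{C}^4)$ commuting with $j$. The action on $\wedge^2\mathbb{C}^4$ gives $\mathfrak{sl}(\mathbb{C}^4)\cong\mathfrak{o}(\mathbb{C}^6)$; via this, metric connections $d+\beta$ on $\underline{\mathbb{C}}^6$ are also viewed as connections on $\underline{\mathbb{C}}^4$. An oriented bundle $V$ of $(3,1)$-planes in $\underline{\mathbb{R}}^{5,1}$ (identified with its complexification) is the same as $S\in\Gamma\mathrm{SL}(\underline{\mathbb{H}}^2)$ with $S^2=-1$: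 with $S^\pm$ the $\pm i$-eigenbundles of $S$ (so $S^-=jS^+$), $V=S^+\wedge S^-$ and $V^\perp=V^\perp_+\oplus V^\perp_-$ with $V^\perp_\pm=\wedge^2S^\pm$ null lines. $k$-perturbed harmonic. $\rho_V$ is reflection across $V$ ($-1$ on $V^\perp$). $(V,d^\lambda)$ is $k$-perturbed harmonic if $d^\lambda$, $\lambda\in\mathbb{C}^\times$, is a family of flat metric connections on $\underline{\mathbb{C}}^6$ with $d^1=d$, $\rho_V\cdot d^\lambda=d^{-\lambda}$, $d^{\lambda^*}=\overline{d^\lambda}$, and $\lambda\mapsto(d^\lambda)^{1,0}$ is holomorphic on $\mathbb{C}$ with a pole of order $k$ at $\infty$. For complementary (i.e. pointwise non-orthogonal) null lines $L^\pm$, $\Gamma^{L^+}_{L^-}(\lambda)$ is multiplication by $\lambda$ on $L^+$, $1$ on $(L^+\oplus L^-)^\perp$, $\lambda^{-1}$ on $L^-$. With $\tau_V=\Gamma^{V^\perp_+}_{V^\perp_-}$, the untwisted family $\nabla^\mu$ is defined by $\nabla^{\lambda^2}=\tau_V(\lambda)\cdot d^\lambda$. One calls $(V,d^\lambda)$, $(V,\nabla^\mu)$ or $(S,\nabla^\mu)$ the $k$-perturbed harmonic bundle. Untwisted dressing. An untwisted dressing gauge for $(V,\nabla^\mu)$ is a family $\mu\mapsto R(\mu)\in\Gamma\mathrm{O}(\underline{\mathbb{C}}^6)$, $\mu\in\mathrm{dom}(R)\subset\mathbb{P}^1$, holomorphic near $0,\infty$, with (a) $R(\mu^* )=\overline{R(\mu)}$;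 (b) $R(\mu)\cdot\nabla^\mu$ extends from $\mathrm{dom}(R)\setminus\{0,\infty\}$ to a holomorphic family $\hat\nabla^\mu$ on $\mathbb{C}^\times$ with $\hat\nabla^1=d$; (c) $R(0)V^\perp_-$ and $R(\infty)V^\perp_+$ are complementary. The untwisted dressing transform is $(\hat V,\hat\nabla^\mu)$ with $\hat V=(R(0)V^\perp_-\oplus R(\infty)V^\perp_+)^\perp$, oriented so that $\hat V^\perp_-=R(0)V^\perp_-$, $\hat V^\perp_+=R(\infty)V^\perp_+$; $\hat S$ is the corresponding section of $\mathrm{SL}(\underline{\mathbb{H}}^2)$. For $\nu\in\mathbb{C}^\times\setminus S^1$ and a null line bundle $M$ with $M,\overline M$ complementary, $P_{\nu,M}(\mu)=\Gamma^M_{\overline M}\bigl(\tfrac{(1-\nu^* )(\mu-\nu)}{(1-\nu)(\mu-\nu^* )}\bigr)$. Surfaces. $S^4$ is the projectivised light-cone of $\mathbb{R}^{5,1}$; a map $\Sigma\to S^4$ is a real null line subbundle $\Lambda\leq\underline{\mathbb{C}}^6$, or equivalently a $j$-stable rank $2$ subbundle $L\leq\underline{\mathbb{C}}^4$ with $\Lambda=\wedge^2L$. For a section $\sigma$ of $\Lambda$ put $\Lambda^{(1)}=\langle\sigma,d\sigma(T\Sigma)\rangle$, $\Lambda^{1,0}=\langle\sigma,d\sigma(T^{1,0}\Sigma)\rangle$, $\Lambda^{0,1}=\overline{\Lambda^{1,0}}$; $\Lambda$ is a conformal immersion iff $\Lambda^{(1)}$ has rank $3$ and $\Lambda^{1,0}$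 is isotropic. Its central sphere congruence is $V=\Lambda^{(1)}\oplus\langle\Delta\sigma\rangle$ ($\Delta$ the Laplacian of $(d\sigma,d\sigma)$), oriented so that the corresponding $S$ satisfies $SL=L$ and $\Lambda^{1,0}=S^+\wedge L^-$, $\Lambda^{0,1}=L^+\wedge S^-$, where $L^\pm=L\cap S^\pm$. Write $d=\mathcal{D}_V+\mathcal{N}_V$ with $V,V^\perp$ $\mathcal{D}_V$-parallel, $\mathcal{N}_V\in\Omega^1(V\wedge V^\perp)$. $L$ (or $\Lambda$) is constrained Willmore with multiplier $q$ if $q\in\Omega^1(\Lambda\wedge\Lambda^{(1)})$ is real (viewed also as $\mathfrak{sl}(\mathbb{H}^2)$-valued), $d^{\mathcal{D}_V}q=0$ and $d^{\mathcal{D}_V}{*}\mathcal{N}_V=2[q\wedge*\mathcal{N}_V]$. Then $V$ is $2$-perturbed harmonic with $d^\lambda=\mathcal{D}_V+\lambda\mathcal{N}_V^{1,0}+\lambda^{-1}\mathcal{N}_V^{0,1}+(\lambda^2-1)q^{1,0}+(\lambda^{-2}-1)q^{0,1}$ ($q=0$ allowed). The untwisted dressing transform of $\Lambda$ by $R$ is $\hat\Lambda=(\pi_{\hat V}R(0)\Lambda^{1,0})\cap(\pi_{\hat V}R(\infty)\Lambda^{0,1})$, with multiplier $\hat q=\mathrm{Ad}_{\pi_{\hat V}R(\infty)}q^{1,0}+\mathrm{Ad}_{\pi_{\hat V}R(0)}q^{0,1}$, where $\pi_{\hat V}$ is orthogonal projection onto $\hat V$ and, for $A:V\to\hat V$,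 $\mathrm{Ad}_A(u\wedge v)=Au\wedge Av$; it is constrained Willmore with central sphere congruence $\hat V$ where it immerses. $\hat L$ is the $j$-stable rank $2$ bundle with $\wedge^2\hat L=\hat\Lambda$. *)

(* Defs.v *)
From HB Require Import structures.
From mathcomp Require Import all_boot all_order all_algebra.
From mathcomp Require Import complex.
From mathcomp Require Import all_classical all_reals all_analysis.

Set Implicit Arguments.
Unset Strict Implicit.
Unset Printing Implicit Defensive.

Import Order.TTheory GRing.Theory Num.Theory.
Import numFieldNormedType.Exports.

Local Open Scope classical_set_scope.
Local Open Scope ring_scope.

Section Calculus.
Variable R : realType.

(* [D] is open in every use; [R[i]^o] carries the usual topology of C, so this is
   complex differentiability at every point of [D]. *)
Definition hol_on (D : set R[i]^o) (f : R[i]^o -> R[i]^o) : Prop :=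
  forall z, D z -> derivable f z 1.

Fixpoint Cn_on (n : nat) (D : set (R * R)%type) (h : (R * R)%type -> R) : Prop :=
  match n with
  | 0 => forall a, D a -> {for a, continuous h}
  | m.+1 => (forall a, D a -> differentiable h a) /\
            (forall v, Cn_on m D (fun a => 'D_v h a))
  end.

Definition Cinf_on (D : set (R * R)%type) (h : (R * R)%type -> R) : Prop :=
  forall n, Cn_on n D h.

Definition toC (a : (R * R)%type) : R[i]^o := (a.1 +i* a.2)%C.
Definition ofC (z : R[i]^o) : (R * R)%type := (complex.Re z, complex.Im z).

Definition cstar (z : R[i]) : R[i] := (conjc z)^-1.

End Calculus.

(* Connectedness is not required: the notions below are used on arbitrary open
   subsets. *)
Record riemannSurface (R : realType) := RiemannSurface {
  rs_points :> topologicalType;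
  rs_hausdorff : hausdorff_space rs_points;
  chart : Type;
  cdom : chart -> set rs_points;
  cmap : chart -> rs_points -> R[i]^o;
  cinv : chart -> R[i]^o -> rs_points;
  cdom_cover : forall p, exists c, cdom c p;
  cdom_open : forall c, open (cdom c);
  cimg_open : forall c, open (cmap c @` cdom c);
  cmapK : forall c p, cdom c p -> cinv c (cmap c p) = p;
  cmap_cont : forall c, {within cdom c, continuous (cmap c)};
  cinv_cont : forall c, {within cmap c @` cdom c, continuous (cinv c)};
  transition_hol : forall c c' p, cdom c p -> cdom c' p ->
    derivable (cmap c' \o cinv c : R[i]^o -> R[i]^o) (cmap c p) 1
}.

Section SurfaceCalculus.
Variables (R : realType) (Sg : riemannSurface R).
Local Notation C := R[i].

Definition in_chart (c : chart Sg) (f : Sg -> C) : (R * R)%type -> C :=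
  fun a => f (cinv c (toC a)).

Definition smooth_on m n (U : set Sg) (f : Sg -> 'M[C]_(m, n)) : Prop :=
  forall (c : chart Sg) i j,
    let D := [set a | (cmap c @` (U `&` cdom c)) (toC a)] in
    Cinf_on D (@complex.Re R \o in_chart c (fun x => f x i j)) /\
    Cinf_on D (@complex.Im R \o in_chart c (fun x => f x i j)).

Definition pderiv (v : (R * R)%type) (c : chart Sg) (f : Sg -> C) (p : Sg) : C :=
  ('D_v (@complex.Re R \o in_chart c f) (ofC (cmap c p)) +i*
   'D_v (@complex.Im R \o in_chart c f) (ofC (cmap c p)))%C.

(* the Wirtinger derivatives d/dz = (d/dx - i d/dy)/2, d/dzbar = (d/dx + i d/dy)/2 *)
Definition dz m n (c : chart Sg) (f : Sg -> 'M[C]_(m, n)) (p : Sg) : 'M[C]_(m, n) :=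
  \matrix_(i, j) ((pderiv (1, 0) c (fun x => f x i j) p
                   - 'i%C * pderiv (0, 1) c (fun x => f x i j) p) / 2%:R).
Definition dzb m n (c : chart Sg) (f : Sg -> 'M[C]_(m, n)) (p : Sg) : 'M[C]_(m, n) :=
  \matrix_(i, j) ((pderiv (1, 0) c (fun x => f x i j) p
                   + 'i%C * pderiv (0, 1) c (fun x => f x i j) p) / 2%:R).

(* A matrix-valued 1-form w is given by its coefficients in every chart:
   w = (w c p).1 dz + (w c p).2 dzbar, so that the first component is the
   (1,0)-part.  A connection d + w on a trivial bundle is represented by w. *)
Definition form1 n := chart Sg -> Sg -> 'M[C]_n * 'M[C]_n.

Definition is_form n (U : set Sg) (w : form1 n) : Prop :=
  (forall c, smooth_on (U `&` cdom c) (fun p => (w c p).1) /\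
             smooth_on (U `&` cdom c) (fun p => (w c p).2)) /\
  (forall c c' p, U p -> cdom c p -> cdom c' p ->
     let dz'dz := 'D_1 (cmap c' \o cinv c : C^o -> C^o) (cmap c p) in
     (w c p).1 = dz'dz *: (w c' p).1 /\ (w c p).2 = conjc dz'dz *: (w c' p).2).

Definition form_eq n (U : set Sg) (w w' : form1 n) : Prop :=
  forall c p, U p -> cdom c p -> w c p = w' c p.

Definition zero_form n : form1 n := fun _ _ => (0, 0).

Definition brk n (A B : 'M[C]_n) : 'M[C]_n := A *m B - B *m A.

(* coefficients of dz /\ dzbar: the curvature of d + w, the exterior covariant
   derivative d^{d+a} w, and the bracket [v /\ w](X,Y) = [v_X,w_Y] - [v_Y,w_X] *)
Definition curvature n (w : form1 n) c p : 'M[C]_n :=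
  dz c (fun x => (w c x).2) p - dzb c (fun x => (w c x).1) p
  + brk (w c p).1 (w c p).2.
Definition dcov n (a w : form1 n) c p : 'M[C]_n :=
  dz c (fun x => (w c x).2) p + brk (a c p).1 (w c p).2
  - (dzb c (fun x => (w c x).1) p + brk (a c p).2 (w c p).1).
Definition brkwedge n (v w : form1 n) c p : 'M[C]_n :=
  brk (v c p).1 (w c p).2 - brk (v c p).2 (w c p).1.

(* *dz = - i dz, *dzbar = i dzbar *)
Definition hodge n (w : form1 n) : form1 n :=
  fun c p => (- 'i%C *: (w c p).1, 'i%C *: (w c p).2).

Definition flat n (U : set Sg) (w : form1 n) : Prop :=
  forall c p, U p -> cdom c p -> curvature w c p = 0.

(* g . (d + w) = g o (d + w) o g^-1 *)
Definition gauge n (g : Sg -> 'M[C]_n) (w : form1 n) : form1 n :=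
  fun c p => (g p *m (w c p).1 *m invmx (g p) - dz c g p *m invmx (g p),
              g p *m (w c p).2 *m invmx (g p) - dzb c g p *m invmx (g p)).

Definition subbundle n (U : set Sg) (r : nat) (E : Sg -> {vspace 'cV[C]_n}) : Prop :=
  forall p, U p -> exists N (s : 'I_r -> Sg -> 'cV[C]_n),
    [/\ open N, N p, N `<=` U, (forall k, smooth_on N (s k)) &
        forall x, N x -> basis_of (E x) [seq s k x | k : 'I_r]].

Definition parallel n (U : set Sg) (w : form1 n) (E : Sg -> {vspace 'cV[C]_n}) : Prop :=
  forall N (s : Sg -> 'cV[C]_n), open N -> N `<=` U -> smooth_on N s ->
    (forall x, N x -> s x \in E x) ->
    forall c p, N p -> cdom c p ->
      dz c s p + (w c p).1 *m s p \in E p /\ dzb c s p + (w c p).2 *m s p \in E p.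

Definition hol_family n (U : set Sg) (D : set C^o) (w : C -> form1 n) : Prop :=
  forall c p, U p -> cdom c p -> forall i j,
    hol_on D (fun z => (w z c p).1 i j) /\ hol_on D (fun z => (w z c p).2 i j).

End SurfaceCalculus.
Arguments form1 {R} Sg n.

Section Subspaces.
Variable K : fieldType.

Definition mximg n (g : 'M[K]_n) (E : {vspace 'cV[K]_n}) : {vspace 'cV[K]_n} :=
  (linfun (mulmx g : 'cV[K]_n -> 'cV[K]_n) @: E)%VS.

Definition eigsp n (g : 'M[K]_n) (a : K) : {vspace 'cV[K]_n} :=
  passmx.leigenspace (linfun (mulmx g : 'cV[K]_n -> 'cV[K]_n)) a.

Definition mx_of n (f : 'End('cV[K]_n)) : 'M[K]_n :=
  \matrix_(i, j) f (delta_mx j 0) i 0.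

End Subspaces.

(* jmx is the matrix of the anti-linear map j, qvol the ratio of the chosen
   element of /\^4 (C^4)^* to the standard determinant *)
Definition qj_of (R : realType) (jmx : 'M[R[i]]_4) (v : 'cV[R[i]]_4) : 'cV[R[i]]_4 :=
  jmx *m map_mx (@conjc R) v.
Definition det4_of (R : realType) (qvol : R[i]) (v1 v2 v3 v4 : 'cV[R[i]]_4) : R[i] :=
  qvol * \det (\matrix_(a < 4, k < 4) (tnth [tuple v1; v2; v3; v4] k) a 0).

Record quaternionic (R : realType) := Quaternionic {
  jmx : 'M[R[i]]_4;
  qvol : R[i];
  qj_sq : forall v, qj_of jmx (qj_of jmx v) = - v;
  qvol_neq0 : qvol != 0;
  qdet_conj : forall v1 v2 v3 v4,
    det4_of qvol (qj_of jmx v1) (qj_of jmx v2) (qj_of jmx v3) (qj_of jmx v4)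
    = conjc (det4_of qvol v1 v2 v3 v4);
  qdet_pos : forall v1 v2,
    det4_of qvol v1 v2 (qj_of jmx v1) (qj_of jmx v2) != 0 ->
    0 < det4_of qvol v1 v2 (qj_of jmx v1) (qj_of jmx v2)
}.

Section WedgeSquare.
Variable K : fieldType.

(* the basis e_a /\ e_b, a < b, of /\^2 K^4 *)
Definition pairs6 : 6.-tuple ('I_4 * 'I_4) :=
  let o k (h : (k < 4)%N) := Ordinal h in
  [tuple (o 0%N isT, o 1%N isT); (o 0%N isT, o 2%N isT); (o 0%N isT, o 3%N isT);
         (o 1%N isT, o 2%N isT); (o 1%N isT, o 3%N isT); (o 2%N isT, o 3%N isT)].
Definition pa (e : 'I_6) : 'I_4 := (tnth pairs6 e).1.
Definition pb (e : 'I_6) : 'I_4 := (tnth pairs6 e).2.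

Definition wedge (u v : 'cV[K]_4) : 'cV[K]_6 :=
  \col_e (u (pa e) 0 * v (pb e) 0 - u (pb e) 0 * v (pa e) 0).

(* the induced action of gl(4) by derivations, and of matrices multiplicatively *)
Definition dwedgemx (X : 'M[K]_4) : 'M[K]_6 :=
  \matrix_(e, f) (wedge (X *m delta_mx (pa f) 0) (delta_mx (pb f) 0) e 0
                  + wedge (delta_mx (pa f) 0) (X *m delta_mx (pb f) 0) e 0).
Definition wedgemx (g : 'M[K]_4) : 'M[K]_6 :=
  \matrix_(e, f) wedge (g *m delta_mx (pa f) 0) (g *m delta_mx (pb f) 0) e 0.

(* The inverse o(6) -> sl(4) of [dwedgemx]: writing B_{ab,cd} for the entries of
   B, antisymmetrised in (a,b) and (c,d), B = dwedgemx X gives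
   \sum_b B_{ab,cb} = 2 X_{ac} + delta_{ac} tr X. *)
Definition o2sl (B : 'M[K]_6) : 'M[K]_4 :=
  \matrix_(a, c) (2%:R^-1 * \sum_b
    ((wedge (delta_mx a 0) (delta_mx b 0))^T *m B
       *m wedge (delta_mx c 0) (delta_mx b 0)) 0 0).

Definition wedgesp (E F : {vspace 'cV[K]_4}) : {vspace 'cV[K]_6} :=
  <<[seq wedge u v | u <- vbasis E, v <- vbasis F]>>%VS.

End WedgeSquare.

Section Conformal.
Variables (R : realType) (Q : quaternionic R).
Local Notation C := R[i].
Local Notation conjmx := (map_mx (@conjc R)).

Definition qj : 'cV[C]_4 -> 'cV[C]_4 := qj_of (jmx Q).
Definition det4 : 'cV[C]_4 -> 'cV[C]_4 -> 'cV[C]_4 -> 'cV[C]_4 -> C :=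
  det4_of (qvol Q).

Definition comm_j (X : 'M[C]_4) : Prop := forall v, X *m qj v = qj (X *m v).

Definition jimg (E : {vspace 'cV[C]_4}) : {vspace 'cV[C]_4} :=
  <<[seq qj v | v <- vbasis E]>>%VS.

(* the Gram matrix of (xi, eta) = det (xi /\ eta) *)
Definition gram : 'M[C]_6 :=
  \matrix_(e, f) det4 (delta_mx (pa e) 0) (delta_mx (pb e) 0)
                      (delta_mx (pa f) 0) (delta_mx (pb f) 0).
Definition ip (u v : 'cV[C]_6) : C := (u^T *m gram *m v) 0 0.

Definition perp (E : {vspace 'cV[C]_6}) : {vspace 'cV[C]_6} :=
  (\bigcap_(u <- vbasis E)
     lker (linfun (mulmx (u^T *m gram) : 'cV[C]_6 -> 'M[C]_1)))%VS.

Definition conj6 (u : 'cV[C]_6) : 'cV[C]_6 := wedgemx (jmx Q) *m conjmx u.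
Definition conjsp6 (E : {vspace 'cV[C]_6}) : {vspace 'cV[C]_6} :=
  <<[seq conj6 v | v <- vbasis E]>>%VS.
Definition bar6 (M : 'M[C]_6) : 'M[C]_6 :=
  wedgemx (jmx Q) *m conjmx M *m invmx (wedgemx (jmx Q)).

Definition skew6 (B : 'M[C]_6) : Prop :=
  forall u v, ip (B *m u) v + ip u (B *m v) = 0.
Definition orth6 (g : 'M[C]_6) : Prop :=
  forall u v, ip (g *m u) (g *m v) = ip u v.

(* /\^2 C^6 = o(C^6), (u /\ v) w = (u, w) v - (v, w) u *)
Definition owedge (u v : 'cV[C]_6) : 'M[C]_6 :=
  v *m (u^T *m gram) - u *m (v^T *m gram).
Definition owedgesp (E F : {vspace 'cV[C]_6}) : {vspace 'M[C]_6} :=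
  <<[seq owedge u v | u <- vbasis E, v <- vbasis F]>>%VS.

(* Ad_A (u /\ v) = A u /\ A v, that is, A B A^* with A^* the transpose of A for
   the inner product *)
Definition Adwedge (A B : 'M[C]_6) : 'M[C]_6 :=
  A *m B *m (invmx gram *m A^T *m gram).

(* two null lines are complementary when they are not orthogonal *)
Definition complementary (Lp Lm : {vspace 'cV[C]_6}) : Prop :=
  [/\ \dim Lp = 1%N, \dim Lm = 1%N,
      (forall u v, u \in Lp -> v \in Lp -> ip u v = 0),
      (forall u v, u \in Lm -> v \in Lm -> ip u v = 0) &
      exists u v, [/\ u \in Lp, v \in Lm & ip u v != 0]].

Definition Gam (Lp Lm : {vspace 'cV[C]_6}) (z : C) : 'M[C]_6 :=
  let O := perp (Lp + Lm) in
  mx_of (z *: daddv_pi Lp (Lm + O) + daddv_pi O (Lp + Lm)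
         + z^-1 *: daddv_pi Lm (Lp + O)).

(* orthogonal projection onto E, and reflection across E, for E nondegenerate *)
Definition oproj (E : {vspace 'cV[C]_6}) : 'M[C]_6 := mx_of (daddv_pi E (perp E)).
Definition orefl (E : {vspace 'cV[C]_6}) : 'M[C]_6 :=
  mx_of (daddv_pi E (perp E) - daddv_pi (perp E) E).

Definition Sp (S : 'M[C]_4) := eigsp S 'i%C.
Definition Sm (S : 'M[C]_4) := eigsp S (- 'i%C).
Definition Vof (S : 'M[C]_4) := wedgesp (Sp S) (Sm S).
Definition Vpp (S : 'M[C]_4) := wedgesp (Sp S) (Sp S).
Definition Vpm (S : 'M[C]_4) := wedgesp (Sm S) (Sm S).

End Conformal.

Section Harmonic.
Variables (R : realType) (Q : quaternionic R) (Sg : riemannSurface R).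
Local Notation C := R[i].

(* sections over U of gl(H^2), and of SL(H^2) with square -1 *)
Definition gl_section (U : set Sg) (X : Sg -> 'M[C]_4) : Prop :=
  smooth_on U X /\ forall p, U p -> comm_j Q (X p).
Definition sphere_bundle (U : set Sg) (S : Sg -> 'M[C]_4) : Prop :=
  [/\ gl_section U S, (forall p, U p -> \det (S p) = 1) &
      forall p, U p -> S p *m S p = - 1%:M].

Definition form4 (w : form1 Sg 6) : form1 Sg 4 :=
  fun c p => (o2sl (w c p).1, o2sl (w c p).2).

Definition metric (U : set Sg) (w : form1 Sg 6) : Prop :=
  forall c p, U p -> cdom c p -> skew6 Q (w c p).1 /\ skew6 Q (w c p).2.

Definition conj_form (w : form1 Sg 6) : form1 Sg 6 :=
  fun c p => (bar6 Q (w c p).2, bar6 Q (w c p).1).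

(* (d^lambda)^{1,0} extends holomorphically to C, with at most a pole of order k
   at infinity: w^k (d^{1/w})^{1,0} is holomorphic at w = 0 *)
Definition pole_le (U : set Sg) (k : nat) (d : C -> form1 Sg 6) : Prop :=
  forall c p, U p -> cdom c p -> forall i j, exists F G : C^o -> C^o,
    [/\ hol_on setT F, hol_on setT G,
        (forall z : C, z != 0 -> F z = (d z c p).1 i j) &
        (forall z : C, z != 0 -> G z = z ^+ k * F z^-1)].

Record twisted_harmonic (U : set Sg) (k : nat) (S : Sg -> 'M[C]_4)
    (d : C -> form1 Sg 6) : Prop := TwistedHarmonic {
  th_sphere : sphere_bundle U S;
  th_form : forall z, z != 0 -> is_form U (d z);
  th_metric : forall z, z != 0 -> metric U (d z);
  th_flat : forall z, z != 0 -> flat U (d z);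
  th_one : form_eq U (d 1) (@zero_form _ Sg 6);
  th_refl : forall z, z != 0 ->
    form_eq U (gauge (fun p => orefl Q (Vof (S p))) (d z)) (d (- z));
  th_real : forall z, z != 0 -> form_eq U (d (cstar z)) (conj_form (d z));
  th_pole : pole_le U k d
}.

Definition tau (S : Sg -> 'M[C]_4) (z : C) : Sg -> 'M[C]_6 :=
  fun p => Gam Q (Vpp (S p)) (Vpm (S p)) z.

Definition untwisted (U : set Sg) (S : Sg -> 'M[C]_4) (d nabla : C -> form1 Sg 6) :=
  forall z, z != 0 -> form_eq U (nabla (z ^+ 2)) (gauge (tau S z) (d z)).

Definition perturbed_harmonic (U : set Sg) (k : nat) (S : Sg -> 'M[C]_4)
    (nabla : C -> form1 Sg 6) : Prop :=
  exists d, twisted_harmonic U k S d /\ untwisted U S d nabla.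

(* the Riemann sphere; None is infinity *)
Definition P1 := option C.
Definition pstar (m : P1) : P1 :=
  match m with
  | None => Some 0
  | Some z => if z == 0 then None else Some (cstar z)
  end.
(* the coordinate centred at infinity *)
Definition pinv (z : C) : P1 := if z == 0 then None else Some z^-1.

Record dressing_gauge (U : set Sg) (S : Sg -> 'M[C]_4) (nabla : C -> form1 Sg 6)
    (dom : set P1) (Rd : P1 -> Sg -> 'M[C]_6) (hnabla : C -> form1 Sg 6) : Prop :=
  DressingGauge {
  dg_orth : forall m, dom m ->
    smooth_on U (Rd m) /\ forall p, U p -> orth6 Q (Rd m p);
  dg_hol0 : exists D : set C^o, [/\ open D, D 0, (forall z, D z -> dom (Some z)) &
    forall p, U p -> forall i j, hol_on D (fun z => Rd (Some z) p i j)];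
  dg_holoo : exists D : set C^o, [/\ open D, D 0, (forall z, D z -> dom (pinv z)) &
    forall p, U p -> forall i j, hol_on D (fun z => Rd (pinv z) p i j)];
  dg_real : forall m, dom m -> dom (pstar m) /\
    forall p, U p -> Rd (pstar m) p = bar6 Q (Rd m p);
  dg_ext : forall z, z != 0 -> dom (Some z) ->
    form_eq U (hnabla z) (gauge (Rd (Some z)) (nabla z));
  dg_form : forall z, z != 0 -> is_form U (hnabla z);
  dg_hol : hol_family U [set z : C^o | z != 0] hnabla;
  dg_one : form_eq U (hnabla 1) (@zero_form _ Sg 6);
  dg_compl : forall p, U p ->
    complementary Q (mximg (Rd (Some 0) p) (Vpm (S p))) (mximg (Rd None p) (Vpp (S p)))
}.

Definition is_dressing_gauge (U : set Sg) (S : Sg -> 'M[C]_4)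
    (nabla : C -> form1 Sg 6) (dom : set P1) (Rd : P1 -> Sg -> 'M[C]_6) : Prop :=
  exists hnabla, dressing_gauge U S nabla dom Rd hnabla.

(* hS is the section of SL(H^2) corresponding to the dressed oriented bundle *)
Definition dressed_sphere (U : set Sg) (S : Sg -> 'M[C]_4)
    (Rd : P1 -> Sg -> 'M[C]_6) (hS : Sg -> 'M[C]_4) : Prop :=
  sphere_bundle U hS /\
  forall p, U p ->
    let hm := mximg (Rd (Some 0) p) (Vpm (S p)) in
    let hp := mximg (Rd None p) (Vpp (S p)) in
    [/\ Vof (hS p) = perp Q (hm + hp), Vpm (hS p) = hm & Vpp (hS p) = hp].

Definition dom_P (nu : C) : set P1 :=
  [set m | m <> Some nu /\ m <> Some (cstar nu)].
Definition P_gauge (nu : C) (M : Sg -> {vspace 'cV[C]_6}) (m : P1) : Sg -> 'M[C]_6 :=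
  fun p => Gam Q (M p) (conjsp6 Q (M p))
    match m with
    | None => (1 - cstar nu) / (1 - nu)
    | Some z => ((1 - cstar nu) * (z - nu)) / ((1 - nu) * (z - cstar nu))
    end.

(* nowhere-zero real local sections *)
Definition local_lift (Lam : Sg -> {vspace 'cV[C]_6}) (N : set Sg)
    (s : Sg -> 'cV[C]_6) : Prop :=
  [/\ open N, smooth_on N s &
      forall x, N x -> [/\ s x \in Lam x, s x != 0 & conj6 Q (s x) = s x]].

(* E10 = Lambda^{1,0} and E1 = Lambda^{(1)}; they do not depend on the section *)
Definition osculating (Lam E10 E1 : Sg -> {vspace 'cV[C]_6}) : Prop :=
  forall N s c p, local_lift Lam N s -> N p -> cdom c p ->
    E10 p = <<[:: s p; dz c s p]>>%VS /\
    E1 p = <<[:: s p; dz c s p; dzb c s p]>>%VS.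

Definition conformal_immersion (E10 E1 : Sg -> {vspace 'cV[C]_6}) : Prop :=
  forall p, \dim (E1 p) = 3%N /\
    forall u v, u \in E10 p -> v \in E10 p -> ip Q u v = 0.

(* for conformal s, (ds,ds) = 2 (s_z, s_zbar) dz dzbar, whose Laplacian is
   2 / (s_z, s_zbar) d/dz d/dzbar *)
Definition laplacian (s : Sg -> 'cV[C]_6) (c : chart Sg) (p : Sg) : 'cV[C]_6 :=
  (2%:R / ip Q (dz c s p) (dzb c s p)) *: dz c (dzb c s) p.

Definition central_sphere (S : Sg -> 'M[C]_4) (L : Sg -> {vspace 'cV[C]_4})
    (E10 E1 : Sg -> {vspace 'cV[C]_6}) : Prop :=
  [/\ sphere_bundle setT S,
      (forall N s c p, local_lift (fun x => wedgesp (L x) (L x)) N s ->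
         N p -> cdom c p -> Vof (S p) = (E1 p + <[laplacian s c p]>)%VS),
      (forall p, mximg (S p) (L p) = L p),
      (forall p, E10 p = wedgesp (Sp (S p)) (L p :&: Sm (S p))%VS) &
      (forall p, conjsp6 Q (E10 p) = wedgesp (L p :&: Sp (S p))%VS (Sm (S p)))].

Definition opp_form n (w : form1 Sg n) : form1 Sg n :=
  fun c p => (- (w c p).1, - (w c p).2).

(* d = (d - N) + N with d - N preserving V and its orthogonal *)
Definition is_NV (S : Sg -> 'M[C]_4) (N : form1 Sg 6) : Prop :=
  [/\ is_form setT N,
      (forall c p, cdom c p ->
         let VV := owedgesp Q (Vof (S p)) (perp Q (Vof (S p))) in
         (N c p).1 \in VV /\ (N c p).2 \in VV),
      parallel setT (opp_form N) (fun p => Vof (S p)) &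
      parallel setT (opp_form N) (fun p => perp Q (Vof (S p)))].

(* L, with Lambda^{1,0} = E10 and Lambda^{(1)} = E1, is constrained Willmore with
   central sphere congruence S, N = N_V and multiplier q *)
Record constrained_willmore (S : Sg -> 'M[C]_4) (L : Sg -> {vspace 'cV[C]_4})
    (E10 E1 : Sg -> {vspace 'cV[C]_6}) (N q : form1 Sg 6) : Prop :=
  ConstrainedWillmore {
  cw_bundle : subbundle setT 2 L;
  cw_jstable : forall p, jimg Q (L p) = L p;
  cw_osc : osculating (fun p => wedgesp (L p) (L p)) E10 E1;
  cw_immersion : conformal_immersion E10 E1;
  cw_sphere : central_sphere S L E10 E1;
  cw_N : is_NV S N;
  cw_form : is_form setT q;
  cw_val : forall c p, cdom c p ->
    let E := owedgesp Q (wedgesp (L p) (L p)) (E1 p) in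
    (q c p).1 \in E /\ (q c p).2 \in E;
  cw_real : form_eq setT q (conj_form q);
  cw_closed : forall c p, cdom c p -> dcov (opp_form N) q c p = 0;
  cw_EL : forall c p, cdom c p ->
    dcov (opp_form N) (hodge N) c p = 2%:R *: brkwedge q (hodge N) c p
}.

(* D + z N^{1,0} + z^-1 N^{0,1} + (z^2 - 1) q^{1,0} + (z^-2 - 1) q^{0,1}, D = d - N *)
Definition cw_family (N q : form1 Sg 6) (z : C) : form1 Sg 6 :=
  fun c p => (- (N c p).1 + z *: (N c p).1 + (z ^+ 2 - 1) *: (q c p).1,
              - (N c p).2 + z^-1 *: (N c p).2 + (z ^- 2 - 1) *: (q c p).2).

Definition dressed_surface (U : set Sg) (hS : Sg -> 'M[C]_4)
    (Rd : P1 -> Sg -> 'M[C]_6) (E10 : Sg -> {vspace 'cV[C]_6})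
    (hL : Sg -> {vspace 'cV[C]_4}) : Prop :=
  [/\ subbundle U 2 hL, (forall p, U p -> jimg Q (hL p) = hL p) &
      forall p, U p ->
        let pi := oproj Q (Vof (hS p)) in
        wedgesp (hL p) (hL p) =
          (mximg (pi *m Rd (Some 0%R) p) (E10 p)
           :&: mximg (pi *m Rd None p) (conjsp6 Q (E10 p)))%VS].

Definition dressed_multiplier (hS : Sg -> 'M[C]_4) (Rd : P1 -> Sg -> 'M[C]_6)
    (q : form1 Sg 6) : form1 Sg 6 :=
  fun c p =>
    let pi := oproj Q (Vof (hS p)) in
    (Adwedge Q (pi *m Rd None p) (q c p).1,
     Adwedge Q (pi *m Rd (Some 0) p) (q c p).2).

Definition conj_by (T : Sg -> 'M[C]_4) (w : form1 Sg 4) : form1 Sg 4 :=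
  fun c p => (T p *m (w c p).1 *m invmx (T p), T p *m (w c p).2 *m invmx (T p)).

End Harmonic.

(* Main.v *)
(* A splitting C^4 = W + jW turns Gamma^{/\^2 W}_{/\^2 jW}(f) into f^{-1} times the
   exterior square of the map acting by f on W and by 1 on jW; every gauge
   transformation of the theorem therefore comes from C^4.  For P_{nu,/\^2 W}(mu) that
   map is a multiple of (X + i) - mu (X - i).  Its values at 0 and infinity,
   X + i = T + 2i pi^+ and X - i = T - 2i pi^-, where pi^+ and pi^- are the projections
   onto S^+ and S^-, agree with T on S^- and on S^+ respectively, whence
   hat S = T S T^{-1}.

   P(mu).nabla^mu has at most simple poles at nu and nu^*.  Their coefficients vanish
   because W is nabla^nu-parallel and, by reality, jW is nabla^{nu^*}-parallel.
   Retwisted by hat S, the family is the gauge transform of d^lambda by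
   (1 - lambda^2) T + 2i (p + lambda (1 - p)) (pi^+ + lambda pi^-), p the projection
   onto hat S^+, which is polynomial in lambda.  Its determinant is non-zero at
   lambda = 0 and of full order at infinity, so the pole of order k is preserved.

   For a surface, the closedness of q and a count of coefficients along a real lift s
   give q^{1,0} = y s /\ s_zb.  In sl(C^4) this is an endomorphism of rank at most one
   from S^+ to L^+, on which the Ad of the dressing acts as conjugation by T. *)
Require Import Defs.
From HB Require Import structures.
From mathcomp Require Import all_boot all_order all_algebra.
From mathcomp Require Import complex ring lra zify.
From mathcomp Require Import perm qpoly all_classical all_reals all_analysis.

Set Implicit Arguments.
Unset Strict Implicit.
Unset Printing Implicit Defensive.

Import Order.TTheory GRing.Theory Num.Theory.
Import numFieldNormedType.Exports.

Local Open Scope classical_set_scope.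
Local Open Scope ring_scope.


(** * Holomorphic functions and Laurent polynomials *)

(** The numbers mu0 and mu1 are Cayley transforms: (mu0 + i) / (mu0 - i) = nu, so the affine family
    (X + i) - mu (X - i) degenerates on W at nu only, and on jW at nu^* only. Two obstacles shape
    the proof. The pole condition merely asserts that certain entire functions exist, so a Liouville
    argument has to turn it into polynomials of degree at most k. The degree bounds do not depend on
    the point of the surface, hence Lagrange interpolation at fixed integers writes the whole family
    as a finite sum of scalar functions of the spectral parameter times fixed forms. Smoothness on
    the surface and holomorphy in the parameter are thereby separated, and removing the poles
    becomes a division of polynomials. Secondly, a gauge transform by g is a form only if dg obeys
    the transition rule between charts. Instead of a chain rule, dS is read off algebraically from
    d^{-1}, the differential of the projection onto W from the two parallel bundles, and the rule is
    carried through sums, products and inverses. *)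

Section RectangleIntegral.
Variable R : realType.
Implicit Types (P Q : R -> R -> R) (phi psi : R -> R).
Local Notation mu := (@lebesgue_measure R).

Definition seg_int phi a b : R := \int[mu]_(x in `[a, b]) phi x.

Lemma integrable_seg phi a b : continuous phi ->
  mu.-integrable `[a, b] (EFin \o phi).
Proof.
move=> cphi; apply: continuous_compact_integrable; first exact: segment_compact.
exact: continuous_subspaceT.
Qed.

Lemma seg_int_split phi a m b : continuous phi -> a <= m -> m <= b ->
  seg_int phi a b = seg_int phi a m + seg_int phi m b.
Proof.
move=> cphi am mb; rewrite /seg_int.
rewrite -(@Rintegral_itv_obnd_cbnd _ m (BRight b)); last first.
  apply: integrableS (integrable_seg m b cphi) => //.
  by apply: subset_itvr; rewrite bnd_simp.
rewrite -(@Rintegral_itvB _ phi (BLeft a) (BRight b) m) ?bnd_simp//.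
  by rewrite addrC subrK.
exact: integrable_seg.
Qed.

Lemma seg_intB phi psi a b : continuous phi -> continuous psi ->
  seg_int (fun x => phi x - psi x) a b = seg_int phi a b - seg_int psi a b.
Proof.
by move=> cphi cpsi; rewrite /seg_int RintegralB//; exact: integrable_seg.
Qed.

Lemma seg_int_cst k a b : a <= b -> seg_int (fun=> k) a b = k * (b - a).
Proof.
move=> ab; rewrite /seg_int Rintegral_cst//.
have := @lebesgue_measure_itv R `[a, b]; rewrite /= lte_fin => ->.
by move: ab; rewrite le_eqVlt => /predU1P[->|->//]; rewrite ltxx subrr.
Qed.

Lemma seg_int_le phi psi a b : continuous phi -> continuous psi ->
  (forall x, a <= x <= b -> phi x <= psi x) -> seg_int phi a b <= seg_int psi a b.
Proof.
move=> cphi cpsi le; apply: le_Rintegral => //; exact: integrable_seg.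
Qed.

Lemma seg_int_near_cst phi a b k e : continuous phi -> a <= b ->
  (forall x, a <= x <= b -> `|phi x - k| <= e) ->
  `|seg_int phi a b - k * (b - a)| <= e * (b - a).
Proof.
move=> cphi ab H; rewrite ler_norml; apply/andP; split.
  rewrite lerBrDr addrC -mulrBl -seg_int_cst //.
  apply: seg_int_le => //; first by move=> ?; exact: cvg_cst.
  by move=> x /H; rewrite ler_norml => /andP[]; lra.
rewrite lerBlDr -mulrDl -seg_int_cst //.
apply: seg_int_le => //; first by move=> ?; exact: cvg_cst.
by move=> x /H; rewrite ler_norml => /andP[]; lra.
Qed.

(** The integral of P dx + Q dy counter-clockwise around the boundary of [a, b] x [c, d]. Opposite
    sides are paired under one integral, so that constants and the derivatives along the sides
    cancel there. *)
Definition rect_circ P Q a b c d : R :=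
  seg_int (fun x => P x c - P x d) a b + seg_int (fun y => Q b y - Q a y) c d.

(** The shared [p2] is closedness: the y-derivative of P equals the x-derivative of Q. Nothing is
    asked of the continuity of the derivatives, so that the real form of a complex differentiable
    function qualifies at once. *)
Definition first_order_closed P Q := forall x0 y0, exists p1 p2 q2, forall e,
  0 < e -> exists2 del, 0 < del & forall x y, `|x - x0| <= del -> `|y - y0| <= del ->
    `|P x y - P x0 y0 - p1 * (x - x0) - p2 * (y - y0)| <= e * (`|x - x0| + `|y - y0|)
    /\ `|Q x y - Q x0 y0 - p2 * (x - x0) - q2 * (y - y0)| <= e * (`|x - x0| + `|y - y0|).

Lemma lin_bound_continuous (phi : R -> R) x0 k : (forall e, 0 < e -> exists2 del, 0 < del &
   forall x, `|x - x0| <= del -> `|phi x - phi x0 - k * (x - x0)| <= e * `|x - x0|) ->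
  {for x0, continuous phi}.
Proof.
move=> H; have [del del0 Hd] := H 1 ltr01.
apply/cvgrPdist_le => e e0.
have K0 : 0 < `|k| + 1 by rewrite ltr_wpDl.
near=> x.
have h1 : `|x - x0| <= del.
  by rewrite distrC; near: x; apply: cvgr_dist_le => //; exact: cvg_id.
have h2 : `|x - x0| <= e / (`|k| + 1).
  rewrite distrC; near: x; apply: cvgr_dist_le; first exact: cvg_id.
  by rewrite divr_gt0.
rewrite distrC; have -> : phi x - phi x0 = (phi x - phi x0 - k * (x - x0)) + k * (x - x0) by ring.
apply: (le_trans (ler_normD _ _)); rewrite normrM.
have := Hd _ h1; move: h2; rewrite ler_pdivlMr // => h2 h3.
by rewrite mul1r in h3; apply: le_trans h2; lra.
Unshelve. all: by end_near.
Qed.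

Lemma first_order_closed_continuous P Q : first_order_closed P Q ->
  [/\ forall y, continuous (P^~ y), forall x, continuous (P x),
      forall y, continuous (Q^~ y) & forall x, continuous (Q x)].
Proof.
move=> H; split=> [y x|x y|y x|x y]; have [p1 [p2 [q2 {}H]]] := H x y;
  [apply: (@lin_bound_continuous _ _ p1)|apply: (@lin_bound_continuous _ _ p2)
  |apply: (@lin_bound_continuous _ _ p2)|apply: (@lin_bound_continuous _ _ q2)];
  move=> e /H[del del0 Hd]; exists del => // z hz.
- have [] := Hd z y hz; first by rewrite subrr normr0 ltW.
  by rewrite subrr normr0 mulr0 !subr0 addr0.
- have [] := Hd x z _ hz; first by rewrite subrr normr0 ltW.
  by rewrite subrr normr0 mulr0 !subr0 add0r.
- have [|_ +] := Hd z y hz; first by rewrite subrr normr0 ltW.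
  by rewrite subrr normr0 mulr0 !subr0 addr0.
- have [|_ +] := Hd x z _ hz; first by rewrite subrr normr0 ltW.
  by rewrite subrr normr0 mulr0 !subr0 add0r.
Qed.

Lemma rect_circ_splitx P Q a m b c d : first_order_closed P Q -> a <= m -> m <= b ->
  rect_circ P Q a b c d = rect_circ P Q a m c d + rect_circ P Q m b c d.
Proof.
move=> /first_order_closed_continuous[P1 P2 Q1 Q2] am mb; rewrite /rect_circ.
rewrite (@seg_int_split _ a m b)//; last by move=> x; apply: cvgB; [exact: P1|exact: P1].
rewrite !(@seg_intB (Q _)) //; lra.
Qed.

Lemma rect_circ_splity P Q a b c m d : first_order_closed P Q -> c <= m -> m <= d ->
  rect_circ P Q a b c d = rect_circ P Q a b c m + rect_circ P Q a b m d.
Proof.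
move=> /first_order_closed_continuous[P1 P2 Q1 Q2] am mb; rewrite /rect_circ.
rewrite (@seg_int_split _ c m d)//; last by move=> x; apply: cvgB; [exact: Q2|exact: Q2].
rewrite !(@seg_intB (P^~ _)) //; lra.
Qed.

Lemma nested_segments (a b : nat -> R) : (forall n, a n <= a n.+1) ->
  (forall n, b n.+1 <= b n) -> (forall n, a n <= b n) ->
  exists x, forall n, a n <= x <= b n.
Proof.
move=> ha hb hab.
have a_le i j : (i <= j)%N -> a i <= a j by move: i j; apply/nondecreasing_seqP.
have b_le i j : (i <= j)%N -> b j <= b i by move: i j; apply/nonincreasing_seqP.
have ab i j : a i <= b j.
  apply: (le_trans (a_le _ _ (leq_maxl i j))).
  exact: (le_trans (hab _) (b_le _ _ (leq_maxr i j))).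
exists (sup (range a)) => n; apply/andP; split.
  by apply: ub_le_sup; [exists (b 0%N) => _ [i _ <-]|exists n].
by apply: ge_sup; [exists (a 0%N); exists 0%N|move=> _ [i _ <-]].
Qed.

Let rect : Type := (R * R * R * R)%type.
Let circ P Q (r : rect) := let: (a, b, c, d) := r in `|rect_circ P Q a b c d|.
(** Selects a quarter carrying at least a fourth of the circulation. The last one is taken untested:
    when the other three fail, additivity and the triangle inequality force it. *)
Let quarter P Q (r : rect) : rect := let: (a, b, c, d) := r in
  let m := (a + b) / 2 in let n := (c + d) / 2 in
  let ok s := circ P Q r <= 4 * circ P Q s in
  if ok (a, m, c, n) then (a, m, c, n) else if ok (m, b, c, n) then (m, b, c, n)
  else if ok (a, m, n, d) then (a, m, n, d) else (m, b, n, d).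

Let quarterP P Q a b c d : first_order_closed P Q -> a <= b -> c <= d ->
  let: (a', b', c', d') := quarter P Q (a, b, c, d) in
  [/\ (a <= a') && (b' <= b), (c <= c') && (d' <= d),
   b' - a' = (b - a) / 2, d' - c' = (d - c) / 2 &
   `|rect_circ P Q a b c d| <= 4 * `|rect_circ P Q a' b' c' d'|].
Proof.
move=> PQ ab cd; rewrite /quarter /circ.
set m := (a + b) / 2; set n := (c + d) / 2.
have am : a <= m by rewrite /m; lra.
have mb : m <= b by rewrite /m; lra.
have cn : c <= n by rewrite /n; lra.
have nd : n <= d by rewrite /n; lra.
have E := rect_circ_splitx c d PQ am mb.
rewrite (rect_circ_splity _ _ PQ cn nd) in E.
rewrite (rect_circ_splity _ _ PQ cn nd) in E.
case: ifPn => [h|/negP/negP]; first by split=> //; rewrite ?lexx ?am ?mb ?cn ?nd // /m /n; lra.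
rewrite -ltNge => h1.
case: ifPn => [h|/negP/negP]; first by split=> //; rewrite ?lexx ?am ?mb ?cn ?nd // /m /n; lra.
rewrite -ltNge => h2.
case: ifPn => [h|/negP/negP]; first by split=> //; rewrite ?lexx ?am ?mb ?cn ?nd // /m /n; lra.
rewrite -ltNge => h3.
split; rewrite ?lexx ?am ?mb ?cn ?nd // ?/m ?/n; try lra.
rewrite -/m -/n.
set A := rect_circ P Q a m c n in E h1; set B := rect_circ P Q a m n d in E h3.
set C := rect_circ P Q m b c n in E h2; set D := rect_circ P Q m b n d in E *.
have : `|rect_circ P Q a b c d| <= `|A| + `|B| + (`|C| + `|D|).
  rewrite (rect_circ_splitx c d PQ am mb) (rect_circ_splity _ _ PQ cn nd).
  rewrite (rect_circ_splity m b PQ cn nd).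
  by apply: (le_trans (ler_normD _ _)); rewrite lerD// ler_normD.
lra.
Qed.

(* Goursat's bisection argument, for the real form P dx + Q dy. *)
Lemma goursat P Q a b c d : first_order_closed P Q -> a <= b -> c <= d ->
  rect_circ P Q a b c d = 0.
Proof.
move=> PQ ab cd.
pose r n := iter n (quarter P Q) (a, b, c, d).
pose an n := (r n).1.1.1; pose bn n := (r n).1.1.2.
pose cn n := (r n).1.2; pose dn n := (r n).2.
have inv n : [/\ bn n - an n = (b - a) / 2 ^+ n, dn n - cn n = (d - c) / 2 ^+ n &
    `|rect_circ P Q a b c d| <= 4 ^+ n * `|rect_circ P Q (an n) (bn n) (cn n) (dn n)|].
  elim: n => [|n [h1 h2 h3]]; first by rewrite /an /bn /cn /dn /= !expr0 !divr1 mul1r.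
  have p0 : 0 < (2:R) ^- n by rewrite invr_gt0 exprn_gt0.
  have le1 : an n <= bn n by rewrite -subr_ge0 h1 mulr_ge0 ?subr_ge0// ltW.
  have le2 : cn n <= dn n by rewrite -subr_ge0 h2 mulr_ge0 ?subr_ge0// ltW.
  have := quarterP PQ le1 le2.
  have -> : quarter P Q (an n, bn n, cn n, dn n) = (an n.+1, bn n.+1, cn n.+1, dn n.+1).
    have -> : (an n, bn n, cn n, dn n) = r n by rewrite /an /bn /cn /dn; case: (r n) => [[[]]].
    by rewrite /an /bn /cn /dn /= -/(r n); case: (quarter P Q (r n)) => [[[]]].
  case=> _ _ e1 e2 e3; rewrite e1 e2 h1 h2 !exprSr invfM !mulrA; split => //.
  apply: (le_trans h3); rewrite -mulrA; apply: ler_wpM2l => //; exact: exprn_ge0.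
have p0 n : 0 < (2:R) ^- n by rewrite invr_gt0 exprn_gt0.
have le1 n : an n <= bn n by have [h _ _] := inv n; rewrite -subr_ge0 h mulr_ge0 ?subr_ge0// ltW.
have le2 n : cn n <= dn n by have [_ h _] := inv n; rewrite -subr_ge0 h mulr_ge0 ?subr_ge0// ltW.
have step n : [/\ an n <= an n.+1, bn n.+1 <= bn n, cn n <= cn n.+1 & dn n.+1 <= dn n].
  have := quarterP PQ (le1 n) (le2 n).
  have -> : quarter P Q (an n, bn n, cn n, dn n) = (an n.+1, bn n.+1, cn n.+1, dn n.+1).
    have -> : (an n, bn n, cn n, dn n) = r n by rewrite /an /bn /cn /dn; case: (r n) => [[[]]].
    by rewrite /an /bn /cn /dn /= -/(r n); case: (quarter P Q (r n)) => [[[]]].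
  by case=> /andP[? ?] /andP[? ?].
have [x hx] : exists x, forall n, an n <= x <= bn n.
  by apply: nested_segments => // n; have [] := step n.
have [y hy] : exists y, forall n, cn n <= y <= dn n.
  by apply: nested_segments => // n; have [] := step n.
have [P1 P2 Q1 Q2] := first_order_closed_continuous PQ.
have [p1 [p2 [q2 H]]] := PQ x y.
pose L := (b - a) + (d - c).
have L0 : 0 <= L by rewrite /L addr_ge0// subr_ge0.
(* On the n-th rectangle the circulation is at most 2 e s^2 with s = L / 2^n. The factor 4^n lost by
   the bisection is exactly compensated by s^2, so only e remains. *)
have bound e : 0 < e -> `|rect_circ P Q a b c d| <= 4 * e * L ^+ 2.
  move=> e0; have [del del0 Hd] := H _ e0.
  have [n Ln] : exists n, L / 2 ^+ n <= del.
    have [n hn] : exists n : nat, L / del <= n%:R.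
      exists (Num.bound (L / del)); apply/ltW/archi_boundP.
      by rewrite divr_ge0// ltW.
    exists n; rewrite ler_pdivrMr ?exprn_gt0// -ler_pdivrMl// mulrC.
    by apply: (le_trans hn); rewrite -natrX ler_nat ltnW// ltn_expl.
  have [e1 e2 e3] := inv n; set s := L / 2 ^+ n in Ln.
  have s0 : 0 <= s by rewrite /s mulr_ge0// ltW.
  have es : (bn n - an n) + (dn n - cn n) = s by rewrite e1 e2 -mulrDl.
  have near u v : an n <= u <= bn n -> cn n <= v <= dn n ->
      [/\ `|u - x| <= del, `|v - y| <= del & `|u - x| + `|v - y| <= s].
    move=> hu hv; have hxn := hx n; have hyn := hy n.
    have h1 : `|u - x| <= bn n - an n by rewrite ler_norml; lra.
    have h2 : `|v - y| <= dn n - cn n by rewrite ler_norml; lra.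
    have := le1 n; have := le2 n.
    by split; lra.
  have lowc : cn n <= cn n <= dn n by rewrite lexx le2.
  have lowd : cn n <= dn n <= dn n by rewrite lexx le2.
  have lowa : an n <= an n <= bn n by rewrite lexx le1.
  have lowb : an n <= bn n <= bn n by rewrite lexx le1.
  have B1 : `|seg_int (fun x => P x (cn n) - P x (dn n)) (an n) (bn n)
        - p2 * (cn n - dn n) * (bn n - an n)| <= (2 * e * s) * (bn n - an n).
    apply: seg_int_near_cst => //; first by move=> z; apply: cvgB; exact: P1.
    move=> u hu; have [d1 d2 d3] := near u _ hu lowc; have [f1 f2 f3] := near u _ hu lowd.
    have [g1 _] := Hd _ _ d1 d2; have [g2 _] := Hd _ _ f1 f2.
    have i1 := le_trans g1 (ler_wpM2l (ltW e0) d3).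
    have i2 := le_trans g2 (ler_wpM2l (ltW e0) f3).
    move: i1 i2; rewrite !ler_norml; lra.
  have B2 : `|seg_int (fun y => Q (bn n) y - Q (an n) y) (cn n) (dn n)
        - p2 * (bn n - an n) * (dn n - cn n)| <= (2 * e * s) * (dn n - cn n).
    apply: seg_int_near_cst => //; first by move=> z; apply: cvgB; exact: Q2.
    move=> u hu; have [d1 d2 d3] := near _ u lowa hu; have [f1 f2 f3] := near _ u lowb hu.
    have [_ g1] := Hd _ _ d1 d2; have [_ g2] := Hd _ _ f1 f2.
    have i1 := le_trans g1 (ler_wpM2l (ltW e0) d3).
    have i2 := le_trans g2 (ler_wpM2l (ltW e0) f3).
    move: i1 i2; rewrite !ler_norml; lra.
  have B3 : `|rect_circ P Q (an n) (bn n) (cn n) (dn n)| <= 2 * e * s ^+ 2.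
    rewrite /rect_circ; set S1 := seg_int _ _ _ in B1 *; set S2 := seg_int _ _ _ in B2 *.
    (* The main terms of the horizontal and of the vertical sides are opposite, since both contain
       the same [p2]. *)
    have -> : S1 + S2 = (S1 - p2 * (cn n - dn n) * (bn n - an n)) +
       (S2 - p2 * (bn n - an n) * (dn n - cn n)) by ring.
    apply: (le_trans (ler_normD _ _)).
    by have := lerD B1 B2; rewrite -mulrDr es expr2 !mulrA.
  apply: (le_trans e3).
  apply: (le_trans (ler_wpM2l _ B3)); first exact: exprn_ge0.
  have -> : 4 ^+ n * (2 * e * s ^+ 2) = 2 * e * L ^+ 2.
    have -> : (4:R) ^+ n = (2 ^+ n) ^+ 2 by rewrite -exprM mulnC exprM; congr (_ ^+ n); ring.
    have : (2:R) ^+ n != 0 by rewrite expf_neq0.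
    by rewrite /s; move: (2 ^+ n) => t t0; field.
  rewrite -!mulrA ler_wpM2r ?mulr_ge0 ?exprn_ge0 ?(ltW e0)//; lra.
apply/eqP; rewrite -normr_eq0 eq_le normr_ge0 andbT; apply/ler_addgt0Pl => e e0.
rewrite addr0.
have K0 : 0 < 4 * (L ^+ 2 + 1) by rewrite mulr_gt0// ltr_wpDl// sqr_ge0.
apply: (le_trans (bound (e / (4 * (L ^+ 2 + 1))) (divr_gt0 e0 K0))).
have L2 := sqr_ge0 L.
rewrite mulrAC mulrA ler_pdivrMr// mulrC ler_wpM2l ?(ltW e0)//; lra.
Qed.

End RectangleIntegral.

(** * Complex differentiability as a first-order estimate *)

Section ComplexDerivative.
Variable R : realType.
Local Notation C := R[i].
Local Notation C1 := (R[i]^o).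
Implicit Types (f g h : C1 -> C1).

Lemma real_complex_gt0 (e : C) : 0 < e -> exists2 r : R, 0 < r & e = r%:C%C.
Proof.
move=> e0; exists (complex.Re e); last by rewrite RRe_real// ger0_real// ltW.
by rewrite -ltcR RRe_real// ger0_real// ltW.
Qed.

(** Replaces the limit of difference quotients by an error estimate without division, valid also at
    [w = z]. The bounds [e] and [del] are real, so they combine directly with estimates in the
    plane. *)
Lemma complex_derivableP f z : derivable f z 1 <-> exists c, forall e : R, 0 < e ->
  exists2 del : R, 0 < del & forall w, `|w - z| <= del%:C%C ->
    `|f w - f z - c * (w - z)| <= e%:C%C * `|w - z|.
Proof.
split=> [df|[c H]].
  exists ('D_1 f z) => e e0.
  have eC : 0 < e%:C%C :> C by rewrite ltcR.
  have /cvgrPdist_le/(_ _ eC) := df.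
  rewrite /nbhs /= /dnbhs /within /=.
  move=> /nbhs_ballP[del /= del0 Hd].
  have [r r0 er] := real_complex_gt0 del0.
  exists (r / 2); first by rewrite divr_gt0.
  move=> w hw; have [->|wz] := eqVneq w z; first by rewrite !subrr !normr0 mulr0 subr0 normr0 mulr0.
  have wz0 : w - z != 0 by rewrite subr_eq0.
  have := Hd (w - z); rewrite /ball /= sub0r normrN => /(_ _ wz0).
  rewrite /= scaler1 addrNK => H.
  have {H} : `|'D_1 f z - (w - z)^-1 *: (f w - f z)| <= e%:C%C.
    apply: H; apply: (le_lt_trans hw); rewrite er ltcR; lra.
  have -> : f w - f z - 'D_1 f z * (w - z) = - (('D_1 f z - (w - z)^-1 *: (f w - f z)) * (w - z)).
    rewrite mulrBl -[_ *: _]/(_ * _) mulrAC mulVf// mul1r; ring.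
  by rewrite normrN normrM => H; apply: ler_wpM2r.
apply/cvg_ex; exists c; apply/cvgrPdist_le => e0 /real_complex_gt0[e egt0 ->{e0}].
have [del del0 Hd] := H _ egt0.
have dC : 0 < del%:C%C :> C by rewrite ltcR.
rewrite /= /dnbhs /within /=; apply/nbhs_ballP; exists del%:C%C => //= u.
rewrite /ball /= sub0r normrN => hu u0.
rewrite -[X in `|X|](mulKf u0) mulrBr -[_ *: _]/(u^-1 * _) mulVKf// normrM normfV.
rewrite ler_pdivrMl ?normr_gt0// distrC mulrC.
have := Hd (u + z); rewrite addrK => /(_ (ltW hu)).
by rewrite -[u *: 1]/(u * 1) mulr1 [_%:C%C * _]mulrC.
Qed.

(** Schwarz reflection; it supplies the second factor of the auxiliary function in the Liouville
    argument. *)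
Lemma derivable_conj f z : derivable f (conjc z) 1 ->
  derivable (fun w : C1 => (conjc (f (conjc w)) : C1)) z 1.
Proof.
move=> /complex_derivableP[c H]; apply/complex_derivableP; exists (conjc c) => e /H.
move=> [del del0 Hd]; exists del => // w hw.
have /Hd : `|(conjc w : C) - conjc z| <= del%:C%C by rewrite -rmorphB normcJ.
have -> : conjc (f (conjc w)) - conjc (f (conjc z)) - conjc c * (w - z) =
  conjc ((f (conjc w) : C) - f (conjc z) - c * (conjc w - conjc z)).
  by rewrite !(rmorphB (@conjc R)) (rmorphM (@conjc R)) (rmorphB (@conjc R)) /= !conjcK.
by rewrite -rmorphB !normcJ.
Qed.

Lemma derivable_shift f w z : derivable f (w + z) 1 ->
  derivable (fun u : C1 => f (w + u)) z 1.
Proof.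
move=> /complex_derivableP[c H]; apply/complex_derivableP; exists c => e /H.
move=> [del del0 Hd]; exists del => // u hu.
have E : u - z = w + u - (w + z) by ring.
by rewrite E; apply: Hd; rewrite -E.
Qed.

Lemma norm_Re_le (z : C) : `|complex.Re z|%:C%C <= `|z|.
Proof. exact: normc_ge_Re. Qed.

Lemma norm_Im_le (z : C) : `|complex.Im z|%:C%C <= `|z|.
Proof.
have := norm_Re_le (z * 'i%C); rewrite ReiNIm normrN normrM.
suff -> : `|'i%C : C| = 1 by rewrite mulr1.
by rewrite normc_def /= expr0n /= expr1n add0r sqrtr1.
Qed.

Lemma norm_complex_le (x y : R) : `|(x +i* y)%C| <= (`|x| + `|y|)%:C%C.
Proof.
have -> : (x +i* y)%C = x%:C%C + 'i%C * y%:C%C :> C.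
  by rewrite [LHS]complexE.
apply: (le_trans (ler_normD _ _)); rewrite normrM rmorphD /=.
have nr (r : R) : `|r%:C%C : C| = `|r|%:C%C.
  by rewrite normc_def /= expr0n /= addr0 sqrtr_sqr.
rewrite !nr; suff -> : `|'i%C : C| = 1 by rewrite mul1r.
by rewrite normc_def /= expr0n /= expr1n add0r sqrtr1.
Qed.

(* The real part of f dz. *)
Lemma holomorphic_first_order_closed f : (forall z, derivable f z 1) ->
  first_order_closed (fun x y => complex.Re (f (x +i* y)%C))
                     (fun x y => - complex.Im (f (x +i* y)%C)).
Proof.
move=> df x0 y0; have /complex_derivableP[[c1 c2] H] := df (x0 +i* y0)%C.
exists c1, (- c2), (- c1) => e e0; have [del del0 Hd] := H e e0; exists (del / 2); first by rewrite divr_gt0.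
move=> x y hx hy.
have E : (x +i* y)%C - (x0 +i* y0)%C = ((x - x0) +i* (y - y0))%C :> C by [].
have hw : `|(x +i* y)%C - (x0 +i* y0)%C : C| <= del%:C%C.
  by rewrite E (le_trans (norm_complex_le _ _))// lecR; lra.
have {Hd} := Hd _ hw; rewrite E => Hd.
have {Hd} : `|(f (x +i* y)%C : C) - f (x0 +i* y0)%C - (c1 +i* c2)%C * ((x - x0) +i* (y - y0))%C|
    <= (e * (`|x - x0| + `|y - y0|))%:C%C.
  apply: (le_trans Hd); rewrite rmorphM /=; apply: ler_wpM2l; last exact: norm_complex_le.
  by rewrite ler0c ltW.
move: (f (x +i* y)%C) (f (x0 +i* y0)%C) => [a b] [a' b'] Hd.
split; rewrite -lecR; apply: le_trans Hd.
  apply: le_trans (norm_Re_le _); rewrite lecR /= le_eqVlt; apply/orP; left; apply/eqP.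
  congr `|_|; ring.
apply: le_trans (norm_Im_le _); rewrite lecR /= le_eqVlt -normrN; apply/orP; left; apply/eqP.
congr `|_|; ring.
Qed.

End ComplexDerivative.

Section Liouville.
Variable R : realType.
Local Notation C := R[i].
Local Notation C1 := (R[i]^o).
Local Notation nrm := (@ComplexField.Normc.normc R).
Implicit Types (f g h F G : C1 -> C1).

Lemma normcR (z : C) : `|z| = (nrm z)%:C%C.
Proof. by []. Qed.

Lemma nrm_ge_Re (z : C) : `|complex.Re z| <= nrm z.
Proof. by rewrite -lecR -normcR norm_Re_le. Qed.

Lemma nrm_ge_Im (z : C) : `|complex.Im z| <= nrm z.
Proof. by rewrite -lecR -normcR norm_Im_le. Qed.

Lemma nrm_ge0 (z : C) : 0 <= nrm z.
Proof. exact: le_trans (nrm_ge_Re z). Qed.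

Lemma nrmJ (z : C) : nrm (conjc z) = nrm z.
Proof. by apply: complexI; rewrite -!normcR normcJ. Qed.

Lemma nrmD (x y : C) : nrm (x + y) <= nrm x + nrm y.
Proof. by rewrite -lecR rmorphD /= -!normcR ler_normD. Qed.

Lemma nrmN (x : C) : nrm (- x) = nrm x.
Proof. by apply: complexI; rewrite -!normcR normrN. Qed.

Lemma nrmM (x y : C) : nrm (x * y) = nrm x * nrm y.
Proof. exact: ComplexField.Normc.normcM. Qed.

(* k(z) = h(w + z) conj(h(w + conj z)) is entire and equals |h(w + x)|^2 >= 0 on the
   real axis, while the three other sides of a large square contribute almost nothing. *)
Lemma entire_vanishing h (B K : R) : (forall z, derivable h z 1) ->
  (forall z, B <= nrm z -> nrm (h z) * nrm z <= K) -> forall w, h w = 0.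
Proof.
move=> dh hB w; apply/eqP/negPn/negP => hw0.
pose k : C1 -> C1 := (fun u : C1 => h (w + u)) * (fun u : C1 => (conjc (h (w + conjc u)) : C1)).
have kE u : k u = h (w + u) * conjc (h (w + conjc u)) by [].
have dk z : derivable k z 1.
  apply: derivableM; first exact: derivable_shift.
  by apply: (@derivable_conj R (fun u : C1 => h (w + u))); exact: derivable_shift.
have PQ := holomorphic_first_order_closed dk.
set P := fun x y => complex.Re (k (x +i* y)%C) in PQ.
set Q := fun x y => - complex.Im (k (x +i* y)%C) in PQ.
have [cP1 cP2 cQ1 cQ2] := first_order_closed_continuous PQ.
have P0 x : P x 0 = nrm (h (w + x%:C%C)) ^+ 2.
  rewrite /P kE complexr0 conjc_real.
  apply: complexI; rewrite -sqr_normc normcR -rmorphXn /=; by rewrite -!complexr0.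
pose m := P 0 0; have m0 : 0 < m.
  rewrite /m P0 exprn_gt0// lt_neqAle nrm_ge0 andbT eq_sym; apply: contra hw0.
  rewrite addr0 => /eqP/ComplexField.Normc.eq0_normc ->; exact: eqxx.
have [del del0 hdel] : exists2 del, 0 < del & forall x, `|x| <= del -> m / 2 <= P x 0.
  have m20 : 0 < m / 2 by rewrite divr_gt0.
  have /cvgrPdist_le/(_ _ m20)/nbhs_ballP[d d0 H] := cP1 0 0.
  exists (d / 2); first by rewrite divr_gt0.
  move=> x hx; have := H x; rewrite /ball /= sub0r normrN.
  have d0' : 0 < d by [].
  have -> : `|x| < d by lra.
  by move=> /(_ isT); rewrite ler_norml -/m; lra.
(* Far out |w + u| >= |u| / 2, so each of the two factors of [k] is at most 2 K / A. *)
pose M A := (2 * K / A) ^+ 2.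
have bound A u : 0 < A -> 2 * nrm w + 2 * `|B| <= A -> A <= nrm u -> nrm (k u) <= M A.
  move=> A0 hA hu.
  have aux v : nrm v = nrm u -> nrm (h (w + v)) <= 2 * K / A.
    move=> hv; have h1 : nrm u / 2 <= nrm (w + v).
      have := nrmD (w + v) (- w).
      rewrite [w + v]addrC addrK nrmN hv.
      have := nrm_ge0 w; have := normr_ge0 B; lra.
    have h2 : B <= nrm (w + v).
      have := ler_norm B; have := nrm_ge0 w; lra.
    have h3 := hB _ h2; rewrite ler_pdivlMr//.
    have h4 : nrm (h (w + v)) * (A / 2) <= nrm (h (w + v)) * nrm (w + v).
      apply: ler_wpM2l; [exact: nrm_ge0|lra].
    lra.
  rewrite kE nrmM nrmJ /M expr2; apply: ler_pM; rewrite ?nrm_ge0//; apply: aux => //.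
  exact: nrmJ.
(* The base contributes at least (m / 2) (2 del); against it stand at most M (2 A) from the top and
   2 M A from the two vertical sides together. *)
have key A : 0 < A -> 2 * nrm w + 2 * `|B| <= A -> del <= A -> m * del <= 4 * M A * A.
  move=> A0 hA hd.
  have G : rect_circ P Q (- A) A 0 A = 0 by apply: goursat => //; lra.
  have up : `|seg_int (P^~ A) (- A) A - 0 * (A - - A)| <= M A * (A - - A).
    apply: seg_int_near_cst => //; first lra.
    move=> x _; rewrite subr0; apply: le_trans (nrm_ge_Re _) _; apply: bound => //.
    by apply: le_trans (nrm_ge_Im _); rewrite /= ler_norm.
  have side : `|seg_int (fun y => Q A y - Q (- A) y) 0 A - 0 * (A - 0)| <= 2 * M A * (A - 0).
    apply: seg_int_near_cst; [by move=> x; apply: cvgB; exact: cQ2|exact: ltW|].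
    move=> x _; rewrite subr0; apply: (le_trans (ler_normB _ _)).
    rewrite /Q !normrN mulr2n mulrDl mul1r; apply: lerD.
      apply: le_trans (nrm_ge_Im _) _; apply: bound => //.
      by apply: le_trans (nrm_ge_Re _); rewrite /= ler_norm.
    apply: le_trans (nrm_ge_Im _) _; apply: bound => //.
    by apply: le_trans (nrm_ge_Re _); rewrite /= normrN ler_norm.
  move: G; rewrite /rect_circ seg_intB// => G.
  have nonneg a b : a <= b -> 0 <= seg_int (P^~ 0) a b.
    move=> ab; rewrite -[leLHS](mul0r (b - a)) -seg_int_cst//.
    apply: seg_int_le => //; first by move=> ?; exact: cvg_cst.
    by move=> x _; rewrite P0 exprn_ge0// nrm_ge0.
  have low : m / 2 * (del - - del) <= seg_int (P^~ 0) (- del) del.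
    rewrite -seg_int_cst; last lra.
    apply: seg_int_le => //; first by move=> ?; exact: cvg_cst.
    by move=> x hx; apply: hdel; rewrite ler_norml.
  have : seg_int (P^~ 0) (- A) A = seg_int (P^~ 0) (- A) (- del) +
     (seg_int (P^~ 0) (- del) del + seg_int (P^~ 0) del A).
    rewrite -(@seg_int_split _ _ _ del)//; [|lra].
    by rewrite -(@seg_int_split _ _ _ (- del))//; lra.
  have : 0 <= seg_int (P^~ 0) (- A) (- del) by apply: nonneg; lra.
  have : 0 <= seg_int (P^~ 0) del A by apply: nonneg; lra.
  move: up side; rewrite !mul0r !subr0 !ler_norml opprK; lra.
(* The summand 16 K^2 / (m del) + 1 makes m del exceed 16 K^2 / A, which contradicts [key]; the
   other summands put A in the range of [key]. *)
pose A := 2 * nrm w + 2 * `|B| + del + 16 * K ^+ 2 / (m * del) + 1.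
have t0 : 0 <= 16 * K ^+ 2 / (m * del).
  have md : 0 < m * del by exact: mulr_gt0.
  by apply: divr_ge0; [apply: mulr_ge0 => //; exact: sqr_ge0|exact: ltW].
have := nrm_ge0 w; have := normr_ge0 B => B0 w0.
have A0 : 0 < A by rewrite /A; lra.
have : m * del <= 4 * M A * A by apply: key => //; rewrite /A; lra.
have -> : 4 * M A * A = 16 * K ^+ 2 / A.
  rewrite /M; have gen (a : R) : a != 0 -> 4 * (2 * K / a) ^+ 2 * a = 16 * K ^+ 2 / a.
    by move=> a0; field.
  by rewrite gen// lt0r_neq0.
rewrite ler_pdivlMr// => hh.
have : m * del * A > 16 * K ^+ 2.
  have md : 0 < m * del by rewrite mulr_gt0.
  rewrite [ltRHS]mulrC -ltr_pdivrMr// /A; lra.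
by rewrite ltNge hh.
Qed.

End Liouville.

Section PoleAtInfinity.
Variable R : realType.
Local Notation C := R[i].
Local Notation C1 := (R[i]^o).
Local Notation nrm := (@ComplexField.Normc.normc R).
Implicit Types (f g h F G : C1 -> C1).

Lemma derivable_nrmP f z : derivable f z 1 <-> exists c, forall e, 0 < e ->
  exists2 del, 0 < del & forall w, nrm (w - z) <= del ->
    nrm (f w - f z - c * (w - z)) <= e * nrm (w - z).
Proof.
rewrite complex_derivableP; split=> -[c H]; exists c => e /H[del del0 Hd]; exists del => // w.
  by move=> hw; rewrite -lecR rmorphM /= -!normcR; apply: Hd; rewrite normcR lecR.
by rewrite normcR lecR => /Hd; rewrite -lecR rmorphM /= -!normcR.
Qed.

Lemma derivable_lip f z : derivable f z 1 -> exists K del, [/\ 0 <= K, 0 < del &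
  forall w, nrm (w - z) <= del -> nrm (f w - f z) <= K * nrm (w - z)].
Proof.
move=> /derivable_nrmP[c /(_ _ ltr01)[del del0 Hd]]; exists (1 + nrm c), del; split => //.
  by rewrite addr_ge0// nrm_ge0.
move=> w /Hd; rewrite mulrDl -nrmM => h.
rewrite -[f w - f z](subrK (c * (w - z))); apply: (le_trans (nrmD _ _)).
by rewrite lerD2r.
Qed.

Lemma cderiv_id (z : C) : derivable (fun w : C1 => w) z 1.
Proof. exact: derivable_id. Qed.

Lemma cderiv_cst (a z : C) : derivable (fun _ : C1 => (a : C1)) z 1.
Proof. exact: derivable_cst. Qed.

Lemma cderivD f g (z : C) : derivable f z 1 -> derivable g z 1 ->
  derivable (fun w : C1 => (f w + g w : C1)) z 1.
Proof. exact: derivableD. Qed.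

Lemma cderivM f g (z : C) : derivable f z 1 -> derivable g z 1 ->
  derivable (fun w : C1 => (f w * g w : C1)) z 1.
Proof. exact: derivableM. Qed.

Lemma cderivV f (z : C) : f z != 0 -> derivable f z 1 ->
  derivable (fun w : C1 => ((f w)^-1 : C1)) z 1.
Proof. exact: derivableV. Qed.

Lemma cderivX f n (z : C) : derivable f z 1 ->
  derivable (fun w : C1 => (f w ^+ n : C1)) z 1.
Proof.
move=> df; elim: n => [|n IH].
  rewrite (_ : (fun w : C1 => _) = (fun=> 1)); first exact: cderiv_cst.
  by apply/funext => w; rewrite expr0.
rewrite (_ : (fun w : C1 => _) = (fun w : C1 => f w * f w ^+ n)); first exact: cderivM.
by apply/funext => w; rewrite exprS.
Qed.

Lemma derivable_poly (p : {poly C}) (z : C) : derivable (fun w : C1 => (p.[w] : C1)) z 1.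
Proof.
elim/poly_ind: p => [|p c IH].
  rewrite (_ : (fun _ => _) = fun _ : C1 => 0); first exact: cderiv_cst.
  by apply/funext => w; rewrite horner0.
rewrite (_ : (fun _ => _) = (fun w : C1 => p.[w] * w + c)).
  exact: cderivD (cderivM IH (@cderiv_id z)) (@cderiv_cst c z).
by apply/funext => w; rewrite hornerMXaddC.
Qed.

Lemma nrmX (z : C) n : nrm (z ^+ n) = nrm z ^+ n.
Proof.
elim: n => [|n IH]; first by rewrite !expr0 ComplexField.Normc.normc1.
by rewrite !exprS nrmM IH.
Qed.

Lemma nrmV (z : C) : nrm z^-1 = (nrm z)^-1.
Proof. exact: ComplexField.Normc.normcV. Qed.

Lemma nrm_gt0 (z : C) : z != 0 -> 0 < nrm z.
Proof.
move=> z0; rewrite lt_neqAle nrm_ge0 andbT eq_sym; apply: contra z0.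
by move=> /eqP/ComplexField.Normc.eq0_normc ->; exact: eqxx.
Qed.

Lemma poly_growth (p : {poly C}) k : (size p <= k.+1)%N ->
  exists2 M, 0 <= M & forall z, 1 <= nrm z -> nrm p.[z] <= M * nrm z ^+ k.
Proof.
move=> sp; exists (\sum_(i < k.+1) nrm p`_i); first by rewrite sumr_ge0// => i _; exact: nrm_ge0.
move=> z z1; rewrite (horner_coef_wide _ sp) mulr_suml.
elim/big_ind2: _ => [|x a y b xa yb|i _].
- by rewrite ComplexField.Normc.normc0.
- by apply: (le_trans (nrmD _ _)); exact: lerD.
- by rewrite nrmM nrmX ler_wpM2l ?nrm_ge0// ler_weXn2l// -ltnS.
Qed.

Lemma nrm_natr n : nrm n%:R = n%:R.
Proof. by apply: complexI; rewrite -normcR normr_nat rmorph_nat. Qed.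

Lemma prod_XsubC_growth (s : seq C) (B : R) : (forall a, a \in s -> 2 * nrm a <= B) ->
  forall z, B <= nrm z -> (nrm z / 2) ^+ size s <= nrm (\prod_(a <- s) ('X - a%:P)).[z].
Proof.
move=> hs z hz; elim: s hs => [|a s IH] hs.
  by rewrite expr0 big_nil hornerC ComplexField.Normc.normc1.
rewrite big_cons hornerM hornerXsubC nrmM /= exprS.
have z0 := nrm_ge0 z; apply: ler_pM.
- by rewrite divr_ge0.
- by rewrite exprn_ge0// divr_ge0.
- have h1 := hs a (mem_head _ _); have := nrmD (z - a) a; rewrite subrK; lra.
- by apply: IH => b hb; apply: hs; rewrite inE hb orbT.
Qed.

(* The quotient (F - q)^(2k+3) / Pi^(2k+1), with q interpolating F at the k+1 roots of
   Pi, is entire (each root is at least a double zero, and x / 0 = 0 there), and it is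
   O(1/|z|) at infinity, hence zero. *)
Lemma entire_pole_polynomial k F G : (forall z, derivable F z 1) ->
  (forall z, derivable G z 1) -> (forall z : C, z != 0 -> G z = z ^+ k * F z^-1) ->
  exists2 q : {poly C}, (size q <= k.+1)%N & forall z, F z = q.[z].
Proof.
move=> dF dG FG.
pose x (i : nat) : C := i.+1%:R.
have x_inj : injective x by move=> i j /eqP; rewrite /x eqr_nat eqSS => /eqP.
pose q : {poly C} := \sum_(i < k.+1) (F (x i))%:P * (tnth (lagrange k.+1 x) i : {poly C}).
have sq : (size q <= k.+1)%N.
  apply: (leq_trans (size_sum _ _ _)); apply/bigmax_leqP => i _.
  by rewrite mul_polyC (leq_trans (size_scale_leq _ _))// size_lagrange_.
have qx (j : 'I_k.+1) : q.[x j] = F (x j).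
  rewrite horner_sum (bigD1 j)//= big1 => [|i ij].
    by rewrite addr0 hornerM hornerC lagrange_sample// eqxx mulr1.
  by rewrite hornerM hornerC lagrange_sample// (negbTE ij) mulr0.
pose s : seq C := [seq x i | i <- iota 0 k.+1].
have ss : size s = k.+1 by rewrite size_map size_iota.
have us : uniq s by rewrite map_inj_uniq// iota_uniq.
have qs a : a \in s -> q.[a] = F a.
  move=> /mapP[l]; rewrite mem_iota add0n => /= lk ->.
  exact: (qx (Ordinal lk)).
pose Pi : {poly C} := \prod_(a <- s) ('X - a%:P).
have Pi0 z : (Pi.[z] == 0) = (z \in s).
  by rewrite -rootE root_prod_XsubC.
pose D : C1 -> C1 := fun z => F z - q.[z].
have dD z : derivable D z 1 by apply: derivableB => //; exact: derivable_poly.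
(* The exponents satisfy k n - (k + 1) m = -1, the decay at infinity, and n - m = 2, the order of
   vanishing left at each root of [Pi]. *)
pose n := (2 * k + 3)%N; pose m := (2 * k + 1)%N.
have nm : n = (m + 2)%N by rewrite /n /m; lia.
pose h : C1 -> C1 := fun z => D z ^+ n / Pi.[z] ^+ m.
suff h0 : forall z, h z = 0.
  exists q => // z; have [/qs //|zs] := boolP (z \in s).
  have /eqP := h0 z; rewrite /h mulf_eq0 invr_eq0 !expf_eq0 Pi0 (negbTE zs) andbF orbF.
  by rewrite nm addn2 /= subr_eq0 => /eqP.
have [M1 M10 hM1] := poly_growth sq.
have [M2 [del [M20 del0 hM2]]] := derivable_lip (dG 0).
pose M := nrm (G 0) + M2 * del + M1.
have M0 : 0 <= M by rewrite !addr_ge0// ?nrm_ge0// mulr_ge0// ltW.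
(* Beyond B the point 1 / z lies in the disc where G is Lipschitz at 0, and |z| is at least twice
   every interpolation node. *)
pose B := 1 + del^-1 + 2 * k.+1%:R.
have dV0 : 0 < del^-1 by rewrite invr_gt0.
have hB z : B <= nrm z -> nrm (D z) <= M * nrm z ^+ k.
  move=> hz; have kr : 0 <= k.+1%:R :> R by [].
  have z0 : 0 < nrm z by move: hz; rewrite /B; lra.
  have zn0 : z != 0.
    by apply/eqP => z00; move: z0; rewrite z00 ComplexField.Normc.normc0 ltxx.
  have -> : D z = z ^+ k * G z^-1 - q.[z].
    by rewrite FG ?invr_eq0// invrK mulrA -exprMn mulfV// expr1n mul1r.
  apply: (le_trans (nrmD _ _)); rewrite nrmN nrmM nrmX.
  have h1 : nrm (G z^-1) <= nrm (G 0) + M2 * del.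
    have hzd : nrm (z^-1 - 0) <= del.
      rewrite subr0 nrmV -[del]invrK lef_pV2 ?posrE//.
      move: hz; rewrite /B; lra.
    have := nrmD (G z^-1 - G 0) (G 0); rewrite subrK.
    have := hM2 _ hzd; have := ler_wpM2l M20 hzd; lra.
  have h2 : nrm q.[z] <= M1 * nrm z ^+ k by apply: hM1; move: hz; rewrite /B; lra.
  have := ler_wpM2l (exprn_ge0 k (ltW z0)) h1.
  rewrite /M; lra.
have hPi z : B <= nrm z -> (nrm z / 2) ^+ k.+1 <= nrm Pi.[z].
  rewrite -ss; apply: prod_XsubC_growth => a /mapP[l]; rewrite mem_iota add0n => /= lk ->.
  rewrite /x nrm_natr /B; have : l.+1%:R <= k.+1%:R :> R by rewrite ler_nat.
  lra.
apply: (@entire_vanishing R h B (M ^+ n * 2 ^+ (k.+1 * m))) => z; last first.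
  move=> hz; have z0 : 0 < nrm z.
    have kr : 0 <= k.+1%:R :> R by [].
    by move: hz; rewrite /B; lra.
  rewrite /h nrmM nrmV !nrmX.
  have a1 : nrm (D z) ^+ n <= (M * nrm z ^+ k) ^+ n.
    by apply: lerXn2r; rewrite ?nnegrE ?nrm_ge0 ?hB// mulr_ge0// exprn_ge0// ltW.
  have p0 : 0 < (nrm z / 2) ^+ k.+1 by rewrite exprn_gt0// divr_gt0.
  have a2 : ((nrm z / 2) ^+ k.+1) ^+ m <= nrm Pi.[z] ^+ m.
    by apply: lerXn2r; rewrite ?nnegrE ?nrm_ge0 ?hPi// ltW.
  have b0 : 0 < nrm Pi.[z] ^+ m by apply: lt_le_trans a2; exact: exprn_gt0.
  rewrite mulrAC ler_pdivrMr//.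
  apply: le_trans (_ : (M * nrm z ^+ k) ^+ n * nrm z <= _); first by rewrite ler_wpM2r// ltW.
  apply: le_trans (ler_wpM2l _ a2); last by rewrite mulr_ge0// exprn_ge0.
  rewrite exprMn -!exprM -mulrA -exprSr exprMn exprVn -!mulrA ler_wpM2l ?exprn_ge0//.
  have -> : (k * n).+1 = (k.+1 * m)%N by rewrite /n /m; ring.
  by rewrite mulrCA mulfV ?mulr1// expf_neq0.
(* At a root the quotient is bounded by a constant times |w - z|^2, so its derivative there is 0. *)
have [zs|zs] := boolP (z \in s); last first.
  have Piz : Pi.[z] != 0 by rewrite Pi0.
  have dPi : derivable (fun w : C1 => (Pi.[w] ^+ m : C1)) z 1.
    exact: (@cderivX _ m _ (@derivable_poly Pi z)).
  have dPV := @cderivV (fun w : C1 => (Pi.[w] ^+ m : C1)) z (expf_neq0 _ Piz) dPi.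
  exact: cderivM (@cderivX _ n _ (dD z)) dPV.
pose Pi' : {poly C} := \prod_(a <- rem z s) ('X - a%:P).
have Pi'E w : Pi.[w] = (w - z) * Pi'.[w].
  by rewrite /Pi (big_rem z)//= hornerM hornerXsubC.
have Pi'z : Pi'.[z] != 0 by rewrite -rootE root_prod_XsubC mem_rem_uniq// inE eqxx.
have [K1 [d1 [K10 d10 h1]]] := derivable_lip (dD z).
have [K2 [d2 [K20 d20 h2]]] := derivable_lip (@derivable_poly Pi' z).
have Dz : D z = 0 by rewrite /D qs// subrr.
have t0 := nrm_gt0 Pi'z; set t := nrm Pi'.[z] in t0.
have K3 : 0 < K2 + 1 by lra.
pose d3 := t / 2 / (K2 + 1).
have d30 : 0 < d3 by rewrite !divr_gt0.
have lowPi w : nrm (w - z) <= d2 -> nrm (w - z) <= d3 -> t / 2 <= nrm Pi'.[w].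
  move=> /h2 g1; rewrite /d3 ler_pdivlMr// => g2.
  have := nrmD (Pi'.[z] - Pi'.[w]) Pi'.[w]; rewrite subrK -[nrm (_ - _)]nrmN opprB -/t.
  have := nrm_ge0 (w - z); lra.
pose L := K1 ^+ n / (t / 2) ^+ m.
have th : 0 < (t / 2) ^+ m by rewrite exprn_gt0// divr_gt0.
have L0 : 0 <= L by apply: divr_ge0; [exact: exprn_ge0|exact: ltW].
have L1 : 0 < L + 1 by lra.
apply/derivable_nrmP; exists 0 => e e0.
pose d4 := e / (L + 1).
have d40 : 0 < d4 by rewrite divr_gt0.
exists (Num.min (Num.min d1 d2) (Num.min d3 d4)); first by rewrite !lt_min d10 d20 d30 d40.
move=> w; rewrite !le_min => /andP[/andP[wd1 wd2] /andP[wd3 wd4]].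
have hz0 : h z = 0 by rewrite /h Dz expr0n nm addn2 mul0r.
rewrite hz0 mul0r !subr0.
have [->|wz] := eqVneq w z.
  by rewrite hz0 subrr ComplexField.Normc.normc0 mulr0.
have r0 : 0 < nrm (w - z) by rewrite nrm_gt0// subr_eq0.
set r := nrm (w - z) in r0 wd1 wd2 wd3 wd4 *.
have lo := lowPi _ wd2 wd3.
have up : nrm (D w) <= K1 * r by have := h1 _ wd1; rewrite Dz subr0.
rewrite /h Pi'E nrmM nrmV !nrmX nrmM -/r exprMn.
have lo' : (t / 2) ^+ m <= nrm Pi'.[w] ^+ m.
  by apply: lerXn2r; rewrite ?nnegrE ?nrm_ge0// ltW// divr_gt0.
have up' : nrm (D w) ^+ n <= K1 ^+ n * r ^+ n.
  by rewrite -exprMn; apply: lerXn2r; rewrite ?nnegrE ?nrm_ge0// mulr_ge0// ltW.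
have p0 : 0 < nrm Pi'.[w] ^+ m by exact: lt_le_trans lo'.
have rm0 : 0 < r ^+ m by exact: exprn_gt0.
rewrite ler_pdivrMr ?mulr_gt0//; apply: (le_trans up').
have : L * r <= e.
  move: wd4; rewrite /d4 ler_pdivlMr//; lra.
rewrite /L mulrAC ler_pdivrMr// => Lr.
have -> : r ^+ n = r ^+ m * r * r by rewrite nm exprD expr2 mulrA.
have rr : 0 <= r ^+ m * r by rewrite mulr_ge0// ltW.
have := ler_wpM2l rr Lr.
have := ler_wpM2l (mulr_ge0 rr (ltW e0)) lo'.
move: (K1 ^+ n) (r ^+ m) ((t / 2) ^+ m) (nrm Pi'.[w] ^+ m) => a b c d; lra.
Qed.

End PoleAtInfinity.

(** * Laurent polynomials and interpolation in the spectral parameter *)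

Section LaurentFunctions.
Variable R : realType.
Local Notation C := R[i].
Local Notation C1 := (R[i]^o).
Local Notation nrm := (@ComplexField.Normc.normc R).
Implicit Types (f g : C1 -> C1) (phi psi : C -> C) (N M : nat).

(** The exponents run from -N to M - N - 1. The value at 0 is left free, because the families of
    connections are constrained only away from 0. *)
Definition laurent N M phi := exists2 q : {poly C}, (size q <= M)%N &
  forall z, z != 0 -> z ^+ N * phi z = q.[z].

Lemma laurent_widen N M n m phi : laurent N M phi -> (M + n <= m)%N -> laurent (N + n) m phi.
Proof.
move=> [q sq qE] Mm; exists ('X^n * q).
  by rewrite mulrC (leq_trans (size_polyMleq _ _))// size_polyXn addnS /= (leq_trans _ Mm)// leq_add2r.
by move=> z z0; rewrite hornerM hornerXn -qE// exprD mulrA [_ ^+ N * _]mulrC.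
Qed.

Lemma laurent_ext N M phi psi : (forall z, z != 0 -> phi z = psi z) ->
  laurent N M phi -> laurent N M psi.
Proof. by move=> e [q sq qE]; exists q => // z z0; rewrite -e// qE. Qed.

Lemma laurentD N M phi psi : laurent N M phi -> laurent N M psi ->
  laurent N M (fun z => phi z + psi z).
Proof.
move=> [p sp pE] [q sq qE]; exists (p + q).
  by rewrite (leq_trans (size_polyD _ _))// geq_max sp.
by move=> z z0; rewrite hornerD mulrDr pE// qE.
Qed.

Lemma laurentM N M N' M' phi psi : laurent N M phi -> laurent N' M' psi ->
  laurent (N + N') (M + M') (fun z => phi z * psi z).
Proof.
move=> [p sp pE] [q sq qE]; exists (p * q).
  by rewrite (leq_trans (size_polyMleq _ _))// (leq_trans (leq_pred _))// leq_add.
by move=> z z0; rewrite hornerM -pE// -qE// exprD mulrACA.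
Qed.

Lemma laurent_cst (a : C) : laurent 0 1 (fun=> a).
Proof. by exists a%:P; [exact: size_polyC_leq1|move=> z _; rewrite hornerC expr0 mul1r]. Qed.

Lemma laurent_sum (I : Type) (r : seq I) N M (phi : I -> C -> C) :
  (forall i, laurent N M (phi i)) -> laurent N M (fun z => \sum_(i <- r) phi i z).
Proof.
move=> H; elim: r => [|i r IH].
  exists 0; first by rewrite size_poly0.
  by move=> z _; rewrite big_nil mulr0 horner0.
apply: laurent_ext (laurentD (H i) IH) => z _; by rewrite big_cons.
Qed.

Lemma laurentZ N M (a : C) phi : laurent N M phi -> laurent N M (fun z => a * phi z).
Proof.
move=> [p sp pE]; exists (a *: p); first exact: leq_trans (size_scale_leq _ _) sp.
by move=> z z0; rewrite hornerZ -pE// mulrCA.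
Qed.

Lemma laurent_inv N M phi : laurent 0 M.+1 phi -> (M <= N)%N -> laurent N N.+1 (fun z => phi z^-1).
Proof.
move=> [p sp pE] MN.
exists (\sum_(i < M.+1) p`_i *: 'X^(N - i)).
  apply: (leq_trans (size_sum _ _ _)); apply/bigmax_leqP => i _.
  by rewrite (leq_trans (size_scale_leq _ _))// size_polyXn ltnS leq_subr.
move=> z z0; rewrite -[phi _]mul1r -[1 * _]/(z^-1 ^+ 0 * _) pE ?invr_eq0//.
rewrite (horner_coef_wide _ sp) horner_sum mulr_sumr; apply: eq_bigr => i _.
rewrite hornerZ hornerXn mulrCA exprVn; congr (_ * _).
have iN : (i <= N)%N by rewrite (leq_trans _ MN)// -ltnS.
by rewrite -{1}(subnK iN) exprD mulfK// expf_neq0.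
Qed.

(** z and - z have the same square, so comparing the two values kills the odd part of the
    polynomial; every w is reached through a square root. *)
Lemma laurent_even N M phi psi : laurent (2 * N) M phi ->
  (forall z, z != 0 -> phi z = psi (z ^+ 2)) -> laurent N M psi.
Proof.
move=> [p sp pE] H; exists (even_poly p).
  apply: (leq_trans _ sp); apply: (leq_trans (size_even_poly _)).
  have := odd_double_half (size p); rewrite uphalf_half; lia.
move=> w w0; set z := sqrtc w.
have zw : z ^+ 2 = w by rewrite sqr_sqrtc.
have z0 : z != 0 by rewrite sqrtc_eq0.
have z0' : - z != 0 by rewrite oppr_eq0.
have split y : p.[y] = (even_poly p).[y ^+ 2] + (odd_poly p).[y ^+ 2] * y.
  by rewrite -{1}(poly_even_odd p) hornerD hornerMX !horner_comp !hornerXn.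
have e1 : w ^+ N * psi w = (even_poly p).[w] + (odd_poly p).[w] * z.
  by have := pE z z0; rewrite split H// exprM zw.
have e2 : w ^+ N * psi w = (even_poly p).[w] - (odd_poly p).[w] * z.
  by have := pE (- z) z0'; rewrite split H// exprM sqrrN zw mulrN.
have two : (2 : C) != 0 by rewrite pnatr_eq0.
apply: (mulfI two).
rewrite [2 * (_ * _)]mulrDl mul1r {1}e1 e2; ring.
Qed.

Definition node (i : nat) : C := i.+1%:R.

Lemma node_inj : injective node.
Proof. by move=> i j /eqP; rewrite eqr_nat eqSS => /eqP. Qed.

Lemma node_neq0 i : node i != 0.
Proof. by rewrite pnatr_eq0. Qed.

(** The Lagrange basis at the integers 1, ..., M, twisted by z^N so that it interpolates functions
    with a pole of order N at 0. *)
Definition ell N M (a : 'I_M) (z : C) : C :=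
  z ^- N * node a ^+ N * ((tnth (lagrange M node) a : {poly C})).[z].

(** The weights do not depend on [phi]: applied to every matrix entry at every point of the surface,
    the formula expresses a family by M of its members. *)
Lemma laurent_interpolation N M phi z : (0 < M)%N -> laurent N M phi -> z != 0 ->
  phi z = \sum_(a < M) ell N a z * phi (node a).
Proof.
move=> M0 [q sq qE] z0.
have zN : z ^+ N != 0 by rewrite expf_neq0.
rewrite -[LHS](mulKf zN) qE// {1}(lagrange_gen M0 node_inj sq) horner_sum mulr_sumr.
apply: eq_bigr => a _; rewrite hornerM hornerC -qE ?node_neq0// /ell; ring.
Qed.

Lemma laurent_ell N M (a : 'I_M) : (0 < M)%N -> laurent N M (ell N a).
Proof.
move=> M0; exists (node a ^+ N *: (tnth (lagrange M node) a : {poly C})).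
  by rewrite (leq_trans (size_scale_leq _ _))// size_lagrange_//; exact: node_inj.
move=> z z0; rewrite /ell hornerZ -!mulrA mulVKf// expf_neq0//.
Qed.

(** Clearing denominators with nu^N z^N gives a polynomial vanishing at nu, hence divisible by z -
    nu. This division later cancels the simple poles of the dressing gauge. *)
Lemma laurent_slope N M phi nu : laurent N M phi -> nu != 0 ->
  exists2 psi, (exists N' M', laurent N' M' psi) &
    forall z, z != 0 -> phi z - phi nu = (z - nu) * psi z.
Proof.
move=> [p sp pE] nu0.
have nuN : nu ^+ N != 0 by rewrite expf_neq0.
pose r := nu ^+ N *: p - p.[nu] *: 'X^N.
have /factor_theorem[q qE] : root r nu.
  by rewrite rootE hornerD hornerN !hornerZ hornerXn mulrC subrr.
exists (fun z => nu ^- N * (z ^- N * q.[z])).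
  exists N, (size q), (nu ^- N *: q); first exact: size_scale_leq.
  by move=> z z0; rewrite hornerZ mulrCA mulVKf// expf_neq0.
move=> z z0; have zN : z ^+ N != 0 by rewrite expf_neq0.
have -> : phi z - phi nu = nu ^- N * (z ^- N * r.[z]).
  rewrite hornerD hornerN !hornerZ hornerXn -!pE//; field.
  by rewrite zN nuN.
by rewrite qE hornerM hornerXsubC; ring.
Qed.

Lemma derivable_continuous f (z : C) : derivable f z 1 -> {for z, continuous f}.
Proof. by move=> /derivable1_diffP; exact: differentiable_continuous. Qed.

Lemma near_neq (z a : C1) : \forall w \near z^', w != a.
Proof.
have [<-|za] := eqVneq z a; first exact: nbhs_dnbhs_neq.
apply: nbhs_dnbhs; have d0 : 0 < `|z - a| by rewrite normr_gt0 subr_eq0.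
near=> w; apply/eqP => wa.
have : `|z - w| < `|z - a| by near: w; exact: cvgr_dist_lt d0.
by rewrite wa ltxx.
Unshelve. all: by end_near.
Qed.

(** Only continuity at [z] enters. Identities known away from the poles are extended to them in this
    way. *)
Lemma hol_eq_near f g (z : C1) : derivable f z 1 -> derivable g z 1 ->
  (\forall w \near z^', f w = g w) -> f z = g z.
Proof.
move=> /derivable_continuous cf /derivable_continuous cg fg.
apply/eqP/negPn/negP => fgz.
have e0 : 0 < `|f z - g z| / 2 by rewrite divr_gt0// normr_gt0 subr_eq0.
have /cvgrPdist_lt/(_ _ e0)/nbhs_dnbhs nf := cf.
have /cvgrPdist_lt/(_ _ e0)/nbhs_dnbhs ng := cg.
have [w [[h1 h2] h3]] := filter_ex (filterI (filterI nf ng) fg).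
have : `|f z - g z| < `|f z - g z|.
  rewrite {2}[`|f z - g z|]splitr; apply: le_lt_trans (ltrD h1 h2).
  by rewrite [`|g z - _|]distrC -h3 (le_trans _ (ler_normD _ _))// addrA subrK.
by rewrite ltxx.
Qed.

Lemma laurent_derivable N M phi (z : C) : laurent N M phi -> z != 0 ->
  derivable (phi : C1 -> C1) z 1.
Proof.
move=> [q _ qE] z0.
have d1 : derivable (fun w : C1 => (q.[w] / w ^+ N : C1)) z 1.
  have dX := @cderivX _ (fun w : C1 => w) N _ (@cderiv_id _ z).
  have dV := @cderivV _ (fun w : C1 => (w ^+ N : C1)) z (expf_neq0 N z0) dX.
  exact: (@cderivM _ (fun w : C1 => (q.[w] : C1)) (fun w : C1 => ((w ^+ N)^-1 : C1)) z
    (@derivable_poly _ q z) dV).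
apply/complex_derivableP; have /complex_derivableP[c H] := d1.
have z0n : 0 < nrm z by exact: nrm_gt0.
(* The radius is cut at |z| / 2 to stay away from 0, where [phi] is arbitrary. *)
exists c => e /H[del del0 Hd]; exists (Num.min del (nrm z / 2)).
  by rewrite lt_min del0 divr_gt0 ?nrm_gt0.
have E w : w != 0 -> q.[w] / w ^+ N = phi w.
  by move=> w0; rewrite -qE// mulrAC mulfV ?mul1r// expf_neq0.
move=> w; rewrite normcR lecR le_min => /andP[h1 h2].
have w0 : w != 0.
  apply/eqP => w0; move: h2; rewrite w0 sub0r nrmN; lra.
by have := Hd w; rewrite !E//; apply; rewrite normcR lecR.
Qed.

End LaurentFunctions.

(** * Calculus on the surface *)

Section PlanarCalculus.
Variable R : realType.
Local Notation R2 := (R * R)%type.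
Implicit Types (D : set R2) (f g h : R2 -> R).

Lemma near_eq_differentiable (V W : normedModType R) (f g : V -> W) (x : V) :
  (\forall y \near x, f y = g y) -> differentiable f x -> differentiable g x.
Proof.
move=> fg /diff_locallyP[dc df].
have fgx : f x = g x by exact: nbhs_singleton fg.
have E : g \o shift x = cst (g x) + 'd f x +o_ 0 id.
  apply/eqaddoP => e e0; have /eqaddoP/(_ e e0) nf := df.
  have nfg : \forall y \near (0 : V), f (y + x) = g (y + x).
    by move: fg; rewrite (near_shift 0) /=; apply: filterS => y; rewrite /= subr0.
  near=> y; rewrite !fctE /= -fgx -(near nfg y)//.
  by near: y; move: nf; apply: filterS => y; rewrite !fctE.
have dg := diff_unique dc E.
by apply/diff_locallyP; rewrite dg.
Unshelve. all: by end_near.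
Qed.

Lemma Cn_on_ext n D f g : open D -> (forall a, D a -> f a = g a) ->
  Cn_on n D f -> Cn_on n D g.
Proof.
move=> oD; elim: n f g => [|n IH] f g fg /=.
  move=> cf a Da; have nfg : \forall y \near a, f y = g y.
    by move: (open_nbhs_nbhs (conj oD Da)); apply: filterS.
  have := cf a Da; rewrite /prop_for /continuous_at (fg _ Da) => H.
  by apply: cvg_trans H; apply: near_eq_cvg; exact: filterS nfg => y.
move=> [df Df]; have nfg a : D a -> \forall y \near a, f y = g y.
  by move=> Da; move: (open_nbhs_nbhs (conj oD Da)); apply: filterS.
split=> [a Da|v]; first exact: near_eq_differentiable (nfg a Da) (df a Da).
by apply: IH (Df v) => a Da; exact: near_eq_derive (nfg a Da).
Qed.

Lemma Cn_onS n D f : Cn_on n.+1 D f -> Cn_on n D f.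
Proof.
elim: n f => [|n IH] f [df Df]; last by split=> // v; exact: IH.
by move=> a /df; exact: differentiable_continuous.
Qed.

Lemma Cn_on_cst n D (c : R) : Cn_on n D (fun=> c).
Proof.
elim: n c => [|n IH] c; first by move=> a _; exact: cvg_cst.
split=> [a _|v]; first exact: differentiable_cst.
rewrite (_ : 'D_v (fun=> c) = fun=> 0)//.
by apply/funext => a; exact: derive_cst.
Qed.

Lemma Cn_onD n D f g : open D -> Cn_on n D f -> Cn_on n D g -> Cn_on n D (fun a => f a + g a).
Proof.
move=> oD; elim: n f g => [|n IH] f g.
  by move=> cf cg a Da; apply: continuousD; [exact: cf|exact: cg].
move=> [df Df] [dg Dg]; split=> [a Da|v].
  by apply: differentiableD; [exact: df|exact: dg].
apply: Cn_on_ext (IH _ _ (Df v) (Dg v)) => // a Da.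
by rewrite [RHS]deriveD//; apply: diff_derivable; [exact: df|exact: dg].
Qed.

Lemma Cn_onM n D f g : open D -> Cn_on n D f -> Cn_on n D g -> Cn_on n D (fun a => f a * g a).
Proof.
move=> oD; elim: n f g => [|n IH] f g.
  by move=> cf cg a Da; apply: continuousM; [exact: cf|exact: cg].
move=> cf cg; have [df Df] := cf; have [dg Dg] := cg; split=> [a Da|v].
  by apply: differentiableM; [exact: df|exact: dg].
apply: Cn_on_ext (Cn_onD oD (IH _ _ (Cn_onS cf) (Dg v)) (IH _ _ (Cn_onS cg) (Df v))) => // a Da.
by rewrite [RHS]deriveM//; apply: diff_derivable; [exact: df|exact: dg].
Qed.

Lemma Cn_onV n D f : open D -> (forall a, D a -> f a != 0) -> Cn_on n D f ->
  Cn_on n D (fun a => (f a)^-1).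
Proof.
move=> oD f0; elim: n f f0 => [|n IH] f f0.
  by move=> cf a Da; apply: continuousV; [exact: f0|exact: cf].
move=> cf; have [df Df] := cf; split=> [a Da|v].
  by apply: differentiableV; [exact: df|exact: f0].
have cV := IH _ f0 (Cn_onS cf).
apply: Cn_on_ext (Cn_onM oD (Cn_on_cst n D (-1)) (Cn_onM oD (Cn_onM oD cV cV) (Df v))) => // a Da.
rewrite [RHS]deriveV ?f0//; last by apply: diff_derivable; exact: df.
by rewrite mulN1r -invfM -expr2 -mulNr.
Qed.

Lemma line_derive (f : R2 -> R) w u s : derivable f (w + s *: u) u ->
  is_derive s 1 (fun t => f (w + t *: u)) ('D_u f (w + s *: u)).
Proof.
have E : (fun h : R => h^-1 *: (((fun t => f (w + t *: u)) \o shift s) (h *: 1) - f (w + s *: u))) =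
  (fun h : R => h^-1 *: ((f \o shift (w + s *: u)) (h *: u) - f (w + s *: u))).
  apply/funext => h /=; congr (_ *: (f _ - _)).
  by rewrite scalerDl [h *: 1]mulr1 addrCA.
by move=> df; apply: DeriveDef; rewrite /derivable /derive E.
Qed.

Lemma mvt_line (f : R2 -> R) w u d : 0 < d ->
  (forall s, 0 <= s <= d -> differentiable f (w + s *: u)) ->
  exists2 s, 0 <= s <= d & f (w + d *: u) - f w = d * 'D_u f (w + s *: u).
Proof.
move=> d0 df.
have der s : 0 <= s <= d -> is_derive s 1 (fun t => f (w + t *: u)) ('D_u f (w + s *: u)).
  by move=> hs; apply: line_derive; apply: diff_derivable; exact: df.
have [s hs E] := @MVT R (fun t => f (w + t *: u)) (fun t => 'D_u f (w + t *: u)) 0 d d0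
  (fun s hs => der s ltac:(by move: hs; rewrite in_itv /= => /andP[/ltW -> /ltW ->])) ltac:(
   apply: derivable_within_continuous => s hs;
   by have [] := der s ltac:(by move: hs; rewrite in_itv /=)).
exists s; first by move: hs; rewrite in_itv /= => /andP[/ltW -> /ltW ->].
by move: E; rewrite scale0r addr0 subr0 mulrC.
Qed.

Lemma differentiable_translate f w x : differentiable f (x + w) ->
  differentiable (fun y => f (y + w)) x.
Proof.
by move=> df; apply: (@differentiable_comp _ _ _ _ (fun y => y + w) f x).
Qed.

Lemma derive_translate f w x u : 'D_u (fun y => f (y + w)) x = 'D_u f (x + w).
Proof.
rewrite /derive; apply: congr1; apply: (congr1 (fun g : R -> R => g @ 0^')); apply/funext => h.
by rewrite /= addrA.
Qed.

(** The mean value theorem in direction u for the difference of f between two parallel sides,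
    followed by the mean value theorem in direction v for the derivative. *)
Lemma mvt_square (f : R2 -> R) a u v d : 0 < d ->
  (forall s t, 0 <= s <= d -> 0 <= t <= d -> differentiable f (a + s *: u + t *: v)) ->
  (forall s t, 0 <= s <= d -> 0 <= t <= d -> differentiable ('D_u f) (a + s *: u + t *: v)) ->
  exists s t, [/\ 0 <= s <= d, 0 <= t <= d &
    f (a + d *: u + d *: v) - f (a + d *: u) - f (a + d *: v) + f a
    = d * d * 'D_v ('D_u f) (a + s *: u + t *: v)].
Proof.
move=> d0 df dDf.
have z0 : 0 <= (0 : R) <= d by rewrite lexx ltW.
have dd : 0 <= d <= d by apply/andP; split=> //; exact: ltW.
pose phi : R2 -> R := fun x => f (x + d *: v) - f x.
have dphi s : 0 <= s <= d -> differentiable phi (a + s *: u).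
  move=> hs; apply: differentiableB; first by apply: differentiable_translate; exact: df.
  by have := df s 0 hs z0; rewrite scale0r addr0.
have [s hs E] := mvt_line d0 dphi.
have Dphi : 'D_u phi (a + s *: u) = 'D_u f (a + s *: u + d *: v) - 'D_u f (a + s *: u).
  rewrite deriveB ?derive_translate//; apply: diff_derivable.
    by apply: differentiable_translate; exact: df.
  by have := df s 0 hs z0; rewrite scale0r addr0.
have [t ht E'] := mvt_line d0 (fun t ht => dDf s t hs ht).
exists s, t; split => //.
rewrite -mulrA -E' -Dphi -E /phi opprB addrACA [- f (a + d *: u) + _]addrC.
ring.
Qed.

Lemma dist_trans_half (x y z e : R) : `|x - z| <= e / 2 -> `|y - z| <= e / 2 -> `|x - y| <= e.
Proof. by rewrite !ler_norml => /andP[? ?] /andP[? ?]; lra. Qed.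

(** The second difference of f over a small parallelogram is symmetric in u and v, and equals d^2
    times either mixed derivative at some point of it. Both mixed derivatives are continuous at [a],
    being differentiable by the third order of smoothness. *)
Lemma derive_comm D f a u v : open D -> Cn_on 3 D f -> D a ->
  'D_u ('D_v f) a = 'D_v ('D_u f) a.
Proof.
move=> oD Cf Da; apply/eqP; rewrite -subr_eq0 -normr_eq0 eq_le normr_ge0 andbT.
apply/ler_addgt0Pl => e e0; rewrite addr0.
have e2 : 0 < e / 2 by rewrite divr_gt0.
have c1 : {for a, continuous ('D_u ('D_v f))}.
  have [_ /(_ v)[_ /(_ u)]] := Cf => -[d1 _]; exact: differentiable_continuous (d1 a Da).
have c2 : {for a, continuous ('D_v ('D_u f))}.
  have [_ /(_ u)[_ /(_ v)]] := Cf => -[d1 _]; exact: differentiable_continuous (d1 a Da).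
have n1 : \forall x \near a, D x by exact: open_nbhs_nbhs.
have /cvgrPdist_le/(_ _ e2) n2 := c1.
have /cvgrPdist_le/(_ _ e2) n3 := c2.
have N : \forall x \near a, D x /\ `|'D_u ('D_v f) a - 'D_u ('D_v f) x| <= e / 2 /\
    `|'D_v ('D_u f) a - 'D_v ('D_u f) x| <= e / 2.
  exact: filterI n1 (filterI n2 n3).
have [r r0' H] := (nbhs_normP _ _).1 N.
have r0 : 0 < r by [].
pose K := `|u| + `|v| + 1.
have K0 : 0 < K by rewrite /K ltr_wpDl// addr_ge0.
pose d := r / 2 / K.
have d0 : 0 < d by rewrite !divr_gt0.
have near_a s t : 0 <= s <= d -> 0 <= t <= d -> `|a - (a + s *: u + t *: v)| < r.
  move=> /andP[s0 sd] /andP[t0 td].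
  rewrite -addrA opprD addNKr normrN; apply: (le_lt_trans (ler_normD _ _)).
  rewrite !normrZ !ger0_norm//.
  apply: (@le_lt_trans _ _ (d * K)); last by rewrite /d divfK ?lt0r_neq0//; lra.
  have := ler_wpM2r (normr_ge0 u) sd; have := ler_wpM2r (normr_ge0 v) td.
  rewrite /K; lra.
have [dfD DfD] := Cf.
have [s [t [hs ht E]]] := @mvt_square f a u v d d0
  (fun s t hs ht => dfD _ (H _ (near_a s t hs ht)).1)
  (fun s t hs ht => (DfD u).1 _ (H _ (near_a s t hs ht)).1).
have comm s' t' : a + s' *: v + t' *: u = a + t' *: u + s' *: v by rewrite addrAC.
have df' p q : 0 <= p <= d -> 0 <= q <= d -> differentiable f (a + p *: v + q *: u).
  by move=> hp hq; rewrite comm; exact: dfD _ (H _ (near_a q p hq hp)).1.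
have dDf' p q : 0 <= p <= d -> 0 <= q <= d -> differentiable ('D_v f) (a + p *: v + q *: u).
  by move=> hp hq; rewrite comm; exact: (DfD v).1 _ (H _ (near_a q p hq hp)).1.
have [s' [t' [hs' ht' E']]] := mvt_square d0 df' dDf'.
have EE : 'D_v ('D_u f) (a + s *: u + t *: v) = 'D_u ('D_v f) (a + s' *: v + t' *: u).
  have dd0 : d * d != 0 by rewrite mulf_neq0// lt0r_neq0.
  have E2 := E'; rewrite [a + d *: v + d *: u]addrAC [X in X + f a]addrAC E in E2.
  exact: (mulfI dd0 E2).
have [_ [_ g2]] := H _ (near_a s t hs ht).
have na' : `|a - (a + s' *: v + t' *: u)| < r by rewrite comm; exact: near_a.
have [_ [g1 _]] := H _ na'.
by apply: dist_trans_half g1 _; rewrite -EE.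
Qed.

End PlanarCalculus.

Section ComplexPlanar.
Variable R : realType.
Local Notation C := R[i].
Local Notation C1 := (R[i]^o).
Local Notation R2 := (R * R)%type.
Implicit Types (D : set R2) (F G : R2 -> C).

Definition csm D F := Cinf_on D (@complex.Re R \o F) /\ Cinf_on D (@complex.Im R \o F).

Lemma Cinf_ext D (f g : R2 -> R) : open D -> (forall a, D a -> f a = g a) ->
  Cinf_on D f -> Cinf_on D g.
Proof. by move=> oD fg H n; exact: Cn_on_ext (H n). Qed.

Lemma csm_ext D F G : open D -> (forall a, D a -> F a = G a) -> csm D F -> csm D G.
Proof.
by move=> oD FG [h1 h2]; split; [apply: Cinf_ext h1|apply: Cinf_ext h2] => // a Da /=; rewrite FG.
Qed.

Lemma csm_cst D (c : C) : csm D (fun=> c).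
Proof. by split=> n; exact: Cn_on_cst. Qed.

Lemma csmD D F G : open D -> csm D F -> csm D G -> csm D (fun a => F a + G a).
Proof.
move=> oD [f1 f2] [g1 g2]; split.
  apply: Cinf_ext (fun n => Cn_onD oD (f1 n) (g1 n)) => // a _ /=.
  by case: (F a) => ? ?; case: (G a).
apply: Cinf_ext (fun n => Cn_onD oD (f2 n) (g2 n)) => // a _ /=.
by case: (F a) => ? ?; case: (G a).
Qed.

Lemma csmM D F G : open D -> csm D F -> csm D G -> csm D (fun a => F a * G a).
Proof.
move=> oD [f1 f2] [g1 g2].
have neg n f : Cn_on n D f -> Cn_on n D (fun a => -1 * f a) by exact/Cn_onM/Cn_on_cst.
split.
  apply: Cinf_ext (fun n => Cn_onD oD (Cn_onM oD (f1 n) (g1 n)) (neg n _ (Cn_onM oD (f2 n) (g2 n)))) => // a _ /=.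
  by case: (F a) => ? ?; case: (G a) => ? ? /=; rewrite mulN1r.
apply: Cinf_ext (fun n => Cn_onD oD (Cn_onM oD (f1 n) (g2 n)) (Cn_onM oD (f2 n) (g1 n))) => // a _ /=.
by case: (F a) => ? ?; case: (G a) => ? ? /=; rewrite addrC.
Qed.

Lemma csm_conj D F : open D -> csm D F -> csm D (fun a => conjc (F a)).
Proof.
move=> oD [f1 f2]; split.
  by apply: Cinf_ext f1 => // a _ /=; case: (F a).
apply: Cinf_ext (fun n => Cn_onM oD (Cn_on_cst n D (-1)) (f2 n)) => // a _ /=.
by case: (F a) => ? ? /=; rewrite mulN1r.
Qed.

(** 1 / F is the conjugate of F divided by the real function |F|^2. *)
Lemma csmV D F : open D -> (forall a, D a -> F a != 0) -> csm D F -> csm D (fun a => (F a)^-1).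
Proof.
move=> oD F0 [f1 f2].
pose N a := complex.Re (F a) * complex.Re (F a) + complex.Im (F a) * complex.Im (F a).
have cN n : Cn_on n D N by apply: Cn_onD => //; apply: Cn_onM.
have N0 a : D a -> N a != 0.
  move=> /F0; rewrite /N -!expr2; apply: contra.
  rewrite paddr_eq0 ?sqr_ge0// !sqrf_eq0 => /andP[/eqP r0 /eqP i0].
  by case: (F a) r0 i0 => x y /= -> ->.
have cV n := Cn_onV oD N0 (cN n).
split.
  apply: Cinf_ext (fun n => Cn_onM oD (f1 n) (cV n)) => // a _ /=.
  by rewrite /N; case: (F a) => x y /=; rewrite -!expr2.
apply: Cinf_ext (fun n => Cn_onM oD (Cn_on_cst n D (-1)) (Cn_onM oD (f2 n) (cV n))) => // a _ /=.
by rewrite /N; case: (F a) => x y /=; rewrite -!expr2 mulN1r.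
Qed.

Lemma csm_sum (I : Type) (r : seq I) (P : pred I) D (F : I -> R2 -> C) : open D ->
  (forall i, P i -> csm D (F i)) -> csm D (fun a => \sum_(i <- r | P i) F i a).
Proof.
move=> oD H; elim: r => [|j r IH].
  by apply: csm_ext (csm_cst D 0) => // a _; rewrite big_nil.
have [Pj|Pj] := boolP (P j).
  by apply: csm_ext (csmD oD (H j Pj) IH) => // a _; rewrite big_cons Pj.
by apply: csm_ext IH => // a _; rewrite big_cons (negbTE Pj).
Qed.

Lemma csm_prod (I : Type) (r : seq I) (P : pred I) D (F : I -> R2 -> C) : open D ->
  (forall i, P i -> csm D (F i)) -> csm D (fun a => \prod_(i <- r | P i) F i a).
Proof.
move=> oD H; elim: r => [|j r IH].
  by apply: csm_ext (csm_cst D 1) => // a _; rewrite big_nil.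
have [Pj|Pj] := boolP (P j).
  by apply: csm_ext (csmM oD (H j Pj) IH) => // a _; rewrite big_cons Pj.
by apply: csm_ext IH => // a _; rewrite big_cons (negbTE Pj).
Qed.

Definition pd (v : R2) F (a : R2) : C :=
  ('D_v (@complex.Re R \o F) a +i* 'D_v (@complex.Im R \o F) a)%C.

Lemma csm_pd D v F : csm D F -> csm D (pd v F).
Proof. by move=> [f1 f2]; split=> n; [have [_ /(_ v)] := f1 n.+1|have [_ /(_ v)] := f2 n.+1]. Qed.

Lemma pd_ext D v F G a : open D -> D a -> (forall b, D b -> F b = G b) -> pd v F a = pd v G a.
Proof.
move=> oD Da FG; have n1 : \forall b \near a, F b = G b.
  by move: (open_nbhs_nbhs (conj oD Da)); apply: filterS.
by congr (_ +i* _)%C; apply: near_eq_derive; apply: filterS n1 => b /= ->.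
Qed.

Lemma Cinf_derivable D (f : R2 -> R) a v : Cinf_on D f -> D a -> derivable f a v.
Proof. by move=> /(_ 1%N)[df _] /df; exact: diff_derivable. Qed.

Lemma pd_cst v (c : C) a : pd v (fun=> c) a = 0.
Proof. by rewrite /pd; congr (_ +i* _)%C; exact: derive_cst. Qed.

Lemma pdD D v F G a : csm D F -> csm D G -> D a ->
  pd v (fun b => F b + G b) a = pd v F a + pd v G a.
Proof.
move=> [f1 f2] [g1 g2] Da.
rewrite /pd; set fr := @complex.Re R \o F; set fi := @complex.Im R \o F.
set gr := @complex.Re R \o G; set gi := @complex.Im R \o G.
have -> : @complex.Re R \o (fun b => F b + G b) = fr + gr.
  by apply/funext => b; rewrite !fctE /fr /gr /=; case: (F b) => ? ?; case: (G b).
have -> : @complex.Im R \o (fun b => F b + G b) = fi + gi.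
  by apply/funext => b; rewrite !fctE /fi /gi /=; case: (F b) => ? ?; case: (G b).
rewrite deriveD; [|exact: Cinf_derivable f1 Da|exact: Cinf_derivable g1 Da].
by rewrite deriveD; [|exact: Cinf_derivable f2 Da|exact: Cinf_derivable g2 Da].
Qed.

Lemma pdM D v F G a : csm D F -> csm D G -> D a ->
  pd v (fun b => F b * G b) a = pd v F a * G a + F a * pd v G a.
Proof.
move=> [f1 f2] [g1 g2] Da.
have df1 := Cinf_derivable (v := v) f1 Da; have df2 := Cinf_derivable (v := v) f2 Da.
have dg1 := Cinf_derivable (v := v) g1 Da; have dg2 := Cinf_derivable (v := v) g2 Da.
rewrite /pd; set fr := @complex.Re R \o F; set fi := @complex.Im R \o F.
set gr := @complex.Re R \o G; set gi := @complex.Im R \o G.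
have -> : @complex.Re R \o (fun b => F b * G b) = fr * gr - fi * gi.
  by apply/funext => b; rewrite !fctE /fr /fi /gr /gi /=; case: (F b) => ? ?; case: (G b).
have -> : @complex.Im R \o (fun b => F b * G b) = fr * gi + fi * gr.
  by apply/funext => b; rewrite !fctE /fr /fi /gr /gi /=; case: (F b) => ? ?; case: (G b).
have d1 : derivable fr a v := df1; have d2 : derivable fi a v := df2.
have d3 : derivable gr a v := dg1; have d4 : derivable gi a v := dg2.
rewrite (deriveB (derivableM d1 d3) (derivableM d2 d4)).
rewrite (deriveD (derivableM d1 d4) (derivableM d2 d3)).
rewrite (deriveM d1 d3) (deriveM d2 d4) (deriveM d1 d4) (deriveM d2 d3).
have -> : F a = (fr a +i* fi a)%C by rewrite /fr /fi /=; case: (F a).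
have -> : G a = (gr a +i* gi a)%C by rewrite /gr /gi /=; case: (G a).
move: ('D_v fr a) ('D_v fi a) ('D_v gr a) ('D_v gi a) (fr a) (fi a) (gr a) (gi a).
move=> a1 a2 a3 a4 b1 b2 b3 b4.
by rewrite /GRing.scale /=; apply/eqP; rewrite eq_complex /=; apply/andP; split; apply/eqP; ring.
Qed.

Lemma pd_conj D v F a : csm D F -> D a -> pd v (fun b => conjc (F b)) a = conjc (pd v F a).
Proof.
move=> [f1 f2] Da; rewrite /pd.
have -> : @complex.Re R \o (fun b => conjc (F b)) = @complex.Re R \o F.
  by apply/funext => b /=; case: (F b).
have -> : @complex.Im R \o (fun b => conjc (F b)) = - (@complex.Im R \o F).
  by apply/funext => b; rewrite !fctE /=; case: (F b).
by rewrite deriveN; last exact: Cinf_derivable f2 Da.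
Qed.

Lemma pd_comm D u v F a : open D -> csm D F -> D a -> pd u (pd v F) a = pd v (pd u F) a.
Proof.
move=> oD [f1 f2] Da.
have h1 := @derive_comm R D _ a u v oD (f1 3%N) Da.
have h2 := @derive_comm R D _ a u v oD (f2 3%N) Da.
rewrite -[LHS]/('D_u ('D_v (@complex.Re R \o F)) a +i* 'D_u ('D_v (@complex.Im R \o F)) a)%C.
by rewrite h1 h2.
Qed.

End ComplexPlanar.

Section SurfaceCalculusLemmas.
Variables (R : realType) (Sg : riemannSurface R).
Local Notation C := R[i].
Local Notation C1 := (R[i]^o).
Local Notation R2 := (R * R)%type.
Implicit Types (U V : set Sg) (c : chart Sg).

(** The set of coordinates on which [smooth_on] tests real and imaginary parts, given a name so that
    its openness can be stated. *)
Definition cimg c U : set R2 := [set a | (cmap c @` (U `&` cdom c)) (toC a)].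

Lemma ofCK (z : C) : toC (ofC z) = z.
Proof. by case: z. Qed.

Lemma toC_continuous : continuous (@toC R).
Proof.
move=> a; apply/cvgrPdist_le => e0 /real_complex_gt0[e egt0 ->{e0}].
have e2 : 0 < e / 2 by rewrite divr_gt0.
have /cvgrPdist_le/(_ _ e2) n1 : x.1 @[x --> a] --> a.1 by exact: cvg_fst.
have /cvgrPdist_le/(_ _ e2) n2 : x.2 @[x --> a] --> a.2 by exact: cvg_snd.
apply: filterS (filterI n1 n2) => b [/= h1 h2].
rewrite -[toC a - toC b]/((a.1 - b.1) +i* (a.2 - b.2))%C.
apply: (le_trans (norm_complex_le _ _)); rewrite lecR (splitr e); exact: lerD.
Qed.

Lemma cimg_open c U : open U -> open (cimg c U).
Proof.
move=> oU; apply: (@open_comp _ _ (@toC R) (cmap c @` (U `&` cdom c))).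
  by move=> a _; exact: toC_continuous.
rewrite openE => _ [p [Up cp] <-]; rewrite /interior.
have Ip : (cmap c @` cdom c) (cmap c p) by exists p.
have := @cinv_cont _ _ c.
rewrite continuous_open_subspace; last exact: cimg_open.
move=> /(_ _ (mem_set Ip)) H.
have N1 : \forall z \near cmap c p, (U `&` cdom c) (cinv c z).
  apply: H; rewrite cmapK//; apply: open_nbhs_nbhs; split => //.
  by apply: openI => //; exact: cdom_open.
have N2 : \forall z \near cmap c p, (cmap c @` cdom c) z.
  by apply: open_nbhs_nbhs; split => //; exact: cimg_open.
apply: filterS (filterI N1 N2) => z [h1 [q cq qz]].
by exists (cinv c z) => //; rewrite -qz cmapK.
Qed.

Lemma cimg_mem c U p : U p -> cdom c p -> cimg c U (ofC (cmap c p)).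
Proof. by move=> Up cp; exists p => //; rewrite ofCK. Qed.

Lemma cimg_cdom c U : cimg c (U `&` cdom c) = cimg c U.
Proof. by rewrite /cimg -setIA setIid. Qed.

Lemma in_chartE c (f : Sg -> C) p : cdom c p -> in_chart c f (ofC (cmap c p)) = f p.
Proof. by move=> cp; rewrite /in_chart ofCK cmapK. Qed.

Lemma cimgP c U a : cimg c U a -> exists p, [/\ U p, cdom c p & forall f, in_chart c f a = f p].
Proof.
by move=> [p [Up cp] e]; exists p; split => // f; rewrite /in_chart -e cmapK.
Qed.

Lemma Cn_on_sub n (D D' : set R2) h : D' `<=` D -> Cn_on n D h -> Cn_on n D' h.
Proof.
move=> sD; elim: n h => [|n IH] h; first by move=> H a Da; exact (H a (sD a Da)).
move=> [dh Dh]; split=> [a Da|v]; first exact (dh a (sD a Da)).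
by apply: IH; exact: Dh.
Qed.

(** Derivatives at a point do not see the ambient set D, so regularity may be tested on pieces that
    need not be the same for different points. *)
Lemma Cn_on_local n (D : set R2) (h : R2 -> R) :
  (forall a, D a -> exists2 D', D' a & Cn_on n D' h) -> Cn_on n D h.
Proof.
elim: n h => [|n IH] h H; first by move=> a Da; have [D' D'a Ch] := H a Da; exact (Ch a D'a).
split=> [a Da|v].
  by have [D' D'a [dh _]] := H a Da; exact (dh a D'a).
by apply: IH => a Da; have [D' D'a [_ Dh]] := H a Da; exists D' => //; exact: Dh.
Qed.

(** The rules of differentiation concern one chart at a time; quantifying over the chart recovers
    [smooth_on]. *)
Definition smc m n c U (f : Sg -> 'M[C]_(m, n)) :=
  forall i j, csm (cimg c U) (in_chart c (fun x => f x i j)).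

Lemma smooth_onP m n U (f : Sg -> 'M[C]_(m, n)) : smooth_on U f <-> forall c, smc c U f.
Proof. by split. Qed.

Lemma smc_cdom m n c U (f : Sg -> 'M[C]_(m, n)) : smc c (U `&` cdom c) f = smc c U f.
Proof. by rewrite /smc cimg_cdom. Qed.

Lemma cimg_sub c U V : V `<=` U -> cimg c V `<=` cimg c U.
Proof. by move=> sV a [p [Vp cp] e]; exists p => //; split => //; exact: sV. Qed.

Lemma smc_sub m n c U V (f : Sg -> 'M[C]_(m, n)) : V `<=` U -> smc c U f -> smc c V f.
Proof.
move=> sV sf i j; have [h1 h2] := sf i j.
by split=> k; [apply: Cn_on_sub (h1 k)|apply: Cn_on_sub (h2 k)]; exact: cimg_sub.
Qed.

Lemma smooth_on_sub m n U V (f : Sg -> 'M[C]_(m, n)) : V `<=` U -> smooth_on U f -> smooth_on V f.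
Proof. by move=> sV /smooth_onP sf; apply/smooth_onP => c; exact: smc_sub (sf c). Qed.

Lemma smooth_on_local m n U (f : Sg -> 'M[C]_(m, n)) :
  (forall p, U p -> exists N, [/\ open N, N p & smooth_on N f]) -> smooth_on U f.
Proof.
move=> H c i j /=; split=> k; apply: Cn_on_local => a [p [Up cp] e]; have [N [oN Np sf]] := H p Up.
  exists (cimg c N); first by exists p.
  by have [h _] := sf c i j; exact: h.
exists (cimg c N); first by exists p.
by have [_ h] := sf c i j; exact: h.
Qed.

Lemma smc_ext m n c U (f g : Sg -> 'M[C]_(m, n)) : open U ->
  (forall p, U p -> cdom c p -> f p = g p) -> smc c U f -> smc c U g.
Proof.
move=> oU fg sf i j; apply: csm_ext (sf i j); first exact: cimg_open.
by move=> a /cimgP[p [Up cp E]]; rewrite !E fg.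
Qed.

Lemma smc_cst m n c U (M : 'M[C]_(m, n)) : smc c U (fun=> M).
Proof. by move=> i j; exact: csm_cst. Qed.

Lemma smcD m n c U (f g : Sg -> 'M[C]_(m, n)) : open U ->
  smc c U f -> smc c U g -> smc c U (fun x => f x + g x).
Proof.
move=> oU sf sg i j; have oI := cimg_open (c := c) oU.
by apply: csm_ext (csmD oI (sf i j) (sg i j)) => // a _; rewrite /in_chart mxE.
Qed.

Lemma smcM m n k c U (f : Sg -> 'M[C]_(m, n)) (g : Sg -> 'M[C]_(n, k)) : open U ->
  smc c U f -> smc c U g -> smc c U (fun x => f x *m g x).
Proof.
move=> oU sf sg i j; have oI := cimg_open (c := c) oU.
apply: (@csm_ext _ _ (fun a => \sum_l in_chart c (fun x => f x i l) a * in_chart c (fun x => g x l j) a)) => //.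
  by move=> a _; rewrite /in_chart mxE.
by apply: csm_sum => // l _; exact: csmM.
Qed.

Lemma smcZ m n c U (a : C) (f : Sg -> 'M[C]_(m, n)) : open U ->
  smc c U f -> smc c U (fun x => a *: f x).
Proof.
move=> oU sf i j; have oI := cimg_open (c := c) oU.
by apply: csm_ext (csmM oI (csm_cst _ a) (sf i j)) => // b _; rewrite /in_chart mxE.
Qed.

Lemma smcN m n c U (f : Sg -> 'M[C]_(m, n)) : open U -> smc c U f -> smc c U (fun x => - f x).
Proof.
move=> oU sf; apply: smc_ext (smcZ (-1) oU sf) => // p _ _.
by rewrite scaleN1r.
Qed.

Lemma smcB m n c U (f g : Sg -> 'M[C]_(m, n)) : open U ->
  smc c U f -> smc c U g -> smc c U (fun x => f x - g x).
Proof. by move=> oU sf sg; apply: smcD => //; exact: smcN. Qed.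

Lemma smc_conj m n c U (f : Sg -> 'M[C]_(m, n)) : open U ->
  smc c U f -> smc c U (fun x => map_mx (@conjc R) (f x)).
Proof.
move=> oU sf i j; have oI := cimg_open (c := c) oU.
by apply: csm_ext (csm_conj oI (sf i j)) => // b _; rewrite /in_chart mxE.
Qed.

Lemma csm_det n c U (f : Sg -> 'M[C]_n) : open U -> smc c U f ->
  csm (cimg c U) (in_chart c (fun x => \det (f x))).
Proof.
move=> oU sf; have oI := cimg_open (c := c) oU.
apply: (@csm_ext _ _ (fun a => \sum_(s : 'S_n) (-1) ^+ s *
  \prod_l in_chart c (fun x => f x l (s l)) a)) => //.
apply: csm_sum => // s _.
have cp : csm (cimg c U) (fun a => \prod_l in_chart c (fun x => f x l (s l)) a).
  by apply: csm_prod => // l _; exact: sf.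
exact: csmM oI (csm_cst _ _) cp.
Qed.

Lemma smcV n c U (f : Sg -> 'M[C]_n) : open U -> (forall p, U p -> f p \in unitmx) ->
  smc c U f -> smc c U (fun x => invmx (f x)).
Proof.
move=> oU uf sf i j; have oI := cimg_open (c := c) oU.
have dV : csm (cimg c U) (fun a => (in_chart c (fun x => \det (f x)) a)^-1).
  apply: csmV => //; last exact: csm_det.
  by move=> a /cimgP[p [Up _ ->]]; have := uf p Up; rewrite unitmxE unitfE.
have dA : csm (cimg c U) (in_chart c (fun x => (\adj (f x)) i j)).
  have cm : csm (cimg c U) (in_chart c (fun x => \det (row' j (col' i (f x))))).
    apply: csm_det => // k l; apply: csm_ext (sf (lift j k) (lift i l)) => // a _.
    by rewrite /in_chart !mxE.
  apply: csm_ext (csmM oI (csm_cst _ ((-1) ^+ (j + i))) cm) => // a _.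
  by rewrite /in_chart mxE.
apply: csm_ext (csmM oI dV dA) => // a /cimgP[p [Up _ E]].
by rewrite !E /= /invmx uf// [RHS]mxE.
Qed.

Definition mpd m n (v : R2) c (f : Sg -> 'M[C]_(m, n)) p : 'M[C]_(m, n) :=
  \matrix_(i, j) pderiv v c (fun x => f x i j) p.

Lemma mpdE m n v c (f : Sg -> 'M[C]_(m, n)) p i j :
  mpd v c f p i j = pderiv v c (fun x => f x i j) p.
Proof. by rewrite /mpd mxE. Qed.

(* Both Wirtinger derivatives are of this form, which lets each rule be proved once. *)
Definition wirt m n (ab : C * C) c (f : Sg -> 'M[C]_(m, n)) p : 'M[C]_(m, n) :=
  ab.1 *: mpd (1, 0) c f p + ab.2 *: mpd (0, 1) c f p.

Definition wz : C * C := (2^-1, - 'i%C / 2).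
Definition wzb : C * C := (2^-1, 'i%C / 2).

Lemma wirt_scalar (t x y : C) : (x - t * y) / 2 = 2^-1 * x + - t / 2 * y.
Proof. ring. Qed.

Lemma dzE m n c (f : Sg -> 'M[C]_(m, n)) : dz c f = wirt wz c f.
Proof. apply/funext => p; apply/matrixP => i j; rewrite mxE [RHS]mxE [X in _ = X + _]mxE [X in _ = _ + X]mxE.
  rewrite [X in _ = _ * X + _]mxE [X in _ = _ + _ * X]mxE; exact: wirt_scalar. Qed.

Lemma dzbE m n c (f : Sg -> 'M[C]_(m, n)) : dzb c f = wirt wzb c f.
Proof. apply/funext => p; apply/matrixP => i j; rewrite mxE [RHS]mxE [X in _ = X + _]mxE [X in _ = _ + X]mxE.
  rewrite [X in _ = _ * X + _]mxE [X in _ = _ + _ * X]mxE; have := wirt_scalar (- 'i%C) (pderiv (1, 0) c (fun x => f x i j) p) (pderiv (0, 1) c (fun x => f x i j) p); rewrite mulNr !opprK => E; exact: E. Qed.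

Lemma wirt_leibniz (m n k : nat) (a b : C) (X X' F : 'M[C]_(m, n)) (G Y Y' : 'M[C]_(n, k)) :
  a *: (X *m G + F *m Y) + b *: (X' *m G + F *m Y') =
  (a *: X + b *: X') *m G + F *m (a *: Y + b *: Y').
Proof.
by rewrite !scalerDr !mulmxDl !mulmxDr -!scalemxAl -!scalemxAr addrACA.
Qed.

Lemma map_conj_comb m n (a b : C) (X Y : 'M[C]_(m, n)) :
  map_mx (@conjc R) (a *: X + b *: Y) =
  conjc a *: map_mx (@conjc R) X + conjc b *: map_mx (@conjc R) Y.
Proof. by rewrite map_mxD !map_mxZ. Qed.

Lemma conj_wz : (conjc wz.1, conjc wz.2) = wzb.
Proof.
rewrite /wz /wzb; congr (_, _); first by rewrite conjc_inv conjc_nat.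
apply/eqP; rewrite eq_complex /=; apply/andP; split; apply/eqP; ring.
Qed.

Section AtPoint.
Variables (c : chart Sg) (U : set Sg) (p : Sg).
Hypotheses (oU : open U) (Up : U p) (cp : cdom c p).
Let oI := cimg_open (c := c) oU.
Let Ip := cimg_mem Up cp.

Lemma mpd_ext m n v (f g : Sg -> 'M[C]_(m, n)) : (forall q, U q -> f q = g q) ->
  mpd v c f p = mpd v c g p.
Proof.
move=> fg; apply/matrixP => i j; rewrite !mxE.
by apply: pd_ext oI Ip _ => a /cimgP[q [Uq cq E]]; rewrite !E fg.
Qed.

Lemma mpd_cst m n v (M : 'M[C]_(m, n)) : mpd v c (fun=> M) p = 0.
Proof. by apply/matrixP => i j; rewrite !mxE; exact: pd_cst. Qed.

Lemma mpdD m n v (f g : Sg -> 'M[C]_(m, n)) : smc c U f -> smc c U g ->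
  mpd v c (fun x => f x + g x) p = mpd v c f p + mpd v c g p.
Proof.
move=> sf sg; apply/matrixP => i j; rewrite !mxE.
rewrite -[RHS](pdD v (sf i j) (sg i j) Ip).
by apply: pd_ext oI Ip _ => a _; rewrite /in_chart mxE.
Qed.

Lemma pd_sum (I : Type) (r : seq I) v (F : I -> R2 -> C) : (forall i, csm (cimg c U) (F i)) ->
  pd v (fun a => \sum_(i <- r) F i a) (ofC (cmap c p)) = \sum_(i <- r) pd v (F i) (ofC (cmap c p)).
Proof.
move=> H; elim: r => [|i r IH].
  rewrite big_nil; transitivity (pd v (fun=> 0 : C) (ofC (cmap c p))); last exact: pd_cst.
  by apply: pd_ext oI Ip _ => a _; rewrite big_nil.
rewrite big_cons -IH -(pdD v (H i) (@csm_sum R I r xpredT (cimg c U) F oI (fun j _ => H j)) Ip).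
by apply: pd_ext oI Ip _ => a _; rewrite big_cons.
Qed.

Lemma mpdM m n k v (f : Sg -> 'M[C]_(m, n)) (g : Sg -> 'M[C]_(n, k)) : smc c U f -> smc c U g ->
  mpd v c (fun x => f x *m g x) p = mpd v c f p *m g p + f p *m mpd v c g p.
Proof.
move=> sf sg; apply/matrixP => i j; rewrite !mxE -big_split /=.
transitivity (pd v (fun a => \sum_l in_chart c (fun x => f x i l) a * in_chart c (fun x => g x l j) a)
   (ofC (cmap c p))).
  by apply: pd_ext oI Ip _ => a _; rewrite /in_chart mxE.
rewrite pd_sum; last by move=> l; exact: csmM.
apply: eq_bigr => l _; rewrite (pdM v (sf i l) (sg l j) Ip) !in_chartE// !mxE.
by [].
Qed.

Lemma mpd_conj m n v (f : Sg -> 'M[C]_(m, n)) : smc c U f ->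
  mpd v c (fun x => map_mx (@conjc R) (f x)) p = map_mx (@conjc R) (mpd v c f p).
Proof.
move=> sf; apply/matrixP => i j; rewrite !mxE -[RHS](pd_conj v (sf i j) Ip).
by apply: pd_ext oI Ip _ => a _; rewrite /in_chart mxE.
Qed.

Lemma wirt_ext m n ab (f g : Sg -> 'M[C]_(m, n)) : (forall q, U q -> f q = g q) ->
  wirt ab c f p = wirt ab c g p.
Proof. by move=> fg; rewrite /wirt !(mpd_ext _ fg). Qed.

Lemma wirt_cst m n ab (M : 'M[C]_(m, n)) : wirt ab c (fun=> M) p = 0.
Proof. by rewrite /wirt !mpd_cst !scaler0 addr0. Qed.

Lemma wirtD m n ab (f g : Sg -> 'M[C]_(m, n)) : smc c U f -> smc c U g ->
  wirt ab c (fun x => f x + g x) p = wirt ab c f p + wirt ab c g p.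
Proof. by move=> sf sg; rewrite /wirt !mpdD// !scalerDr addrACA. Qed.

Lemma wirtM m n k ab (f : Sg -> 'M[C]_(m, n)) (g : Sg -> 'M[C]_(n, k)) : smc c U f -> smc c U g ->
  wirt ab c (fun x => f x *m g x) p = wirt ab c f p *m g p + f p *m wirt ab c g p.
Proof.
move=> sf sg; rewrite /wirt !mpdM//; exact: wirt_leibniz.
Qed.

Lemma wirtZ m n ab (a : C) (f : Sg -> 'M[C]_(m, n)) : smc c U f ->
  wirt ab c (fun x => a *: f x) p = a *: wirt ab c f p.
Proof.
move=> sf; rewrite -mul_scalar_mx -[LHS](_ : wirt ab c (fun x => a%:M *m f x) p = _).
  by rewrite wirtM ?wirt_cst ?mul0mx ?add0r//; exact: smc_cst.
by apply: wirt_ext => q _; rewrite mul_scalar_mx.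
Qed.

Lemma wirtN m n ab (f : Sg -> 'M[C]_(m, n)) : smc c U f ->
  wirt ab c (fun x => - f x) p = - wirt ab c f p.
Proof.
move=> sf; transitivity (wirt ab c (fun x => -1 *: f x) p).
  by apply: wirt_ext => q _; rewrite scaleN1r.
by rewrite (wirtZ ab _ sf) scaleN1r.
Qed.

Lemma wirtB m n ab (f g : Sg -> 'M[C]_(m, n)) : smc c U f -> smc c U g ->
  wirt ab c (fun x => f x - g x) p = wirt ab c f p - wirt ab c g p.
Proof. by move=> sf sg; rewrite wirtD ?wirtN//; exact: smcN. Qed.

Lemma wirtV n ab (f : Sg -> 'M[C]_n) : (forall q, U q -> f q \in unitmx) -> smc c U f ->
  wirt ab c (fun x => invmx (f x)) p = - (invmx (f p) *m wirt ab c f p *m invmx (f p)).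
Proof.
move=> uf sf; have sV := smcV oU uf sf.
have : wirt ab c (fun x => f x *m invmx (f x)) p = 0.
  rewrite -(wirt_cst ab (1%:M : 'M[C]_n)); apply: wirt_ext => q Uq.
  by rewrite mulmxV// uf.
rewrite wirtM// => /(congr1 (mulmx (invmx (f p)))).
rewrite mulmx0 mulmxDr mulmxA mulKmx ?uf// => /eqP; rewrite addrC addr_eq0 => /eqP ->.
by [].
Qed.

Lemma dz_conj m n (f : Sg -> 'M[C]_(m, n)) : smc c U f ->
  dz c (fun x => map_mx (@conjc R) (f x)) p = map_mx (@conjc R) (dzb c f p).
Proof.
move=> sf; rewrite dzE dzbE -conj_wz /wirt !mpd_conj// map_conj_comb !conjcK.
by [].
Qed.

Lemma dzb_conj m n (f : Sg -> 'M[C]_(m, n)) : smc c U f ->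
  dzb c (fun x => map_mx (@conjc R) (f x)) p = map_mx (@conjc R) (dz c f p).
Proof. by move=> sf; rewrite dzE dzbE -conj_wz /wirt !mpd_conj// map_conj_comb. Qed.

Lemma smc_mpd m n v (f : Sg -> 'M[C]_(m, n)) : smc c U f -> smc c U (mpd v c f).
Proof.
move=> sf i j; apply: csm_ext (csm_pd v (sf i j)) => // a [q [Uq cq] e].
by rewrite /in_chart -e cmapK// mxE /pderiv /pd e.
Qed.

Lemma smc_wirt m n ab (f : Sg -> 'M[C]_(m, n)) : smc c U f -> smc c U (wirt ab c f).
Proof. by move=> sf; apply: smcD => //; apply: smcZ => //; exact: smc_mpd. Qed.

Lemma mpd_comm m n u v (f : Sg -> 'M[C]_(m, n)) : smc c U f ->
  mpd u c (mpd v c f) p = mpd v c (mpd u c f) p.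
Proof.
move=> sf; apply/matrixP => i j; rewrite [LHS]mpdE [RHS]mpdE.
transitivity (pd u (pd v (in_chart c (fun x => f x i j))) (ofC (cmap c p))).
  apply: pd_ext oI Ip _ => a [q [Uq cq] e].
  by rewrite /in_chart -e cmapK// mpdE /pderiv /pd e.
rewrite (pd_comm u v oI (sf i j) Ip).
apply: pd_ext oI Ip _ => a [q [Uq cq] e].
by rewrite /in_chart -e cmapK// mpdE /pderiv /pd e.
Qed.

End AtPoint.
End SurfaceCalculusLemmas.

Arguments wz {R}.
Arguments wzb {R}.

(* The Leibniz computation behind the gauge covariance of curvature; G1, G2, G12 stand
   for the first and mixed derivatives of g and h for its inverse. *)
Lemma gauge_curvature_algebra (K : fieldType) n (g h a b G1 G2 G12 A2 B1 : 'M[K]_n) : h *m g = 1%:M -> g *m h = 1%:M ->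
  let u := g *m a *m h - G1 *m h in let v := g *m b *m h - G2 *m h in
  let H1 := - (h *m G1 *m h) in let H2 := - (h *m G2 *m h) in
  (G1 *m b *m h + g *m B1 *m h + g *m b *m H1 - (G12 *m h + G2 *m H1)) -
  (G2 *m a *m h + g *m A2 *m h + g *m a *m H2 - (G12 *m h + G1 *m H2)) + (u *m v - v *m u)
  = g *m (B1 - A2 + (a *m b - b *m a)) *m h.
Proof.
move=> hg gh u v H1 H2; rewrite /u /v /H1 /H2.
have c1 (X Y : 'M[K]_n) : X *m h *m (g *m Y) = X *m Y by rewrite mulmxA -(mulmxA X) hg mulmx1.
rewrite !(mulmxBl, mulmxBr, mulmxDl, mulmxDr, mulmxN, mulNmx, opprB, opprD, opprK, mulmxA).
rewrite -!(mulmxA _ h g) hg !mulmx1.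
apply/eqP; rewrite -subr_eq0; apply/eqP.
move: (g *m B1 *m h) (g *m A2 *m h) (g *m a *m b *m h) (g *m b *m a *m h) (G12 *m h)
  (G1 *m b *m h) (G2 *m a *m h) (g *m b *m h *m G1 *m h) (g *m a *m h *m G2 *m h)
  (G2 *m h *m G1 *m h) (G1 *m h *m G2 *m h) => x1 x2 x3 x4 x5 x6 x7 x8 x9 x10 x11.
apply/matrixP => i j; rewrite !mxE; ring.
Qed.

Section GaugeTheory.
Variables (R : realType) (Sg : riemannSurface R).
Local Notation C := R[i].
Local Notation R2 := (R * R)%type.
Implicit Types (U V : set Sg) (c : chart Sg).

Section AtPoint.
Variables (c : chart Sg) (U : set Sg) (p : Sg).
Hypotheses (oU : open U) (Up : U p) (cp : cdom c p).

(** Both operators are constant combinations of the real partial derivatives, so this is the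
    symmetry of second derivatives. *)
Lemma wirt_comm m n ab ab' (f : Sg -> 'M[C]_(m, n)) : smc c U f ->
  wirt ab c (wirt ab' c f) p = wirt ab' c (wirt ab c f) p.
Proof.
move=> sf; have s1 := smc_mpd oU (1, 0) sf; have s2 := smc_mpd oU (0, 1) sf.
have W ab1 ab2 : wirt ab1 c (wirt ab2 c f) p =
   ab2.1 *: wirt ab1 c (mpd (1, 0) c f) p + ab2.2 *: wirt ab1 c (mpd (0, 1) c f) p.
  rewrite (wirtD oU Up cp ab1 (smcZ ab2.1 oU s1) (smcZ ab2.2 oU s2)).
  by rewrite (wirtZ oU Up cp ab1 _ s1) (wirtZ oU Up cp ab1 _ s2).
rewrite W W /wirt (mpd_comm oU Up cp (1, 0) (0, 1) sf).
move: (mpd _ c (mpd _ c f) p) (mpd (1, 0) c (mpd (1, 0) c f) p) (mpd (0, 1) c (mpd (0, 1) c f) p).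
move=> A B D; case: ab ab' => [a b] [a' b'] /=.
by apply/matrixP => i j; rewrite !mxE; ring.
Qed.

Lemma gauge_parts n (g : Sg -> 'M[C]_n) (w : form1 Sg n) :
  gauge g w c p = (g p *m (w c p).1 *m invmx (g p) - wirt wz c g p *m invmx (g p),
                   g p *m (w c p).2 *m invmx (g p) - wirt wzb c g p *m invmx (g p)).
Proof. by rewrite /gauge dzE dzbE. Qed.

Lemma gauge_comp n (g h : Sg -> 'M[C]_n) (w : form1 Sg n) :
  smc c U g -> smc c U h -> g p \in unitmx -> h p \in unitmx ->
  gauge g (gauge h w) c p = gauge (fun x => g x *m h x) w c p.
Proof.
move=> sg sh ug uh; rewrite !gauge_parts /= !(wirtM oU Up cp _ sg sh).
have inv : invmx (g p *m h p) = invmx (h p) *m invmx (g p).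
  have ugh : g p *m h p \in unitmx by rewrite unitmx_mul ug uh.
  apply: (can_inj (mulKmx ugh)); rewrite mulmxV// -mulmxA [h p *m _]mulmxA mulmxV//.
  by rewrite mul1mx mulmxV.
have gen (A B E : 'M[C]_n) : g p *m (h p *m A *m invmx (h p) - B *m invmx (h p)) *m invmx (g p) - E *m invmx (g p)
    = g p *m h p *m A *m (invmx (h p) *m invmx (g p)) - (E *m h p + g p *m B) *m (invmx (h p) *m invmx (g p)).
  rewrite mulmxBr mulmxBl mulmxDl opprD addrCA addrC !mulmxA.
  rewrite -[E *m h p *m invmx _]mulmxA mulmxV// mulmx1.
  by rewrite addrAC -addrA [- _ - _]addrC addrA addrAC.
by rewrite inv; congr pair; exact: gen.
Qed.

Lemma gauge_at n (g h : Sg -> 'M[C]_n) (v w : form1 Sg n) :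
  (forall x, U x -> g x = h x) -> v c p = w c p -> gauge g v c p = gauge h w c p.
Proof.
by move=> gh vw; rewrite !gauge_parts vw (gh p Up) (wirt_ext oU Up cp wz gh) (wirt_ext oU Up cp wzb gh).
Qed.

Lemma gauge1 n (w : form1 Sg n) : gauge (fun=> 1%:M) w c p = w c p.
Proof.
rewrite gauge_parts !wirt_cst !mul0mx !subr0 invmx1 !mul1mx !mulmx1.
by case: (w c p).
Qed.

Lemma curvature_at n (v w : form1 Sg n) :
  (forall x, U x -> cdom c x -> v c x = w c x) -> curvature v c p = curvature w c p.
Proof.
move=> vw; rewrite /curvature (vw _ Up cp) !dzE !dzbE.
have oV : open (U `&` cdom c) by apply: openI => //; exact: cdom_open.
have Vp : (U `&` cdom c) p by split.
rewrite (@wirt_ext _ _ _ _ _ oV Vp cp _ _ wz (fun x => (v c x).2) (fun x => (w c x).2)); last first.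
  by move=> q [Uq cq]; rewrite vw.
rewrite (@wirt_ext _ _ _ _ _ oV Vp cp _ _ wzb (fun x => (v c x).1) (fun x => (w c x).1))//.
by move=> q [Uq cq]; rewrite vw.
Qed.

End AtPoint.

(** The second derivatives of g enter only antisymmetrised and cancel by [wirt_comm]; the rest is
    [gauge_curvature_algebra]. *)
Lemma curvature_gauge n c U p (g : Sg -> 'M[C]_n) (w : form1 Sg n) :
  open U -> U p -> cdom c p ->
  smc c U g -> smc c U (fun x => (w c x).1) -> smc c U (fun x => (w c x).2) ->
  (forall x, U x -> g x \in unitmx) ->
  curvature (gauge g w) c p = g p *m curvature w c p *m invmx (g p).
Proof.
move=> oU Up cp sg s1 s2 ug; have sV := smcV oU ug sg.
have sgz := smc_wirt oU wz sg; have sgb := smc_wirt oU wzb sg.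
have key ab' ab (b : Sg -> 'M[C]_n) : smc c U b ->
  wirt ab c (fun x => g x *m b x *m invmx (g x) - wirt ab' c g x *m invmx (g x)) p =
  wirt ab c g p *m b p *m invmx (g p) + g p *m wirt ab c b p *m invmx (g p)
  + g p *m b p *m (- (invmx (g p) *m wirt ab c g p *m invmx (g p)))
  - (wirt ab c (wirt ab' c g) p *m invmx (g p) + wirt ab' c g p *m
       (- (invmx (g p) *m wirt ab c g p *m invmx (g p)))).
  move=> sb; have sgb' := smcM oU sg sb.
  have sw := smc_wirt oU ab' sg.
  rewrite (wirtB oU Up cp ab (smcM oU sgb' sV) (smcM oU sw sV)).
  rewrite (wirtM oU Up cp ab sgb' sV) (wirtM oU Up cp ab sg sb) (wirtM oU Up cp ab sw sV).
  by rewrite (wirtV oU Up cp ab ug sg) mulmxDl.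
have e2 : wirt wz c (fun x => (gauge g w c x).2) p =
    wirt wz c (fun x => g x *m (w c x).2 *m invmx (g x) - wirt wzb c g x *m invmx (g x)) p.
  by apply: (wirt_ext oU Up cp) => q _; rewrite gauge_parts.
have e1 : wirt wzb c (fun x => (gauge g w c x).1) p =
    wirt wzb c (fun x => g x *m (w c x).1 *m invmx (g x) - wirt wz c g x *m invmx (g x)) p.
  by apply: (wirt_ext oU Up cp) => q _; rewrite gauge_parts.
rewrite /curvature !dzE !dzbE e1 e2.
rewrite (key _ _ _ s2) (key _ _ _ s1) gauge_parts (wirt_comm oU Up cp wz wzb sg).
have hg := mulVmx (ug p Up); have gh := mulmxV (ug p Up).
exact: (@gauge_curvature_algebra _ n (g p) (invmx (g p)) (w c p).1 (w c p).2
  (wirt wz c g p) (wirt wzb c g p) _ _ _ hg gh).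
Qed.

End GaugeTheory.

(** * The exterior square of C^4 *)

Section WedgeAlgebra.
Variable K : fieldType.
Local Notation o0 := (@Ordinal 4 0 isT).
Local Notation o1 := (@Ordinal 4 1 isT).
Local Notation o2 := (@Ordinal 4 2 isT).
Local Notation o3 := (@Ordinal 4 3 isT).
Local Notation e0 := (@Ordinal 6 0 isT).
Local Notation e1 := (@Ordinal 6 1 isT).
Local Notation e2 := (@Ordinal 6 2 isT).
Local Notation e3 := (@Ordinal 6 3 isT).
Local Notation e4 := (@Ordinal 6 4 isT).
Local Notation e5 := (@Ordinal 6 5 isT).

Lemma sum4 (V : nmodType) (F : 'I_4 -> V) : \sum_i F i = F o0 + F o1 + F o2 + F o3.
Proof.
rewrite !big_ord_recr big_ord0 /= add0r.
by congr (F _ + F _ + F _ + F _); apply: val_inj.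
Qed.

Lemma sum6 (V : nmodType) (F : 'I_6 -> V) :
  \sum_i F i = F e0 + F e1 + F e2 + F e3 + F e4 + F e5.
Proof.
rewrite !big_ord_recr big_ord0 /= add0r.
by congr (F _ + F _ + F _ + F _ + F _ + F _); apply: val_inj.
Qed.

Lemma ord4_ind (P : 'I_4 -> Prop) : P o0 -> P o1 -> P o2 -> P o3 -> forall i, P i.
Proof.
have E n (h h' : (n < 4)%N) : Ordinal h = Ordinal h' by apply: val_inj.
move=> h0 h1 h2 h3 [[|[|[|[|m]]]] hm] //.
- by rewrite (E 0%N hm isT).
- by rewrite (E 1%N hm isT).
- by rewrite (E 2%N hm isT).
- by rewrite (E 3%N hm isT).
Qed.

Lemma ord6_ind (P : 'I_6 -> Prop) :
  P e0 -> P e1 -> P e2 -> P e3 -> P e4 -> P e5 -> forall i, P i.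
Proof.
have E n (h h' : (n < 6)%N) : Ordinal h = Ordinal h' by apply: val_inj.
move=> h0 h1 h2 h3 h4 h5 [[|[|[|[|[|[|m]]]]]] hm] //.
- by rewrite (E 0%N hm isT).
- by rewrite (E 1%N hm isT).
- by rewrite (E 2%N hm isT).
- by rewrite (E 3%N hm isT).
- by rewrite (E 4%N hm isT).
- by rewrite (E 5%N hm isT).
Qed.

Lemma det44_nat (f : nat -> nat -> K) : \det (\matrix_(i < 4, j < 4) f i j) =
  f 0%N 0%N * f 1%N 1%N * f 2%N 2%N * f 3%N 3%N - f 0%N 0%N * f 1%N 1%N * f 2%N 3%N * f 3%N 2%N - f 0%N 0%N * f 1%N 2%N * f 2%N 1%N * f 3%N 3%N + f 0%N 0%N * f 1%N 2%N * f 2%N 3%N * f 3%N 1%N + f 0%N 0%N * f 1%N 3%N * f 2%N 1%N * f 3%N 2%N - f 0%N 0%N * f 1%N 3%N * f 2%N 2%N * f 3%N 1%N - f 0%N 1%N * f 1%N 0%N * f 2%N 2%N * f 3%N 3%N + f 0%N 1%N * f 1%N 0%N * f 2%N 3%N * f 3%N 2%N + f 0%N 1%N * f 1%N 2%N * f 2%N 0%N * f 3%N 3%N - f 0%N 1%N * f 1%N 2%N * f 2%N 3%N * f 3%N 0%N - f 0%N 1%N * f 1%N 3%N * f 2%N 0%N * f 3%N 2%N + f 0%N 1%N * f 1%N 3%N * f 2%N 2%N * f 3%N 0%N + f 0%N 2%N * f 1%N 0%N * f 2%N 1%N * f 3%N 3%N - f 0%N 2%N * f 1%N 0%N * f 2%N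 3%N * f 3%N 1%N - f 0%N 2%N * f 1%N 1%N * f 2%N 0%N * f 3%N 3%N + f 0%N 2%N * f 1%N 1%N * f 2%N 3%N * f 3%N 0%N + f 0%N 2%N * f 1%N 3%N * f 2%N 0%N * f 3%N 1%N - f 0%N 2%N * f 1%N 3%N * f 2%N 1%N * f 3%N 0%N - f 0%N 3%N * f 1%N 0%N * f 2%N 1%N * f 3%N 2%N + f 0%N 3%N * f 1%N 0%N * f 2%N 2%N * f 3%N 1%N + f 0%N 3%N * f 1%N 1%N * f 2%N 0%N * f 3%N 2%N - f 0%N 3%N * f 1%N 1%N * f 2%N 2%N * f 3%N 0%N - f 0%N 3%N * f 1%N 2%N * f 2%N 0%N * f 3%N 1%N + f 0%N 3%N * f 1%N 2%N * f 2%N 1%N * f 3%N 0%N.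
Proof.
do !rewrite (expand_det_row _ ord0) /cofactor !big_ord_recl !big_ord0 /=.
rewrite !det_mx00 !mxE /= /bump /=.
ring.
Qed.

Lemma det44 (M : 'M[K]_4) : \det M =
  M o0 o0 * M o1 o1 * M o2 o2 * M o3 o3 - M o0 o0 * M o1 o1 * M o2 o3 * M o3 o2 - M o0 o0 * M o1 o2 * M o2 o1 * M o3 o3 + M o0 o0 * M o1 o2 * M o2 o3 * M o3 o1 + M o0 o0 * M o1 o3 * M o2 o1 * M o3 o2 - M o0 o0 * M o1 o3 * M o2 o2 * M o3 o1 - M o0 o1 * M o1 o0 * M o2 o2 * M o3 o3 + M o0 o1 * M o1 o0 * M o2 o3 * M o3 o2 + M o0 o1 * M o1 o2 * M o2 o0 * M o3 o3 - M o0 o1 * M o1 o2 * M o2 o3 * M o3 o0 - M o0 o1 * M o1 o3 * M o2 o0 * M o3 o2 + M o0 o1 * M o1 o3 * M o2 o2 * M o3 o0 + M o0 o2 * M o1 o0 * M o2 o1 * M o3 o3 - M o0 o2 * M o1 o0 * M o2 o3 * M o3 o1 - M o0 o2 * M o1 o1 * M o2 o0 * M o3 o3 + M o0 o2 * M o1 o1 * M o2 o3 * M o3 o0 + M o0 o2 * M o1 o3 * M o2 o0 * M o3 o1 - M o0 o2 * M o1 o3 * M o2 o1 * M o3 o0 - M o0 o3 * M o1 o0 * M o2 o1 * M o3 o2 + M o0 o3 * M o1 o0 * M o2 o2 * M o3 o1 + M o0 o3 * M o1 o1 * M o2 o0 * M o3 o2 - M o0 o3 * M o1 o1 * M o2 o2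 * M o3 o0 - M o0 o3 * M o1 o2 * M o2 o0 * M o3 o1 + M o0 o3 * M o1 o2 * M o2 o1 * M o3 o0.
Proof.
have EM : M = \matrix_(i < 4, j < 4) M (inord i) (inord j).
  by apply/matrixP => i j; rewrite mxE !inord_val.
rewrite {1}EM (det44_nat (fun i j : nat => M (inord i) (inord j))).
have E k (h : (k < 4)%N) : inord k = Ordinal h by apply: val_inj; rewrite /= inordK.
by rewrite !(E 0%N isT) !(E 1%N isT) !(E 2%N isT) !(E 3%N isT).
Qed.

Lemma wedgeE u v e : @wedge K u v e 0 = u (pa e) 0 * v (pb e) 0 - u (pb e) 0 * v (pa e) 0.
Proof. by rewrite mxE. Qed.

Lemma wedgeDl (u u' v : 'cV[K]_4) : wedge (u + u') v = wedge u v + wedge u' v.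
Proof. by apply/matrixP => e j; rewrite !mxE; ring. Qed.
Lemma wedgeDr (u v v' : 'cV[K]_4) : wedge u (v + v') = wedge u v + wedge u v'.
Proof. by apply/matrixP => e j; rewrite !mxE; ring. Qed.
Lemma wedgeZl a (u v : 'cV[K]_4) : wedge (a *: u) v = a *: wedge u v.
Proof. by apply/matrixP => e j; rewrite !mxE; ring. Qed.
Lemma wedgeZr a (u v : 'cV[K]_4) : wedge u (a *: v) = a *: wedge u v.
Proof. by apply/matrixP => e j; rewrite !mxE; ring. Qed.
Lemma wedgeC (u v : 'cV[K]_4) : wedge u v = - wedge v u.
Proof. by apply/matrixP => e j; rewrite !mxE; ring. Qed.
Lemma wedgevv (u : 'cV[K]_4) : wedge u u = 0.
Proof. by apply/matrixP => e j; rewrite !mxE; ring. Qed.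
Lemma wedge0l (v : 'cV[K]_4) : wedge 0 v = 0.
Proof. by rewrite -(scale0r (0 : 'cV[K]_4)) wedgeZl scale0r. Qed.
Lemma wedge0r (v : 'cV[K]_4) : wedge v 0 = 0.
Proof. by rewrite wedgeC wedge0l oppr0. Qed.
Lemma wedgeNl (u v : 'cV[K]_4) : wedge (- u) v = - wedge u v.
Proof. by rewrite -scaleN1r wedgeZl scaleN1r. Qed.
Lemma wedgeNr (u v : 'cV[K]_4) : wedge u (- v) = - wedge u v.
Proof. by rewrite -scaleN1r wedgeZr scaleN1r. Qed.

Lemma col_delta n (v : 'cV[K]_n) : v = \sum_i v i 0 *: delta_mx i 0.
Proof.
apply/matrixP => i j; rewrite (ord1 j) summxE (bigD1 i)//= big1 => [|k ki].
  by rewrite !mxE !eqxx mulr1 addr0.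
by rewrite !mxE eq_sym (negbTE ki) mulr0.
Qed.

(** The universal property of the exterior square in coordinates. It lets identities between
    matrices on /\^2 be tested on decomposable vectors. *)
Lemma alternating_expand m n (B : 'cV[K]_4 -> 'cV[K]_4 -> 'M[K]_(m, n)) :
  (forall a u u' v, B (a *: u + u') v = a *: B u v + B u' v) ->
  (forall a u v v', B u (a *: v + v') = a *: B u v + B u v') ->
  (forall u, B u u = 0) ->
  forall u v, B u v = \sum_e wedge u v e 0 *: B (delta_mx (pa e) 0) (delta_mx (pb e) 0).
Proof.
move=> Bl Br B0 u v.
have B0l w : B 0 w = 0 by have := Bl (-1) 0 0 w; rewrite scaler0 addr0 scaleN1r addNr.
have B0r w : B w 0 = 0 by have := Br (-1) w 0 0; rewrite scaler0 addr0 scaleN1r addNr.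
have BC w w' : B w' w = - B w w'.
  have e := B0 (w + w'); have f1 := Bl 1 w w' (w + w'); have f2 := Br 1 w w w'.
  have f3 := Br 1 w' w w'; rewrite !scale1r in f1 f2 f3.
  move: e; rewrite f1 f2 f3 !B0 add0r addr0 => /eqP; rewrite addrC addr_eq0 => /eqP.
  by [].
have Bs1 (F : 'I_4 -> 'cV[K]_4) (x : 'I_4 -> K) w : B (\sum_i x i *: F i) w = \sum_i x i *: B (F i) w.
  rewrite !sum4 -!addrA !Bl; congr (_ + (_ + (_ + _))).
  by have := Bl (x o3) (F o3) 0 w; rewrite addr0 B0l addr0.
have Bs2 (F : 'I_4 -> 'cV[K]_4) (x : 'I_4 -> K) w : B w (\sum_i x i *: F i) = \sum_i x i *: B w (F i).
  rewrite !sum4 -!addrA !Br; congr (_ + (_ + (_ + _))).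
  by have := Br (x o3) w (F o3) 0; rewrite addr0 B0r addr0.
rewrite {1}(col_delta u) Bs1; under eq_bigr do rewrite {1}(col_delta v) Bs2.
rewrite sum4 !sum4 !B0 sum6 !wedgeE.
rewrite -[pa e0]/o0 -[pa e1]/o0 -[pa e2]/o0 -[pa e3]/o1 -[pa e4]/o1 -[pa e5]/o2.
rewrite -[pb e0]/o1 -[pb e1]/o2 -[pb e2]/o3 -[pb e3]/o2 -[pb e4]/o3 -[pb e5]/o3.
rewrite (BC (delta_mx o0 0) (delta_mx o1 0)) (BC (delta_mx o0 0) (delta_mx o2 0)) (BC (delta_mx o0 0) (delta_mx o3 0)).
rewrite (BC (delta_mx o1 0) (delta_mx o2 0)) (BC (delta_mx o1 0) (delta_mx o3 0)) (BC (delta_mx o2 0) (delta_mx o3 0)).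
apply/matrixP => i j; rewrite !mxE; ring.
Qed.

Lemma wedgemx_colE (g : 'M[K]_4) f : wedgemx g *m delta_mx f 0 =
  wedge (g *m delta_mx (pa f) 0) (g *m delta_mx (pb f) 0).
Proof.
apply/matrixP => e j; rewrite (ord1 j) mxE (bigD1 f)//= big1 => [|k kf].
  by rewrite !mxE !eqxx mulr1 addr0.
by rewrite [X in _ * X]mxE (negbTE kf) mulr0.
Qed.

Lemma dwedgemx_colE (g : 'M[K]_4) f : dwedgemx g *m delta_mx f 0 =
  wedge (g *m delta_mx (pa f) 0) (delta_mx (pb f) 0) + wedge (delta_mx (pa f) 0) (g *m delta_mx (pb f) 0).
Proof.
apply/matrixP => e j; rewrite (ord1 j) mxE (bigD1 f)//= big1 => [|k kf].
  by rewrite [X in _ * X]mxE !eqxx mulr1 addr0 [in LHS]mxE [RHS]mxE.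
by rewrite [X in _ * X]mxE (negbTE kf) mulr0.
Qed.

Lemma mulmx_col n m (A : 'M[K]_(n, m)) (v : 'cV[K]_m) : A *m v = \sum_i v i 0 *: (A *m delta_mx i 0).
Proof.
by rewrite {1}(col_delta v) mulmx_sumr; apply: eq_bigr => i _; rewrite -scalemxAr.
Qed.

Lemma wedgemx_wedge (g : 'M[K]_4) u v : wedgemx g *m wedge u v = wedge (g *m u) (g *m v).
Proof.
rewrite mulmx_col; under eq_bigr do rewrite wedgemx_colE.
rewrite -(@alternating_expand _ _ (fun u v => wedge (g *m u) (g *m v)))// => [a x x' y|a x x' y|x].
- by rewrite mulmxDr -scalemxAr wedgeDl wedgeZl.
- by rewrite mulmxDr -scalemxAr wedgeDr wedgeZr.
- exact: wedgevv.
Qed.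

Lemma dwedgemx_wedge (g : 'M[K]_4) u v :
  dwedgemx g *m wedge u v = wedge (g *m u) v + wedge u (g *m v).
Proof.
rewrite mulmx_col; under eq_bigr do rewrite dwedgemx_colE.
rewrite -(@alternating_expand _ _ (fun u v => wedge (g *m u) v + wedge u (g *m v)))// => [a x x' y|a x x' y|x].
- by rewrite mulmxDr -scalemxAr !wedgeDl !wedgeZl scalerDr addrACA.
- by rewrite mulmxDr -scalemxAr !wedgeDr !wedgeZr scalerDr addrACA.
- by rewrite [wedge x _]wedgeC subrr.
Qed.

Lemma eq_on_wedges n (A B : 'M[K]_(n, 6)) :
  (forall u v, A *m wedge u v = B *m wedge u v) -> A = B.
Proof.
move=> H; have W f : delta_mx f 0 = wedge (delta_mx (pa f) 0) (delta_mx (pb f) 0) :> 'cV[K]_6.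
  apply/matrixP => e j; rewrite (ord1 j) !mxE !eqxx !andbT.
  by move: e f; apply: ord6_ind; apply: ord6_ind; rewrite /= ?(mulr0, mul0r, mulr1, subr0, sub0r, oppr0).
apply/matrixP => i j.
have := H (delta_mx (pa j) 0) (delta_mx (pb j) 0); rewrite -W => /matrixP/(_ i 0).
by rewrite -!colE !mxE.
Qed.

Lemma wedgemxM (g h : 'M[K]_4) : wedgemx (g *m h) = wedgemx g *m wedgemx h.
Proof. by apply: eq_on_wedges => u v; rewrite -mulmxA !wedgemx_wedge !mulmxA. Qed.

Lemma wedgemx1 : wedgemx (1%:M : 'M[K]_4) = 1%:M.
Proof. by apply: eq_on_wedges => u v; rewrite wedgemx_wedge !mul1mx. Qed.

Lemma wedgemxZ a (g : 'M[K]_4) : wedgemx (a *: g) = a ^+ 2 *: wedgemx g.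
Proof.
apply: eq_on_wedges => u v; rewrite -scalemxAl !wedgemx_wedge -!scalemxAl wedgeZl wedgeZr.
by rewrite scalerA.
Qed.

Lemma wedgemxV (g : 'M[K]_4) : g \in unitmx ->
  wedgemx g \in unitmx /\ invmx (wedgemx g) = wedgemx (invmx g).
Proof.
move=> ug; have e : wedgemx g *m wedgemx (invmx g) = 1%:M by rewrite -wedgemxM mulmxV// wedgemx1.
have [ug6 _] := mulmx1_unit e; split => //.
by rewrite -[LHS]mulmx1 -e mulmxA mulVmx// mul1mx.
Qed.

Lemma dwedgemxD (X Y : 'M[K]_4) : dwedgemx (X + Y) = dwedgemx X + dwedgemx Y.
Proof.
apply: eq_on_wedges => u v; rewrite mulmxDl !dwedgemx_wedge !mulmxDl wedgeDl wedgeDr.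
by rewrite addrACA.
Qed.

Lemma dwedgemxZ a (X : 'M[K]_4) : dwedgemx (a *: X) = a *: dwedgemx X.
Proof.
apply: eq_on_wedges => u v; rewrite -scalemxAl !dwedgemx_wedge -!scalemxAl wedgeZl wedgeZr.
by rewrite scalerDr.
Qed.

Lemma dwedgemx_conj (g X : 'M[K]_4) : g \in unitmx ->
  wedgemx g *m dwedgemx X *m invmx (wedgemx g) = dwedgemx (g *m X *m invmx g).
Proof.
move=> ug; have [_ ->] := wedgemxV ug; apply: eq_on_wedges => u v.
rewrite -!mulmxA !wedgemx_wedge dwedgemx_wedge mulmxDr !wedgemx_wedge dwedgemx_wedge.
by rewrite !(mulmxA g (invmx g)) !mulmxV// !mul1mx !mulmxA.
Qed.

Lemma o2slD (A B : 'M[K]_6) : o2sl (A + B) = o2sl A + o2sl B.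
Proof.
apply/matrixP => i j; rewrite !mxE -mulrDr -big_split /=; congr (_ * _).
by apply: eq_bigr => k _; rewrite mulmxDr mulmxDl mxE.
Qed.

Lemma o2slZ a (A : 'M[K]_6) : o2sl (a *: A) = a *: o2sl A.
Proof.
have E B i j : o2sl B i j = 2^-1 * \sum_b
    ((wedge (delta_mx i 0) (delta_mx b 0))^T *m B *m wedge (delta_mx j 0) (delta_mx b 0)) 0 0.
  by rewrite mxE.
apply/matrixP => i j; rewrite [RHS]mxE !E [RHS]mulrCA; congr (_ * _); rewrite mulr_sumr.
by apply: eq_bigr => k _; rewrite -scalemxAr -scalemxAl mxE.
Qed.

(* B (e_a /\ e_b) at coordinate (c, d), antisymmetrised. *)
Lemma wedge_delta_form (B : 'M[K]_6) (w w' : 'cV[K]_6) :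
  (w^T *m B *m w') 0 0 = \sum_f (\sum_e w e 0 * B e f) * w' f 0.
Proof.
rewrite mxE; apply: eq_bigr => f _; rewrite mxE; congr (_ * _).
by apply: eq_bigr => e _; rewrite mxE.
Qed.

Lemma wedge_deltaE a b e : wedge (delta_mx a 0 : 'cV[K]_4) (delta_mx b 0) e 0 =
  (pa e == a)%:R * (pb e == b)%:R - (pb e == a)%:R * (pa e == b)%:R.
Proof. by rewrite wedgeE !mxE !eqxx !andbT. Qed.

Lemma wedge_delta :
  (wedge (delta_mx o0 0) (delta_mx o0 0) = 0 *: delta_mx e0 0 :> 'cV[K]_6)
  * (wedge (delta_mx o0 0) (delta_mx o1 0) = 1 *: delta_mx e0 0 :> 'cV[K]_6)
  * (wedge (delta_mx o0 0) (delta_mx o2 0) = 1 *: delta_mx e1 0 :> 'cV[K]_6)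
  * (wedge (delta_mx o0 0) (delta_mx o3 0) = 1 *: delta_mx e2 0 :> 'cV[K]_6)
  * (wedge (delta_mx o1 0) (delta_mx o0 0) = -1 *: delta_mx e0 0 :> 'cV[K]_6)
  * (wedge (delta_mx o1 0) (delta_mx o1 0) = 0 *: delta_mx e0 0 :> 'cV[K]_6)
  * (wedge (delta_mx o1 0) (delta_mx o2 0) = 1 *: delta_mx e3 0 :> 'cV[K]_6)
  * (wedge (delta_mx o1 0) (delta_mx o3 0) = 1 *: delta_mx e4 0 :> 'cV[K]_6)
  * (wedge (delta_mx o2 0) (delta_mx o0 0) = -1 *: delta_mx e1 0 :> 'cV[K]_6)
  * (wedge (delta_mx o2 0) (delta_mx o1 0) = -1 *: delta_mx e3 0 :> 'cV[K]_6)
  * (wedge (delta_mx o2 0) (delta_mx o2 0) = 0 *: delta_mx e0 0 :> 'cV[K]_6)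
  * (wedge (delta_mx o2 0) (delta_mx o3 0) = 1 *: delta_mx e5 0 :> 'cV[K]_6)
  * (wedge (delta_mx o3 0) (delta_mx o0 0) = -1 *: delta_mx e2 0 :> 'cV[K]_6)
  * (wedge (delta_mx o3 0) (delta_mx o1 0) = -1 *: delta_mx e4 0 :> 'cV[K]_6)
  * (wedge (delta_mx o3 0) (delta_mx o2 0) = -1 *: delta_mx e5 0 :> 'cV[K]_6)
  * (wedge (delta_mx o3 0) (delta_mx o3 0) = 0 *: delta_mx e0 0 :> 'cV[K]_6).
Proof.
do !split; apply/matrixP => e j; rewrite (ord1 j) wedge_deltaE !mxE ?eqxx ?andbT;
move: e; apply: ord6_ind; rewrite /=; ring.
Qed.

Lemma delta_form (B : 'M[K]_6) a b e f :
  ((a *: delta_mx e 0)^T *m B *m (b *: delta_mx f (0 : 'I_1))) (0 : 'I_1) 0 = a * b * B e f.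
Proof.
have -> : (a *: delta_mx e (0 : 'I_1))^T = a *: delta_mx (0 : 'I_1) e.
  by rewrite -trmx_delta; apply/matrixP => x y; rewrite !mxE.
by rewrite -!scalemxAl -scalemxAr -colE -rowE !mxE mulrA.
Qed.

(** A table of the inverse isomorphism, by which later identities reduce to [ring] or [field] on
    single entries. *)
Lemma o2slE (B : 'M[K]_6) :
  (o2sl B o0 o0 = 2^-1 * (B e0 e0 + B e1 e1 + B e2 e2))
  * (o2sl B o0 o1 = 2^-1 * (B e1 e3 + B e2 e4))
  * (o2sl B o0 o2 = 2^-1 * (- B e0 e3 + B e2 e5))
  * (o2sl B o0 o3 = 2^-1 * (- B e0 e4 - B e1 e5))
  * (o2sl B o1 o0 = 2^-1 * (B e3 e1 + B e4 e2))
  * (o2sl B o1 o1 = 2^-1 * (B e0 e0 + B e3 e3 + B e4 e4))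
  * (o2sl B o1 o2 = 2^-1 * (B e0 e1 + B e4 e5))
  * (o2sl B o1 o3 = 2^-1 * (B e0 e2 - B e3 e5))
  * (o2sl B o2 o0 = 2^-1 * (- B e3 e0 + B e5 e2))
  * (o2sl B o2 o1 = 2^-1 * (B e1 e0 + B e5 e4))
  * (o2sl B o2 o2 = 2^-1 * (B e1 e1 + B e3 e3 + B e5 e5))
  * (o2sl B o2 o3 = 2^-1 * (B e1 e2 + B e3 e4))
  * (o2sl B o3 o0 = 2^-1 * (- B e4 e0 - B e5 e1))
  * (o2sl B o3 o1 = 2^-1 * (B e2 e0 - B e5 e3))
  * (o2sl B o3 o2 = 2^-1 * (B e2 e1 + B e4 e3))
  * (o2sl B o3 o3 = 2^-1 * (B e2 e2 + B e4 e4 + B e5 e5)).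
Proof.
do !split; rewrite mxE; congr (_ * _); rewrite sum4 !wedge_delta !delta_form;
  move: (fun_of_matrix B) => b; ring.
Qed.

Lemma dwedgemxE (X : 'M[K]_4) e f : dwedgemx X e f =
  X (pa e) (pa f) * (pb e == pb f)%:R - X (pb e) (pa f) * (pa e == pb f)%:R +
  ((pa e == pa f)%:R * X (pb e) (pb f) - (pb e == pa f)%:R * X (pa e) (pb f)).
Proof. by rewrite mxE !wedgeE -!colE !mxE !eqxx !andbT. Qed.

(** The trace term measures the failure of [o2sl] to invert [dwedgemx] on scalar matrices; on sl(4)
    it disappears. *)
Lemma o2sl_dwedgemx (X : 'M[K]_4) : (2 : K) != 0 -> o2sl (dwedgemx X) = X + (\tr X / 2)%:M.
Proof.
move=> two; apply/matrixP => a c; rewrite [RHS]mxE [X in _ = _ + X]mxE /mxtrace sum4.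
move: a c; apply: ord4_ind; apply: ord4_ind; rewrite o2slE !dwedgemxE;
rewrite -?[pa e0]/o0 -?[pa e1]/o0 -?[pa e2]/o0 -?[pa e3]/o1 -?[pa e4]/o1 -?[pa e5]/o2;
rewrite -?[pb e0]/o1 -?[pb e1]/o2 -?[pb e2]/o3 -?[pb e3]/o2 -?[pb e4]/o3 -?[pb e5]/o3;
rewrite /=; move: (fun_of_matrix X) => x; field; exact: two.
Qed.

End WedgeAlgebra.

(** * The inner product on the exterior square and the isomorphism with sl(4) *)

Section Gram.
Variables (R : realType) (Q : quaternionic R).
Local Notation C := R[i].
Local Notation o0 := (@Ordinal 4 0 isT).
Local Notation o1 := (@Ordinal 4 1 isT).
Local Notation o2 := (@Ordinal 4 2 isT).
Local Notation o3 := (@Ordinal 4 3 isT).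
Local Notation e0 := (@Ordinal 6 0 isT).
Local Notation e1 := (@Ordinal 6 1 isT).
Local Notation e2 := (@Ordinal 6 2 isT).
Local Notation e3 := (@Ordinal 6 3 isT).
Local Notation e4 := (@Ordinal 6 4 isT).
Local Notation e5 := (@Ordinal 6 5 isT).

Lemma det4E (a b c d : 'cV[C]_4) : det4 Q a b c d = qvol Q * (a o0 0 * b o1 0 * c o2 0 * d o3 0 - a o0 0 * b o1 0 * d o2 0 * c o3 0 - a o0 0 * c o1 0 * b o2 0 * d o3 0 + a o0 0 * c o1 0 * d o2 0 * b o3 0 + a o0 0 * d o1 0 * b o2 0 * c o3 0 - a o0 0 * d o1 0 * c o2 0 * b o3 0 - b o0 0 * a o1 0 * c o2 0 * d o3 0 + b o0 0 * a o1 0 * d o2 0 * c o3 0 + b o0 0 * c o1 0 * a o2 0 * d o3 0 - b o0 0 * c o1 0 * d o2 0 * a o3 0 - b o0 0 * d o1 0 * a o2 0 * c o3 0 + b o0 0 * d o1 0 * c o2 0 * a o3 0 + c o0 0 * a o1 0 * b o2 0 * d o3 0 - c o0 0 * a o1 0 * d o2 0 * b o3 0 - c o0 0 * b o1 0 * a o2 0 * d o3 0 + c o0 0 * b o1 0 * d o2 0 * a o3 0 + c o0 0 * d o1 0 * a o2 0 * b o3 0 - c o0 0 * d o1 0 * b o2 0 * a o3 0 - d o0 0 * a o1 0 * b o2 0 * c o3 0 + d o0 0 * a o1 0 * c o2 0 * b o3 0 + d o0 0 * b o1 0 * a o2 0 * c o3 0 - d o0 0 * b o1 0 * c o2 0 *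 a o3 0 - d o0 0 * c o1 0 * a o2 0 * b o3 0 + d o0 0 * c o1 0 * b o2 0 * a o3 0).
Proof.
by rewrite /det4 /det4_of det44 !mxE !(tnth_nth 0) /=.
Qed.

(** Index e is paired with 5 - e, the complementary pair of basis vectors of C^4. The sign is
    negative for the pairs {0, 2} and {1, 3}, which together form an odd permutation. *)
Definition gram0 : 'M[C]_6 := \matrix_(e, f)
  (if (e + f == 5)%N then (if (e == 1 :> nat) || (e == 4 :> nat) then -1 else 1) else 0).

Lemma gramE : gram Q = qvol Q *: gram0.
Proof.
apply/matrixP => e f; rewrite mxE det4E !mxE; congr (_ * _).
move: e f; apply: ord6_ind; apply: ord6_ind; rewrite /=; ring.
Qed.

Lemma ipE (u v : 'cV[C]_6) : ip Q u v = qvol Q * (u e0 0 * v e5 0 + u e5 0 * v e0 0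
  - u e1 0 * v e4 0 - u e4 0 * v e1 0 + u e2 0 * v e3 0 + u e3 0 * v e2 0).
Proof.
rewrite /ip wedge_delta_form gramE !sum6 !mxE /=; ring.
Qed.

Lemma ip_wedge a b c d : ip Q (wedge a b) (wedge c d) = det4 Q a b c d.
Proof.
rewrite ipE det4E !wedgeE.
rewrite -[pa e0]/o0 -[pa e1]/o0 -[pa e2]/o0 -[pa e3]/o1 -[pa e4]/o1 -[pa e5]/o2.
rewrite -[pb e0]/o1 -[pb e1]/o2 -[pb e2]/o3 -[pb e3]/o2 -[pb e4]/o3 -[pb e5]/o3.
ring.
Qed.

Lemma det4M g a b c d : det4 Q (g *m a) (g *m b) (g *m c) (g *m d) = \det g * det4 Q a b c d.
Proof.
rewrite /det4 /det4_of mulrCA -det_mulmx; congr (_ * \det _).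
apply/matrixP => i j; rewrite !mxE; move: j; apply: ord4_ind; rewrite !(tnth_nth 0) /= mxE;
by apply: eq_bigr => k _; rewrite mxE (tnth_nth 0).
Qed.

Lemma gram0_sq : gram0 *m gram0 = 1%:M.
Proof.
apply/matrixP => e f; rewrite !mxE sum6 !mxE /=.
by move: e f; apply: ord6_ind; apply: ord6_ind; rewrite /=; ring.
Qed.

Lemma gram_unit : gram Q \in unitmx.
Proof.
rewrite gramE unitmxZ; last by rewrite unitfE; exact: qvol_neq0.
by have [] := mulmx1_unit gram0_sq.
Qed.

Lemma gram_tr : (gram Q)^T = gram Q.
Proof.
rewrite gramE linearZ /=; congr (_ *: _); apply/matrixP => e f; rewrite !mxE addnC.
by move: e f; apply: ord6_ind; apply: ord6_ind.
Qed.

Lemma ipC u v : ip Q u v = ip Q v u.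
Proof. by rewrite !ipE; ring. Qed.

Lemma ipDl u v w : ip Q (u + v) w = ip Q u w + ip Q v w.
Proof. by rewrite /ip linearD /= !mulmxDl mxE. Qed.
Lemma ipZl a u w : ip Q (a *: u) w = a * ip Q u w.
Proof. by rewrite /ip linearZ /= -!scalemxAl mxE. Qed.
Lemma ipDr u v w : ip Q w (u + v) = ip Q w u + ip Q w v.
Proof. by rewrite ipC ipDl !(ipC w). Qed.
Lemma ipZr a u w : ip Q w (a *: u) = a * ip Q w u.
Proof. by rewrite ipC ipZl (ipC w). Qed.
Lemma ipNl u w : ip Q (- u) w = - ip Q u w.
Proof. by rewrite -scaleN1r ipZl mulN1r. Qed.
Lemma ipNr u w : ip Q w (- u) = - ip Q w u.
Proof. by rewrite -scaleN1r ipZr mulN1r. Qed.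
Lemma ip0l w : ip Q 0 w = 0.
Proof. by rewrite -(scale0r 0) ipZl mul0r. Qed.
Lemma ip0r w : ip Q w 0 = 0.
Proof. by rewrite ipC ip0l. Qed.

Lemma ip_nondeg u : (forall v, ip Q u v = 0) -> u = 0.
Proof.
move=> H; have : u^T *m gram Q = 0.
  apply/matrixP => i j; rewrite (ord1 i) [RHS]mxE.
  by have := H (delta_mx j 0); rewrite /ip -colE mxE.
move=> /(congr1 (mulmxr (invmx (gram Q)))) /=; rewrite mulmxK ?gram_unit// mul0mx.
by move=> /(congr1 trmx); rewrite trmxK linear0.
Qed.

Lemma eq_on_wedges2 (A B : 'M[C]_6) : (forall a b c d,
   (wedge a b)^T *m A *m wedge c d = (wedge a b)^T *m B *m wedge c d) -> A = B.
Proof.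
move=> H; apply: trmx_inj; apply: eq_on_wedges => a b; apply: trmx_inj.
by rewrite !trmx_mul !trmxK; apply: eq_on_wedges => c d; exact: H.
Qed.

Lemma ip_wedgemx g u v : ip Q (wedgemx g *m u) (wedgemx g *m v) = \det g * ip Q u v.
Proof.
suff E : (wedgemx g)^T *m gram Q *m wedgemx g = \det g *: gram Q.
  by rewrite /ip trmx_mul !mulmxA -2!(mulmxA u^T) E -scalemxAr -scalemxAl mxE.
apply: eq_on_wedges2 => a b c d; apply/matrixP => i j; rewrite (ord1 i) (ord1 j).
rewrite -scalemxAr -scalemxAl [RHS]mxE.
rewrite -[X in _ * X]/(ip Q (wedge a b) (wedge c d)) ip_wedge -det4M -ip_wedge.
by rewrite /ip -!wedgemx_wedge trmx_mul !mulmxA.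
Qed.

Lemma two_neq0 : (2 : C) != 0.
Proof. by rewrite pnatr_eq0. Qed.

Lemma half_skew n (D : 'M[C]_n) : D^T = - D -> 2^-1 *: D - (2^-1 *: D)^T = D.
Proof.
move=> DT; have -> : (2^-1 *: D)^T = 2^-1 *: D^T by apply/matrixP => i j; rewrite !mxE.
rewrite DT scalerN opprK -scalerDl (_ : 2^-1 + 2^-1 = 1) ?scale1r//.
by field.
Qed.

(* Since gram0 is an involution, every skew B is gram0 (A - A^T) with A free. *)
Lemma skew6P B : skew6 Q B -> exists A, B = gram0 *m (A - A^T).
Proof.
move=> sB; pose D := gram0 *m B.
have DT : D^T = - D.
  have F e f : (D f e + D e f) = 0.
    have gB : gram Q *m B = qvol Q *: D by rewrite gramE -scalemxAl.
    have ipD e' f' : ip Q (delta_mx e' 0) (B *m delta_mx f' 0) = qvol Q * D e' f'.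
      rewrite /ip -mulmxA (mulmxA (gram Q)) gB mulmxA.
      have := delta_form (qvol Q *: D) 1 1 e' f'; rewrite !scale1r !mul1r => ->.
      by rewrite mxE.
    have := sB (delta_mx e 0) (delta_mx f 0); rewrite (ipC (B *m _)) !ipD -mulrDr => /eqP.
    by rewrite mulf_eq0 (negbTE (qvol_neq0 Q)) /= => /eqP.
  apply/matrixP => e f; rewrite [RHS]mxE [LHS]mxE; apply/eqP; rewrite -addr_eq0; apply/eqP.
  exact: F.
exists (2^-1 *: D); rewrite half_skew// /D mulmxA gram0_sq mul1mx.
by [].
Qed.

(** Surjectivity of sl(4) onto o(6). In terms of the free matrix [A] of [skew6P] everything is
    linear, so each of the 36 entries is a formal identity in the entries of [A]. *)
Lemma skew6_dwedgemx B : skew6 Q B -> dwedgemx (o2sl B) = B /\ \tr (o2sl B) = 0.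
Proof.
move=> /skew6P[A ->].
(* Multiplication by [gram0] reverses the order of the rows up to sign. *)
have G e f : (gram0 *m (A - A^T)) e f =
   (if (e == 1 :> nat) || (e == 4 :> nat) then -1 else 1) * (A (rev_ord e) f - A f (rev_ord e)).
  rewrite !mxE (bigD1 (rev_ord e))//= big1 => [|k ke].
    rewrite !mxE /= addr0; congr (_ * _); case: ifP => // /eqP; have := ltn_ord e.
    by case: (nat_of_ord e) => [|[|[|[|[|[|]]]]]].
  rewrite !mxE; case: ifP; rewrite ?mul0r// => /eqP ek; case/eqP: ke; apply: val_inj => /=.
  by rewrite subSS; move: ek; have := ltn_ord e; lia.
have r0 : rev_ord e0 = e5 by apply: val_inj.
have r1 : rev_ord e1 = e4 by apply: val_inj.
have r2 : rev_ord e2 = e3 by apply: val_inj.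
have r3 : rev_ord e3 = e2 by apply: val_inj.
have r4 : rev_ord e4 = e1 by apply: val_inj.
have r5 : rev_ord e5 = e0 by apply: val_inj.
split; last first.
  rewrite /mxtrace sum4 !o2slE !G /= ?(r0, r1, r2, r3, r4, r5); by field.
apply/matrixP => e f; rewrite dwedgemxE.
move: e f; apply: ord6_ind; apply: ord6_ind; rewrite G ?(r0, r1, r2, r3, r4, r5);
rewrite -?[pa e0]/o0 -?[pa e1]/o0 -?[pa e2]/o0 -?[pa e3]/o1 -?[pa e4]/o1 -?[pa e5]/o2;
rewrite -?[pb e0]/o1 -?[pb e1]/o2 -?[pb e2]/o3 -?[pb e3]/o2 -?[pb e4]/o3 -?[pb e5]/o3;
rewrite /= ?(mul0r, mulr0, mul1r, mulr1, subr0, sub0r, addr0, add0r, oppr0, mulr1n, mulr0n) ?o2slE ?G /=;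
rewrite ?(r0, r1, r2, r3, r4, r5); by field.
Qed.

End Gram.

Section SpanLemmas.
Variable K : fieldType.

Lemma span_ind (vT : vectType K) (X : seq vT) (Pr : vT -> Prop) : Pr 0 ->
  (forall a u v, Pr u -> Pr v -> Pr (a *: u + v)) -> (forall u, u \in X -> Pr u) ->
  forall v, v \in <<X>>%VS -> Pr v.
Proof.
move=> P0 Plin Ps v vs; rewrite (coord_span (X := in_tuple X) vs).
elim/big_ind: _ => // [x y Px Py|l _]; first by rewrite -[x]scale1r; exact: Plin.
by rewrite -[_ *: _]addr0; apply: Plin => //; apply: Ps; rewrite mem_nth.
Qed.

Lemma mem_span2 (vT : vectType K) (a b v : vT) :
  (v \in <<[:: a; b]>>%VS) <-> exists x y, v = x *: a + y *: b.
Proof.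
split=> [|[x [y ->]]].
  rewrite !span_cons span_nil addv0 => /memv_addP[u /vlineP[x ->] [w /vlineP[y ->] ->]].
  by exists x, y.
by rewrite memvD// memvZ// memv_span// !inE eqxx ?orbT.
Qed.

Lemma mulmx_lfunE m n k (g : 'M[K]_(m, n)) (v : 'M[K]_(n, k)) : linfun (mulmx g) v = g *m v.
Proof. by rewrite lfunE. Qed.

Lemma mem_mximg n (g : 'M[K]_n) (E : {vspace 'cV[K]_n}) v : v \in E -> g *m v \in mximg g E.
Proof. by move=> vE; apply/memv_imgP; exists v => //; rewrite mulmx_lfunE. Qed.

Lemma mximgP n (g : 'M[K]_n) (E : {vspace 'cV[K]_n}) w :
  w \in mximg g E -> exists2 v, v \in E & w = g *m v.
Proof. by move=> /memv_imgP[v vE ->]; exists v => //; rewrite mulmx_lfunE. Qed.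

Lemma mximg_span n (g : 'M[K]_n) (X : seq 'cV[K]_n) :
  mximg g <<X>>%VS = <<[seq g *m v | v <- X]>>%VS.
Proof.
rewrite /mximg limg_span; congr (span _); apply: eq_map => v; exact: mulmx_lfunE.
Qed.

Lemma mem_eigsp n (g : 'M[K]_n) a v : (v \in eigsp g a) = (g *m v == a *: v).
Proof.
rewrite /eigsp /passmx.leigenspace memv_ker add_lfunE opp_lfunE scale_lfunE id_lfunE.
by rewrite mulmx_lfunE subr_eq0.
Qed.

Lemma mx_ofE n (f : 'End('cV[K]_n)) v : mx_of f *m v = f v.
Proof.
rewrite [in RHS](col_delta v) linear_sum mulmx_col; apply: eq_bigr => l _.
by rewrite linearZ /=; congr (_ *: _); apply/matrixP => x y; rewrite -colE (ord1 y) !mxE.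
Qed.

Lemma daddv_piE (vT : vectType K) (U V : {vspace vT}) x y : (U :&: V = 0)%VS ->
  x \in U -> y \in V -> daddv_pi U V (x + y) = x.
Proof.
move=> UV xU yV; rewrite linearD /= daddv_pi_id//.
have VU : (V :&: U = 0)%VS by rewrite capvC.
have : daddv_pi U V y + daddv_pi V U y = y.
  by apply: daddv_pi_add => //; apply: (subvP (addvSr U V)).
by rewrite (daddv_pi_id VU yV) -[X in _ = X]add0r => /addIr ->; rewrite addr0.
Qed.

Lemma vspace_eq (vT : vectType K) (U V : {vspace vT}) : (forall v, (v \in U) <-> (v \in V)) -> U = V.
Proof. by move=> H; apply/vspaceP => v; apply/idP/idP => /H. Qed.

Lemma mem_wedgesp (E F : {vspace 'cV[K]_4}) u v : u \in E -> v \in F -> wedge u v \in wedgesp E F.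
Proof.
move=> uE vF; rewrite -(span_basis (vbasisP E)) in uE; rewrite -(span_basis (vbasisP F)) in vF.
move: u uE; apply: span_ind => [|a x y hx hy|u uE].
- by rewrite wedge0l mem0v.
- by rewrite wedgeDl wedgeZl memvD// memvZ.
move: v vF; apply: span_ind => [|a x y hx hy|v vF].
- by rewrite wedge0r mem0v.
- by rewrite wedgeDr wedgeZr memvD// memvZ.
by apply: memv_span; apply/allpairsP; exists (u, v).
Qed.

Lemma wedgesp_ind (E F : {vspace 'cV[K]_4}) (Pr : 'cV[K]_6 -> Prop) : Pr 0 ->
  (forall a u v, Pr u -> Pr v -> Pr (a *: u + v)) ->
  (forall u v, u \in E -> v \in F -> Pr (wedge u v)) -> forall w, w \in wedgesp E F -> Pr w.
Proof.
move=> P0 Pl H; apply: span_ind => // w /allpairsP[[u v] [/= /vbasis_mem uE /vbasis_mem vF ->]].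
exact: H.
Qed.

Lemma wedgesp_sub (E F : {vspace 'cV[K]_4}) (G : {vspace 'cV[K]_6}) :
  (forall u v, u \in E -> v \in F -> wedge u v \in G) -> (wedgesp E F <= G)%VS.
Proof.
move=> H; apply/subvP; apply: wedgesp_ind => // [|a u v uG vG]; first exact: mem0v.
by rewrite memvD// memvZ.
Qed.

Lemma wedgesp_sq (a b : 'cV[K]_4) : wedgesp <<[:: a; b]>>%VS <<[:: a; b]>>%VS = <[wedge a b]>%VS.
Proof.
apply/eqP; rewrite eqEsubv; apply/andP; split; last first.
  by rewrite -memvE; apply: mem_wedgesp; rewrite memv_span// !inE eqxx ?orbT.
apply: wedgesp_sub => u v /mem_span2[x [y ->]] /mem_span2[x' [y' ->]].
rewrite !(wedgeDl, wedgeDr, wedgeZl, wedgeZr) !wedgevv !scaler0 addr0 add0r (wedgeC b a).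
by rewrite !scalerN memvB ?memvN// ?memvD// !memvZ// ?memvN// memv_line.
Qed.

Lemma mximg_wedgesp (g : 'M[K]_4) (E F : {vspace 'cV[K]_4}) :
  mximg (wedgemx g) (wedgesp E F) = wedgesp (mximg g E) (mximg g F).
Proof.
apply: vspace_eq => w; split.
  move=> /mximgP[v]; move: v w; suff H v : v \in wedgesp E F -> wedgemx g *m v \in wedgesp (mximg g E) (mximg g F).
    by move=> v w /H + ->.
  move: v; apply: wedgesp_ind => [|a u v hu hv|u v uE vF]; first by rewrite mulmx0 mem0v.
    by rewrite mulmxDr -scalemxAr memvD// memvZ.
  by rewrite wedgemx_wedge mem_wedgesp// mem_mximg.
move: w; apply: wedgesp_ind => [|a u v hu hv|u v /mximgP[u' u'E ->] /mximgP[v' v'F ->]]; first exact: mem0v.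
  by rewrite memvD// memvZ.
by rewrite -wedgemx_wedge mem_mximg// mem_wedgesp.
Qed.

Lemma mximgZ n a (g : 'M[K]_n) (E : {vspace 'cV[K]_n}) : a != 0 -> mximg (a *: g) E = mximg g E.
Proof.
move=> a0; apply: vspace_eq => w; split=> /mximgP[v vE ->].
  by rewrite -scalemxAl memvZ// mem_mximg.
have -> : g *m v = (a *: g) *m (a^-1 *: v) by rewrite -scalemxAl -scalemxAr scalerA mulfV// scale1r.
by rewrite mem_mximg// memvZ.
Qed.

Lemma mximg_eq n (g h : 'M[K]_n) (E : {vspace 'cV[K]_n}) :
  (forall v, v \in E -> g *m v = h *m v) -> mximg g E = mximg h E.
Proof.
move=> gh; apply: vspace_eq => w; split=> /mximgP[v vE ->].
  by rewrite gh// mem_mximg.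
by rewrite -gh// mem_mximg.
Qed.

End SpanLemmas.

Section Quaternionic.
Variables (R : realType) (Q : quaternionic R).
Local Notation C := R[i].
Local Notation conjmx := (map_mx (@conjc R)).
Local Notation J := (jmx Q).

Lemma qjD u v : qj Q (u + v) = qj Q u + qj Q v.
Proof. by rewrite /qj /qj_of map_mxD mulmxDr. Qed.
Lemma qjZ a v : qj Q (a *: v) = conjc a *: qj Q v.
Proof. by rewrite /qj /qj_of map_mxZ -scalemxAr. Qed.
Lemma qj0 : qj Q 0 = 0.
Proof. by rewrite -(scale0r 0) qjZ conjc0 !scale0r. Qed.
Lemma qjK v : qj Q (qj Q v) = - v.
Proof. exact: qj_sq. Qed.
Lemma conjmxK m n (A : 'M[C]_(m, n)) : conjmx (conjmx A) = A.
Proof. by apply/matrixP => i j; rewrite !mxE conjcK. Qed.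

Lemma jmx_sq : J *m conjmx J = - 1%:M.
Proof.
apply/matrixP => x y; have := qjK (delta_mx y 0); rewrite /qj /qj_of map_mxM /= conjmxK mulmxA.
by rewrite -colE => /matrixP/(_ x 0); rewrite !mxE eqxx andbT.
Qed.

Lemma jmx_unit : J \in unitmx.
Proof.
have e : J *m (- conjmx J) = 1%:M by rewrite mulmxN jmx_sq opprK.
by have [] := mulmx1_unit e.
Qed.

Lemma comm_jP X : comm_j Q X <-> X *m J = J *m conjmx X.
Proof.
split=> [H|H v].
  apply/matrixP => x y; have := H (delta_mx y 0); rewrite /qj /qj_of map_mxM !mulmxA.
  have -> : conjmx (delta_mx y 0 : 'cV[C]_4) = delta_mx y 0.
    by apply/matrixP => i j; rewrite !mxE conjc_nat.
  by rewrite -!colE => /matrixP/(_ x 0); rewrite [LHS]mxE [RHS]mxE.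
by rewrite /qj /qj_of map_mxM !mulmxA H.
Qed.

(** Since j^2 = -1, membership in jE is tested by applying j once more, with no preimage to
    choose. *)
Lemma mem_jimg E v : (v \in jimg Q E) = (qj Q v \in E).
Proof.
have H : forall v, v \in jimg Q E -> qj Q v \in E.
  apply: span_ind => [|a x y hx hy|u /mapP[w /vbasis_mem wE ->]]; first by rewrite qj0 mem0v.
    by rewrite qjD qjZ memvD// memvZ.
  by rewrite qjK memvN.
have H2 : forall v, v \in E -> qj Q v \in jimg Q E.
  move=> w; rewrite -{1}(span_basis (vbasisP E)); move: w.
  apply: span_ind => [|a x y hx hy|u uE]; first by rewrite qj0 mem0v.
    by rewrite qjD qjZ memvD// memvZ.
  by apply: memv_span; exact: map_f.
apply/idP/idP => [/H//|/H2]; by rewrite qjK memvN.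
Qed.

Lemma jimg_span2 a b : jimg Q <<[:: a; b]>>%VS = <<[:: qj Q a; qj Q b]>>%VS.
Proof.
apply: vspace_eq => v; rewrite mem_jimg; split=> /mem_span2[x [y E]]; apply/mem_span2.
  exists (- conjc x), (- conjc y); have E2 : v = - qj Q (qj Q v) by rewrite qjK opprK.
  rewrite E2 E qjD !qjZ opprD.
  by rewrite !scaleNr.
by exists (- conjc x), (- conjc y); rewrite E qjD !qjZ !qjK !scalerN !scaleNr.
Qed.

Lemma conj6_wedge u v : conj6 Q (wedge u v) = wedge (qj Q u) (qj Q v).
Proof.
rewrite /conj6 /qj /qj_of -wedgemx_wedge; congr (_ *m _).
by apply/matrixP => e j; rewrite !mxE rmorphB !rmorphM.
Qed.

Lemma conj6D u v : conj6 Q (u + v) = conj6 Q u + conj6 Q v.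
Proof. by rewrite /conj6 map_mxD mulmxDr. Qed.
Lemma conj6Z a v : conj6 Q (a *: v) = conjc a *: conj6 Q v.
Proof. by rewrite /conj6 map_mxZ -scalemxAr. Qed.
Lemma conj60 : conj6 Q 0 = 0.
Proof. by rewrite -(scale0r 0) conj6Z conjc0 !scale0r. Qed.

Lemma conjmx_wedgemx g : conjmx (wedgemx g) = wedgemx (conjmx g).
Proof.
have D (f : 'I_4) : conjmx (delta_mx f 0 : 'cV[C]_4) = delta_mx f 0.
  by apply/matrixP => i j; rewrite !mxE conjc_nat.
apply/matrixP => e f; rewrite mxE [wedgemx g e f]mxE [RHS]mxE !wedgeE rmorphB !rmorphM /=.
have E (x y : 'I_4) : conjc ((g *m delta_mx y 0 : 'cV[C]_4) x 0) = (conjmx g *m (delta_mx y 0 : 'cV[C]_4)) x 0.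
  transitivity ((conjmx (g *m delta_mx y 0 : 'cV[C]_4)) x 0); first by rewrite [RHS]mxE.
  by rewrite map_mxM /= D.
by rewrite !E.
Qed.

Lemma conjmx_dwedgemx X : conjmx (dwedgemx X) = dwedgemx (conjmx X).
Proof.
by apply/matrixP => e f; rewrite mxE !dwedgemxE !rmorphD !rmorphN !rmorphM /= !mxE !conjc_nat.
Qed.

Lemma conjsp6_wedgesp E F : conjsp6 Q (wedgesp E F) = wedgesp (jimg Q E) (jimg Q F).
Proof.
have H : forall w, w \in wedgesp E F -> conj6 Q w \in wedgesp (jimg Q E) (jimg Q F).
  apply: wedgesp_ind => [|a u v hu hv|u v uE vF]; first by rewrite conj60 mem0v.
    by rewrite conj6D conj6Z memvD// memvZ.
  by rewrite conj6_wedge mem_wedgesp// mem_jimg qjK memvN.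
have H2 : forall w, w \in wedgesp E F -> conj6 Q w \in conjsp6 Q (wedgesp E F).
  move=> w; rewrite -{1}(span_basis (vbasisP (wedgesp E F))); move: w.
  apply: span_ind => [|a x y hx hy|u uE]; first by rewrite conj60 mem0v.
    by rewrite conj6D conj6Z memvD// memvZ.
  by apply: memv_span; exact: map_f.
apply/eqP; rewrite eqEsubv; apply/andP; split.
  by apply/span_subvP => u /mapP[w /vbasis_mem wE ->]; exact: H.
apply: wedgesp_sub => u v; rewrite !mem_jimg => uE vF.
have := H2 _ (mem_wedgesp uE vF); rewrite conj6_wedge !qjK wedgeNl wedgeNr opprK.
by [].
Qed.

Lemma wedgemx_jmx_unit : wedgemx J \in unitmx.
Proof. by have [] := wedgemxV jmx_unit. Qed.

Lemma bar6_wedgemx g : bar6 Q (wedgemx g) = wedgemx (J *m conjmx g *m invmx J).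
Proof.
by rewrite /bar6 conjmx_wedgemx (wedgemxV jmx_unit).2 -!wedgemxM.
Qed.

Lemma bar6_dwedgemx X : bar6 Q (dwedgemx X) = dwedgemx (J *m conjmx X *m invmx J).
Proof. by rewrite /bar6 conjmx_dwedgemx dwedgemx_conj// jmx_unit. Qed.

Lemma bar6Z a M : bar6 Q (a *: M) = conjc a *: bar6 Q M.
Proof. by rewrite /bar6 map_mxZ -scalemxAr -scalemxAl. Qed.

Lemma comm_j_conj X : comm_j Q X -> J *m conjmx X *m invmx J = X.
Proof. by move=> /comm_jP <-; rewrite mulmxK// jmx_unit. Qed.

Lemma perpP E w : (w \in perp Q E) <-> (forall u, u \in E -> ip Q u w = 0).
Proof.
have K u : (w \in lker (linfun (mulmx (u^T *m gram Q) : 'cV[C]_6 -> 'M[C]_1))) = (ip Q u w == 0).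
  rewrite memv_ker mulmx_lfunE; apply/eqP/eqP => [|H].
    by move=> /matrixP/(_ 0 0); rewrite [RHS]mxE.
  by apply/matrixP => i j; rewrite (ord1 i) (ord1 j) [RHS]mxE.
split=> H.
  move=> u; rewrite -(span_basis (vbasisP E)); move: u.
  apply: span_ind => [|a x y hx hy|u uE]; first by rewrite ip0l.
    by rewrite ipDl ipZl hx hy mulr0 addr0.
  have : (perp Q E <= lker (linfun (mulmx (u^T *m gram Q) : 'cV[C]_6 -> 'M[C]_1)))%VS.
    by rewrite /perp (big_rem u uE) /= capvSl.
  by move=> /subvP/(_ w H); rewrite K => /eqP.
rewrite /perp big_seq; elim/big_ind: _ => [|U V hU hV|u uE]; first exact: memvf.
  by apply/memv_capP.
by rewrite K H// vbasis_mem.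
Qed.

End Quaternionic.

Lemma dilation_sum (K : fieldType) n (u v w : 'cV[K]_n) a b x y :
  a *: (x *: u) + (w - (x *: u + y *: v)) + b *: (y *: v) =
  w + ((a - 1) * x) *: u + ((b - 1) * y) *: v.
Proof. by apply/matrixP => i j; rewrite !mxE; ring. Qed.

Lemma lfun_comb3 (K : fieldType) (V : vectType K) (f g h : 'End(V)) a b w :
  (a *: f + g + b *: h)%R w = a *: f w + g w + b *: h w.
Proof. by rewrite !add_lfunE !scale_lfunE. Qed.

Lemma lfun_sub (K : fieldType) (V : vectType K) (f g : 'End(V)) w : (f - g)%R w = f w - g w.
Proof. by rewrite add_lfunE opp_lfunE. Qed.

(** * Splittings of C^4 and the operators they induce on the exterior square *)

Section Splittings.
Variables (R : realType) (Q : quaternionic R).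
Local Notation C := R[i].
Implicit Types (p : 'M[C]_4) (E F : {vspace 'cV[C]_4}).

Definition frame4 (a b c d : 'cV[C]_4) : 'M[C]_4 :=
  \matrix_(i, k) (tnth [tuple a; b; c; d] k) i 0.

(* p is the projection onto the plane E along the plane F *)
Definition splits p E F := exists a b c d, [/\ E = <<[:: a; b]>>%VS, F = <<[:: c; d]>>%VS,
  det4 Q a b c d != 0, p *m a = a /\ p *m b = b & p *m c = 0 /\ p *m d = 0].

Definition dilat (z : C) p : 'M[C]_4 := z *: p + (1%:M - p).

Lemma frame4_unit a b c d : det4 Q a b c d != 0 -> frame4 a b c d \in unitmx.
Proof.
by rewrite /det4 /det4_of mulf_eq0 negb_or => /andP[_]; rewrite unitmxE unitfE.
Qed.

Lemma frame4_col a b c d (v : 'cV[C]_4) : frame4 a b c d *m v =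
  v (@Ordinal 4 0 isT) 0 *: a + v (@Ordinal 4 1 isT) 0 *: b +
  v (@Ordinal 4 2 isT) 0 *: c + v (@Ordinal 4 3 isT) 0 *: d.
Proof.
apply/matrixP => i j; rewrite (ord1 j) mxE sum4 !mxE !(tnth_nth 0) /=; ring.
Qed.

Lemma frame4_span a b c d : det4 Q a b c d != 0 -> forall v : 'cV[C]_4,
  exists x y z w, v = x *: a + y *: b + z *: c + w *: d.
Proof.
move=> /frame4_unit u v; pose t := invmx (frame4 a b c d) *m v.
exists (t (@Ordinal 4 0 isT) 0), (t (@Ordinal 4 1 isT) 0), (t (@Ordinal 4 2 isT) 0), (t (@Ordinal 4 3 isT) 0).
by rewrite -frame4_col /t mulmxA mulmxV// mul1mx.
Qed.

Lemma frame4_eq n (A B : 'M[C]_(n, 4)) a b c d : det4 Q a b c d != 0 ->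
  A *m a = B *m a -> A *m b = B *m b -> A *m c = B *m c -> A *m d = B *m d -> A = B.
Proof.
move=> nz ha hb hc hd; apply/matrixP => i j.
have [x [y [z [w E]]]] := frame4_span nz (delta_mx j 0).
have : A *m delta_mx j (0 : 'I_1) = B *m delta_mx j 0.
  by rewrite E !mulmxDr -!scalemxAr ha hb hc hd.
by rewrite -!colE => /matrixP/(_ i 0); rewrite !mxE.
Qed.

Lemma wedge_ind (Pr : 'cV[C]_6 -> Prop) : Pr 0 ->
  (forall a u v, Pr u -> Pr v -> Pr (a *: u + v)) -> (forall u v, Pr (wedge u v)) ->
  forall w, Pr w.
Proof.
move=> P0 PD Pw w; rewrite (col_delta w); elim: (index_enum _) => [|e s IH]; first by rewrite big_nil.
by rewrite big_cons; apply: PD => //; rewrite -[delta_mx e 0]mul1mx -wedgemx1 wedgemx_colE.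
Qed.

Lemma frame6_ind (Pr : 'cV[C]_6 -> Prop) a b c d : det4 Q a b c d != 0 -> Pr 0 ->
  (forall k u v, Pr u -> Pr v -> Pr (k *: u + v)) ->
  Pr (wedge a b) -> Pr (wedge a c) -> Pr (wedge a d) -> Pr (wedge b c) -> Pr (wedge b d) ->
  Pr (wedge c d) -> forall w, Pr w.
Proof.
move=> nz P0 PD ab ac ad bc bd cd.
have PZ k u : Pr u -> Pr (k *: u) by move=> h; rewrite -[_ *: _]addr0; apply: PD.
have PA u v : Pr u -> Pr v -> Pr (u + v) by move=> h h'; rewrite -[u]scale1r; apply: PD.
have PN u v : Pr (wedge u v) -> Pr (wedge v u) by move=> h; rewrite wedgeC -scaleN1r; apply: PZ.
have Pv u : Pr (wedge u u) by rewrite wedgevv.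
have PF u : Pr (wedge u a) -> Pr (wedge u b) -> Pr (wedge u c) -> Pr (wedge u d) -> forall v, Pr (wedge u v).
  move=> ua ub uc ud v; have [x [y [z [t ->]]]] := frame4_span nz v.
  by rewrite !wedgeDr !wedgeZr; apply: PA (PA _ _ (PA _ _ _ _) _) _; apply: PZ.
have Pw r : Pr (wedge a r) -> Pr (wedge b r) -> Pr (wedge c r) -> Pr (wedge d r) -> forall u, Pr (wedge u r).
  by move=> ua ub uc ud u; apply: (PN r u); apply: (PF r); apply: (PN _ r).
apply: wedge_ind => // u v; apply: (PF u); by apply: Pw => //; apply: (PN _ _).
Qed.

Lemma frame6_eq n (A B : 'M[C]_(n, 6)) a b c d : det4 Q a b c d != 0 ->
  A *m wedge a b = B *m wedge a b -> A *m wedge a c = B *m wedge a c ->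
  A *m wedge a d = B *m wedge a d -> A *m wedge b c = B *m wedge b c ->
  A *m wedge b d = B *m wedge b d -> A *m wedge c d = B *m wedge c d -> A = B.
Proof.
move=> nz h1 h2 h3 h4 h5 h6; apply: eq_on_wedges => u v.
apply: (frame6_ind (Pr := fun w => A *m w = B *m w) nz) => //; first by rewrite !mulmx0.
by move=> k s t e e'; rewrite !mulmxDr -!scalemxAr e e'.
Qed.

Lemma det4_rep : ((forall a c d, det4 Q a a c d = 0) * (forall a b d, det4 Q a b a d = 0) *
  (forall a b c, det4 Q a b c a = 0) * (forall a b d, det4 Q a b b d = 0) *
  (forall a b c, det4 Q a b c b = 0) * (forall a b c, det4 Q a b c c = 0))%type.
Proof. by do !split; move=> *; rewrite !det4E; ring. Qed.

Lemma det4_swap a b c d : det4 Q c d a b = det4 Q a b c d.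
Proof. by rewrite !det4E; ring. Qed.

Section WithSplitting.
Variables (p : 'M[C]_4) (E F : {vspace 'cV[C]_4}).
Hypothesis pEF : splits p E F.

Lemma splits_idem : p *m p = p.
Proof.
have [a [b [c [d [_ _ nz [pa pb] [pc pd]]]]]] := pEF.
by apply: (frame4_eq nz); rewrite -!mulmxA ?pa ?pb ?pc ?pd ?mulmx0 ?pa ?pb.
Qed.

Lemma splits_memE v : (v \in E) = (p *m v == v).
Proof.
have [a [b [c [d [EE _ nz [pa pb] [pc pd]]]]]] := pEF.
apply/idP/eqP => [|e].
  by rewrite EE => /mem_span2[x [y ->]]; rewrite mulmxDr -!scalemxAr pa pb.
have [x [y [z [w ev]]]] := frame4_span nz v.
rewrite EE; apply/mem_span2; exists x, y; rewrite -[LHS]e ev !mulmxDr -!scalemxAr pa pb pc pd.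
by rewrite !scaler0 !addr0.
Qed.

Lemma splits_memF v : (v \in F) = (p *m v == 0).
Proof.
have [a [b [c [d [_ FF nz [pa pb] [pc pd]]]]]] := pEF.
apply/idP/eqP => [|e].
  by rewrite FF => /mem_span2[x [y ->]]; rewrite mulmxDr -!scalemxAr pc pd !scaler0 addr0.
have [x [y [z [w ev]]]] := frame4_span nz v.
have e' : x *: a + y *: b = 0.
  by move: e; rewrite ev !mulmxDr -!scalemxAr pa pb pc pd !scaler0 !addr0.
by rewrite FF; apply/mem_span2; exists z, w; rewrite ev e' add0r.
Qed.

Lemma dilat_E z v : v \in E -> dilat z p *m v = z *: v.
Proof.
by rewrite splits_memE => /eqP pv; rewrite /dilat mulmxDl mulmxBl mul1mx -scalemxAl pv subrr addr0.
Qed.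

Lemma dilat_F z v : v \in F -> dilat z p *m v = v.
Proof.
by rewrite splits_memF => /eqP pv; rewrite /dilat mulmxDl mulmxBl mul1mx -scalemxAl pv scaler0 add0r subr0.
Qed.

Lemma splits_frame_mem : exists a b c d, [/\ E = <<[:: a; b]>>%VS, F = <<[:: c; d]>>%VS,
  det4 Q a b c d != 0 & [/\ a \in E, b \in E, c \in F & d \in F]].
Proof.
have [a [b [c [d [EE FF nz _ _]]]]] := pEF; exists a, b, c, d.
by split => //; rewrite EE FF !memv_span ?inE ?eqxx ?orbT.
Qed.

Lemma dilatM z w : dilat z p *m dilat w p = dilat (z * w) p.
Proof.
have [a [b [c [d [_ _ nz [aE bE cF dF]]]]]] := splits_frame_mem.
by apply: (frame4_eq nz); rewrite -mulmxA ?(dilat_E _ aE) ?(dilat_E _ bE) ?(dilat_F _ cF) ?(dilat_F _ dF)//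
  -scalemxAr ?(dilat_E _ aE) ?(dilat_E _ bE) scalerA mulrC.
Qed.

Lemma dilat1 : dilat 1 p = 1%:M.
Proof. by rewrite /dilat scale1r addrC subrK. Qed.

Lemma dilat_unit z : z != 0 -> dilat z p \in unitmx /\ invmx (dilat z p) = dilat z^-1 p.
Proof.
move=> z0; have e : dilat z p *m dilat z^-1 p = 1%:M by rewrite dilatM mulfV// dilat1.
have [u _] := mulmx1_unit e; split=> //.
by rewrite -[LHS]mulmx1 -e mulmxA mulVmx// mul1mx.
Qed.

Lemma det_dilat z : \det (dilat z p) = z ^+ 2.
Proof.
have [a [b [c [d [_ _ nz [aE bE cF dF]]]]]] := splits_frame_mem.
apply: (mulIf nz); rewrite -det4M (dilat_E _ aE) (dilat_E _ bE) (dilat_F _ cF) (dilat_F _ dF).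
by rewrite !det4E !mxE; ring.
Qed.

(* Multiplication by z on /\^2 E, by 1/z on /\^2 F and by 1 on E /\ F. *)
Definition gam6 (z : C) : 'M[C]_6 := z^-1 *: wedgemx (dilat z p).

(** For null u and v with (u, v) non-zero, the component of w along either vector is read off by
    pairing with the other one, and the remainder is orthogonal to both. The five conclusions all
    rest on this decomposition and are therefore proved together. *)
Lemma GamE (u v : 'cV[C]_6) z : ip Q u u = 0 -> ip Q v v = 0 -> ip Q u v != 0 -> forall w,
  [/\ Gam Q <[u]>%VS <[v]>%VS z *m w = w + ((z - 1) * ip Q v w / ip Q u v) *: u + ((z^-1 - 1) * ip Q u w / ip Q u v) *: v,
   oproj Q (<[u]> + <[v]>)%VS *m w = (ip Q v w / ip Q u v) *: u + (ip Q u w / ip Q u v) *: v,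
   (perp Q (perp Q (<[u]> + <[v]>)) = <[u]> + <[v]>)%VS,
   oproj Q (perp Q (<[u]> + <[v]>)%VS) *m w = w - (ip Q v w / ip Q u v) *: u - (ip Q u w / ip Q u v) *: v &
   orefl Q (perp Q (<[u]> + <[v]>)%VS) *m w = Gam Q <[u]>%VS <[v]>%VS (-1) *m w].
Proof.
move=> uu vv uv w; set x := ip Q v w / ip Q u v; set y := ip Q u w / ip Q u v.
pose w0 := w - (x *: u + y *: v).
have vu : ip Q v u = ip Q u v by rewrite ipC.
have xE : x * ip Q u v = ip Q v w by rewrite /x divfK.
have yE : y * ip Q u v = ip Q u w by rewrite /y divfK.
have L t s k l : ip Q t (s - (k *: u + l *: v)) = ip Q t s - (k * ip Q t u + l * ip Q t v).
  by rewrite ipDr ipNr ipDr !ipZr.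
have memO t : (t \in perp Q (<[u]> + <[v]>)) <-> ip Q u t = 0 /\ ip Q v t = 0.
  split=> [/perpP H|[h1 h2]].
    by split; apply: H; [apply: (subvP (addvSl _ _))|apply: (subvP (addvSr _ _))]; exact: memv_line.
  apply/perpP => s /memv_addP[_ /vlineP[k1 ->] [_ /vlineP[k2 ->] ->]].
  by rewrite ipDl !ipZl h1 h2 !mulr0 addr0.
have w0O : w0 \in perp Q (<[u]> + <[v]>).
  apply/memO; rewrite /w0 !L uu vv vu xE yE.
  by rewrite !mulr0 add0r addr0 !subrr.
have wE : w = x *: u + y *: v + w0 by rewrite /w0 addrC subrK.
have lu k : k *: u \in <[u]>%VS by rewrite memvZ// memv_line.
have lv k : k *: v \in <[v]>%VS by rewrite memvZ// memv_line.
set O := perp Q _ in memO w0O *.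
have d1 : (<[u]> :&: (<[v]> + O) = 0)%VS.
  apply/eqP; rewrite -subv0; apply/subvP => t /memv_capP[/vlineP[k ->] /memv_addP[_ /vlineP[l ->] [t2 oO e]]].
  have /memO[_ vo] := oO.
  have : ip Q v (k *: u) = 0 by rewrite e ipDr ipZr vv mulr0 vo addr0.
  rewrite ipZr vu => /eqP; rewrite mulf_eq0 (negbTE uv) orbF => /eqP ->.
  by rewrite scale0r mem0v.
have d2 : (<[v]> :&: (<[u]> + O) = 0)%VS.
  apply/eqP; rewrite -subv0; apply/subvP => t /memv_capP[/vlineP[k ->] /memv_addP[_ /vlineP[l ->] [t2 oO e]]].
  have /memO[uo _] := oO.
  have : ip Q u (k *: v) = 0 by rewrite e ipDr ipZr uu mulr0 uo addr0.
  rewrite ipZr => /eqP; rewrite mulf_eq0 (negbTE uv) orbF => /eqP ->.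
  by rewrite scale0r mem0v.
have d3 : (O :&: (<[u]> + <[v]>) = 0)%VS.
  apply/eqP; rewrite -subv0; apply/subvP => t /memv_capP[tO /memv_addP[_ /vlineP[k ->] [_ /vlineP[l ->] e]]].
  have /memO[ut vt] := tO; move: ut vt; rewrite e !ipDr !ipZr uu vv vu !mulr0 add0r addr0.
  move=> /eqP; rewrite mulf_eq0 (negbTE uv) orbF => /eqP ->.
  move=> /eqP; rewrite mulf_eq0 (negbTE uv) orbF => /eqP ->.
  by rewrite !scale0r addr0 mem0v.
have d4 : ((<[u]> + <[v]>) :&: O = 0)%VS by rewrite capvC.
(* A vector orthogonal to [O] differs from its part along u and v by a vector orthogonal to
   everything, hence by 0. *)
have PO : perp Q O = (<[u]> + <[v]>)%VS.
  apply: vspace_eq => t; split=> [/perpP H|].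
    pose x' := ip Q v t / ip Q u v; pose y' := ip Q u t / ip Q u v.
    suff -> : t = x' *: u + y' *: v by apply: memv_add.
    apply/eqP; rewrite -subr_eq0; apply/eqP; apply: (@ip_nondeg _ Q) => s.
    pose xs := ip Q v s / ip Q u v; pose ys := ip Q u s / ip Q u v.
    pose s0 := s - (xs *: u + ys *: v).
    have s0O : s0 \in O.
      apply/memO; rewrite /s0 !L uu vv vu /xs /ys !divfK//.
      by rewrite !mulr0 add0r addr0 !subrr.
    have := H _ s0O; rewrite ipC => ts0.
    have -> : s = s0 + (xs *: u + ys *: v) by rewrite /s0 subrK.
    have /memO[us0 vs0] := s0O.
    clearbody s0; rewrite !(ipDr, ipDl, ipNl, ipZr, ipZl) ts0 us0 vs0 uu vv vu (ipC _ t) (ipC _ t) /x' /y'.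
    by field.
  by move=> tuv; apply/perpP => s sO; rewrite ipC; move/perpP: sO; apply.
have G z' : Gam Q <[u]>%VS <[v]>%VS z' *m w =
    w + ((z' - 1) * ip Q v w / ip Q u v) *: u + ((z'^-1 - 1) * ip Q u w / ip Q u v) *: v.
  rewrite /Gam -/O mx_ofE lfun_comb3.
  have -> : daddv_pi <[u]> (<[v]> + O) w = x *: u.
    by rewrite wE -addrA; apply: daddv_piE => //; apply: memv_add.
  have -> : daddv_pi <[v]> (<[u]> + O) w = y *: v.
    by rewrite wE addrAC addrC; apply: daddv_piE => //; apply: memv_add.
  have -> : daddv_pi O (<[u]> + <[v]>) w = w0.
    by rewrite wE addrC; apply: daddv_piE => //; apply: memv_add.
  rewrite -mulrA -/x -mulrA -/y; exact: dilation_sum.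
have PiO : daddv_pi O (<[u]> + <[v]>) w = w0.
  by rewrite wE addrC; apply: daddv_piE => //; apply: memv_add.
have PiV : daddv_pi (<[u]> + <[v]>) O w = x *: u + y *: v.
  by rewrite wE; apply: daddv_piE => //; apply: memv_add.
split=> //; first by rewrite /oproj -/O mx_ofE PiV.
  by rewrite /oproj PO mx_ofE PiO /w0 opprD addrA.
rewrite /orefl PO mx_ofE lfun_sub PiV PiO G /w0 invrN1 -!mulrA -/x -/y.
move: (w) => w1; apply/matrixP => i j; rewrite !mxE; ring.
Qed.

End WithSplitting.
End Splittings.

Section Splittings2.
Variables (R : realType) (Q : quaternionic R).
Local Notation C := R[i].
Implicit Types (p : 'M[C]_4) (E F : {vspace 'cV[C]_4}).

Section WithSplitting.
Variables (p : 'M[C]_4) (E F : {vspace 'cV[C]_4}).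
Hypothesis pEF : splits Q p E F.
Local Notation g6 := (gam6 p).

Lemma splits_frame : exists a b c d, [/\ E = <<[:: a; b]>>%VS, F = <<[:: c; d]>>%VS,
  det4 Q a b c d != 0, [/\ a \in E, b \in E, c \in F & d \in F] &
  [/\ wedgesp E E = <[wedge a b]>%VS, wedgesp F F = <[wedge c d]>%VS,
      ip Q (wedge a b) (wedge a b) = 0, ip Q (wedge c d) (wedge c d) = 0 &
      ip Q (wedge a b) (wedge c d) = det4 Q a b c d]].
Proof.
have [a [b [c [d [EE FF nz mem]]]]] := splits_frame_mem pEF; exists a, b, c, d; split=> //.
by rewrite EE FF !wedgesp_sq !ip_wedge !det4_rep; split.
Qed.

(** On E /\ F the dilation has a single factor z, cancelled by the prefactor 1 / z of [gam6]; on the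
    two null lines its factors z^2 and 1 become z and 1 / z. *)
Lemma Gam_splits z : z != 0 -> Gam Q (wedgesp E E) (wedgesp F F) z = g6 z.
Proof.
move=> z0; have [a [b [c [d [_ _ nz [aE bE cF dF] [-> -> uu vv uv]]]]]] := splits_frame.
have nuv : ip Q (wedge a b) (wedge c d) != 0 by rewrite uv.
have D x y s t : ip Q (wedge x y) (wedge s t) = det4 Q x y s t := ip_wedge Q x y s t.
have G w : Gam Q <[wedge a b]>%VS <[wedge c d]>%VS z *m w = w +
    ((z - 1) * ip Q (wedge c d) w / ip Q (wedge a b) (wedge c d)) *: wedge a b +
    ((z^-1 - 1) * ip Q (wedge a b) w / ip Q (wedge a b) (wedge c d)) *: wedge c d.
  have [h _ _ _ _] := GamE z uu vv nuv w; exact: h.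
apply: (frame6_eq nz); rewrite G /gam6 -scalemxAl wedgemx_wedge;
rewrite ?(dilat_E pEF _ aE) ?(dilat_E pEF _ bE) ?(dilat_F pEF _ cF) ?(dilat_F pEF _ dF) ?wedgeZl ?wedgeZr ?scalerA ?D;
rewrite ?det4_rep ?(det4_swap Q a b c d) ?(mulr0, mul0r) ?scale0r ?addr0 ?mulfK// ?mulVf ?scale1r//.
- by rewrite mulKf// scalerBl scale1r addrC subrK.
- by rewrite scalerBl scale1r addrC subrK.
Qed.

(** On each of the six wedges of an adapted frame, subtracting the part along the two null lines
    leaves a vector of E /\ F; by linearity this holds everywhere. *)
Lemma perp_wedges : perp Q (wedgesp E E + wedgesp F F)%VS = wedgesp E F.
Proof.
have [a [b [c [d [EE FF nz [aE bE cF dF] [e1 e2 uu vv uv]]]]]] := splits_frame.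
have nuv : ip Q (wedge a b) (wedge c d) != 0 by rewrite uv.
have G w : oproj Q (<[wedge a b]> + <[wedge c d]>)%VS *m w =
    (ip Q (wedge c d) w / ip Q (wedge a b) (wedge c d)) *: wedge a b +
    (ip Q (wedge a b) w / ip Q (wedge a b) (wedge c d)) *: wedge c d.
  have [_ h _ _ _] := GamE 1 uu vv nuv w; exact: h.
apply: vspace_eq => w; split=> [/perpP H|].
  have -> : w = w - oproj Q (<[wedge a b]> + <[wedge c d]>)%VS *m w.
    rewrite G !H ?mul0r ?scale0r ?addr0 ?subr0//.
      by rewrite e1; apply: (subvP (addvSl _ _)); exact: memv_line.
    by rewrite e2; apply: (subvP (addvSr _ _)); exact: memv_line.
  have O1 : wedge a b - oproj Q (<[wedge a b]> + <[wedge c d]>)%VS *m wedge a b \in wedgesp E F.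
    by rewrite G uu ipC uv divff// mul0r scale0r addr0 scale1r subrr mem0v.
  have O2 : wedge c d - oproj Q (<[wedge a b]> + <[wedge c d]>)%VS *m wedge c d \in wedgesp E F.
    by rewrite G vv uv divff// mul0r scale0r add0r scale1r subrr mem0v.
  have O3 r s : r \in E -> s \in F -> ip Q (wedge a b) (wedge r s) = 0 -> ip Q (wedge c d) (wedge r s) = 0 ->
      wedge r s - oproj Q (<[wedge a b]> + <[wedge c d]>)%VS *m wedge r s \in wedgesp E F.
    move=> rE sF h1 h2; rewrite G h1 h2 !mul0r !scale0r addr0 subr0.
    exact: mem_wedgesp.
  have Oac : wedge a c - oproj Q (<[wedge a b]> + <[wedge c d]>)%VS *m wedge a c \in wedgesp E F.
    by apply: O3; rewrite // ip_wedge ?det4_rep.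
  have Oad : wedge a d - oproj Q (<[wedge a b]> + <[wedge c d]>)%VS *m wedge a d \in wedgesp E F.
    by apply: O3; rewrite // ip_wedge ?det4_rep.
  have Obc : wedge b c - oproj Q (<[wedge a b]> + <[wedge c d]>)%VS *m wedge b c \in wedgesp E F.
    by apply: O3; rewrite // ip_wedge ?det4_rep.
  have Obd : wedge b d - oproj Q (<[wedge a b]> + <[wedge c d]>)%VS *m wedge b d \in wedgesp E F.
    by apply: O3; rewrite // ip_wedge ?det4_rep.
  move: (oproj Q _) O1 O2 Oac Oad Obc Obd => pr O1 O2 Oac Oad Obc Obd {O3 H G}.
  apply: (@frame6_ind _ Q (fun w => w - pr *m w \in wedgesp E F) a b c d nz).
    by rewrite mulmx0 subrr mem0v.
  by move=> k s t hs ht; rewrite mulmxDr -scalemxAr opprD addrACA -scalerBr memvD// memvZ.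
  exact: O1. exact: Oac. exact: Oad. exact: Obc. exact: Obd. exact: O2.
move: w; apply: (@wedgesp_ind _ E F) => [||u v uE vF]; first exact: mem0v.
  by move=> k u v hu hv; rewrite memvD// memvZ.
move: uE vF; rewrite EE FF => /mem_span2[x [y ->]] /mem_span2[z [t ->]].
apply/perpP => s; rewrite -EE -FF e1 e2 => /memv_addP[_ /vlineP[k ->] [_ /vlineP[l ->] ->]].
have z0 r r' s' : det4 Q a b r' s' = 0 -> det4 Q c d r' s' = 0 ->
    ip Q (k *: wedge a b + l *: wedge c d) (r *: wedge r' s') = 0.
  by move=> h1 h2; rewrite ipDl !ipZl !ipZr !ip_wedge h1 h2 !mulr0 addr0.
rewrite wedgeDl !wedgeDr !wedgeZl !wedgeZr !scalerA !ipDr !z0 ?addr0//; by rewrite det4_rep.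
Qed.

(** The scalar -1 is its own inverse, so both null lines are reversed while E /\ F is fixed. *)
Lemma orefl_splits : orefl Q (wedgesp E F) = g6 (-1).
Proof.
rewrite -Gam_splits ?oppr_eq0 ?oner_eq0// -perp_wedges.
have [a [b [c [d [_ _ nz _ [-> -> uu vv uv]]]]]] := splits_frame.
have nuv : ip Q (wedge a b) (wedge c d) != 0 by rewrite uv.
by apply: eq_on_wedges => s t; have [_ _ _ _ ->] := GamE 1 uu vv nuv (wedge s t).
Qed.

Lemma oproj_splits u v : oproj Q (wedgesp E F) *m wedge u v =
  wedge (p *m u) ((1%:M - p) *m v) + wedge ((1%:M - p) *m u) (p *m v).
Proof.
(* The derivation [dwedgemx p] has eigenvalue 2 on /\^2 E, 1 on E /\ F and 0 on /\^2 F; the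
   polynomial 2 t - t^2 takes there the values 0, 1 and 0. *)
have -> : wedge (p *m u) ((1%:M - p) *m v) + wedge ((1%:M - p) *m u) (p *m v) =
    (2 *: dwedgemx p - dwedgemx p *m dwedgemx p) *m wedge u v.
  have pp x : p *m (p *m x) = p *m x by rewrite mulmxA (splits_idem pEF).
  rewrite [in RHS]mulmxBl -[in RHS]mulmxA -scalemxAl !dwedgemx_wedge !mulmxDr !dwedgemx_wedge !pp.
  rewrite !mulmxBl !mul1mx !wedgeDr !wedgeDl !wedgeNr !wedgeNl.
  apply/matrixP => i j; rewrite !mxE; ring.
congr (_ *m _); move: u v => _ _; rewrite -perp_wedges.
have [a [b [c [d [_ _ nz [aE bE cF dF] [-> -> uu vv uv]]]]]] := splits_frame.
have nuv : ip Q (wedge a b) (wedge c d) != 0 by rewrite uv.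
move: aE bE cF dF; rewrite !(splits_memE pEF) !(splits_memF pEF) => /eqP pa /eqP pb /eqP pc /eqP pd.
have G w : oproj Q (perp Q (<[wedge a b]> + <[wedge c d]>)%VS) *m w = w -
    (ip Q (wedge c d) w / ip Q (wedge a b) (wedge c d)) *: wedge a b -
    (ip Q (wedge a b) w / ip Q (wedge a b) (wedge c d)) *: wedge c d.
  have [_ _ _ h _] := GamE 1 uu vv nuv w; exact: h.
apply: (frame6_eq nz); rewrite G;
rewrite !ip_wedge !det4_rep ?(det4_swap Q a b c d) ?mul0r ?divff// ?scale0r ?scale1r;
rewrite mulmxBl -mulmxA -scalemxAl !dwedgemx_wedge ?mulmxDr ?dwedgemx_wedge ?pa ?pb ?pc ?pd;
rewrite ?wedge0l ?wedge0r ?pa ?pb ?pc ?pd ?addr0 ?add0r ?mulmx0 ?scaler0 ?subr0 ?subrr//;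
rewrite ?mulmxDr ?dwedgemx_wedge ?pa ?pb ?pc ?pd ?wedge0l ?wedge0r ?addr0 ?add0r;
apply/matrixP => i j; rewrite !mxE; ring.
Qed.

Lemma complementary_splits : complementary Q (wedgesp E E) (wedgesp F F).
Proof.
have [a [b [c [d [_ _ nz _ [-> -> uu vv uv]]]]]] := splits_frame.
have u0 : wedge a b != 0 by apply: contra_neq nz => e; rewrite -uv e ip0l.
have v0 : wedge c d != 0 by apply: contra_neq nz => e; rewrite -uv e ip0r.
split; rewrite ?dim_vline ?u0 ?v0//.
- by move=> _ _ /vlineP[k ->] /vlineP[l ->]; rewrite ipZl ipZr uu !mulr0.
- by move=> _ _ /vlineP[k ->] /vlineP[l ->]; rewrite ipZl ipZr vv !mulr0.
by exists (wedge a b), (wedge c d); rewrite !memv_line uv.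
Qed.

Lemma gam6M z w : g6 z *m g6 w = g6 (z * w).
Proof.
by rewrite /gam6 -scalemxAl -scalemxAr scalerA -wedgemxM (dilatM pEF) invfM.
Qed.

Lemma gam61 : g6 1 = 1%:M.
Proof. by rewrite /gam6 dilat1 wedgemx1 invr1 scale1r. Qed.

Lemma gam6_unit z : z != 0 -> g6 z \in unitmx /\ invmx (g6 z) = g6 z^-1.
Proof.
move=> z0; have e : g6 z *m g6 z^-1 = 1%:M by rewrite gam6M mulfV// gam61.
have [u _] := mulmx1_unit e; split=> //.
by rewrite -[LHS]mulmx1 -e mulmxA mulVmx// mul1mx.
Qed.

Lemma gam6_orth z : z != 0 -> orth6 Q (g6 z).
Proof.
move=> z0 u v; rewrite /gam6 -!scalemxAl ipZl ipZr ip_wedgemx (det_dilat pEF).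
by field.
Qed.

End WithSplitting.

Section Quat.
Variables (p : 'M[C]_4) (E : {vspace 'cV[C]_4}).
Hypothesis pE : splits Q p E (jimg Q E).
Local Notation J := (jmx Q).
Local Notation conjmx := (map_mx (@conjc R)).

(** Conjugation by j exchanges E and jE, and with them the two complementary projections. *)
Lemma splits_conj : J *m conjmx p *m invmx J = 1%:M - p.
Proof.
suff H : J *m conjmx p = (1%:M - p) *m J by rewrite H -mulmxA mulmxV ?mulmx1// jmx_unit.
have [a [b [c [d [aE FF nz [aa bb] [cc dd]]]]]] := pE.
suff H (v : 'cV[C]_4) : J *m conjmx (p *m v) = (1%:M - p) *m (J *m conjmx v).
  apply/matrixP => i j; have := H (delta_mx j 0); rewrite map_mxM map_delta_mx !mulmxA -!colE.
  by move=> /matrixP/(_ i 0); rewrite !mxE.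
have jj u : J *m conjmx u = qj Q u by [].
have e1 u : u \in E -> (1%:M - p) *m qj Q u = qj Q u.
  move=> uE; have : qj Q u \in jimg Q E by rewrite mem_jimg qjK memvN.
  by rewrite (splits_memF pE) mulmxBl mul1mx => /eqP ->; rewrite subr0.
have e2 u : u \in jimg Q E -> (1%:M - p) *m qj Q u = 0.
  by rewrite mem_jimg (splits_memE pE) mulmxBl mul1mx => /eqP ->; rewrite subrr.
have aE' : a \in E by rewrite aE memv_span ?inE ?eqxx ?orbT.
have bE' : b \in E by rewrite aE memv_span ?inE ?eqxx ?orbT.
have cF' : c \in jimg Q E by rewrite FF memv_span ?inE ?eqxx ?orbT.
have dF' : d \in jimg Q E by rewrite FF memv_span ?inE ?eqxx ?orbT.
have [x [y [z [t ->]]]] := frame4_span nz v.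
rewrite !mulmxDr -!scalemxAr aa bb cc dd !scaler0 !addr0 !jj !qjD !qjZ !mulmxDr -!scalemxAr.
by rewrite (e1 _ aE') (e1 _ bE') (e2 _ cF') (e2 _ dF') !scaler0 !addr0.
Qed.

(** After conjugation the factor conj z sits on jE; pulling it out as a scalar leaves its inverse on
    E. *)
Lemma bar6_gam6 z : z != 0 -> bar6 Q (gam6 p z) = gam6 p (conjc z)^-1.
Proof.
move=> z0; have cz0 : conjc z != 0 by rewrite conjc_eq0.
rewrite /gam6 bar6Z bar6_wedgemx invrK.
have -> : J *m conjmx (dilat z p) *m invmx J = conjc z *: dilat (conjc z)^-1 p.
  have -> : conjmx (dilat z p) = conjc z *: conjmx p + (1%:M - conjmx p).
    by rewrite /dilat map_mxD map_mxZ map_mxB map_mx1.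
  rewrite mulmxDr mulmxDl mulmxBr mulmxBl mulmx1 mulmxV ?jmx_unit// -scalemxAr -scalemxAl splits_conj.
  by rewrite /dilat [in RHS]scalerDr scalerA mulfV// scale1r subKr addrC.
by rewrite wedgemxZ scalerA conjc_inv expr2 mulKf.
Qed.

End Quat.

Lemma quaternionic_frame_det (E : {vspace 'cV[C]_4}) a b : (E + jimg Q E = fullv)%VS ->
  E = <<[:: a; b]>>%VS -> det4 Q a b (qj Q a) (qj Q b) != 0.
Proof.
move=> EJ eE; have eJ : jimg Q E = <<[:: qj Q a; qj Q b]>>%VS by rewrite eE jimg_span2.
pose M := frame4 a b (qj Q a) (qj Q b).
suff /choice[f Hf] : forall k : 'I_4, exists t, M *m t = delta_mx k (0 : 'I_1).
  have : M *m (\matrix_(i, k) f k i 0) = 1%:M.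
    apply/matrixP => i k; have /matrixP/(_ i 0) := Hf k; rewrite !mxE eqxx andbT => <-.
    by apply: eq_bigr => l _; rewrite mxE.
  by move=> /mulmx1_unit[]; rewrite unitmxE unitfE => ? _; rewrite /det4 /det4_of mulf_neq0// qvol_neq0.
move=> k; have : delta_mx k 0 \in (E + jimg Q E)%VS by rewrite EJ memvf.
rewrite eJ eE => /memv_addP[_ /mem_span2[x [y ->]] [_ /mem_span2[z [t ->]] ->]].
exists (\col_i tnth [tuple x; y; z; t] i).
by rewrite frame4_col !mxE !(tnth_nth 0) /= addrA.
Qed.

Lemma quaternionic_frame E : (E + jimg Q E = fullv)%VS -> (E :&: jimg Q E = 0)%VS ->
  exists a b, [/\ E = <<[:: a; b]>>%VS, jimg Q E = <<[:: qj Q a; qj Q b]>>%VS &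
    det4 Q a b (qj Q a) (qj Q b) != 0].
Proof.
move=> EJ E0.
have dj F : (\dim (jimg Q F) <= \dim F)%N.
  by apply: leq_trans (dim_span _) _; rewrite size_map size_tuple.
have jj : jimg Q (jimg Q E) = E.
  by apply: vspace_eq => v; rewrite !mem_jimg qjK memvN.
have dE : \dim (jimg Q E) = \dim E by apply/eqP; rewrite eqn_leq dj -{1}jj dj.
(* The map j preserves dimension, so the two complementary summands of C^4 are both planes. *)
have d2 : \dim E = 2%N.
  have := dimv_sum_cap E (jimg Q E); rewrite EJ E0 dimv0 dE dimvf /dim /= addn0; lia.
have [a [b eE]] : exists a b, E = <<[:: a; b]>>%VS.
  have := span_basis (vbasisP E); case: (vbasis E) => s /=; rewrite d2.
  by case: s => [|a [|b [|]]] //= _ <-; exists a, b.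
have eJ : jimg Q E = <<[:: qj Q a; qj Q b]>>%VS by rewrite eE jimg_span2.
exists a, b; split; [exact: eE|exact: eJ|exact: quaternionic_frame_det EJ eE].
Qed.

Lemma quaternionic_splits E p : (E + jimg Q E = fullv)%VS -> (E :&: jimg Q E = 0)%VS ->
  (forall v, v \in E -> p *m v = v) -> (forall v, v \in jimg Q E -> p *m v = 0) ->
  splits Q p E (jimg Q E).
Proof.
move=> EJ E0 pE pF; have [a [b [eE eF nz]]] := quaternionic_frame EJ E0.
have aE : a \in E by rewrite eE memv_span ?inE ?eqxx ?orbT.
have bE : b \in E by rewrite eE memv_span ?inE ?eqxx ?orbT.
have jE v : v \in E -> qj Q v \in jimg Q E by rewrite mem_jimg qjK memvN.
exists a, b, (qj Q a), (qj Q b); split; [exact: eE|exact: eF|exact: nz|by split; apply: pE|].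
by split; apply: pF; apply: jE.
Qed.

(** The projection onto the eigenspace of S for i along that for - i, when S^2 = -1. *)
Definition prp (S : 'M[C]_4) : 'M[C]_4 := 2^-1 *: (1%:M - 'i%C *: S).

Lemma conjc_i : conjc 'i%C = - 'i%C :> C.
Proof. by apply/eqP; rewrite eq_complex /= oppr0 !eqxx. Qed.

Lemma ii : 'i%C * 'i%C = -1 :> C.
Proof. by rewrite -expr2 sqr_i. Qed.

Lemma i_neq0 : 'i%C != 0 :> C.
Proof. by apply: contra_eq_neq ii => ->; rewrite mul0r eq_sym oppr_eq0 oner_eq0. Qed.

Lemma mem_Sp (S : 'M[C]_4) v : v \in Sp S <-> S *m v = 'i%C *: v.
Proof. by rewrite /Sp mem_eigsp; split=> /eqP. Qed.

Lemma mem_Sm (S : 'M[C]_4) v : v \in Sm S <-> S *m v = - 'i%C *: v.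
Proof. by rewrite /Sm mem_eigsp; split=> /eqP. Qed.

Section Sphere.
Variable S : 'M[C]_4.
Hypotheses (SJ : comm_j Q S) (SS : S *m S = - 1%:M).

Lemma jimg_Sp : jimg Q (Sp S) = Sm S.
Proof.
apply: vspace_eq => v; rewrite mem_jimg !mem_eigsp SJ.
have ci : conjc (- 'i%C) = 'i%C :> C by apply/eqP; rewrite eq_complex /= oppr0 opprK !eqxx.
have -> : 'i%C *: qj Q v = qj Q (- 'i%C *: v) by rewrite qjZ ci.
split=> /eqP e; apply/eqP; last by rewrite e.
by have := congr1 (qj Q) e; rewrite !qjK => /oppr_inj.
Qed.

Lemma splits_sphere : splits Q (prp S) (Sp S) (Sm S).
Proof.
have i0 := ii; have h2 := two_neq0 R.
rewrite -jimg_Sp; apply: quaternionic_splits; rewrite ?jimg_Sp.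
- apply: vspace_eq => v; split=> _; first exact: memvf.
  have -> : v = 2^-1 *: (v - 'i%C *: (S *m v)) + 2^-1 *: (v + 'i%C *: (S *m v)).
      have e (x : 'cV[C]_4) : v - x + (v + x) = 2 *: v by apply/matrixP => k l; rewrite !mxE; ring.
    by rewrite -scalerDr e scalerA mulVf// scale1r.
  apply: memv_add; rewrite mem_eigsp -!scalemxAr !mulmxDr ?mulmxN -!scalemxAr mulmxA SS mulNmx mul1mx;
  apply/eqP/matrixP => k l; rewrite !mxE; ring: i0.
- have H0 (v : 'cV[C]_4) : v \in Sp S -> v \in Sm S -> v = 0.
    move=> /mem_Sp e1 /mem_Sm e2; have e : 'i%C *: v = - ('i%C *: v) by rewrite -scaleNr -e2 e1.
    have : (2 * 'i%C) *: v = 0 by rewrite mulr_natl mulr2n scalerDl {1}e addNr.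
    by move/eqP; rewrite scaler_eq0 mulf_eq0 (negbTE h2) (negbTE i_neq0) /= => /eqP ->.
  by apply/eqP; rewrite -subv0; apply/subvP => v /memv_capP[v1 v2]; rewrite memv0 (H0 v v1 v2).
- move=> v; rewrite mem_eigsp /prp => /eqP e; rewrite -scalemxAl mulmxBl mul1mx -scalemxAl e scalerA i0.
  have -> : v - -1 *: v = 2 *: v by apply/matrixP => k l; rewrite !mxE; ring.
  by rewrite scalerA mulVf// scale1r.
- move=> v; rewrite mem_eigsp /prp => /eqP e; rewrite -scalemxAl mulmxBl mul1mx -scalemxAl e scalerA.
  by rewrite mulrN i0 opprK scale1r subrr scaler0.
Qed.

End Sphere.
End Splittings2.

(** * Connections on C^4 and on its exterior square *)

Section WedgePolar.
Variable K : fieldType.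

Lemma wedgemxE (g : 'M[K]_4) e f : wedgemx g e f =
  g (pa e) (pa f) * g (pb e) (pb f) + (-1) * (g (pb e) (pa f) * g (pa e) (pb f)).
Proof. by rewrite mxE wedgeE -!colE !mxE; ring. Qed.

(** The exterior square is quadratic in g, so its derivative is its polarisation; the entries on the
    left are in the shape delivered by the product rule. *)
Lemma wedgemx_polar_entry (w A B : 'M[K]_4) (x y : K) (G : 'M[K]_4) e f :
  (forall i j, w i j = x * A i j + y * B i j) ->
  x * (A (pa e) (pa f) * G (pb e) (pb f) + G (pa e) (pa f) * A (pb e) (pb f)
    + (-1) * (A (pb e) (pa f) * G (pa e) (pb f) + G (pb e) (pa f) * A (pa e) (pb f))) +
  y * (B (pa e) (pa f) * G (pb e) (pb f) + G (pa e) (pa f) * B (pb e) (pb f)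
    + (-1) * (B (pb e) (pa f) * G (pa e) (pb f) + G (pb e) (pa f) * B (pa e) (pb f))) =
  (wedgemx (w + G) - wedgemx w - wedgemx G) e f.
Proof.
move=> W; have F (X Y Z : 'M[K]_6) : (X - Y - Z) e f = X e f - Y e f - Z e f by rewrite !mxE.
have F4 (X Y : 'M[K]_4) i j : (X + Y) i j = X i j + Y i j by rewrite mxE.
rewrite F !wedgemxE !F4 !W; ring.
Qed.

(** With [a] a derivative of [b], the derivative of the exterior square of [b] times its inverse is
    the derivation induced by a b^-1. Hence gauge terms on /\^2 come from those on C^4. *)
Lemma wedgemx_polar (a b : 'M[K]_4) : b \in unitmx ->
  wedgemx (a + b) - wedgemx a - wedgemx b = dwedgemx (a *m invmx b) *m wedgemx b.
Proof.
move=> ub; apply: eq_on_wedges => u v.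
rewrite !mulmxBl -mulmxA !wedgemx_wedge dwedgemx_wedge !mulmxDl !wedgeDl !wedgeDr.
rewrite -!mulmxA !(mulmxA (invmx b)) !mulVmx// !mul1mx.
by apply/matrixP => i j; rewrite !mxE; ring.
Qed.

Lemma dwedgemxN (X : 'M[K]_4) : dwedgemx (- X) = - dwedgemx X.
Proof. by rewrite -scaleN1r dwedgemxZ scaleN1r. Qed.

Lemma gauge_up_algebra (a : K) (g B D : 'M[K]_4) : g \in unitmx -> a != 0 ->
  (a *: wedgemx g) *m dwedgemx B *m invmx (a *: wedgemx g) -
  (a *: (wedgemx (D + g) - wedgemx D - wedgemx g)) *m invmx (a *: wedgemx g) =
  dwedgemx (g *m B *m invmx g - D *m invmx g).
Proof.
move=> ug a0; have [uw iw] := wedgemxV ug.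
have inv : invmx (a *: wedgemx g) = a^-1 *: invmx (wedgemx g).
  by rewrite invmxZ// unitmxZ// unitfE.
have cancel (X Y : 'M[K]_6) : (a *: X) *m (a^-1 *: Y) = X *m Y.
  by rewrite -scalemxAl -scalemxAr scalerA mulfV// scale1r.
rewrite (wedgemx_polar _ ug) inv -scalemxAl !cancel dwedgemx_conj// -(mulmxA (dwedgemx _)) mulmxV// mulmx1.
by rewrite dwedgemxD dwedgemxN.
Qed.

End WedgePolar.

Section LinearCalculus.
Variables (R : realType) (Sg : riemannSurface R).
Local Notation C := R[i].
Implicit Types (U V : set Sg) (c : chart Sg).

Lemma smc_sum (I : Type) (r : seq I) m n c U (F : I -> Sg -> 'M[C]_(m, n)) : open U ->
  (forall k, smc c U (F k)) -> smc c U (fun x => \sum_(k <- r) F k x).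
Proof.
move=> oU sF; elim: r => [|k r IH].
  by apply: (smc_ext oU _ (smc_cst c U 0)) => q _ _; rewrite big_nil.
by apply: (smc_ext oU _ (smcD oU (sF k) IH)) => q _ _; rewrite big_cons.
Qed.

Section AtPoint.
Variables (c : chart Sg) (U : set Sg) (p : Sg).
Hypotheses (oU : open U) (Up : U p) (cp : cdom c p).

Lemma wirt_sum (I : Type) (r : seq I) m n ab (F : I -> Sg -> 'M[C]_(m, n)) :
  (forall k, smc c U (F k)) ->
  wirt ab c (fun x => \sum_(k <- r) F k x) p = \sum_(k <- r) wirt ab c (F k) p.
Proof.
move=> sF; elim: r => [|k r IH].
  rewrite big_nil (@wirt_ext _ _ c U p oU Up cp _ _ ab _ (fun=> 0)) ?wirt_cst// => q _.
  by rewrite big_nil.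
rewrite big_cons -IH -(wirtD oU Up cp ab (sF k) (smc_sum r oU sF)).
by apply: (wirt_ext oU Up cp) => q _; rewrite big_cons.
Qed.

Lemma wirtMc m n k ab (M : 'M[C]_(m, n)) (g : Sg -> 'M[C]_(n, k)) : smc c U g ->
  wirt ab c (fun x => M *m g x) p = M *m wirt ab c g p.
Proof.
by move=> sg; rewrite (wirtM oU Up cp ab (smc_cst c U M) sg) wirt_cst mul0mx add0r.
Qed.

Lemma wirtcM m n k ab (g : Sg -> 'M[C]_(m, n)) (M : 'M[C]_(n, k)) : smc c U g ->
  wirt ab c (fun x => g x *m M) p = wirt ab c g p *m M.
Proof.
by move=> sg; rewrite (wirtM oU Up cp ab sg (smc_cst c U M)) wirt_cst mulmx0 addr0.
Qed.

End AtPoint.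

Section LinearImage.
Variables (m n r s : nat) (f : 'M[C]_(m, n) -> 'M[C]_(r, s)).
Hypothesis lin_f : forall a X Y, f (a *: X + Y) = a *: f X + f Y.

(** A linear map is a sum of left and right multiplications by constants, so smoothness,
    differentiation and polynomial dependence pass through it by the product rules alone. *)
Lemma lin_expand X : f X = \sum_i \sum_j \sum_k \sum_l
  f (delta_mx i j) k l *: (delta_mx k i *m X *m delta_mx j l).
Proof.
have f0 : f 0 = 0 by have := lin_f (-1) 0 0; rewrite scaler0 addr0 scaleN1r addNr.
have fsum (I : Type) (t : seq I) (G : I -> 'M[C]_(m, n)) :
    f (\sum_(i <- t) G i) = \sum_(i <- t) f (G i).
  elim: t => [|i t IH]; first by rewrite !big_nil.
  by rewrite !big_cons -[G i]scale1r lin_f !scale1r IH.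
rewrite {1}(matrix_sum_delta X) fsum; apply: eq_bigr => i _.
rewrite fsum; apply: eq_bigr => j _.
rewrite -[X i j *: _]addr0 lin_f f0 addr0 {1}(matrix_sum_delta (f _)) scaler_sumr.
apply: eq_bigr => k _; rewrite scaler_sumr; apply: eq_bigr => l _.
have -> : delta_mx k i *m X *m delta_mx j l = X i j *: delta_mx k l.
  apply/matrixP => a b; rewrite !mxE (bigD1 j)//= big1 ?addr0 => [|x xj]; last first.
    by rewrite !mxE (negbTE xj) mulr0.
  rewrite !mxE (bigD1 i)//= big1 ?addr0 => [|x xi]; last first.
    by rewrite !mxE (negbTE xi) andbF mul0r.
  by rewrite !mxE !eqxx andbT /= -mulnb natrM; ring.
by rewrite !scalerA mulrC.
Qed.

Lemma smc_lin c U (X : Sg -> 'M[C]_(m, n)) : open U -> smc c U X -> smc c U (fun x => f (X x)).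
Proof.
move=> oU sX; apply: (smc_ext oU (fun q _ _ => esym (lin_expand (X q)))).
do !(apply: smc_sum => // ?); apply: smcZ => //; apply: smcM => //; last exact: smc_cst.
by apply: smcM => //; exact: smc_cst.
Qed.

Lemma wirt_lin c U p ab (X : Sg -> 'M[C]_(m, n)) : open U -> U p -> cdom c p -> smc c U X ->
  wirt ab c (fun x => f (X x)) p = f (wirt ab c X p).
Proof.
move=> oU Up cp sX; rewrite (lin_expand (wirt _ _ _ _)).
rewrite (@wirt_ext _ _ c U p oU Up cp _ _ ab _ _ (fun q _ => lin_expand (X q))).
have sT i j k l : smc c U (fun x => delta_mx k i *m X x *m (delta_mx j l : 'M[C]_(n, s)) : 'M[C]_(r, s)).
  by apply: smcM => //; [apply: smcM => //|]; exact: smc_cst.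
have sX' i j k l : smc c U (fun x => f (delta_mx i j) k l *: (delta_mx k i *m X x *m delta_mx j l)).
  exact: (smcZ _ oU (sT i j k l)).
have s1 i j k := smc_sum (index_enum _) oU (sX' i j k).
have s2 i j := smc_sum (index_enum _) oU (s1 i j).
have s3 i := smc_sum (index_enum _) oU (s2 i).
rewrite (wirt_sum oU Up cp _ ab s3); apply: eq_bigr => i _.
rewrite (wirt_sum oU Up cp _ ab (s2 i)); apply: eq_bigr => j _.
rewrite (wirt_sum oU Up cp _ ab (s1 i j)); apply: eq_bigr => k _.
rewrite (wirt_sum oU Up cp _ ab (sX' i j k)); apply: eq_bigr => l _.
rewrite (wirtZ oU Up cp ab _ (sT i j k l)); congr (_ *: _).
have sM := smcM oU (smc_cst c U (delta_mx k i : 'M[C]_(r, m))) sX.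
by rewrite (wirtcM oU Up cp ab _ sM) (wirtMc oU Up cp ab _ sX).
Qed.

End LinearImage.

Lemma smc_wedgemx c U (g : Sg -> 'M[C]_4) : open U -> smc c U g -> smc c U (fun x => wedgemx (g x)).
Proof.
move=> oU sg e f; have oI := cimg_open (c := c) oU.
have -> : in_chart c (fun x => wedgemx (g x) e f) = fun a =>
    in_chart c (fun x => g x (pa e) (pa f)) a * in_chart c (fun x => g x (pb e) (pb f)) a
    + (-1) * (in_chart c (fun x => g x (pb e) (pa f)) a * in_chart c (fun x => g x (pa e) (pb f)) a).
  by apply/funext => a; rewrite /in_chart wedgemxE.
apply: csmD => //; first exact: csmM.
by apply: csmM => //; [exact: csm_cst|exact: csmM].
Qed.

Lemma wirt_wedgemx c U p ab (g : Sg -> 'M[C]_4) : open U -> U p -> cdom c p -> smc c U g ->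
  wirt ab c (fun x => wedgemx (g x)) p =
  wedgemx (wirt ab c g p + g p) - wedgemx (wirt ab c g p) - wedgemx (g p).
Proof.
move=> oU Up cp sg; apply/matrixP => e f; have oI := cimg_open (c := c) oU; have Ip := cimg_mem Up cp.
have E v : mpd v c (fun x => wedgemx (g x)) p e f =
    mpd v c g p (pa e) (pa f) * g p (pb e) (pb f) + g p (pa e) (pa f) * mpd v c g p (pb e) (pb f)
    + (-1) * (mpd v c g p (pb e) (pa f) * g p (pa e) (pb f) + g p (pb e) (pa f) * mpd v c g p (pa e) (pb f)).
  rewrite !mpdE /pderiv -!/(pd _ _ _).
  have -> : in_chart c (fun x => wedgemx (g x) e f) = fun a =>
      in_chart c (fun x => g x (pa e) (pa f)) a * in_chart c (fun x => g x (pb e) (pb f)) a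
      + (-1) * (in_chart c (fun x => g x (pb e) (pa f)) a * in_chart c (fun x => g x (pa e) (pb f)) a).
    by apply/funext => a; rewrite /in_chart wedgemxE.
  have m1 := csmM oI (sg (pa e) (pa f)) (sg (pb e) (pb f)).
  have m2 := csmM oI (sg (pb e) (pa f)) (sg (pa e) (pb f)).
  have m3 := csmM oI (csm_cst (cimg c U) (-1)) m2.
  rewrite (pdD v m1 m3 Ip) (pdM v (sg _ _) (sg _ _) Ip).
  rewrite (pdM v (csm_cst _ _) m2 Ip) (pdM v (sg _ _) (sg _ _) Ip) pd_cst mul0r add0r.
  by rewrite !in_chartE.
have W m n (h : Sg -> 'M[C]_(m, n)) i j :
    wirt ab c h p i j = ab.1 * mpd (1, 0) c h p i j + ab.2 * mpd (0, 1) c h p i j.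
  by rewrite /wirt; move: (mpd _ _ _ _) (mpd _ _ _ _) => A B; rewrite !mxE.
apply: etrans (W _ _ (fun x => wedgemx (g x)) e f) _.
apply: etrans (congr2 (fun x y => ab.1 * x + ab.2 * y) (E (1, 0)) (E (0, 1))) _.
exact: (wedgemx_polar_entry (g p) e f (W _ _ g)).
Qed.

Definition up (A : form1 Sg 4) : form1 Sg 6 :=
  fun c p => (dwedgemx (A c p).1, dwedgemx (A c p).2).

(** The constant factor [a] has no derivative and cancels against its inverse; the rest is
    polarisation of the exterior square. *)
Lemma gauge_up c U p (a : C) (g : Sg -> 'M[C]_4) (A : form1 Sg 4) : open U -> U p -> cdom c p ->
  smc c U g -> (forall x, U x -> g x \in unitmx) -> a != 0 ->
  gauge (fun x => a *: wedgemx (g x)) (up A) c p = up (gauge g A) c p.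
Proof.
move=> oU Up cp sg ug a0; have [uw iw] := wedgemxV (ug _ Up).
have sw := smc_wedgemx oU sg.
rewrite gauge_parts /up gauge_parts /= !(wirtZ oU Up cp _ _ sw) !(wirt_wedgemx _ oU Up cp sg).
congr pair; exact: (gauge_up_algebra _ _ (ug _ Up) a0).
Qed.

End LinearCalculus.

Section FormClosure.
Variables (R : realType) (Sg : riemannSurface R).
Local Notation C := R[i].
Implicit Types (U V : set Sg) (c : chart Sg).

Lemma smooth_onM m n k U (f : Sg -> 'M[C]_(m, n)) (g : Sg -> 'M[C]_(n, k)) : open U ->
  smooth_on U f -> smooth_on U g -> smooth_on U (fun x => f x *m g x).
Proof. by move=> oU /smooth_onP sf /smooth_onP sg; apply/smooth_onP => c; exact: smcM. Qed.

Lemma smooth_onD m n U (f g : Sg -> 'M[C]_(m, n)) : open U ->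
  smooth_on U f -> smooth_on U g -> smooth_on U (fun x => f x + g x).
Proof. by move=> oU /smooth_onP sf /smooth_onP sg; apply/smooth_onP => c; exact: smcD. Qed.

Lemma smooth_onB m n U (f g : Sg -> 'M[C]_(m, n)) : open U ->
  smooth_on U f -> smooth_on U g -> smooth_on U (fun x => f x - g x).
Proof. by move=> oU /smooth_onP sf /smooth_onP sg; apply/smooth_onP => c; exact: smcB. Qed.

Lemma smooth_onZ m n U a (f : Sg -> 'M[C]_(m, n)) : open U ->
  smooth_on U f -> smooth_on U (fun x => a *: f x).
Proof. by move=> oU /smooth_onP sf; apply/smooth_onP => c; exact: smcZ. Qed.

Lemma smooth_onV n U (f : Sg -> 'M[C]_n) : open U -> (forall x, U x -> f x \in unitmx) ->
  smooth_on U f -> smooth_on U (fun x => invmx (f x)).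
Proof. by move=> oU uf /smooth_onP sf; apply/smooth_onP => c; exact: smcV. Qed.

Lemma smooth_on_cst m n U (M : 'M[C]_(m, n)) : smooth_on U (fun=> M).
Proof. by apply/smooth_onP => c; exact: smc_cst. Qed.

Lemma smooth_on_ext m n U (f g : Sg -> 'M[C]_(m, n)) : open U ->
  (forall x, U x -> f x = g x) -> smooth_on U f -> smooth_on U g.
Proof.
move=> oU fg /smooth_onP sf; apply/smooth_onP => c.
by apply: (smc_ext oU _ (sf c)) => q Uq _; exact: fg.
Qed.

Lemma smooth_on_lin m n r s U (f : 'M[C]_(m, n) -> 'M[C]_(r, s)) (X : Sg -> 'M[C]_(m, n)) :
  (forall a X Y, f (a *: X + Y) = a *: f X + f Y) -> open U ->
  smooth_on U X -> smooth_on U (fun x => f (X x)).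
Proof. by move=> lf oU /smooth_onP sf; apply/smooth_onP => c; exact: (smc_lin lf oU). Qed.

Lemma smooth_on_conj m n U (f : Sg -> 'M[C]_(m, n)) : open U ->
  smooth_on U f -> smooth_on U (fun x => map_mx (@conjc R) (f x)).
Proof. by move=> oU /smooth_onP sf; apply/smooth_onP => c; exact: smc_conj. Qed.

Lemma smooth_on_wedgemx U (f : Sg -> 'M[C]_4) : open U ->
  smooth_on U f -> smooth_on U (fun x => wedgemx (f x)).
Proof. by move=> oU /smooth_onP sf; apply/smooth_onP => c; exact: smc_wedgemx. Qed.

Lemma chart_open U c : open U -> open (U `&` cdom c).
Proof. by move=> oU; apply: openI => //; exact: cdom_open. Qed.

Section Closure.
Variable U : set Sg.
Hypothesis oU : open U.

Lemma is_form_ext n (w w' : form1 Sg n) : form_eq U w w' -> is_form U w -> is_form U w'.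
Proof.
move=> ww' [sw cw]; split=> [c|c c' p Up cp cp']; last by rewrite -!ww'//; exact: cw.
have [s1 s2] := sw c; split.
  by apply: (smooth_on_ext (chart_open c oU) _ s1) => x [Ux cx]; rewrite ww'.
by apply: (smooth_on_ext (chart_open c oU) _ s2) => x [Ux cx]; rewrite ww'.
Qed.

Lemma is_form_lin m n (f : 'M[C]_m -> 'M[C]_n) (w : form1 Sg m) :
  (forall a X Y, f (a *: X + Y) = a *: f X + f Y) ->
  is_form U w -> is_form U (fun c p => (f (w c p).1, f (w c p).2)).
Proof.
move=> lf [sw cw]; have f0 : f 0 = 0 by have := lf (-1) 0 0; rewrite scaler0 addr0 scaleN1r addNr.
have fZ a X : f (a *: X) = a *: f X by rewrite -[a *: X]addr0 lf f0 addr0.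
split=> [c|c c' p Up cp cp' /=].
  by have [s1 s2] := sw c; split; apply: (smooth_on_lin lf (chart_open c oU)).
by have [/= e1 e2] := cw _ _ _ Up cp cp'; rewrite {1}e1 {1}e2 !fZ.
Qed.

Lemma is_formD n (w v : form1 Sg n) : is_form U w -> is_form U v ->
  is_form U (fun c p => ((w c p).1 + (v c p).1, (w c p).2 + (v c p).2)).
Proof.
move=> [sw cw] [sv cv]; split=> [c|c c' p Up cp cp' /=].
  have [s1 s2] := sw c; have [t1 t2] := sv c.
  by split; apply: (smooth_onD (chart_open c oU)).
have [/= e1 e2] := cw _ _ _ Up cp cp'; have [/= e3 e4] := cv _ _ _ Up cp cp'.
by rewrite {1}e1 {1}e2 {1}e3 {1}e4 !scalerDr.
Qed.

Lemma is_form_sandwich n (g h : Sg -> 'M[C]_n) (w : form1 Sg n) :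
  smooth_on U g -> smooth_on U h -> is_form U w ->
  is_form U (fun c p => (g p *m (w c p).1 *m h p, g p *m (w c p).2 *m h p)).
Proof.
move=> sg sh [sw cw]; split=> [c|c c' p Up cp cp' /=].
  have oc := chart_open c oU; have [s1 s2] := sw c.
  have sub : U `&` cdom c `<=` U by move=> x [].
  by split; apply: (smooth_onM oc); try apply: (smooth_onM oc) => //; exact: (smooth_on_sub sub).
have [/= e1 e2] := cw _ _ _ Up cp cp'.
by rewrite {1}e1 {1}e2 -!scalemxAr -!scalemxAl.
Qed.

Lemma is_form_zero n : is_form U (@zero_form _ Sg n).
Proof.
split=> [c|c c' p _ _ _]; last by rewrite /= !scaler0.
by split; exact: smooth_on_cst.
Qed.

Lemma is_formZ n a (w : form1 Sg n) : is_form U w ->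
  is_form U (fun c p => (a *: (w c p).1, a *: (w c p).2)).
Proof.
by apply: (@is_form_lin n n (fun X => a *: X)) => b X Y; rewrite scalerDr !scalerA mulrC.
Qed.

Lemma is_form_sum n (I : finType) (w : I -> form1 Sg n) : (forall t, is_form U (w t)) ->
  is_form U (fun c p => (\sum_t (w t c p).1, \sum_t (w t c p).2)).
Proof.
move=> fw; elim: (index_enum I) => [|t r IH].
  by apply: is_form_ext (is_form_zero n) => c p _ _; rewrite !big_nil.
by apply: is_form_ext (is_formD (fw t) IH) => c p _ _; rewrite !big_cons.
Qed.

(** That this satisfies [is_form] is the transition rule for dg between charts. It is treated as a
    property of g: obtained by algebra for the basic projections and stable under the operations
    that follow. *)
Definition dform n (g : Sg -> 'M[C]_n) : form1 Sg n := fun c p => (dz c g p, dzb c g p).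

Lemma dform_ext n (g h : Sg -> 'M[C]_n) : (forall x, U x -> g x = h x) ->
  is_form U (dform g) -> is_form U (dform h).
Proof.
move=> gh; apply: is_form_ext => c p Up cp; rewrite /dform !dzE !dzbE.
by rewrite (wirt_ext oU Up cp wz gh) (wirt_ext oU Up cp wzb gh).
Qed.

Lemma dform_cst n (M : 'M[C]_n) : is_form U (dform (fun=> M)).
Proof.
apply: is_form_ext (is_form_zero n) => c p Up cp.
by rewrite /dform dzE dzbE !(wirt_cst c p).
Qed.

Lemma dformD n (g h : Sg -> 'M[C]_n) : smooth_on U g -> smooth_on U h ->
  is_form U (dform g) -> is_form U (dform h) -> is_form U (dform (fun x => g x + h x)).
Proof.
move=> /smooth_onP sg /smooth_onP sh dg dh; apply: is_form_ext (is_formD dg dh) => c p Up cp.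
by rewrite /dform !dzE !dzbE !(wirtD oU Up cp _ (sg c) (sh c)).
Qed.

Lemma dformZ n a (g : Sg -> 'M[C]_n) : smooth_on U g ->
  is_form U (dform g) -> is_form U (dform (fun x => a *: g x)).
Proof.
move=> /smooth_onP sg dg; apply: is_form_ext (is_formZ a dg) => c p Up cp.
by rewrite /dform !dzE !dzbE !(wirtZ oU Up cp _ _ (sg c)).
Qed.

Lemma dformM n (g h : Sg -> 'M[C]_n) : smooth_on U g -> smooth_on U h ->
  is_form U (dform g) -> is_form U (dform h) -> is_form U (dform (fun x => g x *m h x)).
Proof.
move=> sg sh dg dh; have s1 := smooth_on_cst U (1%:M : 'M[C]_n).
apply: is_form_ext (is_formD (is_form_sandwich s1 sh dg) (is_form_sandwich sg s1 dh)) => c p Up cp.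
move/smooth_onP: sg => sg; move/smooth_onP: sh => sh.
have e ab : 1%:M *m wirt ab c g p *m h p + g p *m wirt ab c h p *m 1%:M = wirt ab c (fun x => g x *m h x) p.
  by rewrite (wirtM oU Up cp ab (sg c) (sh c)) mul1mx mulmx1.
by rewrite /dform !dzE !dzbE; exact: (congr2 pair (e wz) (e wzb)).
Qed.

Lemma dformV n (g : Sg -> 'M[C]_n) : smooth_on U g -> (forall x, U x -> g x \in unitmx) ->
  is_form U (dform g) -> is_form U (dform (fun x => invmx (g x))).
Proof.
move=> sg ug dg; have sV := smooth_onV oU ug sg.
apply: is_form_ext (is_formZ (-1) (is_form_sandwich sV sV dg)) => c p Up cp.
move/smooth_onP: sg => sg.
have e ab : -1 *: (invmx (g p) *m wirt ab c g p *m invmx (g p)) = wirt ab c (fun x => invmx (g x)) p.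
  by rewrite (wirtV oU Up cp ab ug (sg c)) scaleN1r.
by rewrite /dform !dzE !dzbE; exact: (congr2 pair (e wz) (e wzb)).
Qed.

Lemma is_form_gauge n (g : Sg -> 'M[C]_n) (w : form1 Sg n) : smooth_on U g ->
  (forall x, U x -> g x \in unitmx) -> is_form U (dform g) -> is_form U w -> is_form U (gauge g w).
Proof.
move=> sg ug dg fw; have sV := smooth_onV oU ug sg; have s1 := smooth_on_cst U (1%:M : 'M[C]_n).
apply: is_form_ext (is_formD (is_form_sandwich sg sV fw) (is_formZ (-1) (is_form_sandwich s1 sV dg))) => c p Up cp.
have e (A B : 'M[C]_n) : A + -1 *: (1%:M *m B *m invmx (g p)) = A - B *m invmx (g p).
  by rewrite scaleN1r mul1mx.
exact: (congr2 pair (e _ _) (e _ _)).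
Qed.

End Closure.
End FormClosure.

Section MetricForms.
Variables (R : realType) (Q : quaternionic R) (Sg : riemannSurface R).
Local Notation C := R[i].
Local Notation G := (gram Q).
Local Notation J := (jmx Q).
Local Notation conjmx := (map_mx (@conjc R)).
Implicit Types (U : set Sg) (c : chart Sg).

Lemma orth6P (h : 'M[C]_6) : orth6 Q h <-> h^T *m G *m h = G.
Proof.
split=> [H|H u v].
  have E (M : 'M[C]_6) i j : (delta_mx (0 : 'I_1) i *m M *m delta_mx j (0 : 'I_1)) 0 0 = M i j.
    by rewrite -rowE -colE !mxE.
  apply/matrixP => i j; have := H (delta_mx i 0) (delta_mx j 0); rewrite /ip trmx_mul trmx_delta.
  by rewrite E -(E (_ *m _ *m h)) !mulmxA.
by rewrite /ip trmx_mul -[in RHS]H !mulmxA.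
Qed.

Lemma orth6_unit (h : 'M[C]_6) : orth6 Q h -> h \in unitmx.
Proof.
move/orth6P => e; have := gram_unit Q; rewrite -e unitmx_mul => /andP[_]; exact.
Qed.

Lemma skew6_conj (h A : 'M[C]_6) : orth6 Q h -> skew6 Q A -> skew6 Q (h *m A *m invmx h).
Proof.
move=> oh sA u v; have uh := orth6_unit oh.
have e (w : 'cV[C]_6) : w = h *m (invmx h *m w) by rewrite mulmxA mulmxV// mul1mx.
rewrite [in X in X + _](e v) [in X in _ + X](e u) -!mulmxA !oh; exact: sA.
Qed.

Lemma skew6B (A B : 'M[C]_6) : skew6 Q A -> skew6 Q B -> skew6 Q (A - B).
Proof.
move=> sA sB u v; rewrite !mulmxBl ipDl ipDr ipNl ipNr addrACA sA add0r -opprD sB oppr0 //.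
Qed.

(** Differentiating h^T G h = G shows that dh h^-1 is skew. *)
Lemma metric_gauge U (h : Sg -> 'M[C]_6) (w : form1 Sg 6) : open U -> smooth_on U h ->
  (forall x, U x -> orth6 Q (h x)) -> metric Q U w -> metric Q U (gauge h w).
Proof.
move=> oU /smooth_onP sh oh mw c p Up cp; have [m1 m2] := mw c p Up cp.
have lt : forall a (X Y : 'M[C]_6), (a *: X + Y)^T = a *: X^T + Y^T.
  by move=> a X Y; rewrite linearP.
have st := smc_lin lt oU (sh c); have sG := smcM oU st (smc_cst c U G).
have D ab : (wirt ab c h p)^T *m G *m h p + (h p)^T *m G *m wirt ab c h p = 0.
  have := wirt_cst c p ab G.
  rewrite -(wirt_ext oU Up cp ab (f := fun x => (h x)^T *m G *m h x)) => [|q Uq]; last first.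
    by apply/orth6P; exact: oh.
  by rewrite (wirtM oU Up cp ab sG (sh c)) (wirtcM oU Up cp ab G st) (wirt_lin lt ab oU Up cp (sh c)).
have S ab : skew6 Q (wirt ab c h p *m invmx (h p)).
  move=> u v; have uh := orth6_unit (oh p Up).
  have e (z : 'cV[C]_6) : z = h p *m (invmx (h p) *m z) by rewrite mulmxA mulmxV// mul1mx.
  rewrite [in X in X + _](e v) [in X in _ + X](e u) -!mulmxA.
  move: (invmx (h p) *m u) (invmx (h p) *m v) => u' v'.
  have F (A B : 'M[C]_1) : A + B = 0 -> A 0 0 + B 0 0 = 0 by move=> /matrixP/(_ 0 0); rewrite !mxE.
  move: (wirt ab c h p) (h p) (D ab) => w' g Dw.
  have := congr1 (fun M => u'^T *m M *m v') Dw.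
  by rewrite mulmx0 mul0mx mulmxDr mulmxDl => /F; rewrite /ip !trmx_mul !mulmxA.
rewrite gauge_parts /=; split; (apply: skew6B; [apply: skew6_conj; [exact: oh|by []]|exact: S]).
Qed.

Lemma metric_up (w : form1 Sg 6) U : metric Q U w -> forall c p, U p -> cdom c p ->
  [/\ w c p = up (form4 w) c p, \tr (form4 w c p).1 = 0 & \tr (form4 w c p).2 = 0].
Proof.
move=> mw c p Up cp; have [m1 m2] := mw c p Up cp.
have [e1 t1] := skew6_dwedgemx m1; have [e2 t2] := skew6_dwedgemx m2.
by split; [exact: (etrans (surjective_pairing _) (congr2 pair (esym e1) (esym e2)))|exact: t1|exact: t2].
Qed.

Lemma gram0_mul n (M : 'M[C]_(6, n)) e f : (gram0 R *m M) e f =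
  (if (e == 1 :> nat) || (e == 4 :> nat) then -1 else 1) * M (rev_ord e) f.
Proof.
rewrite mxE (bigD1 (rev_ord e))//= big1 => [|k ke].
  rewrite mxE /= addr0; congr (_ * _); case: ifP => // /eqP; have := ltn_ord e.
  by case: (nat_of_ord e) => [|[|[|[|[|[|]]]]]].
rewrite mxE; case: ifP; rewrite ?mul0r// => /eqP ek; case/eqP: ke; apply: val_inj => /=.
by rewrite subSS; move: ek; have := ltn_ord e; lia.
Qed.

Lemma skew6_dwedgemx_tr0 (X : 'M[C]_4) : \tr X = 0 -> skew6 Q (dwedgemx X).
Proof.
move=> tX; suff H : (dwedgemx X)^T *m G + G *m dwedgemx X = 0.
  move=> u v; have : (u^T *m ((dwedgemx X)^T *m G + G *m dwedgemx X) *m v) 0 0 = 0.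
    by rewrite H mulmx0 mul0mx mxE.
  by rewrite mulmxDr mulmxDl mxE /ip trmx_mul !mulmxA.
have -> : (dwedgemx X)^T *m G = (G *m dwedgemx X)^T by rewrite trmx_mul gram_tr.
rewrite gramE -scalemxAl.
move: tX; rewrite /mxtrace sum4 => tX; apply/matrixP => e f; rewrite [LHS]mxE [X in X + _]mxE [in LHS]mxE [X in _ + X]mxE.
rewrite [RHS]mxE -mulrDr !gram0_mul !dwedgemxE.
have r0 : rev_ord (@Ordinal 6 0 isT) = @Ordinal 6 5 isT by apply: val_inj.
have r1 : rev_ord (@Ordinal 6 1 isT) = @Ordinal 6 4 isT by apply: val_inj.
have r2 : rev_ord (@Ordinal 6 2 isT) = @Ordinal 6 3 isT by apply: val_inj.
have r3 : rev_ord (@Ordinal 6 3 isT) = @Ordinal 6 2 isT by apply: val_inj.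
have r4 : rev_ord (@Ordinal 6 4 isT) = @Ordinal 6 1 isT by apply: val_inj.
have r5 : rev_ord (@Ordinal 6 5 isT) = @Ordinal 6 0 isT by apply: val_inj.
(* The trace condition eliminates one diagonal entry, after which every matrix entry cancels
   formally. *)
have x00 : X (@Ordinal 4 0 isT) (@Ordinal 4 0 isT) = - (X (@Ordinal 4 1 isT) (@Ordinal 4 1 isT) + X (@Ordinal 4 2 isT) (@Ordinal 4 2 isT) + X (@Ordinal 4 3 isT) (@Ordinal 4 3 isT)).
  by apply/eqP; rewrite -addr_eq0 !addrA; apply/eqP.
apply/eqP; rewrite mulf_eq0; apply/orP; right; apply/eqP.
move: e f; apply: ord6_ind; apply: ord6_ind; rewrite ?(r0, r1, r2, r3, r4, r5);
rewrite -?[pa (@Ordinal 6 0 isT)]/(@Ordinal 4 0 isT) -?[pa (@Ordinal 6 1 isT)]/(@Ordinal 4 0 isT) -?[pa (@Ordinal 6 2 isT)]/(@Ordinal 4 0 isT) -?[pa (@Ordinal 6 3 isT)]/(@Ordinal 4 1 isT) -?[pa (@Ordinal 6 4 isT)]/(@Ordinal 4 1 isT) -?[pa (@Ordinal 6 5 isT)]/(@Ordinal 4 2 isT);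
rewrite -?[pb (@Ordinal 6 0 isT)]/(@Ordinal 4 1 isT) -?[pb (@Ordinal 6 1 isT)]/(@Ordinal 4 2 isT) -?[pb (@Ordinal 6 2 isT)]/(@Ordinal 4 3 isT) -?[pb (@Ordinal 6 3 isT)]/(@Ordinal 4 2 isT) -?[pb (@Ordinal 6 4 isT)]/(@Ordinal 4 3 isT) -?[pb (@Ordinal 6 5 isT)]/(@Ordinal 4 3 isT);
rewrite /= ?(mul0r, mulr0, mul1r, mulr1, subr0, sub0r, addr0, add0r, oppr0, mulr1n, mulr0n) ?x00; by ring.
Qed.

Lemma bar6M (A B : 'M[C]_6) : bar6 Q (A *m B) = bar6 Q A *m bar6 Q B.
Proof.
rewrite /bar6 map_mxM !mulmxA -[_ *m invmx _ *m wedgemx J]mulmxA mulVmx ?mulmx1//.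
exact: wedgemx_jmx_unit.
Qed.

Lemma bar6B (A B : 'M[C]_6) : bar6 Q (A - B) = bar6 Q A - bar6 Q B.
Proof. by rewrite /bar6 map_mxB mulmxBr mulmxBl. Qed.

Lemma bar61 : bar6 Q 1%:M = 1%:M.
Proof. by rewrite /bar6 map_mx1 mulmx1 mulmxV// wedgemx_jmx_unit. Qed.

Lemma bar6V (A : 'M[C]_6) : A \in unitmx -> bar6 Q A \in unitmx /\ invmx (bar6 Q A) = bar6 Q (invmx A).
Proof.
move=> uA; have e : bar6 Q A *m bar6 Q (invmx A) = 1%:M by rewrite -bar6M mulmxV// bar61.
have [u _] := mulmx1_unit e; split=> //.
by rewrite -[LHS]mulmx1 -e mulmxA mulVmx// mul1mx.
Qed.

Lemma wirt_bar6 U c p (h : Sg -> 'M[C]_6) : open U -> U p -> cdom c p -> smc c U h ->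
  wirt wz c (fun x => bar6 Q (h x)) p = bar6 Q (wirt wzb c h p) /\
  wirt wzb c (fun x => bar6 Q (h x)) p = bar6 Q (wirt wz c h p).
Proof.
move=> oU Up cp sh; have sc := smc_conj oU sh; have sK := smcM oU (smc_cst c U (wedgemx J)) sc.
have E ab : wirt ab c (fun x => bar6 Q (h x)) p =
    wedgemx J *m wirt ab c (fun x => conjmx (h x)) p *m invmx (wedgemx J).
  by rewrite (wirtcM oU Up cp ab _ sK) (wirtMc oU Up cp ab _ sc).
by rewrite !E -!dzE -!dzbE (dz_conj oU Up cp sh) (dzb_conj oU Up cp sh).
Qed.

(** Conjugation exchanges the two Wirtinger derivatives, which matches the exchange of components in
    [conj_form]. *)
Lemma conj_form_gauge U c p (h : Sg -> 'M[C]_6) (w : form1 Sg 6) : open U -> U p -> cdom c p ->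
  smc c U h -> h p \in unitmx ->
  gauge (fun x => bar6 Q (h x)) (conj_form Q w) c p = conj_form Q (gauge h w) c p.
Proof.
move=> oU Up cp sh uh; have [e1 e2] := wirt_bar6 oU Up cp sh; have [_ iv] := bar6V uh.
have e (B D D' : 'M[C]_6) : D' = bar6 Q D -> bar6 Q (h p) *m bar6 Q B *m invmx (bar6 Q (h p)) -
    D' *m invmx (bar6 Q (h p)) = bar6 Q (h p *m B *m invmx (h p) - D *m invmx (h p)).
  by move=> ->; rewrite iv bar6B !bar6M.
have d1 : dz c (fun x => bar6 Q (h x)) p = bar6 Q (dzb c h p) by rewrite dzE dzbE.
have d2 : dzb c (fun x => bar6 Q (h x)) p = bar6 Q (dz c h p) by rewrite dzE dzbE.
exact: (congr2 pair (e _ _ _ d1) (e _ _ _ d2)).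
Qed.

End MetricForms.

Section HolomorphicMatrices.
Variable R : realType.
Local Notation C := R[i].
Local Notation C1 := (R[i]^o).

Definition mhol m n (A : C -> 'M[C]_(m, n)) (z : C) :=
  forall i j, derivable ((fun w => A w i j) : C1 -> C1) z 1.

Lemma derivable_fext (f g : C1 -> C1) (z : C1) : f =1 g -> derivable f z 1 -> derivable g z 1.
Proof. by move=> /funext ->. Qed.

Lemma mhol_cst m n (M : 'M[C]_(m, n)) z : mhol (fun=> M) z.
Proof. by move=> i j; exact: (@cderiv_cst R (M i j) z). Qed.

Lemma mholD m n (A B : C -> 'M[C]_(m, n)) z : mhol A z -> mhol B z -> mhol (fun w => A w + B w) z.
Proof.
move=> hA hB i j; apply: (derivable_fext _ (@cderivD R _ _ z (hA i j) (hB i j))) => w.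
by rewrite mxE.
Qed.

Lemma derivable_sum (I : Type) (r : seq I) (f : I -> C -> C) (z : C) :
  (forall k, derivable (f k : C1 -> C1) z 1) ->
  derivable ((fun w => \sum_(k <- r) f k w) : C1 -> C1) z 1.
Proof.
move=> hf; elim: r => [|k r IH].
  by apply: (derivable_fext _ (@cderiv_cst R 0 z)) => w; rewrite big_nil.
by apply: (derivable_fext _ (@cderivD R _ _ z (hf k) IH)) => w; rewrite big_cons.
Qed.

Lemma mholM m n k (A : C -> 'M[C]_(m, n)) (B : C -> 'M[C]_(n, k)) z :
  mhol A z -> mhol B z -> mhol (fun w => A w *m B w) z.
Proof.
move=> hA hB i j.
apply: (@derivable_fext (fun w => \sum_l A w i l * B w l j)) => [w|]; first by rewrite mxE.
exact: (@derivable_sum _ _ (fun l w => A w i l * B w l j) z (fun l => @cderivM R _ _ z (hA i l) (hB l j))).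
Qed.

Lemma mholZ m n (f : C -> C) (A : C -> 'M[C]_(m, n)) z :
  derivable (f : C1 -> C1) z 1 -> mhol A z -> mhol (fun w => f w *: A w) z.
Proof.
by move=> hf hA i j; apply: (derivable_fext _ (@cderivM R _ _ z hf (hA i j))) => w; rewrite mxE.
Qed.

Lemma mhol_lcomb (I : finType) m n (phi : I -> C -> C) (M : I -> 'M[C]_(m, n)) z :
  (forall t, derivable (phi t : C1 -> C1) z 1) -> mhol (fun w => \sum_t phi t w *: M t) z.
Proof.
move=> hphi i j.
apply: (@derivable_fext (fun w => \sum_t phi t w * M t i j)) => [w|].
  by rewrite summxE; apply: eq_bigr => t _; rewrite mxE.
apply: (@derivable_sum _ _ (fun t w => phi t w * M t i j) z) => t.
exact: (@cderivM R _ _ z (hphi t) (@cderiv_cst R (M t i j) z)).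
Qed.

Lemma mholB m n (A B : C -> 'M[C]_(m, n)) z : mhol A z -> mhol B z -> mhol (fun w => A w - B w) z.
Proof.
move=> hA hB i j.
have h := @mholD m n A (fun w => -1 *: B w) z hA (@mholZ m n (fun=> -1) B z (@cderiv_cst R (-1) z) hB) i j.
by apply: (@derivable_fext (fun w => (A w + -1 *: B w) i j)) => // w; rewrite scaleN1r.
Qed.

Lemma mhol_eq_near m n (A B : C -> 'M[C]_(m, n)) (z : C1) : mhol A z -> mhol B z ->
  (\forall w \near z^', A w = B w) -> A z = B z.
Proof.
move=> hA hB AB; apply/matrixP => i j.
by apply: (hol_eq_near (hA i j) (hB i j)); apply: filterS AB => w ->.
Qed.

Lemma near_except (z : C1) (s : seq C) (Pr : C -> Prop) :
  (forall w, w \notin s -> Pr w) -> \forall w \near z^', Pr w.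
Proof.
move=> H; suff : \forall w \near z^', w \notin s by apply: filterS.
elim: s {H} => [|a s IH]; first by apply: nearW => w; rewrite in_nil.
by apply: filterS2 (near_neq z a) IH => w wa ws; rewrite inE negb_or wa.
Qed.

Definition mlaur N M m n (A : C -> 'M[C]_(m, n)) := forall i j, laurent N M (fun z => A z i j).

Lemma mlaurM N M N' M' m n k (A : C -> 'M[C]_(m, n)) (B : C -> 'M[C]_(n, k)) :
  mlaur N M A -> mlaur N' M' B -> mlaur (N + N') (M + M') (fun z => A z *m B z).
Proof.
move=> hA hB i j.
apply: (laurent_ext _ (laurent_sum (index_enum _) (fun l => laurentM (hA i l) (hB l j)))) => w _.
by rewrite mxE.
Qed.

Lemma mlaur_widen N M N' M' m n (A : C -> 'M[C]_(m, n)) : (M + N' <= M')%N ->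
  mlaur N M A -> mlaur (N + N') M' A.
Proof. by move=> h hA i j; exact: laurent_widen (hA i j) h. Qed.

Lemma mlaurD N M m n (A B : C -> 'M[C]_(m, n)) : mlaur N M A -> mlaur N M B ->
  mlaur N M (fun z => A z + B z).
Proof.
by move=> hA hB i j; apply: (laurent_ext _ (laurentD (hA i j) (hB i j))) => w _; rewrite mxE.
Qed.

Lemma mlaur_lin N M m n r s (f : 'M[C]_(m, n) -> 'M[C]_(r, s)) (A : C -> 'M[C]_(m, n)) :
  (forall a X Y, f (a *: X + Y) = a *: f X + f Y) -> mlaur N M A -> mlaur N M (fun z => f (A z)).
Proof.
move=> lf hA k l.
have f0 : f 0 = 0 by have := lf (-1) 0 0; rewrite scaler0 addr0 scaleN1r addNr.
have fsum (I : Type) (t : seq I) (H : I -> 'M[C]_(m, n)) : f (\sum_(i <- t) H i) = \sum_(i <- t) f (H i).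
  elim: t => [|i t IH]; first by rewrite !big_nil.
  by rewrite !big_cons -[H i]scale1r lf !scale1r IH.
have fZ a X : f (a *: X) = a *: f X by rewrite -[a *: X]addr0 lf f0 addr0.
apply: (laurent_ext _ (laurent_sum (index_enum _) (fun i => laurent_sum (index_enum _)
  (fun j => laurentZ (f (delta_mx i j) k l) (hA i j))))) => w _.
rewrite [in RHS](matrix_sum_delta (A w)) fsum summxE; apply: eq_bigr => i _.
rewrite fsum summxE; apply: eq_bigr => j _.
by rewrite fZ mxE mulrC.
Qed.

Lemma mlaur_cst m n (M : 'M[C]_(m, n)) : mlaur 0 1 (fun=> M).
Proof. by move=> i j; exact: laurent_cst. Qed.

Lemma mlaurZ N M N' M' m n (f : C -> C) (A : C -> 'M[C]_(m, n)) : laurent N M f ->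
  mlaur N' M' A -> mlaur (N + N') (M + M') (fun z => f z *: A z).
Proof.
by move=> hf hA i j; apply: (laurent_ext _ (laurentM hf (hA i j))) => w _; rewrite mxE.
Qed.

Lemma laurent_id : laurent 0 2 (fun z : C => z).
Proof. by exists 'X; rewrite ?size_polyX// => z _; rewrite expr0 mul1r hornerX. Qed.

Lemma laurent_idV : laurent 1 1 (fun z : C => z^-1).
Proof. by exists 1; rewrite ?size_poly1// => z z0; rewrite expr1 mulfV// hornerC. Qed.

(** Conjugating the coefficients and inverting the variable reverses the polynomial, so poles at 0
    and at infinity change places. The bounds are generous. *)
Lemma laurent_conjinv N M (phi : C -> C) : laurent N M phi ->
  laurent M (N.+1 + M.+1) (fun z => conjc (phi (cstar z))).
Proof.
move=> [q sq qE].
have hz : laurent 0 N.+1 (fun z : C => z ^+ N).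
  by exists 'X^N; rewrite ?size_polyXn// => z _; rewrite expr0 mul1r hornerXn.
have hq : laurent 0 M.+1 (fun z => (map_poly (@conjc R) q).[z]).
  exists (map_poly (@conjc R) q); first by rewrite size_map_poly (leq_trans sq).
  by move=> z _; rewrite expr0 mul1r.
have h := laurentM hz (laurent_inv hq (leqnn M)).
apply: laurent_ext h => z z0; have w0 : cstar z != 0 by rewrite invr_eq0 conjc_eq0.
have e : z^-1 = conjc (cstar z) by rewrite conjc_inv conjcK.
have zN : z ^+ N != 0 by rewrite expf_neq0.
rewrite e horner_map /= -qE// rmorphM rmorphXn /= -e.
by rewrite exprVn mulrA mulfV// mul1r.
Qed.

Lemma mlaur_interpolation N M m n (A : C -> 'M[C]_(m, n)) z : (0 < M)%N -> mlaur N M A -> z != 0 ->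
  A z = \sum_(a < M) ell N a z *: A (node R a).
Proof.
move=> M0 hA z0; apply/matrixP => i j; rewrite (laurent_interpolation M0 (hA i j) z0) summxE.
by apply: eq_bigr => a _; rewrite mxE.
Qed.

End HolomorphicMatrices.

Section LaurentForms.
Variables (R : realType) (Sg : riemannSurface R).
Local Notation C := R[i].
Local Notation C1 := (R[i]^o).
Implicit Types (U V : set Sg) (c : chart Sg).

(** All dependence on the spectral parameter sits in the scalars [phi], all dependence on the
    surface in the fixed forms [F]. *)
Definition lcomb n (I : finType) (phi : I -> C -> C) (F : I -> form1 Sg n) (z : C) : form1 Sg n :=
  fun c p => (\sum_t phi t z *: (F t c p).1, \sum_t phi t z *: (F t c p).2).

Lemma is_form_lcomb U n (I : finType) (phi : I -> C -> C) (F : I -> form1 Sg n) z : open U ->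
  (forall t, is_form U (F t)) -> is_form U (lcomb phi F z).
Proof.
move=> oU hF.
exact: (is_form_sum oU (w := fun t c p => (phi t z *: (F t c p).1, phi t z *: (F t c p).2)) (fun t => is_formZ oU (phi t z) (hF t))).
Qed.

Section AtPoint.
Variables (n : nat) (I : finType) (phi : I -> C -> C) (F : I -> form1 Sg n) (z : C).
Hypothesis hphi : forall t, derivable (phi t : C1 -> C1) z 1.

Lemma lcomb_hol c p : mhol (fun w => (lcomb phi F w c p).1) z /\ mhol (fun w => (lcomb phi F w c p).2) z.
Proof.
split; first exact: (@mhol_lcomb R I n n phi (fun t => (F t c p).1) z hphi).
exact: (@mhol_lcomb R I n n phi (fun t => (F t c p).2) z hphi).
Qed.

(** Differentiation on the surface meets only the fixed forms, so the curvature is a quadratic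
    expression in the holomorphic scalars. *)
Lemma curvature_lcomb_hol U c p : open U -> U p -> cdom c p ->
  (forall t, is_form U (F t)) -> mhol (fun w => curvature (lcomb phi F w) c p) z.
Proof.
move=> oU Up cp hF; have [h1 h2] := lcomb_hol c p.
have oc := chart_open c oU; have Vp : (U `&` cdom c) p by [].
have s1 t : smc c (U `&` cdom c) (fun x => (F t c x).1) by have [/(_ c)[/smooth_onP]] := hF t.
have s2 t : smc c (U `&` cdom c) (fun x => (F t c x).2) by have [/(_ c)[_ /smooth_onP]] := hF t.
have E w : curvature (lcomb phi F w) c p =
    \sum_t phi t w *: wirt wz c (fun x => (F t c x).2) p
    - \sum_t phi t w *: wirt wzb c (fun x => (F t c x).1) p
    + ((lcomb phi F w c p).1 *m (lcomb phi F w c p).2 - (lcomb phi F w c p).2 *m (lcomb phi F w c p).1).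
  rewrite /curvature dzE dzbE; congr (_ - _ + _).
    rewrite (wirt_sum oc Vp cp _ wz (fun t => smcZ (phi t w) oc (s2 t))).
    by apply: eq_bigr => t _; rewrite (wirtZ oc Vp cp wz _ (s2 t)).
  rewrite (wirt_sum oc Vp cp _ wzb (fun t => smcZ (phi t w) oc (s1 t))).
  by apply: eq_bigr => t _; rewrite (wirtZ oc Vp cp wzb _ (s1 t)).
have -> : (fun w => curvature (lcomb phi F w) c p) = _ := funext E.
apply: mholD; last by apply: mholB; apply: mholM; [exact: h1|exact: h2|exact: h2|exact: h1].
apply: mholB; first exact: (@mhol_lcomb R I n n phi (fun t => wirt wz c (fun x => (F t c x).2) p) z hphi).
exact: (@mhol_lcomb R I n n phi (fun t => wirt wzb c (fun x => (F t c x).1) p) z hphi).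
Qed.

End AtPoint.
End LaurentForms.

(** * Harmonic families *)

Section SplittingFields.
Variables (R : realType) (Q : quaternionic R) (Sg : riemannSurface R).
Local Notation C := R[i].
Implicit Types (c : chart Sg).

Definition splitting_field (U : set Sg) (pr : Sg -> 'M[C]_4) :=
  smooth_on U pr /\ forall p, U p -> exists E, splits Q (pr p) E (jimg Q E).

Definition gam (pr : Sg -> 'M[C]_4) (z : C) : Sg -> 'M[C]_6 := fun p => gam6 (pr p) z.

Lemma dwedgemx_linear a (X Y : 'M[C]_4) : dwedgemx (a *: X + Y) = a *: dwedgemx X + dwedgemx Y.
Proof. by rewrite dwedgemxD dwedgemxZ. Qed.

Lemma o2sl_linear a (X Y : 'M[C]_6) : o2sl (a *: X + Y) = a *: o2sl X + o2sl Y.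
Proof. by rewrite o2slD o2slZ. Qed.

Lemma dwedgemx0 : dwedgemx (0 : 'M[C]_4) = 0.
Proof. by rewrite -[0](scale0r 0) dwedgemxZ scale0r. Qed.

Lemma cstarK (z : C) : cstar (cstar z) = z.
Proof. by rewrite /cstar conjc_inv conjcK invrK. Qed.

Lemma cstar_neq0 (z : C) : z != 0 -> cstar z != 0.
Proof. by move=> z0; rewrite invr_eq0 conjc_eq0. Qed.

Section Field.
Variables (U : set Sg) (pr : Sg -> 'M[C]_4).
Hypotheses (oU : open U) (hp : splitting_field U pr).

Lemma gam_unit z p : z != 0 -> U p -> gam pr z p \in unitmx.
Proof. by move=> z0 /hp.2[E sE]; have [] := gam6_unit sE z0. Qed.

Lemma dilat_field_unit z p : z != 0 -> U p -> dilat z (pr p) \in unitmx.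
Proof. by move=> z0 /hp.2[E sE]; have [] := dilat_unit sE z0. Qed.

Lemma dilat_field_inv z p : z != 0 -> U p -> invmx (dilat z (pr p)) = dilat z^-1 (pr p).
Proof. by move=> z0 /hp.2[E sE]; have [] := dilat_unit sE z0. Qed.

Lemma gam_orth z p : z != 0 -> U p -> orth6 Q (gam pr z p).
Proof. by move=> z0 /hp.2[E sE]; exact: (gam6_orth sE). Qed.

Lemma gam_bar z p : z != 0 -> U p -> bar6 Q (gam pr z p) = gam pr (cstar z) p.
Proof. by move=> z0 /hp.2[E sE]; exact: (bar6_gam6 sE). Qed.

Lemma dilat_smooth z : smooth_on U (fun p => dilat z (pr p)).
Proof.
apply: (smooth_onD oU (smooth_onZ z oU hp.1)).
exact: (smooth_onB oU (@smooth_on_cst _ _ _ _ U 1%:M) hp.1).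
Qed.

Lemma gam_smooth z : smooth_on U (gam pr z).
Proof. exact: (smooth_onZ _ oU (smooth_on_wedgemx oU (dilat_smooth z))). Qed.

Lemma gam_smc c z : smc c U (gam pr z).
Proof. by have /smooth_onP := gam_smooth z; exact. Qed.

Lemma gauge_gam_comp z w (om : form1 Sg 6) c p : z != 0 -> w != 0 -> U p -> cdom c p ->
  gauge (gam pr z) (gauge (gam pr w) om) c p = gauge (gam pr (z * w)) om c p.
Proof.
move=> z0 w0 Up cp.
apply: etrans (gauge_comp oU Up cp om (gam_smc c z) (gam_smc c w) (gam_unit z0 Up) (gam_unit w0 Up)) _.
by apply: (gauge_at oU Up cp) => // x /hp.2[E sE]; rewrite /gam (gam6M sE).
Qed.

Lemma gauge_gam1 (om : form1 Sg 6) c p : U p -> cdom c p -> gauge (gam pr 1) om c p = om c p.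
Proof.
move=> Up cp; rewrite -[RHS](gauge1 c p om); apply: (gauge_at oU Up cp) => // x _.
by rewrite /gam gam61.
Qed.

Lemma gauge_gam_conj z (om : form1 Sg 6) c p : z != 0 -> U p -> cdom c p ->
  gauge (gam pr (cstar z)) (conj_form Q om) c p = conj_form Q (gauge (gam pr z) om) c p.
Proof.
move=> z0 Up cp; rewrite -(conj_form_gauge Q om oU Up cp (gam_smc c z) (gam_unit z0 Up)).
by apply: (gauge_at oU Up cp) => // x Ux; rewrite gam_bar.
Qed.

Lemma gauge_gam_up z (A : form1 Sg 4) c p : z != 0 -> U p -> cdom c p ->
  gauge (gam pr z) (up A) c p = up (gauge (fun x => dilat z (pr x)) A) c p.
Proof.
move=> z0 Up cp; have /smooth_onP sd := dilat_smooth z.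
by apply: (gauge_up A oU Up cp (sd c) (fun x => dilat_field_unit z0)); rewrite invr_neq0.
Qed.

(** By [wedgemx_polar] the differential of the exterior square is algebraic in g and dg, so the
    transition rule is inherited. *)
Lemma dform_wedgemx (g : Sg -> 'M[C]_4) : smooth_on U g -> (forall x, U x -> g x \in unitmx) ->
  is_form U (dform g) -> is_form U (dform (fun x => wedgemx (g x))).
Proof.
move=> sg ug dg; have sV := smooth_onV oU ug sg; have s1 := smooth_on_cst U (1%:M : 'M[C]_4).
have s6 := smooth_on_cst U (1%:M : 'M[C]_6); have sw := smooth_on_wedgemx oU sg.
have := is_form_sandwich oU s6 sw (is_form_lin oU dwedgemx_linear (is_form_sandwich oU s1 sV dg)).
apply: (is_form_ext oU) => c p Up cp; move/smooth_onP: sg => sg.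
have e ab : 1%:M *m dwedgemx (1%:M *m wirt ab c g p *m invmx (g p)) *m wedgemx (g p) =
    wirt ab c (fun x => wedgemx (g x)) p.
  by rewrite (wirt_wedgemx ab oU Up cp (sg c)) (wedgemx_polar _ (ug _ Up)) !mul1mx.
by rewrite /dform !dzE !dzbE; exact: (congr2 pair (e wz) (e wzb)).
Qed.

Hypothesis dp : is_form U (dform pr).

Lemma dform_dilat z : is_form U (dform (fun p => dilat z (pr p))).
Proof.
have s1 := smooth_on_cst U (1%:M : 'M[C]_4).
have := dformD oU (smooth_onZ (z - 1) oU hp.1) s1 (dformZ oU (z - 1) hp.1 dp) (dform_cst oU 1%:M).
by apply: (dform_ext oU) => x _; rewrite /dilat scalerBl scale1r addrAC -addrA.
Qed.

Lemma is_form_gauge_gam z (om : form1 Sg 6) : z != 0 -> is_form U om -> is_form U (gauge (gam pr z) om).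
Proof.
move=> z0; apply: (is_form_gauge oU (gam_smooth z) (fun x => gam_unit z0)).
apply: (dformZ oU); first exact: (smooth_on_wedgemx oU (dilat_smooth z)).
exact: (dform_wedgemx (dilat_smooth z) (fun x => dilat_field_unit z0) (dform_dilat z)).
Qed.

End Field.

Lemma flat_gauge_at (U : set Sg) n (g : Sg -> 'M[C]_n) (w : form1 Sg n) : open U -> smooth_on U g ->
  (forall x, U x -> g x \in unitmx) -> is_form U w -> flat U w -> flat U (gauge g w).
Proof.
move=> oU sg ug [fw _] flw c p Up cp; have oc := chart_open c oU.
have Vp : (U `&` cdom c) p by [].
have sub : U `&` cdom c `<=` U by move=> x [].
have /smooth_onP sg' := smooth_on_sub sub sg.
have [/smooth_onP s1 /smooth_onP s2] := fw c.
rewrite (curvature_gauge oc Vp cp (sg' c) (s1 c) (s2 c)) => [|x /sub]; last exact: ug.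
by rewrite flw// mulmx0 mul0mx.
Qed.

Lemma flat_ext (U : set Sg) n (v w : form1 Sg n) : open U -> form_eq U v w -> flat U v -> flat U w.
Proof.
move=> oU vw fv c p Up cp; rewrite -(fv c p Up cp).
by apply: (curvature_at oU Up cp) => x Ux cx; rewrite vw.
Qed.

Section SphereBundle.
Variables (U : set Sg) (S : Sg -> 'M[C]_4).
Hypotheses (oU : open U) (hS : sphere_bundle Q U S).
Local Notation pr := (fun p => prp (S p)).

Lemma sphere_splits p : U p -> splits Q (prp (S p)) (Sp (S p)) (Sm (S p)).
Proof. by case: hS => -[_ cS] _ SS Up; exact: (splits_sphere (cS _ Up) (SS _ Up)). Qed.

Lemma sphere_field : splitting_field U pr.
Proof.
case: hS => -[sS cS] _ SS; split=> [|p Up].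
  apply: (smooth_onZ _ oU); apply: (smooth_onB oU (@smooth_on_cst _ _ _ _ U 1%:M)).
  exact: (smooth_onZ _ oU sS).
exists (Sp (S p)); rewrite (jimg_Sp (cS _ Up)); exact: sphere_splits.
Qed.

Lemma tauE z p : z != 0 -> U p -> tau Q S z p = gam pr z p.
Proof. by move=> z0 Up; exact: (Gam_splits (sphere_splits Up)). Qed.

Lemma oreflE p : U p -> orefl Q (Vof (S p)) = gam pr (-1) p.
Proof. by move=> Up; exact: (orefl_splits (sphere_splits Up)). Qed.

Lemma gauge_tau z (om : form1 Sg 6) c p : z != 0 -> U p -> cdom c p ->
  gauge (tau Q S z) om c p = gauge (gam pr z) om c p.
Proof. by move=> z0 Up cp; apply: (gauge_at oU Up cp) => // x Ux; rewrite tauE. Qed.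

Lemma gauge_orefl (om : form1 Sg 6) c p : U p -> cdom c p ->
  gauge (fun x => orefl Q (Vof (S x))) om c p = gauge (gam pr (-1)) om c p.
Proof. by move=> Up cp; apply: (gauge_at oU Up cp) => // x Ux; rewrite oreflE. Qed.

(* The reflection of the trivial connection in V is d^{-1}, so that the derivative
   of S is an algebraic expression in the coefficients of d^{-1}. *)
Lemma dform_sphere (w1 : form1 Sg 6) : is_form U w1 ->
  form_eq U (gauge (fun p => orefl Q (Vof (S p))) (@zero_form _ Sg 6)) w1 -> is_form U (dform pr).
Proof.
move=> fw1 e1; have hp := sphere_field; have m1 : (-1 : C) != 0 by rewrite oppr_eq0 oner_eq0.
pose g p := dilat (-1) (prp (S p)); have sg : smooth_on U g := dilat_smooth oU hp (-1).
have ug p : U p -> g p \in unitmx by exact: (dilat_field_unit hp m1).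
have ig p : U p -> invmx (g p) = g p by move=> Up; rewrite /g (dilat_field_inv hp m1 Up) invrN1.
(* [g] is an involution. Gauging the trivial connection by it gives the coefficients - dg g^-1, from
   which dg is recovered by a product with g. *)
have gg p : U p -> g p *m g p = 1%:M by move=> Up; rewrite -{2}ig// mulmxV// ug.
have s1 := smooth_on_cst U (1%:M : 'M[C]_4).
suff dg : is_form U (dform g).
  have h := dformD oU s1 (smooth_onZ (-1) oU sg) (dform_cst oU 1%:M) (dformZ oU (-1) sg dg).
  have := dformZ oU (2^-1) (smooth_onD oU s1 (smooth_onZ (-1) oU sg)) h.
  apply: (dform_ext oU) => x _; rewrite /g /dilat !scaleN1r opprD opprK opprB.
  have -> (P : 'M[C]_4) : 1%:M + (P + (P - 1%:M)) = 2 *: P.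
    by rewrite scaler_nat mulr2n addrCA [_ + (P - _)]addrC subrK.
  by rewrite scalerA mulVf ?scale1r// two_neq0.
have F := is_form_sandwich oU s1 (smooth_onZ (-1) oU sg) (is_form_lin oU o2sl_linear fw1).
apply: (is_form_ext oU) F => c p Up cp.
have z0 : @zero_form _ Sg 6 c p = up (@zero_form _ Sg 4) c p.
  exact: (congr2 pair (esym dwedgemx0) (esym dwedgemx0)).
rewrite -e1// gauge_orefl// (gauge_at oU Up cp (h := gam pr (-1)) (w := up (@zero_form _ Sg 4)))//.
rewrite (gauge_gam_up oU hp _ m1 Up cp).
have E ab : 1%:M *m o2sl (dwedgemx (g p *m 0 *m invmx (g p) - wirt ab c g p *m invmx (g p))) *m (-1 *: g p) =
    wirt ab c g p.
  have D : wirt ab c g p *m g p + g p *m wirt ab c g p = 0.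
    move/smooth_onP: sg => sg.
    by rewrite -(wirtM oU Up cp ab (sg c) (sg c)) (wirt_ext oU Up cp ab gg) (wirt_cst c p).
  (* Because g^2 = 1, the trace of dg g equals its own negative; this removes the trace correction
     of [o2sl]. *)
  have T : \tr (wirt ab c g p *m g p) = 0.
    have := congr1 mxtrace D; rewrite mxtraceD mxtrace_mulC mxtrace0 => /eqP.
    by rewrite -mulr2n -mulr_natl mulf_eq0 (negbTE (two_neq0 R)) => /eqP; rewrite mxtrace_mulC.
  rewrite mulmx0 mul0mx sub0r ig// o2sl_dwedgemx ?two_neq0// raddfN /= T oppr0 mul0r raddf0 addr0 mul1mx.
  by rewrite scaleN1r mulmxN mulNmx opprK -mulmxA gg// mulmx1.
rewrite /up gauge_parts /dform dzE dzbE.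
exact: (congr2 pair (E wz) (E wzb)).
Qed.

End SphereBundle.
End SplittingFields.

Section UntwistedFamily.
Variables (R : realType) (Q : quaternionic R) (Sg : riemannSurface R).
Local Notation C := R[i].
Local Notation J := (jmx Q).
Local Notation conjmx := (map_mx (@conjc R)).
Implicit Types (c : chart Sg).

Definition barJ (X : 'M[C]_4) : 'M[C]_4 := J *m conjmx X *m invmx J.

Lemma tr_barJ X : \tr (barJ X) = conjc (\tr X).
Proof.
by rewrite /barJ mxtrace_mulC mulmxA mulVmx ?jmx_unit// mul1mx trace_map_mx.
Qed.

Lemma o2sl_bar6 X : \tr X = 0 -> o2sl (bar6 Q (dwedgemx X)) = barJ X.
Proof.
move=> t; rewrite bar6_dwedgemx o2sl_dwedgemx ?two_neq0// -/(barJ X) tr_barJ t conjc0 mul0r.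
by rewrite raddf0 addr0.
Qed.

Lemma metric_ext (U : set Sg) (v w : form1 Sg 6) : form_eq U v w -> metric Q U v -> metric Q U w.
Proof. by move=> vw mv c p Up cp; rewrite -vw//; exact: mv. Qed.

Lemma form_eq_sym n (U : set Sg) (v w : form1 Sg n) : form_eq U v w -> form_eq U w v.
Proof. by move=> vw c p Up cp; rewrite vw. Qed.

Variables (U : set Sg) (k : nat) (S : Sg -> 'M[C]_4) (d nabla : C -> form1 Sg 6).
Hypotheses (oU : open U) (hd : twisted_harmonic Q U k S d) (hn : untwisted Q U S d nabla).
Local Notation pr := (fun p => prp (S p)).
Let hS := th_sphere hd.
Let hp := sphere_field oU hS.
Let one0 : (1 : C) != 0 := oner_neq0 _.

Lemma dform_prp : is_form U (dform pr).
Proof.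
apply: (dform_sphere oU hS (th_form hd (z := -1) _)); first by rewrite oppr_eq0.
move=> c p Up cp; rewrite -(th_refl hd one0 Up cp).
by apply: (gauge_at oU Up cp) => //; rewrite (th_one hd Up cp).
Qed.

Lemma untwisted_gam z : z != 0 -> form_eq U (nabla (z ^+ 2)) (gauge (gam pr z) (d z)).
Proof. by move=> z0 c p Up cp; rewrite (hn z0 Up cp) (gauge_tau oU hS). Qed.

Lemma sqrtc_neq0 (z : C) : z != 0 -> sqrtc z != 0.
Proof. by apply: contra_neq => e; rewrite -(sqr_sqrtc z) e expr0n. Qed.

(** [untwisted] prescribes the family at squares; the choice of a root reaches every non-zero
    parameter. *)
Lemma nabla_gam z : z != 0 -> form_eq U (nabla z) (gauge (gam pr (sqrtc z)) (d (sqrtc z))).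
Proof. by move=> z0; have := untwisted_gam (sqrtc_neq0 z0); rewrite sqr_sqrtc. Qed.

Lemma nabla_metric z : z != 0 -> metric Q U (nabla z).
Proof.
move=> z0; have w0 := sqrtc_neq0 z0; apply: (metric_ext (form_eq_sym (nabla_gam z0))).
exact: (metric_gauge oU (gam_smooth oU hp _) (fun x => gam_orth hp w0) (th_metric hd w0)).
Qed.

Lemma nabla_form z : z != 0 -> is_form U (nabla z).
Proof.
move=> z0; have w0 := sqrtc_neq0 z0; apply: (is_form_ext oU (form_eq_sym (nabla_gam z0))).
exact: (is_form_gauge_gam oU hp dform_prp w0 (th_form hd w0)).
Qed.

Lemma nabla_flat z : z != 0 -> flat U (nabla z).
Proof.
move=> z0; have w0 := sqrtc_neq0 z0; apply: (flat_ext oU (form_eq_sym (nabla_gam z0))).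
exact: (flat_gauge_at oU (gam_smooth oU hp _) (fun x => gam_unit hp w0) (th_form hd w0) (th_flat hd w0)).
Qed.

Lemma nabla_one : form_eq U (nabla 1) (@zero_form _ Sg 6).
Proof.
move=> c p Up cp; have := untwisted_gam one0 Up cp; rewrite expr1n => ->.
exact: (etrans (@gauge_gam1 R Sg U pr oU (d 1) c p Up cp) (th_one hd Up cp)).
Qed.

Lemma nabla_real z : z != 0 -> form_eq U (nabla (cstar z)) (conj_form Q (nabla z)).
Proof.
move=> z0 c p Up cp; have w0 := sqrtc_neq0 z0.
have -> : cstar z = cstar (sqrtc z) ^+ 2 by rewrite /cstar exprVn -rmorphXn /= sqr_sqrtc.
rewrite (untwisted_gam (cstar_neq0 w0) Up cp).
have -> : conj_form Q (nabla z) c p = conj_form Q (gauge (gam pr (sqrtc z)) (d (sqrtc z))) c p.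
  by rewrite /conj_form (nabla_gam z0 Up cp).
rewrite -(gauge_gam_conj oU hp _ w0 Up cp); apply: (gauge_at oU Up cp) => //.
exact: (th_real hd w0 Up cp).
Qed.

Lemma nabla_up z c p : z != 0 -> U p -> cdom c p ->
  [/\ nabla z c p = up (form4 (nabla z)) c p, \tr (form4 (nabla z) c p).1 = 0
    & \tr (form4 (nabla z) c p).2 = 0].
Proof. by move=> z0; exact: (metric_up (nabla_metric z0)). Qed.

Lemma nabla4_real z c p : z != 0 -> U p -> cdom c p ->
  form4 (nabla (cstar z)) c p = (barJ (form4 (nabla z) c p).2, barJ (form4 (nabla z) c p).1).
Proof.
move=> z0 Up cp; have [e t1 t2] := nabla_up z0 Up cp.
have e1 : (nabla z c p).1 = dwedgemx (form4 (nabla z) c p).1 := congr1 fst e.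
have e2 : (nabla z c p).2 = dwedgemx (form4 (nabla z) c p).2 := congr1 snd e.
have r1 : o2sl (bar6 Q (nabla z c p).1) = barJ (form4 (nabla z) c p).1 by exact: (etrans (congr1 (fun M => o2sl (bar6 Q M)) e1) (o2sl_bar6 t1)).
have r2 : o2sl (bar6 Q (nabla z c p).2) = barJ (form4 (nabla z) c p).2 by exact: (etrans (congr1 (fun M => o2sl (bar6 Q M)) e2) (o2sl_bar6 t2)).
rewrite {1}/form4 (nabla_real z0 Up cp); exact: (congr2 pair r2 r1).
Qed.

Lemma mlaur_le N M N' M' m n (A : C -> 'M[C]_(m, n)) : (N <= N')%N -> (M + (N' - N) <= M')%N ->
  mlaur N M A -> mlaur N' M' A.
Proof. by move=> h1 h2 hA; rewrite -(subnKC h1); exact: (mlaur_widen h2 hA). Qed.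

(** The (1,0)-part is polynomial by the Liouville argument. Reality expresses the (0,1)-part at z
    through the (1,0)-part at z^*, which makes it a Laurent polynomial. *)
Lemma d_laurent c p : U p -> cdom c p ->
  mlaur 0 k.+1 (fun z => (d z c p).1) /\ mlaur k.+1 (k + 5) (fun z => (d z c p).2).
Proof.
move=> Up cp; have h1 : mlaur 0 k.+1 (fun z => (d z c p).1).
  move=> i j; have [F [H [hF hH FE HE]]] := th_pole hd Up cp i j.
  have [q sq qE] := entire_pole_polynomial (fun z => hF z I) (fun z => hH z I) HE.
  by exists q => // z z0; rewrite expr0 mul1r -FE// qE.
split=> //; pose K := wedgemx J.
have h2 : mlaur (0 + k.+1 + 0) (1 + (1 + k.+2) + 1)
    (fun z => K *m conjmx (d (cstar z) c p).1 *m invmx K).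
  apply: mlaurM (mlaurM (mlaur_cst K) _) (mlaur_cst (invmx K)) => i j.
  apply: laurent_ext (laurent_conjinv (h1 i j)) => z _.
  by rewrite mxE.
move=> i j; have := h2 i j; rewrite add0n addn0 (_ : (1 + (1 + k.+2) + 1 = k + 5)%N); last by lia.
apply: laurent_ext => z z0.
by rewrite -{2}(cstarK z) (th_real hd (cstar_neq0 z0) Up cp).
Qed.

(* In the untwisted family z^2 is the natural variable, whence laurent_even. *)
Lemma nabla4_laurent c p : U p -> cdom c p ->
  mlaur k.+2 (3 * k + 12) (fun z => (form4 (nabla z) c p).1) /\
  mlaur k.+2 (3 * k + 12) (fun z => (form4 (nabla z) c p).2).
Proof.
move=> Up cp; have [d1 d2] := d_laurent Up cp.
have B1 : mlaur 0 k.+1 (fun z => o2sl (d z c p).1) by exact: (mlaur_lin (@o2sl_linear R) d1).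
have B2 : mlaur k.+1 (k + 5) (fun z => o2sl (d z c p).2) by exact: (mlaur_lin (@o2sl_linear R) d2).
pose P := prp (S p).
have g1 : mlaur 0 3 (fun z => dilat z P).
  apply: mlaurD; first exact: (@mlaurZ _ 0 2 0 1 _ _ id (fun=> P) (laurent_id R) (mlaur_cst P)).
  by apply: (@mlaur_le 0 1); last exact: mlaur_cst.
have g2 : mlaur 1 2 (fun z => dilat z^-1 P).
  apply: mlaurD; first exact: (@mlaurZ _ 1 1 0 1 _ _ (fun z => z^-1) (fun=> P) (laurent_idV R) (mlaur_cst P)).
  by apply: (@mlaur_le 0 1); last exact: mlaur_cst.
have lz : laurent 0 2 (fun z : C => 1 - z).
  exists (1 - 'X); last by move=> z _; rewrite expr0 mul1r !hornerE.
  by rewrite -opprB size_polyN size_XsubC.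
have D ab : mlaur 1 5 (fun z => ((1 - z) *: wirt ab c pr p) *m dilat z^-1 P).
  exact: (mlaurM (@mlaurZ _ 0 2 0 1 _ _ (fun z => 1 - z) (fun=> wirt ab c pr p) lz (mlaur_cst _)) g2).
have dd z ab : wirt ab c (fun x => dilat z (prp (S x))) p = (z - 1) *: wirt ab c pr p.
  have /smooth_onP sp := hp.1; have s1 := smc_cst c U (1%:M : 'M[C]_4).
  rewrite -(wirtZ oU Up cp ab (z - 1) (sp c)).
  rewrite -[RHS]addr0 -(wirt_cst c p ab (1%:M : 'M[C]_4)) -(wirtD oU Up cp ab (smcZ (z - 1) oU (sp c)) s1).
  by apply: (wirt_ext oU Up cp) => x _; rewrite /dilat scalerBl scale1r addrAC -addrA.
have E z : z != 0 -> form4 (nabla (z ^+ 2)) c p =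
    form4 (up (gauge (fun x => dilat z (prp (S x))) (form4 (d z)))) c p.
  move=> z0; have [e _ _] := metric_up (th_metric hd z0) Up cp.
  have ge : gauge (gam pr z) (d z) c p = gauge (gam pr z) (up (form4 (d z))) c p.
    by apply: (gauge_at oU Up cp).
  have E3 := etrans (untwisted_gam z0 Up cp) (etrans ge (gauge_gam_up oU hp (form4 (d z)) z0 Up cp)).
  exact: (congr1 (fun w => (o2sl w.1, o2sl w.2)) E3).
have lf a (X Y : 'M[C]_4) : o2sl (dwedgemx (a *: X + Y)) = a *: o2sl (dwedgemx X) + o2sl (dwedgemx Y).
  by rewrite dwedgemx_linear o2sl_linear.
(* The bounds are not sharp. What matters is that they depend neither on the chart nor on the point,
   so that the same nodes serve everywhere. *)
have gen N M ab (B : C -> 'M[C]_4) : mlaur N M B -> (N <= k.+1)%N ->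
    (M + 5 + (2 * k.+2 - N.+1) <= 3 * k + 12)%N ->
    mlaur (2 * k.+2) (3 * k + 12) (fun z => o2sl (dwedgemx
      (dilat z P *m B z *m dilat z^-1 P + ((1 - z) *: wirt ab c pr p) *m dilat z^-1 P))).
  move=> hB hN hM; apply: (mlaur_lin lf); apply: mlaurD.
    by apply: (@mlaur_le (0 + N + 1) (3 + M + 2)); [lia|lia|exact: (mlaurM (mlaurM g1 hB) g2)].
  by apply: (@mlaur_le 1 5); [lia|lia|exact: D].
have F ab z (X : 'M[C]_4) : z != 0 ->
    dilat z P *m X *m invmx (dilat z P) - wirt ab c (fun x => dilat z (prp (S x))) p *m invmx (dilat z P) =
    dilat z P *m X *m dilat z^-1 P + ((1 - z) *: wirt ab c pr p) *m dilat z^-1 P.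
  by move=> z0; rewrite dd (dilat_field_inv hp z0 Up) -mulNmx -scaleNr opprB.
have parts z := gauge_parts c p (fun x => dilat z (prp (S x))) (form4 (d z)).
have E1 z : z != 0 -> (form4 (nabla (z ^+ 2)) c p).1 = o2sl (dwedgemx
    (dilat z P *m o2sl (d z c p).1 *m dilat z^-1 P + ((1 - z) *: wirt wz c pr p) *m dilat z^-1 P)).
  move=> z0; apply: etrans (congr1 fst (E z z0)) _; apply: (congr1 (fun X => o2sl (dwedgemx X))).
  exact: (etrans (congr1 fst (parts z)) (F wz z _ z0)).
have E2 z : z != 0 -> (form4 (nabla (z ^+ 2)) c p).2 = o2sl (dwedgemx
    (dilat z P *m o2sl (d z c p).2 *m dilat z^-1 P + ((1 - z) *: wirt wzb c pr p) *m dilat z^-1 P)).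
  move=> z0; apply: etrans (congr1 snd (E z z0)) _; apply: (congr1 (fun X => o2sl (dwedgemx X))).
  exact: (etrans (congr1 snd (parts z)) (F wzb z _ z0)).
split=> i j.
  by apply: (laurent_even (gen _ _ wz _ B1 _ _ i j)); [by []|lia|move=> z z0; rewrite (E1 z z0)].
by apply: (laurent_even (gen _ _ wzb _ B2 _ _ i j)); [by []|lia|move=> z z0; rewrite (E2 z z0)].
Qed.

End UntwistedFamily.

(** In blocks for P and 1 - P, conjugation by the dilation keeps the diagonal blocks and scales the
    off-diagonal ones by f and 1 / f. The derivative term has only off-diagonal content, and the two
    combine into differences with V and V'. *)
Lemma dilat_gauge_algebra (K : fieldType) n (f : K) (P B V V' : 'M[K]_n) : f != 0 -> P *m P = P ->
  (f *: P + (1%:M - P)) *m B *m (f^-1 *: P + (1%:M - P)) -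
  ((f - 1) *: (P *m V' *m (1%:M - P) - (1%:M - P) *m V *m P)) *m (f^-1 *: P + (1%:M - P)) =
  B + (f^-1 - 1) *: ((1%:M - P) *m (B - V) *m P) + (f - 1) *: (P *m (B - V') *m (1%:M - P)).
Proof.
move=> f0 PP; pose P' : 'M[K]_n := 1%:M - P.
have PP' : P *m P' = 0 by rewrite /P' mulmxBr mulmx1 PP subrr.
have P'P : P' *m P = 0 by rewrite /P' mulmxBl mul1mx PP subrr.
have P'P' : P' *m P' = P' by rewrite {1}/P' mulmxBl mul1mx PP' subr0.
have s : P + P' = 1%:M by rewrite addrC subrK.
rewrite -/P'; clearbody P'.
have BE : B = P *m B *m P + P *m B *m P' + (P' *m B *m P + P' *m B *m P').
  by rewrite -!mulmxDr s !mulmx1 -mulmxDl s mul1mx.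
have L : (f *: P + P') *m B *m (f^-1 *: P + P') = P *m B *m P + f *: (P *m B *m P')
    + (f^-1 *: (P' *m B *m P) + P' *m B *m P').
  rewrite !mulmxDl !mulmxDr -!scalemxAl -!scalemxAr !scalerA mulfV// scale1r.
  by rewrite addrACA addrA.
have L2 : (P *m V' *m P' - P' *m V *m P) *m (f^-1 *: P + P') = P *m V' *m P' - f^-1 *: (P' *m V *m P).
  rewrite mulmxBl !mulmxDr -!scalemxAr -!(mulmxA _ P' P') -!(mulmxA _ P' P) -!(mulmxA _ P P) -!(mulmxA _ P P').
  by rewrite P'P P'P' PP PP' !mulmx0 scaler0 addr0 add0r.
rewrite -scalemxAl L L2 !mulmxBr !mulmxBl; move: (P *m V' *m P') (P' *m V *m P) => x5 x6.
move: (P *m B *m P) (P *m B *m P') (P' *m B *m P) (P' *m B *m P') BE => x1 x2 x3 x4 ->.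
by apply/matrixP => i j; rewrite !mxE; field.
Qed.

Section ParallelProjection.
Variables (R : realType) (Q : quaternionic R) (Sg : riemannSurface R).
Local Notation C := R[i].
Local Notation J := (jmx Q).
Local Notation conjmx := (map_mx (@conjc R)).
Implicit Types (c : chart Sg).
Variables (W : Sg -> {vspace 'cV[C]_4}) (pr : Sg -> 'M[C]_4) (w w' : form1 Sg 4).
Hypotheses (spr : smooth_on setT pr) (hpr : forall p, splits Q (pr p) (W p) (jimg Q (W p))).
Hypothesis wpar : parallel setT w W.
Hypothesis ww' : forall c p, cdom c p -> w' c p = (barJ Q (w c p).2, barJ Q (w c p).1).

Let oT : open [set: Sg] := openT.

Lemma barJM (A B : 'M[C]_4) : barJ Q (A *m B) = barJ Q A *m barJ Q B.
Proof.
by rewrite /barJ map_mxM !mulmxA -[_ *m invmx J *m J]mulmxA mulVmx ?mulmx1// jmx_unit.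
Qed.

Lemma barJD (A B : 'M[C]_4) : barJ Q (A + B) = barJ Q A + barJ Q B.
Proof. by rewrite /barJ map_mxD mulmxDr mulmxDl. Qed.

Lemma barJ0 : barJ Q 0 = 0.
Proof. by rewrite /barJ map_mx0 mulmx0 mul0mx. Qed.

(** For constant v the section P v lies in W; parallelism says that its covariant derivative has no
    component in jW. *)
Lemma proj_parallel c p : cdom c p ->
  (1%:M - pr p) *m (wirt wz c pr p + (w c p).1 *m pr p) = 0 /\
  (1%:M - pr p) *m (wirt wzb c pr p + (w c p).2 *m pr p) = 0.
Proof.
move=> cp; have /smooth_onP sp := spr.
have key (v : 'cV[C]_4) : (1%:M - pr p) *m (wirt wz c pr p + (w c p).1 *m pr p) *m v = 0 /\
    (1%:M - pr p) *m (wirt wzb c pr p + (w c p).2 *m pr p) *m v = 0.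
  pose s x := pr x *m v.
  have ss : smooth_on setT s := smooth_onM oT spr (@smooth_on_cst _ _ _ _ setT v).
  have sW x : setT x -> s x \in W x.
    by move=> _; rewrite (splits_memE (hpr x)) /s mulmxA (splits_idem (hpr x)).
  have [h1 h2] := wpar oT (fun _ _ => I) ss sW (I : setT p) cp.
  move: h1 h2; rewrite !(splits_memE (hpr p)) dzE dzbE !(wirtcM oT I cp _ v (sp c)).
  have e (Y B : 'M[C]_4) : pr p *m (Y *m v + B *m s p) == Y *m v + B *m s p ->
      (1%:M - pr p) *m (Y + B *m pr p) *m v = 0.
    move=> /eqP h; have -> : (1%:M - pr p) *m (Y + B *m pr p) *m v = (1%:M - pr p) *m (Y *m v + B *m s p).
      by rewrite -mulmxA; congr (_ *m _); rewrite mulmxDl /s mulmxA.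
    by rewrite mulmxBl mul1mx h subrr.
  by move=> /e h1 /e h2.
have z (Y : 'M[C]_4) : (forall v : 'cV[C]_4, Y *m v = 0) -> Y = 0.
  by move=> H; apply/matrixP => i j; have := H (delta_mx j 0); rewrite -colE => /matrixP/(_ i 0); rewrite !mxE.
by split; apply: z => v; have [] := key v.
Qed.

Lemma barJ_pr p : barJ Q (pr p) = 1%:M - pr p.
Proof. exact: (splits_conj (hpr p)). Qed.

Lemma barJ_pr' p : barJ Q (1%:M - pr p) = pr p.
Proof.
rewrite /barJ map_mxB map_mx1 mulmxBr mulmxBl mulmx1 mulmxV ?jmx_unit//.
by rewrite -[X in _ - X]/(barJ Q (pr p)) barJ_pr subKr.
Qed.

(** The derivative of [barJ_pr], with conjugation exchanging d/dz and d/dzbar. *)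
Lemma wirt_barJ c p : cdom c p ->
  barJ Q (wirt wzb c pr p) = - wirt wz c pr p /\ barJ Q (wirt wz c pr p) = - wirt wzb c pr p.
Proof.
move=> cp; have /smooth_onP sp := spr; have sc := smc_conj oT (sp c).
have sK := smcM oT (smc_cst c setT J) sc; have s1 := smc_cst c setT (1%:M : 'M[C]_4).
have E ab : wirt ab c (fun x => barJ Q (pr x)) p = J *m wirt ab c (fun x => conjmx (pr x)) p *m invmx J.
  by rewrite (wirtcM oT I cp ab _ sK) (wirtMc oT I cp ab _ sc).
have E' ab : wirt ab c (fun x => barJ Q (pr x)) p = - wirt ab c pr p.
  rewrite (wirt_ext oT I cp ab (fun x _ => barJ_pr x)) (wirtB oT I cp ab s1 (sp c)).
  by rewrite (wirt_cst c p) sub0r.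
rewrite -!E' !E; split; rewrite /barJ -?dzE -?dzbE; last by rewrite (dzb_conj oT I cp (sp c)).
by rewrite (dz_conj oT I cp (sp c)).
Qed.

(* The first term is the parallelism of W for w, the second that of jW for w'. *)
Lemma wirt_proj c p : cdom c p ->
  wirt wz c pr p = pr p *m (w' c p).1 *m (1%:M - pr p) - (1%:M - pr p) *m (w c p).1 *m pr p /\
  wirt wzb c pr p = pr p *m (w' c p).2 *m (1%:M - pr p) - (1%:M - pr p) *m (w c p).2 *m pr p.
Proof.
move=> cp; have [h1 h2] := proj_parallel cp; have [b1 b2] := wirt_barJ cp.
have gen (D A A' D' B' : 'M[C]_4) : (1%:M - pr p) *m (D + A *m pr p) = 0 ->
    (1%:M - pr p) *m (D' + B' *m pr p) = 0 -> barJ Q D' = - D -> A' = barJ Q B' ->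
    D = pr p *m A' *m (1%:M - pr p) - (1%:M - pr p) *m A *m pr p.
  move=> e1 e2 eD ->; move: e2 => /(congr1 (barJ Q)); rewrite barJ0 barJM barJD barJM eD barJ_pr barJ_pr'.
  move=> e3; have a1 : (1%:M - pr p) *m D = - ((1%:M - pr p) *m A *m pr p).
    by apply/eqP; rewrite -addr_eq0 -mulmxA -mulmxDr; apply/eqP.
  have a2 : pr p *m D = pr p *m barJ Q B' *m (1%:M - pr p).
    by apply/eqP; rewrite eq_sym -subr_eq0 -mulmxA -mulmxBr addrC; apply/eqP.
  have e : D = (1%:M - pr p) *m D + pr p *m D by rewrite -mulmxDl subrK mul1mx.
  by rewrite [LHS]e a1 a2 addrC.
by split; apply: (gen _ _ _ _ _ h1 h2) || apply: (gen _ _ _ _ _ h2 h1); rewrite // ww'.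
Qed.

(** By [wirt_proj] the differential of the projection is algebraic in the two connection forms and
    inherits their transition rule. *)
Lemma dform_proj : is_form setT w -> is_form setT w' -> is_form setT (dform pr).
Proof.
move=> fw fw'; have s1 := @smooth_on_cst R Sg _ _ setT (1%:M : 'M[C]_4).
have sp' : smooth_on setT (fun x => 1%:M - pr x) := smooth_onB oT s1 spr.
have := is_formD oT (is_form_sandwich oT spr sp' fw') (is_formZ oT (-1) (is_form_sandwich oT sp' spr fw)).
apply: (is_form_ext oT) => c p _ cp; have [e1 e2] := wirt_proj cp.
rewrite /dform dzE dzbE e1 e2.
have gen (A B : 'M[C]_4) : A + -1 *: B = A - B by rewrite scaleN1r.
exact: (congr2 pair (gen _ _) (gen _ _)).
Qed.

(** The factors 1 / f - 1 and f - 1, which will have the poles, multiply exactly the differences of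
    A with the connections for which W and jW are parallel. When A runs through the family, these
    differences vanish at the respective poles. *)
Lemma gauge_dilat_proj (f : C) (A : form1 Sg 4) c p : f != 0 -> cdom c p ->
  gauge (fun x => dilat f (pr x)) A c p =
  ((A c p).1 + (f^-1 - 1) *: ((1%:M - pr p) *m ((A c p).1 - (w c p).1) *m pr p)
     + (f - 1) *: (pr p *m ((A c p).1 - (w' c p).1) *m (1%:M - pr p)),
   (A c p).2 + (f^-1 - 1) *: ((1%:M - pr p) *m ((A c p).2 - (w c p).2) *m pr p)
     + (f - 1) *: (pr p *m ((A c p).2 - (w' c p).2) *m (1%:M - pr p))).
Proof.
move=> f0 cp; have /smooth_onP sp := spr; have s1 := smc_cst c setT (1%:M : 'M[C]_4).
have dd ab : wirt ab c (fun x => dilat f (pr x)) p = (f - 1) *: wirt ab c pr p.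
  rewrite -(wirtZ oT I cp ab (f - 1) (sp c)).
  rewrite -[RHS]addr0 -(wirt_cst c p ab (1%:M : 'M[C]_4)) -(wirtD oT I cp ab (smcZ (f - 1) oT (sp c)) s1).
  by apply: (wirt_ext oT I cp) => x _; rewrite /dilat scalerBl scale1r addrAC -addrA.
have [_ iv] := dilat_unit (hpr p) f0; have pp := splits_idem (hpr p).
have [e1 e2] := wirt_proj cp.
have gen (B D V V' : 'M[C]_4) : D = pr p *m V' *m (1%:M - pr p) - (1%:M - pr p) *m V *m pr p ->
    dilat f (pr p) *m B *m invmx (dilat f (pr p)) - ((f - 1) *: D) *m invmx (dilat f (pr p)) =
    B + (f^-1 - 1) *: ((1%:M - pr p) *m (B - V) *m pr p) + (f - 1) *: (pr p *m (B - V') *m (1%:M - pr p)).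
  move=> ->; rewrite iv /dilat; exact: (dilat_gauge_algebra _ _ _ f0 pp).
rewrite gauge_parts !dd; exact: (congr2 pair (gen _ _ _ _ e1) (gen _ _ _ _ e2)).
Qed.

End ParallelProjection.

(** * The dressing gauge *)

Section DressedFamily.
Variables (R : realType) (Q : quaternionic R) (Sg : riemannSurface R).
Local Notation C := R[i].
Local Notation C1 := (R[i]^o).
Implicit Types (c : chart Sg).

Section SpectralValue.
Variable nu : C.
Hypotheses (nu0 : nu != 0) (nu1 : `|nu| != 1).

Lemma cstar1 : cstar 1 = 1 :> C.
Proof. by rewrite /cstar conjc1 invr1. Qed.

(** nu = nu^* would mean |nu|^2 = 1. *)
Lemma nu_neq_cstar : nu != cstar nu.
Proof.
apply: contra_neq nu1 => e; have cn0 : conjc nu != 0 by rewrite conjc_eq0.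
have h : `|nu| ^+ 2 = 1 by rewrite sqr_normc {1}e /cstar mulVf.
by apply/eqP; rewrite -(@pexpr_eq1 _ `|nu| 2)// h.
Qed.

Lemma nu_neq1 : nu != 1.
Proof. by apply: contra_neq nu1 => ->; rewrite normr1. Qed.

Lemma cstar_nu_neq1 : cstar nu != 1.
Proof. by apply: contra_neq nu_neq1 => e; rewrite -(cstarK nu) e cstar1. Qed.

Definition fP (z : C) : C := ((1 - cstar nu) * (z - nu)) / ((1 - nu) * (z - cstar nu)).

Lemma fP_neq0 z : z != nu -> z != cstar nu -> fP z != 0.
Proof.
move=> h1 h2; have := nu_neq1; have := cstar_nu_neq1 => h3 h4.
by rewrite /fP mulf_neq0 ?invr_neq0 ?mulf_neq0 ?subr_eq0// eq_sym.
Qed.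

Lemma fP1 : fP 1 = 1.
Proof.
have := nu_neq1; have := cstar_nu_neq1 => h3 h4.
by rewrite /fP (mulrC (1 - nu)) divff// mulf_neq0// subr_eq0 eq_sym.
Qed.

(** [eP] and [eP'] are the numerators of 1 / f - 1 over z - nu and of f - 1 over z - nu^*. *)
Definition eP (z : C) : C := (cstar nu - nu) * (z - 1) / (1 - cstar nu).
Definition eP' (z : C) : C := (nu - cstar nu) * (z - 1) / (1 - nu).

Lemma fPV z : z != nu -> z != cstar nu -> (fP z)^-1 - 1 = eP z / (z - nu).
Proof.
move=> h1 h2; have := nu_neq1; have := cstar_nu_neq1 => h3 h4; rewrite /fP /eP; field.
by rewrite !subr_eq0 ![1 == _]eq_sym h1 h2 h3 h4.
Qed.

Lemma fPB z : z != nu -> z != cstar nu -> fP z - 1 = eP' z / (z - cstar nu).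
Proof.
move=> h1 h2; have := nu_neq1; have := cstar_nu_neq1 => h3 h4; rewrite /fP /eP'; field.
by rewrite !subr_eq0 ![1 == _]eq_sym h2 h4.
Qed.

Lemma fP_star z : z != 0 -> z != nu -> z != cstar nu -> fP (cstar z) = cstar (fP z).
Proof.
move=> z0 h1 h2; have := nu_neq1; have := cstar_nu_neq1 => h3 h4.
rewrite /fP [in RHS]/cstar !rmorphM !fmorphV !rmorphM !rmorphB !rmorph1 /= !conjc_inv conjcK /cstar.
have cz : conjc z != 0 by rewrite conjc_eq0.
have cn : conjc nu != 0 by rewrite conjc_eq0.
have h5 : conjc nu != 1 by apply: contra_neq h4 => e; rewrite -(conjcK nu) e conjc1.
have h6 : conjc z != conjc nu by rewrite (inj_eq (can_inj (@conjcK R))).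
have h7 : conjc z * nu != 1.
  apply: contra_neq h2 => e; have e' : z * conjc nu = 1.
    by rewrite -(conjcK z) -rmorphM e; exact: rmorph1.
  by rewrite /cstar -[LHS]mulr1 -(mulfV cn) mulrA e' mul1r.
field.
rewrite mulN1r !subr_eq0 nu0 h7 (eq_sym 1) h5 h6 h4 cn cz (eq_sym (conjc nu)) h6 (eq_sym 1) h4.
by [].
Qed.

Lemma laurent_eP (phi : C -> C) (N M : nat) (a b : C) : laurent N M phi ->
  laurent N (M + 2) (fun z => a * (z - 1) / b * phi z).
Proof.
move=> hp; have h : laurent 0 2 (fun z : C => a * (z - 1) / b).
  exists ((a / b) *: ('X - 1%:P)); first by rewrite (leq_trans (size_scale_leq _ _))// size_XsubC.
  by move=> z _; rewrite expr0 mul1r hornerZ hornerXsubC mulrAC.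
by have := laurentM h hp; rewrite add0n addnC.
Qed.

End SpectralValue.

Variables (k : nat) (S : Sg -> 'M[C]_4) (d nabla : C -> form1 Sg 6).
Hypotheses (hd : twisted_harmonic Q setT k S d) (hn : untwisted Q setT S d nabla).
Variables (nu : C).
Hypotheses (nu0 : nu != 0) (nu1 : `|nu| != 1).
Variables (W : Sg -> {vspace 'cV[C]_4}) (pr : Sg -> 'M[C]_4).
Hypotheses (spr : smooth_on setT pr) (hpr : forall p, splits Q (pr p) (W p) (jimg Q (W p))).
Hypothesis wpar : parallel setT (form4 (nabla nu)) W.

Let oT : open [set: Sg] := openT.
Let n0s := cstar_neq0 nu0.

Lemma nabla4_form z : z != 0 -> is_form setT (form4 (nabla z)).
Proof. by move=> z0; exact: (is_form_lin oT (@o2sl_linear R) (nabla_form oT hd hn z0)). Qed.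

Lemma W_field : splitting_field Q setT pr.
Proof. by split=> // p _; exists (W p). Qed.

Lemma nabla4_star c p : cdom c p -> form4 (nabla (cstar nu)) c p =
  (barJ Q (form4 (nabla nu) c p).2, barJ Q (form4 (nabla nu) c p).1).
Proof. exact: (nabla4_real oT hd hn nu0 I). Qed.

Lemma dform_W : is_form setT (dform pr).
Proof.
exact: (dform_proj spr hpr wpar nabla4_star (nabla4_form nu0) (nabla4_form n0s)).
Qed.

Lemma tr_sandwich (P B : 'M[C]_4) : P *m P = P ->
  \tr ((1%:M - P) *m B *m P) = 0 /\ \tr (P *m B *m (1%:M - P)) = 0.
Proof.
move=> PP; split; rewrite mxtrace_mulC mulmxA; first by rewrite mulmxBr mulmx1 PP subrr mul0mx mxtrace0.
by rewrite mulmxBl mul1mx PP subrr mul0mx mxtrace0.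
Qed.

(** Interpolation turns the differences with the members at nu and nu^* into multiples of z - nu and
    z - nu^*, which cancel the denominators in [gauge_dilat_proj]. The resulting sum makes sense at
    the poles too and serves as the extension. *)
Lemma dressing_family : exists (I : finType) (phi : I -> C -> C) (F : I -> form1 Sg 4),
  [/\ (forall t, exists N M, laurent N M (phi t)), (forall t, is_form setT (F t)),
      (forall t c p, cdom c p -> \tr (F t c p).1 = 0 /\ \tr (F t c p).2 = 0) &
      forall z, z != 0 -> z != nu -> z != cstar nu ->
        form_eq setT (up (lcomb phi F z)) (gauge (gam pr (fP nu z)) (nabla z))].
Proof.
set N := k.+2; set M := (3 * k + 12)%N; have M0 : (0 < M)%N by rewrite /M; lia.
pose A (a : 'I_M) := form4 (nabla (node R a)).
have slope (mu : C) : mu != 0 -> exists m : 'I_M -> C -> C, forall a,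
    (exists N' M', laurent N' M' (m a)) /\
    forall z, z != 0 -> ell N a z - ell N a mu = (z - mu) * m a z.
  move=> mu0; have /choice[m hm] : forall a : 'I_M, exists f : C -> C,
      (exists N' M', laurent N' M' f) /\ forall z, z != 0 -> ell N a z - ell N a mu = (z - mu) * f z.
    by move=> a; have [f ? ?] := laurent_slope (@laurent_ell R N M a M0) mu0; exists f.
  by exists m.
have [m hm] := slope nu nu0; have [m' hm'] := slope (cstar nu) n0s.
(* One copy of the nodes for the family itself and one for each of the two off-diagonal blocks. *)
pose I := ('I_M + ('I_M + 'I_M))%type.
pose phi (t : I) : C -> C := match t with
  | inl a => ell N a
  | inr (inl a) => fun z => eP nu z * m a z
  | inr (inr a) => fun z => eP' nu z * m' a z end.
pose F (t : I) : form1 Sg 4 := match t with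
  | inl a => A a
  | inr (inl a) => fun c p => ((1%:M - pr p) *m (A a c p).1 *m pr p, (1%:M - pr p) *m (A a c p).2 *m pr p)
  | inr (inr a) => fun c p => (pr p *m (A a c p).1 *m (1%:M - pr p), pr p *m (A a c p).2 *m (1%:M - pr p)) end.
have s1 := @smooth_on_cst R Sg _ _ setT (1%:M : 'M[C]_4).
have spr' : smooth_on setT (fun x => 1%:M - pr x) := smooth_onB oT s1 spr.
have fA a : is_form setT (A a) by apply: nabla4_form; exact: node_neq0.
exists I, phi, F; split.
- case=> [a|[a|a]].
  + by exists N, M; exact: laurent_ell.
  + have [[N' [M' h]] _] := hm a; exists N', (M' + 2)%N; exact: laurent_eP.
  + have [[N' [M' h]] _] := hm' a; exists N', (M' + 2)%N; exact: laurent_eP.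
- case=> [a|[a|a]]; first exact: fA.
  + exact: (is_form_sandwich oT spr' spr (fA a)).
  + exact: (is_form_sandwich oT spr spr' (fA a)).
- case=> [a|[a|a]] c p cp; have pp := splits_idem (hpr p).
  + have [_ t1 t2] := nabla_up oT hd hn (node_neq0 R a) (Logic.I : setT p) cp; exact: (conj t1 t2).
  + exact: (conj (tr_sandwich (A a c p).1 pp).1 (tr_sandwich (A a c p).2 pp).1).
  + exact: (conj (tr_sandwich (A a c p).1 pp).2 (tr_sandwich (A a c p).2 pp).2).
move=> z z0 zn zs c p _ cp; have f0 := fP_neq0 nu1 zn zs.
have [e _ _] := nabla_up oT hd hn z0 (Logic.I : setT p) cp.
have G : gauge (gam pr (fP nu z)) (nabla z) c p = up (gauge (fun x => dilat (fP nu z) (pr x)) (form4 (nabla z))) c p.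
  rewrite -(gauge_gam_up oT W_field (form4 (nabla z)) f0 Logic.I cp).
  exact: (gauge_at oT (Logic.I : setT p) cp).
rewrite G; suff E : gauge (fun x => dilat (fP nu z) (pr x)) (form4 (nabla z)) c p = lcomb phi F z c p.
  exact: (congr1 (fun w => (dwedgemx w.1, dwedgemx w.2)) (esym E)).
rewrite (gauge_dilat_proj spr hpr wpar nabla4_star (form4 (nabla z)) f0 cp).
have [L1 L2] := nabla4_laurent oT hd hn (Logic.I : setT p) cp.
have gen (B : C -> 'M[C]_4) : mlaur N M B ->
    B z + ((fP nu z)^-1 - 1) *: ((1%:M - pr p) *m (B z - B nu) *m pr p)
      + (fP nu z - 1) *: (pr p *m (B z - B (cstar nu)) *m (1%:M - pr p)) =
    \sum_(a < M) ell N a z *: B (node R a) +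
    (\sum_(a < M) (eP nu z * m a z) *: ((1%:M - pr p) *m B (node R a) *m pr p) +
     \sum_(a < M) (eP' nu z * m' a z) *: (pr p *m B (node R a) *m (1%:M - pr p))).
  move=> hB; have LB := mlaur_interpolation M0 hB.
  have DB mu (q : 'I_M -> C -> C) : mu != 0 ->
      (forall a z, z != 0 -> ell N a z - ell N a mu = (z - mu) * q a z) ->
      B z - B mu = (z - mu) *: \sum_(a < M) q a z *: B (node R a).
    move=> mu0 hq; rewrite (LB _ z0) (LB _ mu0) -sumrB scaler_sumr; apply: eq_bigr => a _.
    by rewrite -scalerBl hq// scalerA.
  rewrite (DB _ _ nu0 (fun a => (hm a).2)) (DB _ _ n0s (fun a => (hm' a).2)) {1}(LB _ z0) -addrA.
  rewrite (fPV nu1 zn zs) (fPB nu1 zn zs) -!scalemxAr -!scalemxAl !scalerA !divfK ?subr_eq0//.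
  have S' (P1 P2 : 'M[C]_4) e1 (q : 'I_M -> C -> C) : e1 *: (P1 *m (\sum_(a < M) q a z *: B (node R a)) *m P2) =
      \sum_(a < M) (e1 * q a z) *: (P1 *m B (node R a) *m P2).
    rewrite mulmx_sumr mulmx_suml scaler_sumr; apply: eq_bigr => a _.
    by rewrite -scalemxAr -scalemxAl scalerA.
  rewrite !S'; reflexivity.
have b1 : (lcomb phi F z c p).1 = _ := etrans (big_sumType _ _ _) (congr1 _ (big_sumType _ _ _)).
have b2 : (lcomb phi F z c p).2 = _ := etrans (big_sumType _ _ _) (congr1 _ (big_sumType _ _ _)).
apply: etrans (esym (surjective_pairing (lcomb phi F z c p))); rewrite b1 b2.
exact: (congr2 pair (gen (fun z => (form4 (nabla z) c p).1) L1) (gen (fun z => (form4 (nabla z) c p).2) L2)).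
Qed.

End DressedFamily.

Lemma laurent_exD (R : realType) (f g : R[i] -> R[i]) : (exists N M, laurent N M f) -> (exists N M, laurent N M g) ->
  exists N M, laurent N M (fun z => f z + g z).
Proof.
move=> [N [M hf]] [N' [M' hg]]; exists (N + N')%N, (M + M' + N + N')%N.
apply: laurentD; first by apply: laurent_widen hf _; lia.
by rewrite addnC; apply: laurent_widen hg _; lia.
Qed.

Section ExtendedFamily.
Variables (R : realType) (Q : quaternionic R) (Sg : riemannSurface R).
Local Notation C := R[i].
Local Notation C1 := (R[i]^o).
Implicit Types (c : chart Sg).
Variables (k : nat) (S : Sg -> 'M[C]_4) (d nabla : C -> form1 Sg 6).
Hypotheses (hd : twisted_harmonic Q setT k S d) (hn : untwisted Q setT S d nabla).
Variables (nu : C).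
Hypotheses (nu0 : nu != 0) (nu1 : `|nu| != 1).
Variables (W : Sg -> {vspace 'cV[C]_4}) (pr : Sg -> 'M[C]_4).
Hypotheses (spr : smooth_on setT pr) (hpr : forall p, splits Q (pr p) (W p) (jimg Q (W p))).
Hypothesis wpar : parallel setT (form4 (nabla nu)) W.

Let oT : open [set: Sg] := openT.
Let n0s := cstar_neq0 nu0.
Let fW := W_field spr hpr.

Section Combination.
Variables (I : finType) (phi : I -> C -> C) (F : I -> form1 Sg 4).
Hypothesis hphi : forall t, exists N M, laurent N M (phi t).
Hypothesis fF : forall t, is_form setT (F t).
Hypothesis tF : forall t c p, cdom c p -> \tr (F t c p).1 = 0 /\ \tr (F t c p).2 = 0.
Hypothesis ext : forall z, z != 0 -> z != nu -> z != cstar nu ->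
  form_eq setT (up (lcomb phi F z)) (gauge (gam pr (fP nu z)) (nabla z)).
Local Notation h z := (up (lcomb phi F z)).

Lemma h_lcomb z : h z = lcomb phi (fun t => up (F t)) z.
Proof.
have E (G : I -> 'M[C]_4) : dwedgemx (\sum_t phi t z *: G t) = \sum_t phi t z *: dwedgemx (G t).
  elim: (index_enum I) => [|t r IH]; first by rewrite !big_nil dwedgemx0.
  by rewrite !big_cons dwedgemxD dwedgemxZ IH.
apply/funext => c; apply/funext => p; exact: (congr2 pair (E _) (E _)).
Qed.

Lemma phi_derivable t z : z != 0 -> derivable (phi t : C1 -> C1) z 1.
Proof. by move=> z0; have [N [M hL]] := hphi t; exact: laurent_derivable hL z0. Qed.

Lemma up_form (A : form1 Sg 4) : is_form setT A -> is_form setT (up A).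
Proof. exact: (is_form_lin oT (@dwedgemx_linear R)). Qed.

Lemma h_form z : is_form setT (h z).
Proof. exact: (up_form (is_form_lcomb phi z oT fF)). Qed.

Lemma h_mhol z c p : z != 0 -> mhol (fun w => (h w c p).1) z /\ mhol (fun w => (h w c p).2) z.
Proof.
move=> z0; have := lcomb_hol (fun t => up (F t)) (fun t => @phi_derivable t z z0) c p.
have e1 := funext (fun w => congr1 (fun g : form1 Sg 6 => (g c p).1) (h_lcomb w)).
have e2 := funext (fun w => congr1 (fun g : form1 Sg 6 => (g c p).2) (h_lcomb w)).
by move=> [h1 h2]; split; [exact: (eq_ind_r (fun g => mhol g z) h1 e1)|exact: (eq_ind_r (fun g => mhol g z) h2 e2)].
Qed.

Lemma h_hol : hol_family setT [set z : C1 | z != 0] (fun z => h z).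
Proof.
move=> c p _ _ i j; split=> z z0.
  by have [H _] := h_mhol c p z0; exact: (H i j).
by have [_ H] := h_mhol c p z0; exact: (H i j).
Qed.

Lemma lcomb_tr0 z c p : cdom c p -> \tr (lcomb phi F z c p).1 = 0 /\ \tr (lcomb phi F z c p).2 = 0.
Proof.
move=> cp; have E (G : I -> 'M[C]_4) : (forall t, \tr (G t) = 0) -> \tr (\sum_t phi t z *: G t) = 0.
  by move=> H; rewrite raddf_sum big1// => t _; rewrite /= mxtraceZ H mulr0.
by split; apply: E => t; have [] := tF t cp.
Qed.

Lemma h_metric z : metric Q setT (h z).
Proof.
move=> c p _ cp; have [t1 t2] := lcomb_tr0 z cp.
by split; apply: skew6_dwedgemx_tr0; [exact: t1|exact: t2].
Qed.

Lemma h_one : form_eq setT (h 1) (@zero_form _ Sg 6).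
Proof.
have h3 := nu_neq1 nu1; have h4 := cstar_nu_neq1 nu1.
move=> c p Up cp; rewrite (ext (oner_neq0 _) _ _ Up cp) 1?eq_sym// fP1//.
exact: (etrans (@gauge_gam1 R Sg setT pr oT (nabla 1) c p Up cp) (nabla_one oT hd hn Up cp)).
Qed.

Lemma h_flat_good z : z != 0 -> z != nu -> z != cstar nu -> flat setT (h z).
Proof.
move=> z0 h1 h2; have f0 := fP_neq0 nu1 h1 h2.
apply: (flat_ext oT (form_eq_sym (ext z0 h1 h2))).
exact: (flat_gauge_at oT (gam_smooth oT fW _) (fun x => gam_unit fW f0) (nabla_form oT hd hn z0)
  (nabla_flat oT hd hn z0)).
Qed.

Lemma near_good (z : C1) (Pr : C -> Prop) :
  (forall w, w != 0 -> w != nu -> w != cstar nu -> Pr w) -> \forall w \near z^', Pr w.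
Proof.
move=> H; apply: (@near_except _ z [:: 0; nu; cstar nu]) => w.
by rewrite !inE !negb_or => /and3P[]; exact: H.
Qed.

(* At the poles of the dressing gauge flatness and reality follow by continuity. *)
Lemma h_flat z : z != 0 -> flat setT (h z).
Proof.
move=> z0 c p Up cp.
have fu t : is_form setT (up (F t)) by exact: up_form.
have hol := curvature_lcomb_hol (fun t => @phi_derivable t z z0) oT Up cp fu.
have := @mhol_eq_near R 6 6 _ (fun=> 0) z hol (@mhol_cst R 6 6 0 z); rewrite -h_lcomb; apply.
by apply: near_good => w h1 h2 h3; rewrite -h_lcomb; exact: h_flat_good.
Qed.

Lemma h_real_good z : z != 0 -> z != nu -> z != cstar nu -> form_eq setT (h (cstar z)) (conj_form Q (h z)).
Proof.
move=> z0 h1 h2 c p Up cp; have f0 := fP_neq0 nu1 h1 h2.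
have g1 : cstar z != nu by apply: contra_neq h2 => <-; rewrite cstarK.
have g2 : cstar z != cstar nu by apply: contra_neq h1 => e; rewrite -(cstarK z) e cstarK.
have E : conj_form Q (h z) c p = conj_form Q (gauge (gam pr (fP nu z)) (nabla z)) c p.
  exact: (congr1 (fun w => (bar6 Q w.2, bar6 Q w.1)) (ext z0 h1 h2 Up cp)).
rewrite (ext (cstar_neq0 z0) g1 g2 Up cp) E fP_star//.
rewrite -(gauge_gam_conj oT fW (nabla z) f0 Up cp).
by apply: (gauge_at oT Up cp); last exact: (nabla_real oT hd hn z0 Up cp).
Qed.

Lemma bar6_lcomb (G : I -> 'M[C]_4) w : bar6 Q (dwedgemx (\sum_t phi t (cstar w) *: G t)) =
  \sum_t conjc (phi t (cstar w)) *: bar6 Q (dwedgemx (G t)).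
Proof.
elim: (index_enum I) => [|t r IH]; first by rewrite !big_nil dwedgemx0 /bar6 map_mx0 mulmx0 mul0mx.
rewrite !big_cons dwedgemxD dwedgemxZ -IH -bar6Z.
by rewrite /bar6 map_mxD mulmxDr mulmxDl.
Qed.

Lemma h_real z : z != 0 -> form_eq setT (h (cstar z)) (conj_form Q (h z)).
Proof.
move=> z0 c p Up cp; have w0 := cstar_neq0 z0; set w1 := cstar z in w0 *.
(* Conjugation composed with z -> z^* preserves Laurent polynomials, so this side is holomorphic as
   well and the limit may be taken. *)
have dc t : derivable ((fun w => conjc (phi t (cstar w))) : C1 -> C1) w1 1.
  by have [N [M hL]] := hphi t; exact: laurent_derivable (laurent_conjinv hL) w0.
have hol (G : I -> 'M[C]_4) : mhol (fun w => bar6 Q (dwedgemx (\sum_t phi t (cstar w) *: G t))) w1.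
  have -> : (fun w => bar6 Q (dwedgemx (\sum_t phi t (cstar w) *: G t))) = _ := funext (bar6_lcomb G).
  exact: (@mhol_lcomb R I 6 6 _ (fun t => bar6 Q (dwedgemx (G t))) w1 dc).
have [m1 m2] := h_mhol c p w0.
have nr w : w != 0 -> w != nu -> w != cstar nu -> h w c p = conj_form Q (h (cstar w)) c p.
  move=> v0 v1 v2; rewrite -{1}(cstarK w); apply: h_real_good => //; first exact: cstar_neq0.
    by apply: contra_neq v2 => <-; rewrite cstarK.
  by apply: contra_neq v1 => e; rewrite -(cstarK w) e cstarK.
have e1 : (h w1 c p).1 = bar6 Q (h (cstar w1) c p).2.
  apply: (@mhol_eq_near R 6 6 (fun w => (h w c p).1) _ w1 m1 (hol (fun t => (F t c p).2))).
  by apply: near_good => w v0 v1 v2; exact: (congr1 fst (nr w v0 v1 v2)).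
have e2 : (h w1 c p).2 = bar6 Q (h (cstar w1) c p).1.
  apply: (@mhol_eq_near R 6 6 (fun w => (h w c p).2) _ w1 m2 (hol (fun t => (F t c p).1))).
  by apply: near_good => w v0 v1 v2; exact: (congr1 snd (nr w v0 v1 v2)).
rewrite /w1 cstarK -/w1 in e1 e2.
exact: (etrans (surjective_pairing _) (congr2 pair e1 e2)).
Qed.

Lemma lcomb_laurent c p i j : (exists N M, laurent N M (fun z => (lcomb phi F z c p).1 i j)) /\
  (exists N M, laurent N M (fun z => (lcomb phi F z c p).2 i j)).
Proof.
have E (G : I -> 'M[C]_4) : exists N M, laurent N M (fun z => (\sum_t phi t z *: G t) i j).
  elim: (index_enum I) => [|t r [N [M IH]]].
    by exists 0%N, 1%N; apply: laurent_ext (laurent_cst 0) => z _; rewrite big_nil mxE.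
  have [N' [M' hL]] := hphi t.
  have hf : exists N M, laurent N M (fun z => G t i j * phi t z) by exists N', M'; exact: laurentZ.
  have hg : exists N M, laurent N M (fun z => (\sum_(t0 <- r) phi t0 z *: G t0) i j) by exists N, M.
  have [N2 [M2 h2]] := laurent_exD hf hg.
  by exists N2, M2; apply: laurent_ext h2 => z _; rewrite big_cons mxE mxE mulrC.
exact: (conj (E _) (E _)).
Qed.

End Combination.

Lemma extended_family : exists h4 : C -> form1 Sg 4,
  [/\ (forall z, is_form setT (up (h4 z))), hol_family setT [set z : C1 | z != 0] (fun z => up (h4 z)),
      (forall z, metric Q setT (up (h4 z))), (forall z, z != 0 -> flat setT (up (h4 z))) &
   [/\ form_eq setT (up (h4 1)) (@zero_form _ Sg 6),
      (forall z, z != 0 -> form_eq setT (up (h4 (cstar z))) (conj_form Q (up (h4 z)))),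
      (forall z, z != 0 -> z != nu -> z != cstar nu ->
         form_eq setT (up (h4 z)) (gauge (gam pr (fP nu z)) (nabla z))) &
      (forall c p i j, (exists N M, laurent N M (fun z => (h4 z c p).1 i j)) /\
         (exists N M, laurent N M (fun z => (h4 z c p).2 i j)))]].
Proof.
have [I [phi [F [hphi fF tF ext]]]] := dressing_family hd hn nu0 nu1 spr hpr wpar.
exists (lcomb phi F); split.
- by move=> z; exact: h_form.
- exact: h_hol.
- by move=> z; exact: h_metric.
- by move=> z; exact: h_flat.
split; [exact: h_one|exact: h_real|exact: ext|exact: lcomb_laurent].
Qed.

(** A dressing gauge comes with an unspecified extension over the poles. Any two agree, so what is
    proved for the constructed one applies to each. *)
Lemma extension_unique (U : set Sg) (h h' : C -> form1 Sg 6) :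
  hol_family U [set z : C1 | z != 0] h -> hol_family U [set z : C1 | z != 0] h' ->
  (forall z, z != 0 -> z != nu -> z != cstar nu -> form_eq U (h z) (h' z)) ->
  forall z, z != 0 -> form_eq U (h z) (h' z).
Proof.
move=> hh hh' e z z0 c p Up cp.
have e1 : (h z c p).1 = (h' z c p).1.
  apply: (@mhol_eq_near R 6 6 (fun w => (h w c p).1) (fun w => (h' w c p).1) z).
  - by move=> i j; exact: ((hh c p Up cp i j).1 z z0).
  - by move=> i j; exact: ((hh' c p Up cp i j).1 z z0).
  by apply: near_good => w v0 v1 v2; rewrite (e w v0 v1 v2 c p Up cp).
have e2 : (h z c p).2 = (h' z c p).2.
  apply: (@mhol_eq_near R 6 6 (fun w => (h w c p).2) (fun w => (h' w c p).2) z).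
  - by move=> i j; exact: ((hh c p Up cp i j).2 z z0).
  - by move=> i j; exact: ((hh' c p Up cp i j).2 z z0).
  by apply: near_good => w v0 v1 v2; rewrite (e w v0 v1 v2 c p Up cp).
exact: (etrans (surjective_pairing _) (etrans (congr2 pair e1 e2) (esym (surjective_pairing _)))).
Qed.

End ExtendedFamily.

(** * Bounding poles at 0 and at infinity with the help of a determinant *)

Section PolynomialFunctions.
Variable R : realType.
Local Notation C := R[i].
Implicit Types (f g : C -> C).

Definition pol f := exists M, laurent 0 M f.

Lemma pol_ext f g : (forall z, z != 0 -> f z = g z) -> pol f -> pol g.
Proof. by move=> e [M h]; exists M; exact: laurent_ext h. Qed.

Lemma pol_poly (q : {poly C}) : pol (fun z => q.[z]).
Proof. by exists (size q), q => // z _; rewrite expr0 mul1r. Qed.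

Lemma polP f : pol f -> exists q : {poly C}, forall z, z != 0 -> f z = q.[z].
Proof. by move=> [M [q _ h]]; exists q => z z0; rewrite -h// expr0 mul1r. Qed.

Lemma pol_cst a : pol (fun=> a).
Proof. by exists 1%N; exact: laurent_cst. Qed.

Lemma pol_id : pol id.
Proof. by exists 2%N; exact: laurent_id. Qed.

Lemma polD f g : pol f -> pol g -> pol (fun z => f z + g z).
Proof.
move=> /polP[p hp] /polP[q hq]; apply: pol_ext (pol_poly (p + q)) => z z0.
by rewrite hornerD hp// hq.
Qed.

Lemma polM f g : pol f -> pol g -> pol (fun z => f z * g z).
Proof.
move=> /polP[p hp] /polP[q hq]; apply: pol_ext (pol_poly (p * q)) => z z0.
by rewrite hornerM hp// hq.
Qed.

Lemma polX n : pol (fun z => z ^+ n).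
Proof. by apply: pol_ext (pol_poly 'X^n) => z _; rewrite hornerXn. Qed.

Lemma pol_sum (I : Type) (r : seq I) (F : I -> C -> C) :
  (forall k, pol (F k)) -> pol (fun z => \sum_(k <- r) F k z).
Proof.
move=> hF; elim: r => [|k r IH]; first by apply: pol_ext (pol_cst 0) => z _; rewrite big_nil.
by apply: pol_ext (polD (hF k) IH) => z _; rewrite big_cons.
Qed.

Lemma pol_prod (I : Type) (r : seq I) (F : I -> C -> C) :
  (forall k, pol (F k)) -> pol (fun z => \prod_(k <- r) F k z).
Proof.
move=> hF; elim: r => [|k r IH]; first by apply: pol_ext (pol_cst 1) => z _; rewrite big_nil.
by apply: pol_ext (polM (hF k) IH) => z _; rewrite big_cons.
Qed.

Definition mpol m n (A : C -> 'M[C]_(m, n)) := forall i j, pol (fun z => A z i j).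

Lemma mpol_cst m n (M : 'M[C]_(m, n)) : mpol (fun=> M).
Proof. by move=> i j; exact: pol_cst. Qed.

Lemma mpolD m n (A B : C -> 'M[C]_(m, n)) : mpol A -> mpol B -> mpol (fun z => A z + B z).
Proof. by move=> hA hB i j; apply: pol_ext (polD (hA i j) (hB i j)) => z _; rewrite mxE. Qed.

Lemma mpolZ m n f (A : C -> 'M[C]_(m, n)) : pol f -> mpol A -> mpol (fun z => f z *: A z).
Proof. by move=> hf hA i j; apply: pol_ext (polM hf (hA i j)) => z _; rewrite mxE. Qed.

Lemma mpolB m n (A B : C -> 'M[C]_(m, n)) : mpol A -> mpol B -> mpol (fun z => A z - B z).
Proof.
move=> hA hB i j; apply: pol_ext (mpolD hA (mpolZ (pol_cst (-1)) hB) i j) => z _.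
by rewrite scaleN1r.
Qed.

Lemma mpolM m n k (A : C -> 'M[C]_(m, n)) (B : C -> 'M[C]_(n, k)) :
  mpol A -> mpol B -> mpol (fun z => A z *m B z).
Proof.
move=> hA hB i j; apply: pol_ext (pol_sum (index_enum _) (fun l => polM (hA i l) (hB l j))) => z _.
by rewrite mxE.
Qed.

Lemma pol_det n (A : C -> 'M[C]_n) : mpol A -> pol (fun z => \det (A z)).
Proof.
move=> hA; apply: pol_ext (pol_sum (index_enum _) (fun s : 'S_n =>
  polM (pol_cst ((-1) ^+ s)) (pol_prod (index_enum _) (fun i => hA i (s i))))) => z _.
by [].
Qed.

Lemma mpol_adj n (A : C -> 'M[C]_n) : mpol A -> mpol (fun z => \adj (A z)).
Proof.
move=> hA i j; apply: pol_ext (polM (pol_cst ((-1) ^+ (j + i))) (pol_det (A := fun z => row' j (col' i (A z))) _)) => [z _|k l].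
  by rewrite mxE.
by apply: pol_ext (hA (lift j k) (lift i l)) => z _; rewrite !mxE.
Qed.

Lemma mpol_lin m n r s (f : 'M[C]_(m, n) -> 'M[C]_(r, s)) (A : C -> 'M[C]_(m, n)) :
  (forall a X Y, f (a *: X + Y) = a *: f X + f Y) -> mpol A -> mpol (fun z => f (A z)).
Proof.
move=> lf hA a b.
apply: pol_ext (pol_sum (index_enum _) (fun i => pol_sum (index_enum _) (fun j =>
  pol_sum (index_enum _) (fun k => pol_sum (index_enum _) (fun l =>
  mpolZ (pol_cst (f (delta_mx i j) k l)) (mpolM (mpolM (mpol_cst (delta_mx k i)) hA) (mpol_cst (delta_mx j l))) a b))))) => z _.
rewrite [in RHS](lin_expand lf (A z)) summxE; apply: eq_bigr => i _.
by rewrite summxE; apply: eq_bigr => j _; rewrite summxE; apply: eq_bigr => k _; rewrite summxE.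
Qed.

Lemma poly_vanish (p : {poly C}) : (forall z, p.[z] = 0) -> p = 0.
Proof.
move=> H; apply/eqP/negPn/negP => p0.
have h1 : all (root p) [seq node R i | i <- iota 0 (size p)] by apply/allP => z _; rewrite rootE H.
have h2 : uniq [seq node R i | i <- iota 0 (size p)] by rewrite map_inj_uniq ?iota_uniq//; exact: node_inj.
by have := max_poly_roots p0 h1 h2; rewrite size_map size_iota ltnn.
Qed.

(** Multiplying by the product over the exceptional points turns an identity off these points into
    one everywhere. *)
Lemma poly_eq_cofinite (p q : {poly C}) (s : seq C) :
  (forall z, z \notin s -> p.[z] = q.[z]) -> p = q.
Proof.
move=> H; apply/eqP; rewrite -subr_eq0.
have /eqP : (p - q) * \prod_(a <- s) ('X - a%:P) = 0.
  apply: poly_vanish => z; rewrite hornerM; have [zs|zs] := boolP (z \in s).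
    have /eqP -> : root (\prod_(a <- s) ('X - a%:P)) z by rewrite root_prod_XsubC.
    by rewrite mulr0.
  by rewrite hornerD hornerN H// subrr mul0r.
by rewrite mulf_eq0 (negbTE (monic_neq0 (monic_prod_XsubC _ _ _))) orbF.
Qed.

(** With f = p / z^N, the relation reads p D = z^N q off finitely many points, hence identically.
    Since D does not vanish at 0 it is coprime to z^N, which must divide p. *)
Lemma pole_at_zero N M f g (D : {poly C}) (s : seq C) : laurent N M f -> pol g -> D.[0] != 0 ->
  (forall z, z != 0 -> z \notin s -> f z * D.[z] = g z) -> pol f.
Proof.
move=> [p _ pE] /polP[q qE] D0 H.
have e : p * D = 'X^N * q.
  apply: (@poly_eq_cofinite _ _ (0 :: s)) => z; rewrite inE negb_or => /andP[z0 zs].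
  by rewrite !hornerM hornerXn -pE// -mulrA H// qE.
have cop : coprimep 'X^N D.
  by rewrite coprimep_sym; apply: coprimep_expr; rewrite coprimepX.
have /dvdpP[r rE] : 'X^N %| p by rewrite -(Gauss_dvdpl _ cop) e dvdp_mulr.
apply: pol_ext (pol_poly r) => z z0.
by apply: (mulfI (expf_neq0 N z0)); rewrite pE// rE hornerM hornerXn mulrC.
Qed.

(** The reversed polynomial z^n q(1 / z): it moves the behaviour of q at infinity to 0. *)
Definition revp n (q : {poly C}) : {poly C} := \poly_(i < n.+1) q`_(n - i).

Lemma revpE n (q : {poly C}) w : (size q <= n.+1)%N -> w != 0 -> (revp n q).[w] = w ^+ n * q.[w^-1].
Proof.
move=> sq w0; rewrite horner_poly (horner_coef_wide _ sq) mulr_sumr (reindex_inj rev_ord_inj) /=.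
apply: eq_bigr => i _; rewrite subSS subKn; last by rewrite -ltnS.
rewrite -[X in w ^+ X * (_ * _)](subnK (_ : i <= n)%N); last by rewrite -ltnS.
have wi : w ^+ i != 0 by rewrite expf_neq0.
by rewrite exprD exprVn; move: (w ^+ (n - i)) (w ^+ i) wi => x y y0; field.
Qed.

(** If q had degree n > k, the reversed polynomial times D would be divisible by a positive power of
    z; its value at 0, the leading coefficient of q times the value of D, would then vanish. *)
Lemma pole_at_infinity k (q : {poly C}) g (D : {poly C}) (s : seq C) : pol g -> D.[0] != 0 ->
  (forall w, w != 0 -> w \notin s -> w ^+ k * q.[w^-1] * D.[w] = g w) -> (size q <= k.+1)%N.
Proof.
move=> /polP[r rE] D0 H; rewrite leqNgt; apply/negP => sq.
pose n := (size q).-1; have nS : n.+1 = size q by rewrite /n prednK// (leq_trans _ sq).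
have kn : (k < n)%N by rewrite -ltnS nS.
have e : revp n q * D = 'X^(n - k) * r.
  apply: (@poly_eq_cofinite _ _ (0 :: s)) => w; rewrite inE negb_or => /andP[w0 ws].
  rewrite !hornerM hornerXn -rE// -H// revpE ?nS// !mulrA -exprD subnK//; exact: ltnW.
have := congr1 (fun p => p.[0]) e; rewrite !hornerM hornerXn expr0n subn_eq0 leqNgt kn mul0r.
move/eqP; rewrite mulf_eq0 (negbTE D0) orbF horner_coef0 coef_poly /= subn0.
by rewrite -/(lead_coef q) lead_coef_eq0 -size_poly_eq0 -nS.
Qed.

End PolynomialFunctions.

(** * The dressing matrices on a single fibre *)

Section DressedSphere.
Variables (R : realType) (Q : quaternionic R).
Local Notation C := R[i].
Local Notation J := (jmx Q).
Local Notation conjmx := (map_mx (@conjc R)).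

Lemma barJ1 : barJ Q 1%:M = 1%:M.
Proof. by rewrite /barJ map_mx1 mulmx1 mulmxV// jmx_unit. Qed.

Lemma barJZ a (X : 'M[C]_4) : barJ Q (a *: X) = conjc a *: barJ Q X.
Proof. by rewrite /barJ map_mxZ -scalemxAr -scalemxAl. Qed.

Lemma comm_j_barJ (X : 'M[C]_4) : comm_j Q X <-> barJ Q X = X.
Proof.
split=> [/comm_j_conj //|e]; apply/comm_jP.
by rewrite -{1}e /barJ -mulmxA mulVmx ?mulmx1// jmx_unit.
Qed.

Lemma comm_j_inv (X : 'M[C]_4) : X \in unitmx -> comm_j Q X -> comm_j Q (invmx X).
Proof.
move=> uX /comm_j_barJ e; apply/comm_j_barJ.
have h : X *m barJ Q (invmx X) = 1%:M by rewrite -{1}e -barJM mulmxV// barJ1.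
by rewrite -[LHS]mul1mx -(mulVmx uX) -mulmxA h mulmx1.
Qed.

Lemma comm_j_mul (X Y : 'M[C]_4) : comm_j Q X -> comm_j Q Y -> comm_j Q (X *m Y).
Proof. by move=> /comm_j_barJ e /comm_j_barJ e'; apply/comm_j_barJ; rewrite barJM e e'. Qed.

Lemma barJB (X Y : 'M[C]_4) : barJ Q (X - Y) = barJ Q X - barJ Q Y.
Proof. by rewrite /barJ map_mxB mulmxBr mulmxBl. Qed.

Variables (nu : C) (W : {vspace 'cV[C]_4}) (P S X T : 'M[C]_4).
Hypotheses (nu0 : nu != 0) (nu1 : `|nu| != 1).
Hypothesis hP : splits Q P W (jimg Q W).
Hypotheses (SJ : comm_j Q S) (SS : S *m S = - 1%:M) (dS : \det S = 1).
Let mu0 : C := 'i%C * ((nu + 1) / (nu - 1)).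
Let mu1 : C := 'i%C * ((cstar nu + 1) / (cstar nu - 1)).
Hypothesis hX : X = mu0 *: P + mu1 *: (1%:M - P).
Hypothesis hT : T = X - S.

Let i0 := i_neq0 R.
Let n1 := nu_neq1 nu1.
Let s1 := cstar_nu_neq1 nu1.
Let n1' : nu - 1 != 0. Proof. by rewrite subr_eq0. Qed.
Let s1' : cstar nu - 1 != 0. Proof. by rewrite subr_eq0. Qed.
Let ii1 : 'i%C * 'i%C = -1 :> C := ii R.

(** The Cayley transform carries reflection in the unit circle to complex conjugation. This is what
    makes X commute with j. *)
Lemma conj_mu0 : conjc mu0 = mu1.
Proof.
have cn : conjc nu != 0 by rewrite conjc_eq0.
have h5 : conjc nu - 1 != 0.
  by rewrite subr_eq0; apply: contra_neq n1 => e; rewrite -(conjcK nu) e; exact: rmorph1.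
have -> : conjc mu0 = conjc 'i%C * ((conjc nu + 1) / (conjc nu - 1)).
  by rewrite /mu0 rmorphM fmorph_div rmorphB rmorphD rmorph1.
rewrite conjc_i /mu1.
have -> : cstar nu - 1 = (1 - conjc nu) / conjc nu by rewrite /cstar; field.
have -> : cstar nu + 1 = (1 + conjc nu) / conjc nu by rewrite /cstar; field.
move: (conjc nu) cn h5 => c cn h5; field.
by rewrite cn h5 -opprB oppr_eq0 h5.
Qed.

Lemma X_comm_j : comm_j Q X.
Proof.
apply/comm_j_barJ; have e := splits_conj hP.
rewrite hX barJD !barJZ barJB barJ1 -/(barJ Q P) -[barJ Q P]/(J *m conjmx P *m invmx J) e conj_mu0.
have -> : conjc mu1 = mu0 by rewrite -conj_mu0 conjcK.
by rewrite subKr addrC.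
Qed.

Lemma T_comm_j : comm_j Q T.
Proof.
by apply/comm_j_barJ; rewrite hT barJB; move/comm_j_barJ: X_comm_j => ->; move/comm_j_barJ: SJ => ->.
Qed.

Lemma XpE : X + 'i%C%:M = T + (2 * 'i%C) *: prp S.
Proof.
rewrite hT /prp scalerA mulrAC mulfV ?two_neq0// mul1r scalerBr scalerA ii1 scaleN1r opprK.
by rewrite scalemx1 addrA addrAC -addrA -addrA [S + _]addrC addNr addr0 || (apply/matrixP => a b; rewrite !mxE; ring).
Qed.

Lemma XmE : X - 'i%C%:M = T - (2 * 'i%C) *: (1%:M - prp S).
Proof.
have e : (2 * 'i%C) *: prp S = 'i%C%:M + S.
  by rewrite /prp scalerA mulrAC mulfV ?two_neq0// mul1r scalerBr scalerA ii1 scaleN1r opprK scalemx1.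
rewrite scalerBr e hT scalemx1; apply/matrixP => a b; rewrite !mxE; case: (a == b) => /=; ring.
Qed.

(** [alphaP] and [betaP] are the eigenvalues of [pz] on W and on jW. Their quotient is [fP], which
    identifies the dressing gauge with [pz] up to a scalar. *)
Definition alphaP (z : C) : C := 2 * 'i%C * (nu - z) / (nu - 1).
Definition betaP (z : C) : C := 2 * 'i%C * (cstar nu - z) / (cstar nu - 1).
Definition pz (z : C) : 'M[C]_4 := (X + 'i%C%:M) - z *: (X - 'i%C%:M).

Lemma pzE z : pz z = alphaP z *: P + betaP z *: (1%:M - P).
Proof.
have ea : alphaP z = (mu0 + 'i%C) - z * (mu0 - 'i%C) by rewrite /alphaP /mu0; field.
have eb : betaP z = (mu1 + 'i%C) - z * (mu1 - 'i%C) by rewrite /betaP /mu1; field.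
rewrite /pz hX ea eb; apply/matrixP => a b; rewrite !mxE; case: (a == b) => /=; ring.
Qed.

Lemma betaP_neq0 z : z != cstar nu -> betaP z != 0.
Proof.
by move=> h; rewrite /betaP !mulf_neq0 ?two_neq0 ?invr_neq0// subr_eq0 eq_sym.
Qed.

Lemma fP_alpha z : z != cstar nu -> fP nu z = alphaP z / betaP z.
Proof.
move=> h; have h' : cstar nu - z != 0 by rewrite subr_eq0 eq_sym.
rewrite /fP /betaP /alphaP; move: n1' s1' h' i0; move: ('i%C : C) (cstar nu) => i c n2 s2 h2 i2; field.
have n3 : 1 - nu != 0 by rewrite -opprB oppr_eq0.
have h3 : z - c != 0 by rewrite -opprB oppr_eq0.
by rewrite s2 h2 i2 n2 h3 n3.
Qed.

Lemma dilat_fP z : z != cstar nu -> dilat (fP nu z) P = (betaP z)^-1 *: pz z.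
Proof.
move=> h; have b0 := betaP_neq0 h; rewrite pzE scalerDr !scalerA mulVf// scale1r /dilat.
by rewrite fP_alpha// mulrC.
Qed.

(** The product of the three dilations that retwist the dressed family, freed of its scalar
    denominator; [rc] is the same matrix in the coordinate w = 1 / z, multiplied by w^2. *)
Definition rz (z : C) : 'M[C]_4 := (1 - z ^+ 2) *: T + (2 * 'i%C) *:
  ((T *m prp S *m invmx T + z *: (1%:M - T *m prp S *m invmx T)) *m (prp S + z *: (1%:M - prp S))).
Definition rc (w : C) : 'M[C]_4 := (w ^+ 2 - 1) *: T + (2 * 'i%C) *:
  ((w *: (T *m prp S *m invmx T) + (1%:M - T *m prp S *m invmx T)) *m (w *: prp S + (1%:M - prp S))).

Lemma rz_inv w : w != 0 -> rz w^-1 = w ^- 2 *: rc w.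
Proof.
move=> w0; rewrite /rz /rc [RHS]scalerDr; congr (_ + _).
  by rewrite scalerA; congr (_ *: _); field.
rewrite [RHS]scalerA [w ^- 2 * _]mulrC -[RHS]scalerA; congr (_ *: _).
have e (A B : 'M[C]_4) : A + w^-1 *: B = w^-1 *: (w *: A + B) by rewrite scalerDr scalerA mulVf// scale1r.
by rewrite !e -scalemxAl -scalemxAr scalerA expr2 invfM.
Qed.

Hypothesis uT : T \in unitmx.
Local Notation Sh := (T *m S *m invmx T).

Lemma prpJ : prp Sh = T *m prp S *m invmx T.
Proof.
by rewrite /prp -scalemxAr -scalemxAl mulmxBr mulmxBl mulmx1 mulmxV// -scalemxAr -scalemxAl.
Qed.

Lemma Sh_comm_j : comm_j Q Sh.
Proof. exact: (comm_j_mul (comm_j_mul T_comm_j SJ) (comm_j_inv uT T_comm_j)). Qed.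

Lemma Sh_sq : Sh *m Sh = - 1%:M.
Proof.
by rewrite !mulmxA -[_ *m invmx T *m T]mulmxA mulVmx// mulmx1 -(mulmxA T) SS mulmxN mulmx1 mulNmx mulmxV.
Qed.

Lemma Sh_det : \det Sh = 1.
Proof. by rewrite !det_mulmx dS mulr1 -det_mulmx mulmxV// det1. Qed.

Lemma mximg_T_Sp : mximg T (Sp S) = Sp Sh.
Proof.
apply: vspace_eq => v; split=> [/mximgP[u /mem_Sp e ->]|/mem_Sp e].
  by apply/mem_Sp; rewrite -!mulmxA mulKmx// e scalemxAr.
have -> : v = T *m (invmx T *m v) by rewrite mulmxA mulmxV// mul1mx.
apply: mem_mximg; apply/mem_Sp; apply: (can_inj (mulKmx uT)).
by rewrite -scalemxAr mulKVmx// -e !mulmxA.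
Qed.

Lemma mximg_T_Sm : mximg T (Sm S) = Sm Sh.
Proof.
apply: vspace_eq => v; split=> [/mximgP[u /mem_Sm e ->]|/mem_Sm e].
  by apply/mem_Sm; rewrite -!mulmxA mulKmx// e scalemxAr.
have -> : v = T *m (invmx T *m v) by rewrite mulmxA mulmxV// mul1mx.
apply: mem_mximg; apply/mem_Sm; apply: (can_inj (mulKmx uT)).
by rewrite -scalemxAr mulKVmx// -e !mulmxA.
Qed.

(** V intertwines the two splittings, so the outer dilations cancel on the V-term. On the other term
    the right dilation yields a factor z that absorbs the 1 / z on the left, and no negative power
    of z survives. *)
Lemma rz_algebra (p p' h h' V : 'M[C]_4) (z t : C) : p *m p = p -> p *m p' = 0 -> p' *m p = 0 ->
  p' *m p' = p' -> h *m V = V *m p -> h' *m V = V *m p' -> p + p' = 1%:M -> z != 0 ->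
  (z^-1 *: h + h') *m ((1 - z ^+ 2) *: V + t *: (p + z ^+ 2 *: p')) *m (z *: p + p') =
  (1 - z ^+ 2) *: V + t *: ((h + z *: h') *m (p + z *: p')).
Proof.
move=> pp pp' p'p p'p' hV h'V s z0.
have e2 : (z^-1 *: h + h') *m V *m (z *: p + p') = V.
  have -> : (z^-1 *: h + h') *m V = V *m (z^-1 *: p + p').
    by rewrite mulmxDl mulmxDr -scalemxAl -scalemxAr hV h'V.
  have -> : V *m (z^-1 *: p + p') *m (z *: p + p') = V *m ((z^-1 *: p + p') *m (z *: p + p')) by rewrite mulmxA.
  have -> : (z^-1 *: p + p') *m (z *: p + p') = 1%:M.
    rewrite mulmxDl !mulmxDr -!scalemxAl -!scalemxAr pp pp' p'p p'p' scalerA mulVf// !scaler0.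
    by rewrite !(addr0, add0r) scale1r s.
  by rewrite mulmx1.
have e3 : (z^-1 *: h + h') *m (p + z ^+ 2 *: p') *m (z *: p + p') = (h + z *: h') *m (p + z *: p').
  rewrite -mulmxA.
  have -> : (p + z ^+ 2 *: p') *m (z *: p + p') = z *: (p + z *: p').
    rewrite mulmxDl !mulmxDr -!scalemxAl -!scalemxAr pp pp' p'p p'p' !scaler0 addr0 add0r.
    by rewrite scalerDr scalerA expr2.
  by rewrite -scalemxAr scalemxAl scalerDr scalerA mulfV// scale1r.
move: (z^-1 *: h + h') (z *: p + p') e2 e3 => A B e2 e3.
by rewrite mulmxDr mulmxDl -!scalemxAr -!scalemxAl e2 e3.
Qed.

Lemma rz_product z : z != 0 -> z ^+ 2 != cstar nu ->
  dilat z^-1 (prp Sh) *m dilat (fP nu (z ^+ 2)) P *m dilat z (prp S) = (betaP (z ^+ 2))^-1 *: rz z.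
Proof.
move=> z0 zs; rewrite dilat_fP// -scalemxAr -scalemxAl; congr (_ *: _).
pose p := prp S; pose p' : 'M[C]_4 := 1%:M - p; pose h := T *m p *m invmx T; pose h' : 'M[C]_4 := 1%:M - h.
have pp : p *m p = p := splits_idem (splits_sphere SJ SS).
have pp' : p *m p' = 0 by rewrite /p' mulmxBr mulmx1 pp subrr.
have p'p : p' *m p = 0 by rewrite /p' mulmxBl mul1mx pp subrr.
have p'p' : p' *m p' = p' by rewrite {1}/p' mulmxBl mul1mx pp' subr0.
have hT' : h *m T = T *m p by rewrite /h -mulmxA mulVmx// mulmx1.
have h'T : h' *m T = T *m p' by rewrite /h' /p' mulmxBl mulmxBr mul1mx mulmx1 hT'.
have e1 : pz (z ^+ 2) = (1 - z ^+ 2) *: T + (2 * 'i%C) *: (p + z ^+ 2 *: p').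
  have gen (A B D : 'M[C]_4) (y t : C) :
      (A + t *: B) - y *: (A - t *: D) = (1 - y) *: A + t *: (B + y *: D).
    by apply/matrixP => a b; rewrite !mxE; ring.
  by rewrite /pz XpE XmE; exact: gen.
rewrite prpJ e1; apply: rz_algebra => //; by rewrite addrC subrK.
Qed.

(** The outer dilations have determinants z^-2 and z^2, the middle one the square of alpha / beta;
    the scalar beta, of weight four in the determinant, clears the denominator. *)
Lemma det_rz z : z != 0 -> z ^+ 2 != cstar nu -> \det (rz z) = (alphaP (z ^+ 2) * betaP (z ^+ 2)) ^+ 2.
Proof.
move=> z0 zs; have b0 := betaP_neq0 zs.
have sp := splits_sphere SJ SS; have sh := splits_sphere Sh_comm_j Sh_sq.
have d3 := etrans (det_mulmx (dilat z^-1 (prp Sh) *m dilat (fP nu (z ^+ 2)) P) (dilat z (prp S)))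
  (congr2 *%R (etrans (det_mulmx (dilat z^-1 (prp Sh)) (dilat (fP nu (z ^+ 2)) P))
    (congr2 *%R (det_dilat sh z^-1) (det_dilat hP (fP nu (z ^+ 2))))) (det_dilat sp z)).
have e := etrans (esym d3) (etrans (congr1 determinant (rz_product z0 zs)) (detZ _ _)).
rewrite (fP_alpha zs) in e; apply: (mulfI (expf_neq0 4 (invr_neq0 b0))); rewrite -e.
by move: (alphaP _) (betaP _) b0 => a b b0; field; rewrite z0 b0.
Qed.

Lemma mximg_P0 : mximg (gam6 P (fP nu 0)) (Vpm S) = Vpm Sh.
Proof.
have s0 : (0 : C) != cstar nu by rewrite eq_sym cstar_neq0.
have n0 : (0 : C) != nu by rewrite eq_sym.
have f0 := fP_neq0 nu1 n0 s0; have b0 := betaP_neq0 s0.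
rewrite /gam6 mximgZ ?invr_neq0// dilat_fP// wedgemxZ mximgZ ?expf_neq0 ?invr_neq0//.
rewrite /Vpm mximg_wedgesp -mximg_T_Sm; suff -> : mximg (pz 0) (Sm S) = mximg T (Sm S) by [].
apply: mximg_eq => v; rewrite (splits_memF (splits_sphere SJ SS)) => /eqP e.
by rewrite /pz scale0r subr0 XpE mulmxDl -scalemxAl e scaler0 addr0.
Qed.

Lemma dilat_foo : dilat ((1 - cstar nu) / (1 - nu)) P = ((cstar nu - 1) / (2 * 'i%C)) *: (X - 'i%C%:M).
Proof.
have n1'' : 1 - nu != 0 by rewrite subr_eq0 eq_sym.
have s1'' : 1 - cstar nu != 0 by rewrite subr_eq0 eq_sym.
have -> : X - 'i%C%:M = (2 * 'i%C / (nu - 1)) *: P + (2 * 'i%C / (cstar nu - 1)) *: (1%:M - P).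
  have ea : 2 * 'i%C / (nu - 1) = mu0 - 'i%C by rewrite /mu0; field.
  have eb : 2 * 'i%C / (cstar nu - 1) = mu1 - 'i%C by rewrite /mu1; field.
  rewrite hX ea eb; apply/matrixP => a b; rewrite !mxE; case: (a == b) => /=; ring.
rewrite scalerDr !scalerA /dilat -[1%:M - P in LHS]scale1r.
move: n1'' s1'' n1' s1' i0; move: ('i%C : C) (cstar nu) => i c n2 s2 n3 s3 i2.
by congr (_ *: _ + _ *: _); field; rewrite ?(n2, s2, n3, s3, i2, two_neq0).
Qed.

Lemma mximg_Poo : mximg (gam6 P ((1 - cstar nu) / (1 - nu))) (Vpp S) = Vpp Sh.
Proof.
have n1'' : 1 - nu != 0 by rewrite subr_eq0 eq_sym.
have s1'' : 1 - cstar nu != 0 by rewrite subr_eq0 eq_sym.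
have f0 : (1 - cstar nu) / (1 - nu) != 0 by rewrite mulf_neq0 ?invr_neq0.
rewrite /gam6 mximgZ ?invr_neq0// dilat_foo wedgemxZ mximgZ ?expf_neq0 ?mulf_neq0 ?invr_neq0 ?mulf_neq0 ?two_neq0//.
rewrite /Vpp mximg_wedgesp -mximg_T_Sp; suff -> : mximg (X - 'i%C%:M) (Sp S) = mximg T (Sp S) by [].
apply: mximg_eq => v; rewrite (splits_memE (splits_sphere SJ SS)) => /eqP e'.
by rewrite XmE mulmxBl -scalemxAl mulmxBl mul1mx e' subrr scaler0 subr0.
Qed.

End DressedSphere.

Section SmoothData.
Variables (R : realType) (Q : quaternionic R) (Sg : riemannSurface R).
Local Notation C := R[i].
Local Notation C1 := (R[i]^o).
Local Notation R2 := (R * R)%type.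
Implicit Types (c : chart Sg).

Let oT : open [set: Sg] := openT.

Lemma ofC_cvg (V : Type) (F : set_system V) (FF : Filter F) (f : V -> C1) (z : C1) :
  f x @[x --> F] --> z -> ofC (f x) @[x --> F] --> ofC z.
Proof.
move=> /cvgrPdist_le H.
have h1 : complex.Re (f x) @[x --> F] --> complex.Re z.
  apply/cvgrPdist_le => e e0; have e0' : (0 : C) < e%:C%C by rewrite ltcR.
  apply: filterS (H _ e0') => w; rewrite -lecR; apply: le_trans.
  by rewrite -raddfB; exact: norm_Re_le.
have h2 : complex.Im (f x) @[x --> F] --> complex.Im z.
  apply/cvgrPdist_le => e e0; have e0' : (0 : C) < e%:C%C by rewrite ltcR.
  apply: filterS (H _ e0') => w; rewrite -lecR; apply: le_trans.
  by rewrite -raddfB; exact: norm_Im_le.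
exact: (cvg_pair h1 h2).
Qed.

(** A non-zero determinant has a non-zero real or imaginary part, and each of these is a continuous
    real function in a chart. *)
Lemma open_unitmx n (f : Sg -> 'M[C]_n) : smooth_on setT f -> open [set p | f p \in unitmx].
Proof.
move=> /smooth_onP sf; rewrite openE => p Up; rewrite /interior.
have [c cp] := cdom_cover p; have [dR dI] := csm_det oT (sf c).
pose a := ofC (cmap c p); have Ia : cimg c setT a by exact: cimg_mem.
have cc : cmap c x @[x --> p] --> cmap c p.
  have := @cmap_cont _ _ c; rewrite continuous_open_subspace; last exact: cdom_open.
  by apply; exact: mem_set.
have ca : ofC (cmap c x) @[x --> p] --> a by exact: ofC_cvg.
have np : \forall x \near p, cdom c x by apply: open_nbhs_nbhs; split=> //; exact: cdom_open.
have key (g : R2 -> R) : {for a, continuous g} -> g a != 0 ->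
    \forall x \near p, g (ofC (cmap c x)) != 0.
  by move=> cg ga; apply: (@cvgr_neq0 _ _ _ _ _ (fun x => g (ofC (cmap c x))) (g a) _ ga); exact: cvg_comp ca cg.
have E x : cdom c x -> in_chart c (fun x => \det (f x)) (ofC (cmap c x)) = \det (f x) by exact: in_chartE.
have := Up; rewrite /= unitmxE unitfE -E// => nz.
have [n1|n1] := eqVneq (complex.Re (in_chart c (fun x => \det (f x)) a)) 0.
  have n2 : complex.Im (in_chart c (fun x => \det (f x)) a) != 0.
    by apply: contra_neq nz => n2; apply/eqP; rewrite eq_complex n1 n2 !eqxx.
  apply: filterS (filterI np (key _ (dI 0%N a Ia) n2)) => x [cx /= h].
  by rewrite unitmxE unitfE -E//; apply: contra_neq h => ->.
apply: filterS (filterI np (key _ (dR 0%N a Ia) n1)) => x [cx /= h].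
by rewrite unitmxE unitfE -E//; apply: contra_neq h => ->.
Qed.

Lemma smooth_frame4 U (a b e f : Sg -> 'cV[C]_4) : open U -> smooth_on U a -> smooth_on U b ->
  smooth_on U e -> smooth_on U f -> smooth_on U (fun x => frame4 (a x) (b x) (e x) (f x)).
Proof.
move=> oU /smooth_onP sa /smooth_onP sb /smooth_onP se /smooth_onP sf; apply/smooth_onP => c i k.
have E (g : Sg -> 'cV[C]_4) : smc c U g -> (forall x, frame4 (a x) (b x) (e x) (f x) i k = g x i 0) ->
    csm (cimg c U) (in_chart c (fun x => frame4 (a x) (b x) (e x) (f x) i k)).
  move=> sg h; have -> : in_chart c (fun x => frame4 (a x) (b x) (e x) (f x) i k) = in_chart c (fun x => g x i 0).
    by apply/funext => t; exact: h.
  exact: sg.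
move: k E; apply: ord4_ind => E.
- by apply: (E a) => // x; rewrite mxE.
- by apply: (E b) => // x; rewrite mxE.
- by apply: (E e) => // x; rewrite mxE.
- by apply: (E f) => // x; rewrite mxE.
Qed.

Lemma smooth_qj U (a : Sg -> 'cV[C]_4) : open U -> smooth_on U a -> smooth_on U (fun x => qj Q (a x)).
Proof.
by move=> oU sa; exact: (smooth_onM oU (@smooth_on_cst _ _ _ _ U (jmx Q)) (smooth_on_conj oU sa)).
Qed.

(** In the local frame (s0, s1, j s0, j s1) the projection is diag(1, 1, 0, 0); it is smooth as the
    conjugate of a constant matrix by the frame. *)
Lemma projection_smooth (W : Sg -> {vspace 'cV[C]_4}) (pr : Sg -> 'M[C]_4) :
  subbundle setT 2 W -> (forall p, (W p + jimg Q (W p))%VS = fullv) ->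
  (forall p, splits Q (pr p) (W p) (jimg Q (W p))) -> smooth_on setT pr.
Proof.
move=> sW WJ hpr; apply: smooth_on_local => p _.
have [N [s [oN Np _ ss sb]]] := sW p I; exists N; split=> //.
pose s0 := s (@Ordinal 2 0 isT); pose s1 := s (@Ordinal 2 1 isT).
have sE x : N x -> W x = <<[:: s0 x; s1 x]>>%VS.
  move=> Nx; rewrite -(span_basis (sb x Nx)); apply: eq_span => v; rewrite !inE.
  apply/mapP/orP => [[k _ ->]|[/eqP ->|/eqP ->]].
  - by case: k => -[|[|k]] // ik; [left|right]; apply/eqP; congr (s _ x); apply: val_inj.
  - by exists (@Ordinal 2 0 isT); rewrite ?mem_enum.
  - by exists (@Ordinal 2 1 isT); rewrite ?mem_enum.
pose M x := frame4 (s0 x) (s1 x) (qj Q (s0 x)) (qj Q (s1 x)).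
have sM : smooth_on N M.
  by apply: smooth_frame4 => //; try apply: smooth_qj => //; exact: ss.
have uM x : N x -> M x \in unitmx.
  by move=> Nx; apply: (@frame4_unit _ Q); apply: (quaternionic_frame_det (WJ x)); exact: sE.
pose D : 'M[C]_4 := \matrix_(i, j) ((i == j) && (i < 2)%N)%:R.
apply: (smooth_on_ext oN (f := fun x => M x *m D *m invmx (M x))) => [x Nx|]; last first.
  apply: (smooth_onM oN); last exact: smooth_onV.
  by apply: (smooth_onM oN sM); exact: smooth_on_cst.
suff e : M x *m D = pr x *m M x by rewrite e -mulmxA mulmxV ?mulmx1 ?uM.
have h0 : pr x *m s0 x = s0 x.
  by apply/eqP; rewrite -(splits_memE (hpr x)) sE// memv_span// inE eqxx.
have h1 : pr x *m s1 x = s1 x.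
  by apply/eqP; rewrite -(splits_memE (hpr x)) sE// memv_span// !inE eqxx orbT.
have jW v : v \in W x -> pr x *m qj Q v = 0.
  by move=> vW; apply/eqP; rewrite -(splits_memF (hpr x)) mem_jimg qjK memvN.
have j0 : pr x *m qj Q (s0 x) = 0 by apply: jW; rewrite sE// memv_span// inE eqxx.
have j1 : pr x *m qj Q (s1 x) = 0 by apply: jW; rewrite sE// memv_span// !inE eqxx orbT.
have C0 (A : 'M[C]_4) (v : 'cV[C]_4) k : (forall i, M x i k = v i 0) ->
    forall i, (A *m M x) i k = (A *m v) i 0.
  by move=> h i; rewrite !mxE; apply: eq_bigr => l _; rewrite h.
have MD i k : (M x *m D) i k = M x i k *+ (k < 2)%N.
  rewrite mxE (bigD1 k)//= big1 => [|l lk]; last by rewrite [D _ _]mxE (negbTE lk) mulr0.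
  by rewrite addr0 [D _ _]mxE eqxx /= mulr_natr.
apply/matrixP => i k; rewrite MD; move: k; apply: ord4_ind.
- by rewrite (C0 _ (s0 x)) ?h0 => [|l]; rewrite /M !mxE.
- by rewrite (C0 _ (s1 x)) ?h1 => [|l]; rewrite /M !mxE.
- by rewrite (C0 _ (qj Q (s0 x))) ?j0 => [|l]; rewrite ?mxE /M ?mxE.
- by rewrite (C0 _ (qj Q (s1 x))) ?j1 => [|l]; rewrite ?mxE /M ?mxE.
Qed.

End SmoothData.

Section DressingGauge.
Variables (R : realType) (Q : quaternionic R) (Sg : riemannSurface R).
Local Notation C := R[i].
Local Notation C1 := (R[i]^o).
Implicit Types (c : chart Sg).

Let oT : open [set: Sg] := openT.

(** Makes the dependence on the scalar explicit, so that holomorphy of the gauge reduces to that of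
    the scalar and of its inverse. *)
Lemma Gam_combination (p : 'M[C]_4) E F : splits Q p E F -> exists A B D : 'M[C]_6,
  forall z, Gam Q (wedgesp E E) (wedgesp F F) z = A + z *: B + z^-1 *: D.
Proof.
move=> sp; have [a [b [e [f [_ _ nz _ [-> -> uu vv uv]]]]]] := splits_frame sp.
have nuv : ip Q (wedge a b) (wedge e f) != 0 by rewrite uv.
set u := wedge a b in uu uv nuv *; set v := wedge e f in vv uv nuv *.
have op (x y w : 'cV[C]_6) : (x *m (y^T *m gram Q)) *m w = ip Q y w *: x.
  by rewrite -mulmxA -mulmxA [y^T *m _]mulmxA [_ *m w]mx11_scalar mul_mx_scalar.
pose B := (ip Q u v)^-1 *: (u *m (v^T *m gram Q)); pose D := (ip Q u v)^-1 *: (v *m (u^T *m gram Q)).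
have Bw w : B *m w = (ip Q v w / ip Q u v) *: u by rewrite /B -scalemxAl op scalerA mulrC.
have Dw w : D *m w = (ip Q u w / ip Q u v) *: v by rewrite /D -scalemxAl op scalerA mulrC.
exists (1%:M - B - D), B, D => z; apply: eq_on_wedges => s t.
have [h _ _ _ _] := GamE z uu vv nuv (wedge s t); rewrite h {h}.
move: (wedge s t) => w; clearbody B D u v.
rewrite [RHS]mulmxDl [X in _ = X + _]mulmxDl [X in _ = X + _ + _]mulmxBl [X in _ = X - _ + _ + _]mulmxBl.
rewrite mul1mx -!scalemxAl Bw Dw.
by apply/matrixP => i j; rewrite !mxE; ring.
Qed.

Lemma complementary_sym (L M : {vspace 'cV[C]_6}) : complementary Q L M -> complementary Q M L.
Proof.
by move=> [h1 h2 h3 h4 [u [v [hu hv huv]]]]; split=> //; exists v, u; rewrite ipC.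
Qed.

Lemma is_form_sub n (U V : set Sg) (w : form1 Sg n) : V `<=` U -> is_form U w -> is_form V w.
Proof.
move=> VU [sw cw]; split=> [c|c c' p Vp cp cp']; last by apply: cw => //; exact: VU.
have sub : V `&` cdom c `<=` U `&` cdom c by move=> x [/VU].
by have [s1 s2] := sw c; split; [exact: smooth_on_sub sub s1|exact: smooth_on_sub sub s2].
Qed.

Variables (k : nat) (S : Sg -> 'M[C]_4) (d nabla : C -> form1 Sg 6).
Hypotheses (hd : twisted_harmonic Q setT k S d) (hn : untwisted Q setT S d nabla).
Variables (nu : C).
Hypotheses (nu0 : nu != 0) (nu1 : `|nu| != 1).
Variables (W : Sg -> {vspace 'cV[C]_4}) (pr : Sg -> 'M[C]_4).
Hypotheses (spr : smooth_on setT pr) (hpr : forall p, splits Q (pr p) (W p) (jimg Q (W p))).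
Hypothesis wpar : parallel setT (form4 (nabla nu)) W.
Variables (X T : Sg -> 'M[C]_4).
Local Notation mu0 := ('i%C * ((nu + 1) / (nu - 1))).
Local Notation mu1 := ('i%C * ((cstar nu + 1) / (cstar nu - 1))).
Hypothesis hX : forall p, X p = mu0 *: pr p + mu1 *: (1%:M - pr p).
Hypothesis hT : forall p, T p = X p - S p.
Local Notation U := [set p | T p \in unitmx].
Local Notation Sh := (fun p => T p *m S p *m invmx (T p)).

Let fW := W_field spr hpr.
Let SJ p : comm_j Q (S p). Proof. by have [[_ h] _ _] := th_sphere hd; exact: h. Qed.
Let SS p : S p *m S p = - 1%:M. Proof. by have [_ _ h] := th_sphere hd; exact: h. Qed.
Let dS p : \det (S p) = 1. Proof. by have [_ h _] := th_sphere hd; exact: h. Qed.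

Lemma X_section : gl_section Q setT X.
Proof.
split=> [|p _]; last exact: (X_comm_j nu0 nu1 (hpr p) (hX p)).
have s1 := @smooth_on_cst R Sg _ _ setT (1%:M : 'M[C]_4).
apply: (smooth_on_ext oT (fun x _ => esym (hX x))).
by apply: (smooth_onD oT); apply: (smooth_onZ _ oT) => //; exact: (smooth_onB oT).
Qed.

Lemma T_section : gl_section Q setT T.
Proof.
split=> [|p _]; last exact: (T_comm_j nu0 nu1 (hpr p) (SJ p) (hX p) (hT p)).
apply: (smooth_on_ext oT (fun x _ => esym (hT x))).
by apply: (smooth_onB oT); [have [] := X_section|have [[]] := th_sphere hd].
Qed.

Lemma U_open : open U.
Proof. by apply: open_unitmx; have [] := T_section. Qed.

Let oU := U_open.
Let subU : U `<=` setT. Proof. by []. Qed.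

Lemma Sh_sphere : sphere_bundle Q U Sh.
Proof.
have [sT _] := T_section; have [[sS _] _ _] := th_sphere hd.
split; first split.
- have sT' := smooth_on_sub subU sT; apply: (smooth_onM oU); last exact: smooth_onV.
  by apply: (smooth_onM oU sT'); exact: smooth_on_sub subU sS.
- by move=> p Up; exact: (Sh_comm_j nu0 nu1 (hpr p) (SJ p) (hX p) (hT p) Up).
- by move=> p Up; exact: (Sh_det (dS p) Up).
- by move=> p Up; exact: (Sh_sq (SS p) Up).
Qed.

(** X is affine in the projection onto W and S is affine in [prp S]; the differentials of both
    projections are already known to be forms. *)
Lemma dform_T : is_form setT (dform T).
Proof.
have dW := dform_W hd hn nu0 spr hpr wpar; have dS' := dform_prp oT hd.
have [sS _] := sphere_field oT (th_sphere hd).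
have s1 := @smooth_on_cst R Sg _ _ setT ((mu1 + 'i%C)%:M : 'M[C]_4).
have z1 := smooth_onZ (mu0 - mu1) oT spr; have z2 := smooth_onZ (- (2 * 'i%C)) oT sS.
have := dformD oT (smooth_onD oT z1 z2) s1 (dformD oT z1 z2 (dformZ oT _ spr dW) (dformZ oT _ sS dS'))
  (dform_cst oT (mu1 + 'i%C)%:M).
apply: (dform_ext oT) => p _; have e := XpE (hT p); rewrite hX in e.
have -> : T p = mu0 *: pr p + mu1 *: (1%:M - pr p) + 'i%C%:M - (2 * 'i%C) *: prp (S p) by rewrite e addrK.
move: mu0 mu1 (pr p) (prp (S p)) => m0 m1 A B.
by apply/matrixP => a b; rewrite !mxE; case: (a == b) => /=; ring.
Qed.

Lemma dform_Sh : is_form U (dform (fun p => prp (Sh p))).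
Proof.
have [sS _] := sphere_field oT (th_sphere hd); have [sT _] := T_section.
have sT' := smooth_on_sub subU sT; have sS' := smooth_on_sub subU sS.
have dT := is_form_sub subU dform_T; have dS' := is_form_sub subU (dform_prp oT hd).
have sV := smooth_onV oU (fun x (Ux : U x) => Ux) sT'.
have := dformM oU (smooth_onM oU sT' sS') sV (dformM oU sT' sS' dT dS') (dformV oU sT' (fun x (Ux : U x) => Ux) dT).
by apply: (dform_ext oU) => p Up; rewrite (prpJ _ Up).
Qed.

Local Notation P := (P_gauge Q nu (fun p => wedgesp (W p) (W p))).
Local Notation foo := ((1 - cstar nu) / (1 - nu)).

Lemma P_some z p : z != nu -> z != cstar nu -> P (Some z) p = gam pr (fP nu z) p.
Proof.
move=> h1 h2; rewrite /P_gauge conjsp6_wedgesp; exact: (Gam_splits (hpr p) (fP_neq0 nu1 h1 h2)).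
Qed.

Lemma foo_neq0 : foo != 0.
Proof.
have h3 := nu_neq1 nu1; have h4 := cstar_nu_neq1 nu1.
by rewrite mulf_neq0 ?invr_neq0// subr_eq0 eq_sym.
Qed.

Lemma P_none p : P None p = gam pr foo p.
Proof. by rewrite /P_gauge conjsp6_wedgesp; exact: (Gam_splits (hpr p) foo_neq0). Qed.

Lemma domP_cases m : dom_P nu m ->
  (exists z, [/\ m = Some z, z != nu & z != cstar nu]) \/ m = None.
Proof.
case: m => [z [h1 h2]|_]; last by right.
by left; exists z; split=> //; apply/eqP => e; [apply: h1|apply: h2]; rewrite e.
Qed.

Lemma domP_gam m : dom_P nu m -> exists2 f, f != 0 & forall p, P m p = gam pr f p.
Proof.
move=> /domP_cases[[z [-> h1 h2]]|->].
  by exists (fP nu z); [exact: fP_neq0|move=> p; exact: P_some].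
by exists foo; [exact: foo_neq0|exact: P_none].
Qed.

Lemma P0_image p : U p -> mximg (P (Some 0) p) (Vpm (S p)) = Vpm (Sh p).
Proof.
move=> Up; have h0 : (0 : C) != nu by rewrite eq_sym.
have h0' : (0 : C) != cstar nu by rewrite eq_sym cstar_neq0.
have e := mximg_P0 nu0 nu1 (SJ p) (SS p) (hX p) (hT p) Up.
exact: (etrans (congr1 (fun M => mximg M (Vpm (S p))) (P_some p h0 h0')) e).
Qed.

Lemma Poo_image p : U p -> mximg (P None p) (Vpp (S p)) = Vpp (Sh p).
Proof.
move=> Up; have e := mximg_Poo nu1 (SJ p) (SS p) (hX p) (hT p) Up.
exact: (etrans (congr1 (fun M => mximg M (Vpp (S p))) (P_none p)) e).
Qed.

(** The reflection z -> z^* exchanges 0 and infinity, so the reality of the gauge there is this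
    relation between its two scalars. *)
Lemma fP0_star : fP nu 0 = cstar foo.
Proof.
have h3 := nu_neq1 nu1; have h4 := cstar_nu_neq1 nu1; have cn : conjc nu != 0 by rewrite conjc_eq0.
rewrite /fP [in RHS]/cstar !rmorphM !fmorphV !rmorphB !rmorph1 /= !conjc_inv conjcK /cstar.
have h5 : conjc nu != 1 by apply: contra_neq h3 => e; rewrite -(conjcK nu) e; exact: rmorph1.
field.
by rewrite ?nu0 ?cn !subr_eq0 ?[1 == _]eq_sym ?h3 ?h5 ?nu0.
Qed.

Lemma P_real m : dom_P nu m -> dom_P nu (pstar m) /\
  forall p, U p -> P (pstar m) p = bar6 Q (P m p).
Proof.
have n0s := cstar_neq0 nu0; have h0 : (0 : C) != nu by rewrite eq_sym.
have h0' : (0 : C) != cstar nu by rewrite eq_sym.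
move=> /domP_cases[[z [-> h1 h2]]|->] /=; last first.
  split=> [|p _]; first by split=> -[] /esym/eqP; [exact/negP|exact/negP].
  by rewrite (P_some p h0 h0') P_none fP0_star (gam_bar fW foo_neq0 (I : setT p)).
case: eqP => [z0|/eqP z0]; first subst z.
  split=> [|p _]; first by split.
  by rewrite P_none (P_some p h0 h0') (gam_bar fW (fP_neq0 nu1 h0 h0') (I : setT p)) fP0_star cstarK.
have g1 : cstar z != nu by apply: contra_neq h2 => <-; rewrite cstarK.
have g2 : cstar z != cstar nu by apply: contra_neq h1 => e; rewrite -(cstarK z) e cstarK.
split=> [|p _]; first by split=> -[] /eqP; exact/negP.
by rewrite (P_some p g1 g2) (P_some p h1 h2) (gam_bar fW (fP_neq0 nu1 h1 h2) (I : setT p)) (fP_star nu0 nu1 z0 h1 h2).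
Qed.

Lemma derivable_mobius (a b e f z : C) : a * z + b != 0 -> e * z + f != 0 ->
  derivable ((fun w => (a * w + b) / (e * w + f)) : C1 -> C1) z 1.
Proof.
move=> h1 h2.
have D (x y : C) : derivable ((fun w => x * w + y) : C1 -> C1) z 1.
  exact: (@cderivD R _ _ z (@cderivM R _ _ z (@cderiv_cst R x z) (@cderiv_id R z)) (@cderiv_cst R y z)).
exact: (@cderivM R _ _ z (D a b) (@cderivV R _ z h2 (D e f))).
Qed.

Lemma Gam_mobius_hol (a b e f z : C) p i j : a * z + b != 0 -> e * z + f != 0 ->
  derivable ((fun w => Gam Q (wedgesp (W p) (W p)) (wedgesp (jimg Q (W p)) (jimg Q (W p)))
    ((a * w + b) / (e * w + f)) i j) : C1 -> C1) z 1.
Proof.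
move=> h1 h2; have [A [B [D E]]] := Gam_combination (hpr p).
have d1 := @derivable_mobius a b e f z h1 h2; have d2 := @derivable_mobius e f a b z h2 h1.
pose g1 := (fun w => (a * w + b) / (e * w + f)) : C1 -> C1.
pose g2 := (fun w => (e * w + f) / (a * w + b)) : C1 -> C1.
apply: (@derivable_fext R (fun w : C1 => (A i j : C1) + g1 w * (B i j : C1) + g2 w * (D i j : C1)) _ z) => [w|].
  by rewrite E !mxE invf_div.
have c1 := @cderivM R g1 (fun=> B i j) z d1 (@cderiv_cst R (B i j) z).
have c2 := @cderivM R g2 (fun=> D i j) z d2 (@cderiv_cst R (D i j) z).
have c3 := @cderivD R (fun=> A i j) (fun w => g1 w * (B i j : C1)) z (@cderiv_cst R (A i j) z) c1.
exact: (@cderivD R (fun w => (A i j : C1) + g1 w * (B i j : C1)) (fun w => g2 w * (D i j : C1)) z c3 c2).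
Qed.

Lemma open_neq (a : C) : open [set z : C1 | z != a].
Proof.
rewrite openE => z /= za; rewrite /interior.
have d0 : 0 < `|z - a| by rewrite normr_gt0 subr_eq0.
near=> w; apply/eqP => wa.
have : `|z - w| < `|z - a| by near: w; exact: cvgr_dist_lt d0.
by rewrite wa ltxx.
Unshelve. all: by end_near. Qed.

Lemma open_avoid2 (a b : C) : open [set z : C1 | z != a /\ z != b].
Proof.
suff -> : [set z : C1 | z != a /\ z != b] = [set z : C1 | z != a] `&` [set z : C1 | z != b].
  by apply: openI; exact: open_neq.
by apply/seteqP; split.
Qed.

Lemma P_dressing (h : C -> form1 Sg 6) : (forall z, is_form setT (h z)) ->
  hol_family setT [set z : C1 | z != 0] h -> form_eq setT (h 1) (@zero_form _ Sg 6) ->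
  (forall z, z != 0 -> z != nu -> z != cstar nu ->
     form_eq setT (h z) (gauge (gam pr (fP nu z)) (nabla z))) ->
  dressing_gauge Q U S nabla (dom_P nu) P h.
Proof.
move=> hf hh h1 he.
have n0s := cstar_neq0 nu0; have h3 := nu_neq1 nu1; have h4 := cstar_nu_neq1 nu1.
have a1 : 1 - nu != 0 by rewrite subr_eq0 eq_sym.
have a2 : 1 - cstar nu != 0 by rewrite subr_eq0 eq_sym.
have PE m p : P m p = Gam Q (wedgesp (W p) (W p)) (wedgesp (jimg Q (W p)) (jimg Q (W p)))
    match m with None => foo | Some z => ((1 - cstar nu) * (z - nu)) / ((1 - nu) * (z - cstar nu)) end.
  by rewrite /P_gauge conjsp6_wedgesp.
split.
- move=> m /domP_gam[f f0 Pf]; split=> [|p Up]; last by rewrite Pf; exact: (gam_orth fW f0 (I : setT p)).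
  apply: (smooth_on_sub subU); apply: (smooth_on_ext oT (fun x _ => esym (Pf x))).
  exact: (gam_smooth oT fW f).
- exists [set z : C1 | z != nu /\ z != cstar nu]; split; first exact: open_avoid2.
  + by rewrite /= ![0 == _]eq_sym.
  + by move=> z [/eqP e1 /eqP e2]; split=> -[].
  move=> p _ i j z [z1 z2].
  have := @Gam_mobius_hol (1 - cstar nu) (- ((1 - cstar nu) * nu)) (1 - nu) (- ((1 - nu) * cstar nu)) z p i j.
  rewrite -!mulrBr !mulf_neq0 ?subr_eq0 ?[1 == _]eq_sym// => /(_ isT isT).
  by apply: derivable_fext => w; rewrite PE -!mulrBr.
(* In the coordinate at infinity the scalar is again a Moebius function, whose value at 0 is the
   constant chosen for [None]. *)
- exists [set z : C1 | z != nu^-1 /\ z != (cstar nu)^-1]; split; first exact: open_avoid2.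
  + by split; rewrite eq_sym invr_eq0.
  + move=> z [e1 e2]; rewrite /Defs.pinv; case: ifP => _; first by split.
    by split=> -[] e; [move: e1; rewrite -e invrK eqxx|move: e2; rewrite -e invrK eqxx].
  move=> p _ i j z [z1 z2].
  have := @Gam_mobius_hol (- ((1 - cstar nu) * nu)) (1 - cstar nu) (- ((1 - nu) * cstar nu)) (1 - nu) z p i j.
  have E (x y : C) : - (x * y) * z + x = x * (1 - y * z) by ring.
  have nz y : y != 0 -> z != y^-1 -> 1 - y * z != 0.
    by move=> y0; apply: contra_neq => /eqP; rewrite subr_eq0 => /eqP e; rewrite -[RHS]mulr1 e mulKf.
  rewrite !E !mulf_neq0 ?nz// => /(_ isT isT).
  apply: derivable_fext => w; rewrite PE /Defs.pinv; have [->|w0] := eqVneq w 0.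
    by rewrite !mulr0 !add0r.
  congr (Gam _ _ _ _ i j).
  have E' (x y : C) : x * (w^-1 - y) = (- (x * y) * w + x) / w by field.
  by rewrite !E' invfM invrK mulrACA mulVf ?mulr1.
- exact: P_real.
- move=> z z0 /domP_cases[[_ [[<-] h5 h6]]|//] c p Up cp.
  rewrite (he z z0 h5 h6 c p I cp); apply: (gauge_at oU Up cp) => // x _.
  by rewrite P_some.
- by move=> z z0; exact: (is_form_sub subU (hf z)).
- by move=> c p _ cp; exact: hh.
- by move=> c p _ cp; exact: h1.
move=> p Up.
have hc := complementary_sym (complementary_splits (sphere_splits Sh_sphere Up)).
exact: (eq_ind_r (fun M => complementary Q M (mximg (P None p) (Vpp (S p))))
  (eq_ind_r (fun M => complementary Q (Vpm (Sh p)) M) hc (Poo_image Up)) (P0_image Up)).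
Qed.

Lemma P_dressed_sphere (Sh' : Sg -> 'M[C]_4) : (forall p, Sh' p = Sh p) -> dressed_sphere Q U S P Sh'.
Proof.
move=> /funext ->; split=> [|p Up]; first exact: Sh_sphere.
move=> hm hp; have e1 : hm = Vpm (Sh p) := P0_image Up; have e2 : hp = Vpp (Sh p) := Poo_image Up.
split; [|exact: (esym e1)|exact: (esym e2)].
by rewrite e1 e2 addvC; exact: (esym (perp_wedges (sphere_splits Sh_sphere Up))).
Qed.

End DressingGauge.

(** * The order of the pole *)

Section GaugedPole.
Variables (R : realType) (Q : quaternionic R) (Sg : riemannSurface R).
Local Notation C := R[i].
Local Notation C1 := (R[i]^o).
Implicit Types (c : chart Sg).

Lemma laurent_sq N M (phi : C -> C) : laurent N M phi ->
  exists M', laurent (2 * N) M' (fun z => phi (z ^+ 2)).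
Proof.
move=> [q _ qE]; exists (size (q \Po 'X^2)), (q \Po 'X^2) => // z z0.
by rewrite horner_comp hornerXn -qE ?expf_neq0// exprM.
Qed.

(** Only the existence of bounds is recorded; the orders at 0 and infinity are sharpened afterwards
    with the help of the determinant. *)
Definition elaur (f : C -> C) := exists N M, laurent N M f.
Definition emlaur m n (A : C -> 'M[C]_(m, n)) := forall i j, elaur (fun z => A z i j).

Lemma elaur_ext (f g : C -> C) : (forall z, z != 0 -> f z = g z) -> elaur f -> elaur g.
Proof. by move=> e [N [M h]]; exists N, M; exact: laurent_ext h. Qed.

Lemma elaurD (f g : C -> C) : elaur f -> elaur g -> elaur (fun z => f z + g z).
Proof. exact: laurent_exD. Qed.

Lemma elaurM (f g : C -> C) : elaur f -> elaur g -> elaur (fun z => f z * g z).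
Proof. by move=> [N [M h]] [N' [M' h']]; exists (N + N')%N, (M + M')%N; exact: laurentM. Qed.

Lemma elaur_sum (I : Type) (r : seq I) (F : I -> C -> C) : (forall k, elaur (F k)) ->
  elaur (fun z => \sum_(k <- r) F k z).
Proof.
move=> hF; elim: r => [|k r IH].
  by exists 0%N, 1%N; apply: laurent_ext (laurent_cst 0) => z _; rewrite big_nil.
by apply: elaur_ext (elaurD (hF k) IH) => z _; rewrite big_cons.
Qed.

Lemma emlaurM m n k (A : C -> 'M[C]_(m, n)) (B : C -> 'M[C]_(n, k)) :
  emlaur A -> emlaur B -> emlaur (fun z => A z *m B z).
Proof.
move=> hA hB i j.
apply: elaur_ext (elaur_sum (index_enum _) (fun l => elaurM (hA i l) (hB l j))) => z _.
by rewrite mxE.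
Qed.

Lemma emlaurD m n (A B : C -> 'M[C]_(m, n)) : emlaur A -> emlaur B -> emlaur (fun z => A z + B z).
Proof. by move=> hA hB i j; apply: elaur_ext (elaurD (hA i j) (hB i j)) => z _; rewrite mxE. Qed.

Lemma emlaurZ m n f (A : C -> 'M[C]_(m, n)) : elaur f -> emlaur A -> emlaur (fun z => f z *: A z).
Proof. by move=> hf hA i j; apply: elaur_ext (elaurM hf (hA i j)) => z _; rewrite mxE. Qed.

Lemma elaur_pol (f : C -> C) : pol f -> elaur f.
Proof. by move=> [M h]; exists 0%N, M. Qed.

Lemma emlaur_cst m n (M : 'M[C]_(m, n)) : emlaur (fun=> M).
Proof. by move=> i j; apply: elaur_pol; exact: pol_cst. Qed.

Lemma elaur_inv : elaur (fun z => z^-1).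
Proof. by exists 1%N, 1%N; exact: laurent_idV. Qed.

Lemma emlaur_lin m n r s (f : 'M[C]_(m, n) -> 'M[C]_(r, s)) (A : C -> 'M[C]_(m, n)) :
  (forall a X Y, f (a *: X + Y) = a *: f X + f Y) -> emlaur A -> emlaur (fun z => f (A z)).
Proof.
move=> lf hA a b.
apply: elaur_ext (elaur_sum (index_enum _) (fun i => elaur_sum (index_enum _) (fun j =>
  elaur_sum (index_enum _) (fun k => elaur_sum (index_enum _) (fun l =>
  emlaurZ (elaur_pol (pol_cst (f (delta_mx i j) k l))) (emlaurM (emlaurM (emlaur_cst (delta_mx k i)) hA)
    (emlaur_cst (delta_mx j l))) a b))))) => z _.
rewrite [in RHS](lin_expand lf (A z)) summxE; apply: eq_bigr => i _.
by rewrite summxE; apply: eq_bigr => j _; rewrite summxE; apply: eq_bigr => k _; rewrite summxE.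
Qed.

Lemma gauge_scale U c p n (a : C) (g : Sg -> 'M[C]_n) (w : form1 Sg n) : open U -> U p -> cdom c p ->
  smc c U g -> g p \in unitmx -> a != 0 -> gauge (fun x => a *: g x) w c p = gauge g w c p.
Proof.
move=> oU Up cp sg ug a0.
have iv : invmx (a *: g p) = a^-1 *: invmx (g p) by rewrite invmxZ// unitmxZ// unitfE.
have E (B D : 'M[C]_n) : (a *: g p) *m B *m invmx (a *: g p) - (a *: D) *m invmx (a *: g p) =
    g p *m B *m invmx (g p) - D *m invmx (g p).
  by rewrite iv -!scalemxAl -!scalemxAr !scalerA mulfV// !scale1r.
rewrite !gauge_parts !(wirtZ oU Up cp _ _ sg); exact: (congr2 pair (E _ _) (E _ _)).
Qed.

(** The common shape of [rz] and [rc], which lets the behaviour at 0 and at infinity be computed by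
    the same formulas. *)
Definition gmx (a b e t : C) (T h s : 'M[C]_4) : 'M[C]_4 :=
  a *: T + t *: ((b *: h + e *: (1%:M - h)) *m (b *: s + e *: (1%:M - s))).

Lemma wirt_gmx U c p ab (a b e t : C) (T h s : Sg -> 'M[C]_4) : open U -> U p -> cdom c p ->
  smc c U T -> smc c U h -> smc c U s ->
  wirt ab c (fun x => gmx a b e t (T x) (h x) (s x)) p =
  a *: wirt ab c T p + t *: ((b *: wirt ab c h p + e *: (- wirt ab c h p)) *m (b *: s p + e *: (1%:M - s p))
    + (b *: h p + e *: (1%:M - h p)) *m (b *: wirt ab c s p + e *: (- wirt ab c s p))).
Proof.
move=> oU Up cp sT sh ss; have s1 := smc_cst c U (1%:M : 'M[C]_4).
have sc (g : Sg -> 'M[C]_4) : smc c U g -> smc c U (fun x => b *: g x + e *: (1%:M - g x)).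
  by move=> sg; apply: (smcD oU (smcZ b oU sg)); apply: (smcZ e oU); exact: (smcB oU s1 sg).
have wc (g : Sg -> 'M[C]_4) : smc c U g ->
    wirt ab c (fun x => b *: g x + e *: (1%:M - g x)) p = b *: wirt ab c g p + e *: (- wirt ab c g p).
  move=> sg; have sB := smcB oU s1 sg.
  rewrite (wirtD oU Up cp ab (smcZ b oU sg) (smcZ e oU sB)) (wirtZ oU Up cp ab b sg) (wirtZ oU Up cp ab e sB).
  by rewrite (wirtB oU Up cp ab s1 sg) (wirt_cst c p) sub0r.
have sM := smcM oU (sc h sh) (sc s ss).
rewrite (wirtD oU Up cp ab (smcZ a oU sT) (smcZ t oU sM)) (wirtZ oU Up cp ab a sT) (wirtZ oU Up cp ab t sM).
by rewrite (wirtM oU Up cp ab (sc h sh) (sc s ss)) (wc h sh) (wc s ss).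
Qed.

Lemma smc_gmx U c (a b e t : C) (T h s : Sg -> 'M[C]_4) : open U ->
  smc c U T -> smc c U h -> smc c U s -> smc c U (fun x => gmx a b e t (T x) (h x) (s x)).
Proof.
move=> oU sT sh ss; have s1 := smc_cst c U (1%:M : 'M[C]_4).
have sc (g : Sg -> 'M[C]_4) : smc c U g -> smc c U (fun x => b *: g x + e *: (1%:M - g x)).
  by move=> sg; apply: (smcD oU (smcZ b oU sg)); apply: (smcZ e oU); exact: (smcB oU s1 sg).
by apply: (smcD oU (smcZ a oU sT)); apply: (smcZ t oU); exact: (smcM oU (sc h sh) (sc s ss)).
Qed.

(* The gauge transform by gmx becomes polynomial after multiplication by its determinant. *)
Lemma pol_gauge_gmx (a b e y : C -> C) (t : C) (B : C -> 'M[C]_4) (T h s dT dh ds : 'M[C]_4) i j :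
  pol a -> pol b -> pol e -> pol y -> mpol B ->
  pol (fun z => dwedgemx (gmx (a z) (b z) (e z) t T h s *m B z *m \adj (gmx (a z) (b z) (e z) t T h s)
    - y z *: ((a z *: dT + t *: ((b z *: dh + e z *: (- dh)) *m (b z *: s + e z *: (1%:M - s))
    + (b z *: h + e z *: (1%:M - h)) *m (b z *: ds + e z *: (- ds)))) *m
      \adj (gmx (a z) (b z) (e z) t T h s))) i j).
Proof.
move=> ha hb he hy hB.
have lc (u v : 'M[C]_4) : mpol (fun z => b z *: u + e z *: v).
  by apply: mpolD; apply: mpolZ => //; exact: mpol_cst.
have hg : mpol (fun z => gmx (a z) (b z) (e z) t T h s).
  apply: mpolD; first by apply: mpolZ => //; exact: mpol_cst.
  by apply: mpolZ; [exact: pol_cst|exact: (mpolM (lc _ _) (lc _ _))].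
have hd : mpol (fun z => a z *: dT + t *: ((b z *: dh + e z *: (- dh)) *m (b z *: s + e z *: (1%:M - s))
    + (b z *: h + e z *: (1%:M - h)) *m (b z *: ds + e z *: (- ds)))).
  apply: mpolD; first by apply: mpolZ => //; exact: mpol_cst.
  apply: mpolZ; first exact: pol_cst.
  by apply: mpolD; exact: (mpolM (lc _ _) (lc _ _)).
have hA := mpol_adj hg.
exact: (mpol_lin (@dwedgemx_linear R) (mpolB (mpolM (mpolM hg hB) hA) (mpolZ hy (mpolM hd hA))) i j).
Qed.

Lemma gauge_adj (n : nat) (g B D : 'M[C]_n) : g \in unitmx ->
  \det g *: (g *m B *m invmx g - D *m invmx g) = g *m B *m \adj g - D *m \adj g.
Proof.
move=> ug; have dg : \det g != 0 by move: ug; rewrite unitmxE unitfE.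
have -> : invmx g = (\det g)^-1 *: \adj g by rewrite /invmx ug.
by rewrite -!scalemxAr -scalerBr scalerA mulfV// scale1r.
Qed.

Lemma polynomial_pole k (q : {poly C}) (f : C -> C) : (size q <= k.+1)%N ->
  (forall z, z != 0 -> f z = q.[z]) -> exists F G : C1 -> C1,
  [/\ hol_on setT F, hol_on setT G, (forall z : C, z != 0 -> F z = f z) &
      (forall z : C, z != 0 -> G z = z ^+ k * F z^-1)].
Proof.
move=> sq e; exists (fun z => q.[z]), (fun z => (revp k q).[z]); split.
- by move=> z _; exact: (@derivable_poly R q z).
- by move=> z _; exact: (@derivable_poly R (revp k q) z).
- by move=> z z0; rewrite e.
by move=> z z0; exact: revpE.
Qed.

End GaugedPole.

Lemma dwedgemx_conj_adjZ (F : fieldType) (a : F) (A A' B B' M : 'M[F]_4) : A = A' -> B = B' ->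
  a *: dwedgemx (A *m M *m \adj A - B *m \adj A) =
  dwedgemx (A' *m (a *: M) *m \adj A' - a *: (B' *m \adj A')).
Proof. by move=> <- <-; rewrite -dwedgemxZ scalerBr -!scalemxAr -!scalemxAl. Qed.

Lemma dwedgemx_conj_adj (F : fieldType) (A A' B B' M : 'M[F]_4) : A = A' -> B = B' ->
  dwedgemx (A *m M *m \adj A - B *m \adj A) = dwedgemx (A' *m M *m \adj A' - 1 *: (B' *m \adj A')).
Proof. by move=> eA eB; have := dwedgemx_conj_adjZ 1 M eA eB; rewrite (scale1r M) (scale1r (dwedgemx _)). Qed.

Section DressedHarmonic.
Variables (R : realType) (Q : quaternionic R) (Sg : riemannSurface R).
Local Notation C := R[i].
Local Notation C1 := (R[i]^o).
Implicit Types (c : chart Sg).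

Let oT : open [set: Sg] := openT.

Variables (k : nat) (S : Sg -> 'M[C]_4) (d nabla : C -> form1 Sg 6).
Hypotheses (hd : twisted_harmonic Q setT k S d) (hn : untwisted Q setT S d nabla).
Variables (nu : C).
Hypotheses (nu0 : nu != 0) (nu1 : `|nu| != 1).
Variables (W : Sg -> {vspace 'cV[C]_4}) (pr : Sg -> 'M[C]_4).
Hypotheses (spr : smooth_on setT pr) (hpr : forall p, splits Q (pr p) (W p) (jimg Q (W p))).
Hypothesis wpar : parallel setT (form4 (nabla nu)) W.
Variables (X T : Sg -> 'M[C]_4).
Local Notation mu0 := ('i%C * ((nu + 1) / (nu - 1))).
Local Notation mu1 := ('i%C * ((cstar nu + 1) / (cstar nu - 1))).
Hypothesis hX : forall p, X p = mu0 *: pr p + mu1 *: (1%:M - pr p).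
Hypothesis hT : forall p, T p = X p - S p.
Local Notation U := [set p | T p \in unitmx].
Local Notation Sh := (fun p => T p *m S p *m invmx (T p)).
Local Notation ps := (fun p => prp (S p)).
Local Notation ph := (fun p => prp (Sh p)).

Let fW := W_field spr hpr.
Let SJ p : comm_j Q (S p). Proof. by have [[_ h] _ _] := th_sphere hd; exact: h. Qed.
Let SS p : S p *m S p = - 1%:M. Proof. by have [_ _ h] := th_sphere hd; exact: h. Qed.
Let oU : open U := U_open hd nu0 nu1 spr hpr hX hT.
Let hSh : sphere_bundle Q U Sh := Sh_sphere hd nu0 nu1 spr hpr hX hT.
Let hF := sphere_field oU hSh.
Let hS0 := sphere_field oT (th_sphere hd).
Let sT : smooth_on U T.
Proof. by apply: (smooth_on_sub (U := setT)) => //; have [] := T_section hd nu0 nu1 spr hpr hX hT. Qed.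
Let sS : smooth_on U ps. Proof. by apply: (smooth_on_sub (U := setT)) => //; exact: hS0.1. Qed.

Variable h4 : C -> form1 Sg 4.
Hypothesis h_ext : forall z, z != 0 -> z != nu -> z != cstar nu ->
  form_eq setT (up (h4 z)) (gauge (gam pr (fP nu z)) (nabla z)).
Hypothesis h_laur : forall c p i j, (exists N M, laurent N M (fun z => (h4 z c p).1 i j)) /\
  (exists N M, laurent N M (fun z => (h4 z c p).2 i j)).

(** The dressed family twisted back by the dressed sphere: [gam] at 1 / z undoes the untwisting at
    parameter z^2. *)
Definition dhat (z : C) : form1 Sg 6 := gauge (gam ph z^-1) (up (h4 (z ^+ 2))).

Lemma dhat_up z c p : z != 0 -> U p -> cdom c p ->
  dhat z c p = up (gauge (fun x => dilat z^-1 (ph x)) (h4 (z ^+ 2))) c p.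
Proof. by move=> z0 Up cp; exact: (gauge_gam_up oU hF (h4 (z ^+ 2)) (invr_neq0 z0) Up cp). Qed.

Section AtPoint.
Variables (c : chart Sg) (p : Sg).
Hypotheses (Up : U p) (cp : cdom c p).

Lemma dhat_laurent i j : elaur (fun z => (dhat z c p).1 i j).
Proof.
have cs (M : 'M[C]_4) := emlaur_cst M.
have id1 : elaur (fun z : C => z) by apply: elaur_pol; exact: pol_id.
have hA : emlaur (fun z => (h4 (z ^+ 2) c p).1).
  move=> a b; have [[N [M h]] _] := h_laur c p a b; have [M' h'] := laurent_sq h.
  by exists (2 * N)%N, M'.
have g1 : emlaur (fun z => dilat z^-1 (ph p)).
  by apply: emlaurD (cs _); exact: (emlaurZ (elaur_inv R) (cs _)).
have g2 : emlaur (fun z => dilat z (ph p)) by apply: emlaurD (cs _); exact: (emlaurZ id1 (cs _)).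
have hz : elaur (fun z : C => 1 - z^-1).
  by apply: elaurD; [exact: (elaur_pol (pol_cst 1))|apply: elaur_ext (elaurM (elaur_pol (pol_cst (-1))) (elaur_inv R)) => z _; rewrite mulN1r].
have hW := emlaurM (emlaurZ hz (cs (wirt wz c ph p))) g2.
have h := emlaur_lin (@dwedgemx_linear R) (emlaurD (emlaurM (emlaurM g1 hA) g2) hW).
apply: elaur_ext (h i j) => z z0.
have /smooth_onP sp := hF.1; have s1 := smc_cst c U (1%:M : 'M[C]_4).
have dd : wirt wz c (fun x => dilat z^-1 (ph x)) p = (z^-1 - 1) *: wirt wz c ph p.
  rewrite -(wirtZ oU Up cp wz (z^-1 - 1) (sp c)).
  rewrite -[RHS]addr0 -(wirt_cst c p wz (1%:M : 'M[C]_4)) -(wirtD oU Up cp wz (smcZ (z^-1 - 1) oU (sp c)) s1).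
  by apply: (wirt_ext oU Up cp) => x _; rewrite /dilat scalerBl scale1r addrAC -addrA.
have iv : invmx (dilat z^-1 (ph p)) = dilat z (ph p).
  by rewrite (dilat_field_inv hF (invr_neq0 z0) Up) invrK.
have E1 := congr1 fst (dhat_up z0 Up cp).
have E2 := congr1 fst (gauge_parts c p (fun x => dilat z^-1 (ph x)) (h4 (z ^+ 2))).
have E3 : dilat z^-1 (ph p) *m (h4 (z ^+ 2) c p).1 *m invmx (dilat z^-1 (ph p)) -
    wirt wz c (fun x => dilat z^-1 (ph x)) p *m invmx (dilat z^-1 (ph p)) =
    dilat z^-1 (ph p) *m (h4 (z ^+ 2) c p).1 *m dilat z (ph p) + (1 - z^-1) *: wirt wz c ph p *m dilat z (ph p).
  by rewrite iv dd -[1 - _]opprB scaleNr mulNmx.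
exact: (congr1 (fun M : 'M[C]_6 => M i j) (esym (etrans E1 (congr1 (fun X => dwedgemx X) (etrans E2 E3))))).
Qed.

(** Away from the poles three successive gauges, all induced from C^4, act on d^z. They multiply out
    by [rz_product], and the scalar denominator, being constant on the surface, drops. *)
Lemma dhat_good z : z != 0 -> z ^+ 2 != nu -> z ^+ 2 != cstar nu ->
  rz (S p) (T p) z \in unitmx /\
  dhat z c p = up (gauge (fun x => rz (S x) (T x) z) (form4 (d z))) c p.
Proof.
move=> z0 h1 h2; have z20 : z ^+ 2 != 0 by rewrite expf_neq0.
have f0 := fP_neq0 nu1 h1 h2; have b0 := betaP_neq0 nu1 h2.
pose B := form4 (d z); pose g1 x := dilat z^-1 (ph x); pose g2 x := dilat (fP nu (z ^+ 2)) (pr x).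
pose g3 x := dilat z (ps x).
have e0 : d z c p = up B c p by have [] := metric_up (th_metric hd z0) (I : setT p) cp.
have e1 : nabla (z ^+ 2) c p = up (gauge g3 B) c p.
  apply: etrans (untwisted_gam oT hd hn z0 (I : setT p) cp) _.
  apply: etrans (gauge_at oT (I : setT p) cp (fun x _ => erefl (gam ps z x)) e0) _.
  exact: (gauge_gam_up oT hS0 B z0 (I : setT p) cp).
have e2 : up (h4 (z ^+ 2)) c p = up (gauge g2 (gauge g3 B)) c p.
  apply: etrans (h_ext z20 h1 h2 (I : setT p) cp) _.
  apply: etrans (gauge_at oT (I : setT p) cp (fun x _ => erefl (gam pr (fP nu (z ^+ 2)) x)) e1) _.
  exact: (gauge_gam_up oT fW (gauge g3 B) f0 (I : setT p) cp).
have e3 : dhat z c p = up (gauge g1 (gauge g2 (gauge g3 B))) c p.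
  apply: etrans (gauge_at oU Up cp (fun x _ => erefl (gam ph z^-1 x)) e2) _.
  exact: (gauge_gam_up oU hF (gauge g2 (gauge g3 B)) (invr_neq0 z0) Up cp).
have s1 : smc c U g1 by have /smooth_onP := dilat_smooth oU hF z^-1; exact.
have s2 : smc c U g2.
  by have /smooth_onP := smooth_on_sub (fun x (_ : U x) => I) (dilat_smooth oT fW (fP nu (z ^+ 2))); exact.
have ss3 : smooth_on U g3.
  apply: (smooth_on_sub (U := setT)); [exact: (fun x (_ : U x) => I)|exact: (dilat_smooth oT hS0 z)].
have /(_ c) s3 := (smooth_onP U g3).1 ss3.
have u1 : g1 p \in unitmx by exact: (dilat_field_unit hF (invr_neq0 z0) Up).
have u2 : g2 p \in unitmx by exact: (dilat_field_unit fW f0 (I : setT p)).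
have u3 : g3 p \in unitmx by exact: (dilat_field_unit hS0 z0 (I : setT p)).
have u12 : g1 p *m g2 p \in unitmx by rewrite unitmx_mul u1 u2.
have pE x : U x -> g1 x *m g2 x *m g3 x = (betaP nu (z ^+ 2))^-1 *: rz (S x) (T x) z.
  by move=> Ux; exact: (rz_product nu1 (SJ x) (SS x) (hX x) (hT x) Ux z0 h2).
have bU : (betaP nu (z ^+ 2))^-1 \is a GRing.unit by rewrite unitfE invr_neq0.
have ur : rz (S p) (T p) z \in unitmx.
  rewrite -(unitmxZ (rz (S p) (T p) z) bU) -(pE p Up) unitmx_mul u12; exact: u3.
split; first exact: ur.
apply: etrans e3 _; apply: (congr1 (fun w => (dwedgemx w.1, dwedgemx w.2))).
apply: etrans (gauge_comp oU Up cp (gauge g3 B) s1 s2 u1 u2) _.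
apply: etrans (gauge_comp oU Up cp B (smcM oU s1 s2) s3 u12 u3) _.
apply: etrans (gauge_at oU Up cp pE (erefl (B c p))) _.
have sr : smc c U (fun x => rz (S x) (T x) z).
  have := smcZ (betaP nu (z ^+ 2)) oU (smcM oU (smcM oU s1 s2) s3).
  apply: (smc_ext oU) => x Ux _; rewrite (pE x Ux) scalerA (mulfV b0); exact: scale1r.
exact: (gauge_scale B oU Up cp sr ur (invr_neq0 b0)).
Qed.

Local Notation h0 := (T p *m prp (S p) *m invmx (T p)).
Let hx := fun x => T x *m prp (S x) *m invmx (T x).

Lemma rz_gmx x z : rz (S x) (T x) z = gmx (1 - z ^+ 2) 1 z (2 * 'i%C) (T x) (hx x) (prp (S x)).
Proof. by rewrite /rz /gmx !scale1r. Qed.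

Lemma rc_gmx x w : rc (S x) (T x) w = gmx (w ^+ 2 - 1) w 1 (2 * 'i%C) (T x) (hx x) (prp (S x)).
Proof. by rewrite /rc /gmx !scale1r. Qed.

Let scT : smc c U T. Proof. by move/smooth_onP: sT. Qed.
Let scS : smc c U ps. Proof. by move/smooth_onP: sS. Qed.
Let scH : smc c U hx.
Proof. by apply: (smcM oU (smcM oU scT scS)); exact: (smcV oU (fun x (Ux : U x) => Ux) scT). Qed.

(** The parameters z at which z^2 is nu or nu^*, the poles of the dressing gauge. *)
Definition bad_points : seq C := [:: sqrtc nu; - sqrtc nu; sqrtc (cstar nu); - sqrtc (cstar nu)].

Lemma good_point z : z \notin bad_points -> z ^+ 2 != nu /\ z ^+ 2 != cstar nu.
Proof.
rewrite !inE !negb_or => /and4P[a1 a2 a3 a4].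
split; [rewrite -(sqr_sqrtc nu)|rewrite -(sqr_sqrtc (cstar nu))]; rewrite eqf_sqr negb_or; exact/andP.
Qed.

(** Multiplication by the determinant of [rz] replaces the inverse by the adjugate, and the right
    side becomes visibly polynomial in z. *)
Lemma dhat_detE z : z != 0 -> z \notin bad_points -> forall i j,
  (dhat z c p).1 i j * (alphaP nu (z ^+ 2) * betaP nu (z ^+ 2)) ^+ 2 =
  dwedgemx (gmx (1 - z ^+ 2) 1 z (2 * 'i%C) (T p) (hx p) (prp (S p)) *m (form4 (d z) c p).1 *m
      \adj (gmx (1 - z ^+ 2) 1 z (2 * 'i%C) (T p) (hx p) (prp (S p)))
    - 1 *: (((1 - z ^+ 2) *: wirt wz c T p + (2 * 'i%C) *: ((1 *: wirt wz c hx p + z *: (- wirt wz c hx p)) *m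
        (1 *: prp (S p) + z *: (1%:M - prp (S p)))
      + (1 *: hx p + z *: (1%:M - hx p)) *m (1 *: wirt wz c ps p + z *: (- wirt wz c ps p)))) *m
      \adj (gmx (1 - z ^+ 2) 1 z (2 * 'i%C) (T p) (hx p) (prp (S p))))) i j.
Proof.
move=> z0 /good_point[h1 h2] i j; have [ur e] := dhat_good z0 h1 h2.
rewrite -(det_rz nu0 nu1 (hpr p) (SJ p) (SS p) (hX p) (hT p) Up z0 h2).
have E1 := congr1 fst e.
have E2 := congr1 fst (gauge_parts c p (fun x => rz (S x) (T x) z) (form4 (d z))).
have E3 : wirt wz c (fun x => rz (S x) (T x) z) p = wirt wz c (fun x => gmx (1 - z ^+ 2) 1 z (2 * 'i%C) (T x) (hx x) (prp (S x))) p.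
  by apply: (wirt_ext oU Up cp) => x _; exact: rz_gmx.
have E4 := gauge_adj (form4 (d z) c p).1 (wirt wz c (fun x => rz (S x) (T x) z) p) ur.
have E5 : \det (rz (S p) (T p) z) *: (dhat z c p).1 = dwedgemx (rz (S p) (T p) z *m (form4 (d z) c p).1 *m \adj (rz (S p) (T p) z)
    - wirt wz c (fun x => rz (S x) (T x) z) p *m \adj (rz (S p) (T p) z)).
  by rewrite -E4 dwedgemxZ; congr (_ *: _); exact: (etrans E1 (congr1 (fun X => dwedgemx X) E2)).
have scE a (M : 'M[C]_6) : M i j * a = (a *: M) i j by rewrite mxE mulrC.
apply: etrans (scE _ _) _.
have E6 := etrans E3 (wirt_gmx wz _ _ _ _ oU Up cp scT scH scS).
exact: (congr1 (fun M : 'M[C]_6 => M i j) (etrans E5 (dwedgemx_conj_adj _ (rz_gmx p z) E6))).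
Qed.

Lemma dhat_detE_inv w : w != 0 -> w^-1 \notin bad_points -> forall i j,
  w ^+ k * (dhat w^-1 c p).1 i j * (w ^+ 2 * alphaP nu (w ^- 2) * (w ^+ 2 * betaP nu (w ^- 2))) ^+ 2 =
  dwedgemx (gmx (w ^+ 2 - 1) w 1 (2 * 'i%C) (T p) (hx p) (prp (S p)) *m (w ^+ k *: (form4 (d w^-1) c p).1) *m
      \adj (gmx (w ^+ 2 - 1) w 1 (2 * 'i%C) (T p) (hx p) (prp (S p)))
    - w ^+ k *: (((w ^+ 2 - 1) *: wirt wz c T p + (2 * 'i%C) *: ((w *: wirt wz c hx p + 1 *: (- wirt wz c hx p)) *m
        (w *: prp (S p) + 1 *: (1%:M - prp (S p)))
      + (w *: hx p + 1 *: (1%:M - hx p)) *m (w *: wirt wz c ps p + 1 *: (- wirt wz c ps p)))) *m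
      \adj (gmx (w ^+ 2 - 1) w 1 (2 * 'i%C) (T p) (hx p) (prp (S p))))) i j.
Proof.
move=> w0 /good_point[h1 h2] i j; have z0 : w^-1 != 0 by rewrite invr_eq0.
have [ur e] := dhat_good z0 h1 h2; have rE x := rz_inv (S x) (T x) w0.
have w2 : w ^- 2 != 0 by rewrite invr_neq0// expf_neq0.
have uc : rc (S p) (T p) w \in unitmx by move: ur; rewrite rE unitmxZ// unitfE.
(* In size 4 the factor w^-2 between [rz] and [rc] changes the determinant by w^-8, which is spread
   as w^2 over the two squared factors. *)
have dE : \det (rc (S p) (T p) w) = (w ^+ 2 * alphaP nu (w ^- 2) * (w ^+ 2 * betaP nu (w ^- 2))) ^+ 2.
  have := det_rz nu0 nu1 (hpr p) (SJ p) (SS p) (hX p) (hT p) Up z0 h2.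
  rewrite rE detZ => e8; apply: (mulfI (expf_neq0 4 w2)); apply: etrans e8 _; rewrite exprVn.
  by move: (alphaP _ _) (betaP _ _) => a b; field.
rewrite -dE; have sc : smc c U (fun x => rc (S x) (T x) w).
  by apply: (smc_ext oU _ (smc_gmx (w ^+ 2 - 1) w 1 (2 * 'i%C) oU scT scH scS)) => x _ _; rewrite rc_gmx.
have e' : dhat w^-1 c p = up (gauge (fun x => rc (S x) (T x) w) (form4 (d w^-1))) c p.
  apply: etrans e _; apply: (congr1 (fun w => (dwedgemx w.1, dwedgemx w.2))).
  apply: etrans (gauge_at oU Up cp (fun x _ => rE x) (erefl _)) _.
  exact: (gauge_scale (form4 (d w^-1)) oU Up cp sc uc w2).
have E1 := congr1 fst e'.
have E2 := congr1 fst (gauge_parts c p (fun x => rc (S x) (T x) w) (form4 (d w^-1))).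
have E3 : wirt wz c (fun x => rc (S x) (T x) w) p = wirt wz c (fun x => gmx (w ^+ 2 - 1) w 1 (2 * 'i%C) (T x) (hx x) (prp (S x))) p.
  by apply: (wirt_ext oU Up cp) => x _; exact: rc_gmx.
have E4 := gauge_adj (form4 (d w^-1) c p).1 (wirt wz c (fun x => rc (S x) (T x) w) p) uc.
have E5 : \det (rc (S p) (T p) w) *: (dhat w^-1 c p).1 = dwedgemx (rc (S p) (T p) w *m (form4 (d w^-1) c p).1 *m \adj (rc (S p) (T p) w)
    - wirt wz c (fun x => rc (S x) (T x) w) p *m \adj (rc (S p) (T p) w)).
  by rewrite -E4 dwedgemxZ; congr (_ *: _); exact: (etrans E1 (congr1 (fun X => dwedgemx X) E2)).
have scE a b (M : 'M[C]_6) : a * M i j * b = (a *: (b *: M)) i j by rewrite !mxE; ring.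
apply: etrans (scE _ _ _) _.
have E6 := etrans E3 (wirt_gmx wz _ _ _ _ oU Up cp scT scH scS).
have E7 := congr1 (fun M : 'M[C]_6 => w ^+ k *: M) E5.
exact: (congr1 (fun M : 'M[C]_6 => M i j) (etrans E7 (dwedgemx_conj_adjZ (w ^+ k) _ (rc_gmx p w) E6))).
Qed.

(** The entries are Laurent polynomials in z. Multiplied by a determinant that is non-zero at 0 they
    become polynomial, so they have no pole at 0; the same argument in 1 / z bounds their degree by
    k. *)
Lemma dhat_pole i j : exists F G : C1 -> C1,
  [/\ hol_on setT F, hol_on setT G, (forall z : C, z != 0 -> F z = (dhat z c p).1 i j) &
      (forall z : C, z != 0 -> G z = z ^+ k * F z^-1)].
Proof.
have n1' : nu - 1 != 0 by rewrite subr_eq0; exact: nu_neq1.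
have s1' : cstar nu - 1 != 0 by rewrite subr_eq0; exact: cstar_nu_neq1.
have i0 := i_neq0 R; have n0s := cstar_neq0 nu0.
have t0 : 2 * 'i%C != 0 :> C by rewrite mulf_neq0 ?two_neq0.
have [d1 _] := d_laurent hd (I : setT p) cp.
have B1 : mlaur 0 k.+1 (fun z => (form4 (d z) c p).1) by exact: (mlaur_lin (@o2sl_linear R) d1).
have mB : mpol (fun z => (form4 (d z) c p).1) by move=> a b; exists k.+1; exact: B1.
have mB' : mpol (fun w => w ^+ k *: (form4 (d w^-1) c p).1).
  move=> a b; have [q sq qE] := laurent_inv (B1 a b) (leqnn k).
  by exists (size q), q => // w w0; rewrite expr0 mul1r mxE; exact: qE.
have p1 : pol (fun z : C => 1 - z ^+ 2).
  by apply: pol_ext (polD (pol_cst 1) (polM (pol_cst (-1)) (polX R 2))) => z _; rewrite mulN1r.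
have p2 : pol (fun z : C => z ^+ 2 - 1) by exact: (polD (polX R 2) (pol_cst (-1))).
(* The determinant of [rz] as a polynomial in z, non-zero at 0 because nu and nu^* are. [Do] below
   is its counterpart for [rc] and is likewise non-zero at 0. *)
pose D0 : {poly C} := ((2 * 'i%C / (nu - 1)) *: (nu%:P - 'X^2) * ((2 * 'i%C / (cstar nu - 1)) *: ((cstar nu)%:P - 'X^2))) ^+ 2.
have D0E z : D0.[z] = (alphaP nu (z ^+ 2) * betaP nu (z ^+ 2)) ^+ 2.
  rewrite /D0 horner_exp hornerM !hornerZ !hornerD !hornerN !hornerC hornerXn /alphaP /betaP. congr (_ ^+ 2).
  by congr (_ * _); rewrite mulrAC.
pose Do : {poly C} := ((2 * 'i%C / (nu - 1)) *: (nu *: 'X^2 - 1) * ((2 * 'i%C / (cstar nu - 1)) *: (cstar nu *: 'X^2 - 1))) ^+ 2.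
have DoE w : w != 0 -> Do.[w] = (w ^+ 2 * alphaP nu (w ^- 2) * (w ^+ 2 * betaP nu (w ^- 2))) ^+ 2.
  by move=> w0; rewrite /Do horner_exp hornerM !hornerZ !hornerD !hornerN !hornerZ !hornerC hornerXn /alphaP /betaP; congr (_ ^+ 2); field; rewrite n1' s1' w0.
have [N [M hL]] := dhat_laurent i j.
have pE := pol_gauge_gmx (2 * 'i%C) (T p) (hx p) (prp (S p)) (wirt wz c T p) (wirt wz c hx p) (wirt wz c ps p) i j
  p1 (pol_cst 1) (pol_id R) (pol_cst 1) mB.
have D00 : D0.[0] != 0.
  rewrite D0E expr0n /= /alphaP /betaP !subr0 expf_neq0//; move: (cstar nu) n0s s1' => ns n0s s1'.
  by rewrite !mulf_neq0 ?invr_neq0.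
have := @pole_at_zero R N M _ _ D0 bad_points hL pE D00.
move=> /(_ (fun z z0 zb => etrans (congr1 (fun y => _ * y) (D0E z)) (dhat_detE z0 zb i j)))/polP[q qE].
have pE' := pol_gauge_gmx (2 * 'i%C) (T p) (hx p) (prp (S p)) (wirt wz c T p) (wirt wz c hx p) (wirt wz c ps p) i j
  p2 (pol_id R) (pol_cst 1) (polX R k) mB'.
have Do0 : Do.[0] != 0.
  rewrite /Do horner_exp hornerM !hornerZ !hornerD !hornerN !hornerZ !hornerC hornerXn expr0n /= !mulr0 !sub0r expf_neq0//.
  move: (cstar nu) n0s s1' => ns n0s s1'.
  by rewrite !mulf_neq0 ?invr_neq0 ?oppr_eq0 ?oner_eq0.
have sq : (size q <= k.+1)%N.
  apply: (@pole_at_infinity R k q _ Do [seq x^-1 | x <- bad_points] pE' Do0) => w w0 wb.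
  have wb' : w^-1 \notin bad_points by rewrite -(mem_map (@invr_inj C)) invrK.
  have w0' : w^-1 != 0 by rewrite invr_eq0.
  by rewrite (DoE w w0) -(qE _ w0'); exact: dhat_detE_inv.
by have [F [G [h1 h2 h3 h5]]] := polynomial_pole sq qE; exists F, G.
Qed.

End AtPoint.
End DressedHarmonic.

Section DressedTwisted.
Variables (R : realType) (Q : quaternionic R) (Sg : riemannSurface R).
Local Notation C := R[i].
Local Notation C1 := (R[i]^o).

Variables (k : nat) (S : Sg -> 'M[C]_4) (d nabla : C -> form1 Sg 6).
Hypotheses (hd : twisted_harmonic Q setT k S d) (hn : untwisted Q setT S d nabla).
Variables (nu : C).
Hypotheses (nu0 : nu != 0) (nu1 : `|nu| != 1).
Variables (W : Sg -> {vspace 'cV[C]_4}) (pr : Sg -> 'M[C]_4).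
Hypotheses (spr : smooth_on setT pr) (hpr : forall p, splits Q (pr p) (W p) (jimg Q (W p))).
Hypothesis wpar : parallel setT (form4 (nabla nu)) W.
Variables (X T : Sg -> 'M[C]_4).
Local Notation mu0 := ('i%C * ((nu + 1) / (nu - 1))).
Local Notation mu1 := ('i%C * ((cstar nu + 1) / (cstar nu - 1))).
Hypothesis hX : forall p, X p = mu0 *: pr p + mu1 *: (1%:M - pr p).
Hypothesis hT : forall p, T p = X p - S p.
Local Notation U := [set p | T p \in unitmx].
Local Notation Sh := (fun p => T p *m S p *m invmx (T p)).
Local Notation ph := (fun p => prp (Sh p)).
Local Notation P := (P_gauge Q nu (fun p => wedgesp (W p) (W p))).

Lemma dressed_harmonic : is_dressing_gauge Q U S nabla (dom_P nu) P /\
  forall hnabla, dressing_gauge Q U S nabla (dom_P nu) P hnabla -> perturbed_harmonic Q U k Sh hnabla.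
Proof.
have oT : open [set: Sg] := openT.
have oU : open U := U_open hd nu0 nu1 spr hpr hX hT.
have hSh : sphere_bundle Q U Sh := Sh_sphere hd nu0 nu1 spr hpr hX hT.
have hF := sphere_field oU hSh.
have [h4 [hf hh hm hfl [h1 hr hext hl]]] := extended_family hd hn nu0 nu1 spr hpr wpar.
have hP := P_dressing hd nu0 nu1 spr hpr hX hT hf hh h1 hext.
split; first by exists (fun z => up (h4 z)).
have subU : U `<=` setT by [].
have cX n (z : C) : z ^+ n != 0 -> cstar z ^+ n = cstar (z ^+ n).
  by move=> _; rewrite /cstar exprVn -rmorphXn.
have ff z : is_form U (up (h4 z)) := is_form_sub subU (hf z).
have dp : is_form U (dform ph) := dform_Sh hd hn nu0 nu1 spr hpr wpar hX hT.
have hD : twisted_harmonic Q U k Sh (dhat S T h4).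
  have dE z c p : dhat S T h4 z c p = gauge (gam ph z^-1) (up (h4 (z ^+ 2))) c p by [].
  split; first exact: hSh.
  - by move=> z z0; exact: (is_form_gauge_gam oU hF dp (invr_neq0 z0) (ff _)).
  - move=> z z0; apply: (metric_gauge oU (gam_smooth oU hF z^-1) (fun x => gam_orth hF (invr_neq0 z0))).
    by move=> c p _ cp; exact: hm.
  - move=> z z0; apply: (flat_gauge_at oU (gam_smooth oU hF z^-1) (fun x => gam_unit hF (invr_neq0 z0)) (ff _)).
    by move=> c p _ cp; apply: hfl => //; rewrite expf_neq0.
  - move=> c p Up cp; rewrite dE invr1 expr1n.
    have e := gauge_gam1 ph oU (up (h4 1)) Up cp; exact: (etrans e (h1 c p I cp)).
  (* The reflection is [gam] at -1, and -1 times 1 / z is the inverse of - z, while z^2 is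
     unchanged. *)
  - move=> z z0 c p Up cp.
    apply: etrans (gauge_orefl oU hSh _ Up cp) _.
    apply: etrans (gauge_gam_comp oU hF _ _ (invr_neq0 z0) Up cp) _; first by rewrite oppr_eq0 oner_eq0.
    by rewrite dE mulN1r -invrN sqrrN.
  - move=> z z0 c p Up cp; have z2 : z ^+ 2 != 0 by rewrite expf_neq0.
    rewrite dE (cX _ _ z2) -(gauge_gam_conj oU hF _ (invr_neq0 z0) Up cp).
    apply: (gauge_at oU Up cp); last exact: hr.
    by move=> x _; rewrite /cstar fmorphV.
  by move=> c p Up cp i j; exact: (dhat_pole hd hn nu0 nu1 spr hpr hX hT hext hl).
(* A given extension agrees with the constructed one, so untwisting [dhat] returns it. *)
move=> hnab [_ _ _ _ ge _ gh _ _]; exists (dhat S T h4); split; first exact: hD.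
move=> z z0 c p Up cp; have z2 : z ^+ 2 != 0 by rewrite expf_neq0.
have hhU : hol_family U [set z : C1 | z != 0] (fun z => up (h4 z)) by move=> c' p' _; exact: hh.
have e : form_eq U (hnab (z ^+ 2)) (up (h4 (z ^+ 2))).
  apply: (extension_unique (nu := nu) gh hhU _ z2) => w w0 wn ws c' p' Up' cp'.
  have dw : dom_P nu (Some w) by split=> -[]; exact/eqP.
  rewrite (ge w w0 dw c' p' Up' cp') (hext w w0 wn ws c' p' I cp').
  exact: (gauge_at oU Up' cp' (fun x _ => P_some nu1 hpr x wn ws) (erefl (nabla w c' p'))).
rewrite (e c p Up cp); apply: esym.
apply: etrans (gauge_tau oU hSh _ z0 Up cp) _.
apply: etrans (gauge_gam_comp oU hF _ z0 (invr_neq0 z0) Up cp) _.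
rewrite mulfV; [|exact: z0]; exact: (gauge_gam1 ph oU _ Up cp).
Qed.

End DressedTwisted.

(** * Constrained Willmore surfaces *)

Section Owedge.
Variables (R : realType) (Q : quaternionic R).
Local Notation C := R[i].

Lemma owedge_mul (u v w : 'cV[C]_6) : owedge Q u v *m w = ip Q u w *: v - ip Q v w *: u.
Proof.
have e (a b : 'cV[C]_6) : a *m (b^T *m gram Q) *m w = ip Q b w *: a.
  by rewrite -mulmxA; apply/matrixP => i j; rewrite mxE big_ord1 (ord1 j) [RHS]mxE mulrC.
by rewrite /owedge mulmxBl !e.
Qed.

Lemma owedgevv (u : 'cV[C]_6) : owedge Q u u = 0.
Proof. by rewrite /owedge subrr. Qed.

Lemma owedgeC (u v : 'cV[C]_6) : owedge Q u v = - owedge Q v u.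
Proof. by rewrite /owedge opprB. Qed.

Lemma owedgeDr (u v w : 'cV[C]_6) : owedge Q u (v + w) = owedge Q u v + owedge Q u w.
Proof.
by rewrite /owedge mulmxDl linearD /= mulmxDl mulmxDr opprD addrACA.
Qed.

Lemma owedgeZr a (u v : 'cV[C]_6) : owedge Q u (a *: v) = a *: owedge Q u v.
Proof. by rewrite /owedge linearZ /= -!scalemxAl -scalemxAr scalerBr. Qed.

Lemma owedgeZl a (u v : 'cV[C]_6) : owedge Q (a *: u) v = a *: owedge Q u v.
Proof. by rewrite owedgeC owedgeZr -scalerN -owedgeC. Qed.

Lemma Adwedge_owedge A (u v : 'cV[C]_6) : Adwedge Q A (owedge Q u v) = owedge Q (A *m u) (A *m v).
Proof.
have e (a b : 'cV[C]_6) : A *m (a *m (b^T *m gram Q)) *m (invmx (gram Q) *m A^T *m gram Q) =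
    A *m a *m ((A *m b)^T *m gram Q).
  rewrite trmx_mul -!mulmxA; congr (_ *m (_ *m (_ *m _))).
  by rewrite !mulmxA mulmxV ?mul1mx// gram_unit.
by rewrite /Adwedge /owedge mulmxBr mulmxBl !e.
Qed.

Lemma AdwedgeZ A a (B : 'M[C]_6) : Adwedge Q A (a *: B) = a *: Adwedge Q A B.
Proof. by rewrite /Adwedge -scalemxAr -scalemxAl. Qed.

Lemma owedgesp_ind (E F : {vspace 'cV[C]_6}) (Pr : 'M[C]_6 -> Prop) : Pr 0 ->
  (forall a u v, Pr u -> Pr v -> Pr (a *: u + v)) ->
  (forall u v, u \in E -> v \in F -> Pr (owedge Q u v)) -> forall w, w \in owedgesp Q E F -> Pr w.
Proof.
move=> P0 Pl H; apply: span_ind => // w /allpairsP[[u v] [/= /vbasis_mem uE /vbasis_mem vF ->]].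
exact: H.
Qed.

Lemma owedgesp_line (s : 'cV[C]_6) (E : {vspace 'cV[C]_6}) B : B \in owedgesp Q <[s]>%VS E ->
  exists2 w, w \in E & B = owedge Q s w.
Proof.
move: B; apply: owedgesp_ind => [|a _ _ [u uE ->] [v vE ->]|u v /vlineP[a ->] vE].
- by exists 0; [exact: mem0v|rewrite -[X in owedge _ _ X](scale0r s) owedgeZr scale0r].
- by exists (a *: u + v); [rewrite memvD// memvZ|rewrite owedgeDr owedgeZr].
exists (a *: v); [exact: memvZ|exact: etrans (owedgeZl a s v) (esym (owedgeZr a s v))].
Qed.

(* The nilpotent of rank at most one corresponding to (a /\ v) /\ (a /\ w). *)
Definition rank1 (a v w : 'cV[C]_4) : 'M[C]_4 :=
  \matrix_(i, j) (det4 Q (delta_mx j 0) a v w * a i 0).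

Lemma rank1_mul a v w (y : 'cV[C]_4) : rank1 a v w *m y = det4 Q y a v w *: a.
Proof.
apply/matrixP => i j; rewrite (ord1 j) !mxE.
under eq_bigr do rewrite mxE mulrAC.
rewrite -big_distrl /=; congr (_ * _); rewrite sum4 !det4E !mxE /=; ring.
Qed.

Lemma rank1_tr a v w : \tr (rank1 a v w) = 0.
Proof. by rewrite /mxtrace sum4 !mxE !det4E !mxE /=; ring. Qed.

Lemma owedge_wedge a v w : owedge Q (wedge a v) (wedge a w) = dwedgemx (rank1 a v w).
Proof.
apply: eq_on_wedges => y z; rewrite owedge_mul !ip_wedge dwedgemx_wedge !rank1_mul wedgeZl wedgeZr.
apply/matrixP => e j; rewrite (ord1 j) !mxE !det4E.
move: (pa e) (pb e); do 2!apply: ord4_ind; ring.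
Qed.

Lemma o2sl_owedge a v w : o2sl (owedge Q (wedge a v) (wedge a w)) = rank1 a v w.
Proof.
rewrite owedge_wedge o2sl_dwedgemx ?two_neq0// rank1_tr mul0r.
by rewrite (_ : 0%:M = 0) ?addr0//; apply/matrixP => i j; rewrite !mxE mul0rn.
Qed.

Lemma det4_linear3 a b d k x y : det4 Q a b (k *: x + y) d = k * det4 Q a b x d + det4 Q a b y d.
Proof. by rewrite -!ip_wedge wedgeDl wedgeZl ipDr ipZr. Qed.

Lemma det4_shift a b x y k l m n : det4 Q b a (x - (k *: a + l *: b)) (y - (m *: a + n *: b)) = det4 Q b a x y.
Proof.
have e u k' l' : u - (k' *: a + l' *: b) = (- k') *: a + ((- l') *: b + u).
  by rewrite !scaleNr opprD addrC addrA.
have ha z : det4 Q b a a z = 0 by rewrite det4E; ring.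
have hb z : det4 Q b a b z = 0 by rewrite det4E; ring.
have hC u z : det4 Q b a u z = - det4 Q b a z u by rewrite !det4E; ring.
have h k' l' u z : det4 Q b a (u - (k' *: a + l' *: b)) z = det4 Q b a u z.
  by rewrite e !det4_linear3 (ha z) (hb z) !mulr0 !add0r.
by rewrite h hC h -hC.
Qed.

Lemma det4_plane z u w v1 v2 e : z \in <<[:: v1; v2]>>%VS -> u \in <<[:: v1; v2]>>%VS ->
  w \in <<[:: v1; v2]>>%VS -> det4 Q z e u w = 0.
Proof.
move=> /mem_span2[x1 [y1 ->]] /mem_span2[x2 [y2 ->]] /mem_span2[x3 [y3 ->]]; rewrite -ip_wedge.
have -> : wedge (x2 *: v1 + y2 *: v2) (x3 *: v1 + y3 *: v2) = (x2 * y3 - y2 * x3) *: wedge v1 v2.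
  rewrite !(wedgeDl, wedgeDr, wedgeZl, wedgeZr) !wedgevv !scaler0 addr0 add0r (wedgeC v2 v1).
  by rewrite !scalerN !scalerA -scalerBl mulrC.
rewrite wedgeDl !wedgeZl ipZr ipDl !ipZl !ip_wedge.
have -> : det4 Q v1 e v1 v2 = 0 by rewrite det4E; ring.
have -> : det4 Q v2 e v1 v2 = 0 by rewrite det4E; ring.
by rewrite !mulr0 addr0 mulr0.
Qed.

(** * Transport of an adapted frame by a projected dressing matrix *)

Section Transport.
Variables (a b v w : 'cV[C]_4) (T Y P : 'M[C]_4) (O : 'M[C]_6) (s : C).
Hypothesis nz : det4 Q a b v w != 0.
Hypotheses (uT : T \in unitmx) (uY : Y \in unitmx).
Hypotheses (Pa : P *m (T *m a) = T *m a) (Pb : P *m (T *m b) = T *m b).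
Hypotheses (Pv : P *m (T *m v) = 0) (Pw : P *m (T *m w) = 0).
Hypothesis hO : forall x y, O *m wedge x y =
  wedge (P *m x) ((1%:M - P) *m y) + wedge ((1%:M - P) *m x) (P *m y).
Hypotheses (Ya : Y *m a = T *m a) (Yb : Y *m b = T *m b).
Local Notation A := (O *m (s *: wedgemx Y)).
Local Notation p' y := ((1%:M - P) *m (Y *m y)).

Let nzT : det4 Q (T *m a) (T *m b) (T *m v) (T *m w) != 0.
Proof. by rewrite det4M mulf_neq0// -unitfE -unitmxE. Qed.

Let pT y : exists x1 x2 x3 x4, y = x1 *: (T *m a) + x2 *: (T *m b) + (x3 *: (T *m v) + x4 *: (T *m w)) /\
  P *m y = x1 *: (T *m a) + x2 *: (T *m b).
Proof.
have [x1 [x2 [x3 [x4 ->]]]] := frame4_span nzT y; exists x1, x2, x3, x4; split; first by rewrite addrA.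
by rewrite !mulmxDr -!scalemxAr Pa Pb Pv Pw !scaler0 !addr0.
Qed.

Lemma transport_mem y : p' y \in <<[:: T *m v; T *m w]>>%VS.
Proof.
have [x1 [x2 [x3 [x4 [-> e]]]]] := pT (Y *m y); apply/mem_span2; exists x3, x4.
rewrite mulmxBl mul1mx !mulmxDr -!scalemxAr Pa Pb Pv Pw !scaler0 !addr0.
have g (A B : 'cV[C]_4) : A + B - A = B by rewrite addrAC subrr add0r.
exact: g.
Qed.

(** [Y] agrees with T on the plane of a and b, and P projects onto the image of that plane. The
    projection O therefore leaves of a /\ y only T a wedged with the complementary part of Y y. The
    section serves at infinity and, with the eigenbundles exchanged, at 0. *)
Lemma transport_wedge y : A *m wedge a y = s *: wedge (T *m a) (p' y).
Proof.
rewrite -mulmxA -scalemxAl -scalemxAr wedgemx_wedge hO Ya Pa; congr (_ *: _).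
have -> : (1%:M - P) *m (T *m a) = 0 by rewrite mulmxBl mul1mx Pa subrr.
by rewrite wedge0l addr0.
Qed.

Lemma transport_image : s != 0 -> mximg A (wedgesp <[a]>%VS <<[:: v; w]>>%VS) =
  wedgesp <[T *m a]>%VS <<[:: T *m v; T *m w]>>%VS.
Proof.
move=> s0; apply: vspace_eq => x; split.
  move=> /mximgP[y]; move: y x; suff H y : y \in wedgesp <[a]>%VS <<[:: v; w]>>%VS ->
    A *m y \in wedgesp <[T *m a]>%VS <<[:: T *m v; T *m w]>>%VS by move=> y x /H + ->.
  move: y; apply: wedgesp_ind => [|k x y hx hy|x y /vlineP[k ->] yE]; first by rewrite mulmx0 mem0v.
    by rewrite mulmxDr -scalemxAr memvD// memvZ.
  rewrite wedgeZl -scalemxAr transport_wedge !memvZ// mem_wedgesp ?memv_line//.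
  exact: transport_mem.
move: x; apply: wedgesp_ind => [|k x y hx hy|x y /vlineP[k ->] yE]; first exact: mem0v.
  by rewrite memvD// memvZ.
(* A preimage of y is found from the v and w components of Y^-1 y: the other components are sent by
   [Y] to the range of P and disappear in the complementary part. *)
have [x1 [x2 [x3 [x4 e]]]] := frame4_span nz (invmx Y *m y).
have ey : y = x1 *: (T *m a) + x2 *: (T *m b) + Y *m (x3 *: v + x4 *: w).
  rewrite -Ya -Yb !scalemxAr -!mulmxDr addrA -e mulmxA mulmxV// mul1mx.
  by [].
have py : P *m y = 0.
  by move: yE => /mem_span2[m [n ->]]; rewrite mulmxDr -!scalemxAr Pv Pw !scaler0 addr0.
have e' : y = p' (x3 *: v + x4 *: w).
  have : (1%:M - P) *m y = y by rewrite mulmxBl mul1mx py subr0.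
  rewrite {1}ey mulmxDr [X in X + _ = _](_ : _ = 0) ?add0r//.
  by rewrite mulmxBl mul1mx !mulmxDr -!scalemxAr Pa Pb subrr.
rewrite e' wedgeZl; have := transport_wedge (x3 *: v + x4 *: w).
move=> e2; have -> : wedge (T *m a) (p' (x3 *: v + x4 *: w)) = s^-1 *: (A *m wedge a (x3 *: v + x4 *: w)).
  by rewrite e2 scalerA mulVf// scale1r.
rewrite !memvZ// mem_mximg// mem_wedgesp ?memv_line//.
by apply/mem_span2; exists x3, x4.
Qed.

(** After moving T^-1 to the other side both endomorphisms take values in the line of T a. On the
    frame only b is not annihilated, and there s^2 det Y = 1 matches the two factors. *)
Lemma transport_rank1 : s ^+ 2 * \det Y = 1 ->
  Adwedge Q A (owedge Q (wedge a v) (wedge a w)) = dwedgemx (T *m rank1 a v w *m invmx T).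
Proof.
move=> sY; rewrite Adwedge_owedge !transport_wedge owedgeZl owedgeZr scalerA -expr2 owedge_wedge -dwedgemxZ.
congr (dwedgemx _); apply: (canRL (mulmxK uT)).
have vE : T *m v \in <<[:: T *m v; T *m w]>>%VS by apply/mem_span2; exists 1, 0; rewrite scale1r scale0r addr0.
have wE : T *m w \in <<[:: T *m v; T *m w]>>%VS by apply/mem_span2; exists 0, 1; rewrite scale1r scale0r add0r.
have E y : (s ^+ 2 *: rank1 (T *m a) (p' v) (p' w)) *m T *m y =
    (s ^+ 2 * det4 Q (T *m y) (T *m a) (p' v) (p' w)) *: (T *m a).
  by rewrite -mulmxA -scalemxAl rank1_mul scalerA.
have F y : T *m rank1 a v w *m y = det4 Q y a v w *: (T *m a) by rewrite -mulmxA rank1_mul scalemxAr.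
have pE y : exists k l, p' y = Y *m y - (k *: (T *m a) + l *: (T *m b)).
  have [x1 [x2 [x3 [x4 [_ e]]]]] := pT (Y *m y); exists x1, x2; by rewrite mulmxBl mul1mx e.
have eb : s ^+ 2 * det4 Q (T *m b) (T *m a) (p' v) (p' w) = det4 Q b a v w.
  have [k [l ->]] := pE v; have [m [n ->]] := pE w.
  by rewrite det4_shift -Ya -Yb det4M mulrA sY mul1r.
have mv := transport_mem v; have mw := transport_mem w.
apply: (frame4_eq nz); rewrite E F; congr (_ *: _).
- have h x y z : det4 Q x x y z = 0 by rewrite det4E; ring.
  by rewrite !h mulr0.
- exact: eb.
- by rewrite (det4_plane _ vE mv mw) mulr0 det4E; ring.
by rewrite (det4_plane _ wE mv mw) mulr0 det4E; ring.
Qed.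

End Transport.

(** A vector of the first space is a /\ (k v + l w); pairing with b /\ v annihilates the second
    space and detects l. *)
Lemma wedgesp_meet (a b v w : 'cV[C]_4) : det4 Q a b v w != 0 ->
  (wedgesp <[a]> <<[:: v; w]>> :&: wedgesp <[v]> <<[:: a; b]>>)%VS = <[wedge a v]>%VS.
Proof.
move=> nz; apply: vspace_eq => x; split; last first.
  have m1 (c d : 'cV[C]_4) : c \in <<[:: c; d]>>%VS by apply/mem_span2; exists 1, 0; rewrite scale1r scale0r addr0.
  move=> /vlineP[k ->]; rewrite memvZ// memv_cap; apply/andP.
  split; last rewrite wedgeC memvN; by apply: mem_wedgesp => //; exact: memv_line.
have H1 y : y \in wedgesp <[a]>%VS <<[:: v; w]>>%VS -> exists k l, y = k *: wedge a v + l *: wedge a w.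
  move: y; apply: wedgesp_ind => [|m _ _ [k1 [l1 ->]] [k2 [l2 ->]]|u y /vlineP[m ->] /mem_span2[k [l ->]]].
  - by exists 0, 0; rewrite !scale0r addr0.
  - by exists (m * k1 + k2), (m * l1 + l2); rewrite scalerDr !scalerDl !scalerA addrACA.
  by exists (m * k), (m * l); rewrite wedgeDr !wedgeZr !wedgeZl !scalerA ![_ * m]mulrC.
have H2 y : y \in wedgesp <[v]>%VS <<[:: a; b]>>%VS -> ip Q y (wedge b v) = 0.
  move: y; apply: wedgesp_ind => [|m u u' e e'|u y /vlineP[m ->] _]; first exact: ip0l.
    by rewrite ipDl ipZl e e' mulr0 addr0.
  by rewrite wedgeZl ipZl ip_wedge !det4_rep mulr0.
move=> /memv_capP[/H1[k [l ->]] /H2].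
rewrite ipDl !ipZl !ip_wedge det4_rep mulr0 add0r => /eqP; rewrite mulf_eq0.
have -> : det4 Q a w b v = det4 Q a b v w by rewrite !det4E; ring.
by rewrite (negbTE nz) orbF => /eqP ->; rewrite scale0r addr0 memvZ// memv_line.
Qed.

(** j has no eigenvector: j a = k a would give - a = |k|^2 a. *)
Lemma qj_free (a : 'cV[C]_4) k : qj Q a = k *: a -> a = 0.
Proof.
move=> e; have : - a = conjc k *: (k *: a) by rewrite -(qjK Q a) e qjZ e.
rewrite scalerA mulrC -sqr_normc => /eqP; rewrite -subr_eq0 -scaleN1r -scalerBl scaler_eq0.
have h : 0 < 1 + `|k| ^+ 2 by rewrite ltr_wpDr// exprn_ge0.
by rewrite -opprD oppr_eq0 (gt_eqF h) => /eqP.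
Qed.

(** L is stable under S and j, so it contains an eigenvector a of S for i: project any non-zero
    vector, or apply j to it when the projection vanishes. Then a and j a span L. *)
Lemma central_frame (S : 'M[C]_4) (L : {vspace 'cV[C]_4}) : comm_j Q S -> S *m S = - 1%:M ->
  \dim L = 2%N -> jimg Q L = L -> mximg S L = L -> exists a b,
  [/\ det4 Q a b (qj Q a) (qj Q b) != 0, Sp S = <<[:: a; b]>>%VS, Sm S = <<[:: qj Q a; qj Q b]>>%VS,
      L = <<[:: a; qj Q a]>>%VS &
      (L :&: Sp S)%VS = <[a]>%VS /\ (L :&: Sm S)%VS = <[qj Q a]>%VS].
Proof.
move=> SJ SS dL jL SL; have sS := splits_sphere SJ SS; have jS := jimg_Sp SJ.
have SLm v : v \in L -> S *m v \in L by move=> vL; rewrite -SL mem_mximg.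
have jLm v : v \in L -> qj Q v \in L by rewrite -{2}jL mem_jimg qjK memvN.
have pL v : v \in L -> prp S *m v \in L.
  by move=> vL; rewrite /prp -scalemxAl mulmxBl mul1mx -scalemxAl memvZ// memvB// memvZ// SLm.
have [a aL [a0 aS]] : exists2 a, a \in L & a != 0 /\ a \in Sp S.
  have [v vL v0] : exists2 v, v \in L & v != 0.
    by exists (vpick L); [exact: memv_pick|rewrite vpick0 -dimv_eq0 dL].
  have [e|ne] := eqVneq (prp S *m v) 0.
    exists (qj Q v); first exact: jLm.
    split; first by apply: contra_neq v0 => e'; rewrite -[v]opprK -(qjK Q v) e' qj0 oppr0.
    have vm : v \in Sm S by rewrite (splits_memF sS) e.
    by rewrite -jS mem_jimg in vm.
  exists (prp S *m v); first exact: pL.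
  by split=> //; rewrite (splits_memE sS) mulmxA (splits_idem sS).
have jaS : qj Q a \in Sm S by rewrite -jS mem_jimg qjK memvN.
have fr : free [:: a; qj Q a].
  rewrite free_cons andbC; apply/andP; split.
    by rewrite seq1_free; apply: contra_neq a0 => e; rewrite -[a]opprK -(qjK Q a) e qj0 oppr0.
  apply: contra a0; rewrite span_seq1 => /vlineP[k e].
  apply/eqP; apply: (@qj_free a k^-1); rewrite {2}e scalerA.
  have [k0|k0] := eqVneq k 0; last by rewrite mulVf// scale1r.
  by rewrite e k0 scale0r qj0 scaler0.
have eL : L = <<[:: a; qj Q a]>>%VS.
  apply/esym/eqP; rewrite eqEdim (eqP fr) dL leqnn andbT; apply/span_subvP => v.
  by rewrite !inE => /orP[] /eqP -> //; exact: jLm.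
have [c2 [d2 [_ [_ [eS' _ _ _ _]]]]] := sS.
(* An exchange: one of the two vectors of a basis of S^+ is replaced by a. *)
have [b eb] : exists b, Sp S = <<[:: a; b]>>%VS.
  have h (E : {vspace 'cV[C]_4}) : Sp S = E -> a \in E by move=> <-; exact: aS.
  have /mem_span2[x [y ea]] := h _ eS'.
  have sub u v : (forall z, z \in [:: u; v] -> z \in <<[:: c2; d2]>>%VS) ->
      (forall z, z \in [:: c2; d2] -> z \in <<[:: u; v]>>%VS) -> Sp S = <<[:: u; v]>>%VS.
    move=> h1 h2; rewrite eS'; apply/eqP; rewrite eqEsubv; apply/andP.
    by split; apply/span_subvP.
  have [x0|x0] := eqVneq x 0.
    have y0 : y != 0 by apply: contra_neq a0 => y0; rewrite ea x0 y0 !scale0r addr0.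
    exists c2; apply: sub => z; rewrite !inE => /orP[] /eqP ->.
    - by apply/mem_span2; exists x, y.
    - by rewrite memv_span// inE eqxx.
    - by rewrite memv_span// !inE eqxx orbT.
    apply/mem_span2; exists y^-1, 0.
    by rewrite ea x0 scale0r add0r addr0 scalerA mulVf// scale1r.
  exists d2; apply: sub => z; rewrite !inE => /orP[] /eqP ->.
  - by apply/mem_span2; exists x, y.
  - by rewrite memv_span// !inE eqxx orbT.
  - apply/mem_span2; exists x^-1, (- (x^-1 * y)).
    by rewrite ea scalerDr !scalerA mulVf// scale1r scaleNr addrK.
  by rewrite memv_span// !inE eqxx orbT.
have ejb : Sm S = <<[:: qj Q a; qj Q b]>>%VS by rewrite -jS eb jimg_span2.
have full : (Sp S + jimg Q (Sp S))%VS = fullv.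
  apply: vspace_eq => v; split=> _; first exact: memvf.
  have -> : v = prp S *m v + (v - prp S *m v) by rewrite addrC subrK.
  rewrite jS; apply: memv_add.
    by rewrite (splits_memE sS) mulmxA (splits_idem sS); exact: eqxx.
  by rewrite (splits_memF sS) mulmxBr mulmxA (splits_idem sS) subrr; exact: eqxx.
exists a, b; split; [exact: quaternionic_frame_det full eb|exact: eb|exact: ejb|exact: eL|].
have pa : prp S *m a = a by apply/eqP; rewrite -(splits_memE sS); exact: aS.
have pja : prp S *m qj Q a = 0 by apply/eqP; rewrite -(splits_memF sS); exact: jaS.
split; apply: vspace_eq => v; split.
- move=> /memv_capP[]; rewrite eL (splits_memE sS) => /mem_span2[x [y ->]].
  by rewrite mulmxDr -!scalemxAr pa pja scaler0 addr0 => /eqP <-; exact: (memvZ x (memv_line a)).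
- by move=> /vlineP[k ->]; apply: memvZ; rewrite memv_cap aL; exact: aS.
- move=> /memv_capP[]; rewrite eL (splits_memF sS) => /mem_span2[x [y ->]].
  rewrite mulmxDr -!scalemxAr pa pja scaler0 addr0 => /eqP e1.
  by rewrite e1 add0r; exact: (memvZ y (memv_line (qj Q a))).
by move=> /vlineP[k ->]; apply: memvZ; rewrite memv_cap jaS andbT; exact: jLm.
Qed.

End Owedge.

Section ConstrainedWillmore.
Variables (R : realType) (Q : quaternionic R) (Sg : riemannSurface R).
Local Notation C := R[i].
Implicit Types (c : chart Sg).

Lemma smooth_wedge U (u v : Sg -> 'cV[C]_4) : open U -> smooth_on U u -> smooth_on U v ->
  smooth_on U (fun x => wedge (u x) (v x)).
Proof.
move=> oU su sv.
have st : smooth_on U (fun x => (v x)^T).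
  by apply: (smooth_on_lin (f := trmx)) oU sv => a X Y; rewrite linearP.
pose f (M : 'M[C]_4) : 'cV[C]_6 := \col_e (M (pa e) (pb e) - M (pb e) (pa e)).
have lf a X Y : f (a *: X + Y) = a *: f X + f Y by apply/matrixP => i j; rewrite !mxE; ring.
apply: (smooth_on_ext oU _ (smooth_on_lin lf oU (smooth_onM oU su st))) => x _.
by apply/matrixP => i j; rewrite !mxE !big_ord1 !mxE.
Qed.

Lemma mem_span3 (K : fieldType) (vT : vectType K) (a b e v : vT) : v \in <<[:: a; b; e]>>%VS ->
  exists x y z, v = x *: a + y *: b + z *: e.
Proof.
rewrite span_cons => /memv_addP[_ /vlineP[x ->] [_ /mem_span2[y [z ->]] ->]].
by exists x, y, z; rewrite addrA.
Qed.

Lemma owedge_swap (V : {vspace 'cV[C]_6}) B w : B \in owedgesp Q V (perp Q V) -> w \in V ->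
  B *m w \in perp Q V.
Proof.
move=> BV wV; move: B BV; apply: owedgesp_ind => [|a A B hA hB|u v uV vP].
- by rewrite mul0mx mem0v.
- by rewrite mulmxDl -scalemxAl memvD// memvZ.
move/perpP: (vP) => hv; rewrite owedge_mul [ip Q v w]ipC hv// scale0r subr0.
exact: memvZ.
Qed.

Section Derivatives.
Variables (c : chart Sg) (V : set Sg) (p : Sg).
Hypotheses (oV : open V) (Vp : V p) (cp : cdom c p).

Lemma wirt_ip0 ab (f h : Sg -> 'cV[C]_6) : smc c V f -> smc c V h -> (forall x, V x -> ip Q (f x) (h x) = 0) ->
  ip Q (wirt ab c f p) (h p) + ip Q (f p) (wirt ab c h p) = 0.
Proof.
move=> sf sh z.
have lt a (X Y : 'cV[C]_6) : (a *: X + Y)^T = a *: X^T + Y^T by rewrite linearP.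
have st := smc_lin lt oV sf; have sg := smcM oV st (smc_cst c V (gram Q)).
have := wirtM oV Vp cp ab sg sh; rewrite (wirtcM oV Vp cp ab (gram Q) st) (wirt_lin lt ab oV Vp cp sf).
have z' x : V x -> (f x)^T *m gram Q *m h x = 0.
  by move=> Vx; apply/matrixP => i j; rewrite !ord1 [RHS]mxE; exact: z.
rewrite (wirt_ext oV Vp cp ab z') wirt_cst => /(congr1 (fun M : 'M[C]_1 => M 0 0)).
by rewrite [LHS]mxE [RHS]mxE => e; apply: esym; exact: e.
Qed.

Lemma wirt_mul0 ab (M : Sg -> 'M[C]_6) (h : Sg -> 'cV[C]_6) : smc c V M -> smc c V h ->
  (forall x, V x -> M x *m h x = 0) -> wirt ab c M p *m h p + M p *m wirt ab c h p = 0.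
Proof.
by move=> sM sh z; rewrite -(wirtM oV Vp cp ab sM sh) (wirt_ext oV Vp cp ab z) wirt_cst.
Qed.

Lemma wirt_conj6 (s : Sg -> 'cV[C]_6) : smc c V s -> (forall x, V x -> conj6 Q (s x) = s x) ->
  wirt wzb c s p = conj6 Q (wirt wz c s p).
Proof.
move=> ss e; rewrite -(wirt_ext oV Vp cp wzb e) /conj6.
rewrite (wirtMc oV Vp cp wzb _ (smc_conj oV ss)); congr (_ *m _).
by have := dzb_conj oV Vp cp ss; rewrite dzE dzbE.
Qed.
End Derivatives.

(* The coefficient comparison: writing q^{1,0} = s /\ (x s_z + y s_zb) and
   q^{0,1} = s /\ (x' s_zb + y' s_z), the equation d^D q = 0 forces x = x' on
   s and x = - x' on the pair (s_zb, s_z). *)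
Lemma multiplier_coefficients (V : {vspace 'cV[C]_6}) (s sz sb szb sbb sbz szz : 'cV[C]_6)
  (B1 B2 N1 N2 Q1 Q2 : 'M[C]_6) (x y x' y' : C) :
  s \in V -> sz \in V -> sb \in V -> s != 0 -> ip Q sz sb != 0 ->
  N1 \in owedgesp Q V (perp Q V) -> N2 \in owedgesp Q V (perp Q V) ->
  Q1 = owedge Q s (x *: sz + y *: sb) -> Q2 = owedge Q s (x' *: sb + y' *: sz) ->
  ip Q s s = 0 -> ip Q s sz = 0 -> ip Q s sb = 0 -> ip Q sz sz = 0 -> ip Q sb sb = 0 ->
  ip Q sb sz + ip Q s szb = 0 -> ip Q sb sb + ip Q s sbb = 0 ->
  ip Q sz sb + ip Q s sbz = 0 -> ip Q sz sz + ip Q s szz = 0 ->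
  B1 *m s + Q1 *m sb = 0 -> B2 *m s + Q2 *m sz = 0 ->
  ip Q szb (Q1 *m sb) + ip Q sz (B1 *m sb + Q1 *m sbb) = 0 ->
  ip Q szz (Q2 *m sb) + ip Q sz (B2 *m sb + Q2 *m sbz) = 0 ->
  B2 + brk (- N1) Q2 - (B1 + brk (- N2) Q1) = 0 ->
  x = 0 /\ x' = 0.
Proof.
move=> sV zV bV s0 g0 hN1 hN2 eQ1 eQ2 i0 i1 i2 i3 i4 d1 d2 d3 d4 b1 b2 f1 f2 E.
set g := ip Q sz sb in g0 d3; have gC : ip Q sb sz = g by rewrite ipC.
have hp w u : w \in perp Q V -> u \in V -> ip Q w u = 0 by move=> /perpP h uV; rewrite ipC h.
have n1 u : u \in V -> N1 *m u \in perp Q V by exact: owedge_swap.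
have n2 u : u \in V -> N2 *m u \in perp Q V by exact: owedge_swap.
have q1 u : Q1 *m u = ip Q s u *: (x *: sz + y *: sb) - (x * ip Q sz u + y * ip Q sb u) *: s.
  by rewrite eQ1 owedge_mul ipDl !ipZl.
have q2 u : Q2 *m u = ip Q s u *: (x' *: sb + y' *: sz) - (x' * ip Q sb u + y' * ip Q sz u) *: s.
  by rewrite eQ2 owedge_mul ipDl !ipZl.
(* [N1] and [N2] send V into its orthogonal, which [Q1] and [Q2] annihilate; on V only one half of
   each bracket survives. *)
have k1 u : u \in perp Q V -> Q1 *m u = 0.
  move=> uP; rewrite q1 [ip Q s u]ipC [ip Q sz u]ipC [ip Q sb u]ipC !hp//.
  by rewrite !mulr0 addr0 !scale0r subrr.
have k2 u : u \in perp Q V -> Q2 *m u = 0.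
  move=> uP; rewrite q2 [ip Q s u]ipC [ip Q sz u]ipC [ip Q sb u]ipC !hp//.
  by rewrite !mulr0 addr0 !scale0r subrr.
have a1 : Q1 *m s = 0 by rewrite q1 i0 [ip Q sz s]ipC [ip Q sb s]ipC i1 i2 !mulr0 addr0 !scale0r subrr.
have a2 : Q2 *m s = 0 by rewrite q2 i0 [ip Q sz s]ipC [ip Q sb s]ipC i1 i2 !mulr0 addr0 !scale0r subrr.
have a3 : Q1 *m sb = - (x * g) *: s by rewrite q1 i2 i4 mulr0 addr0 scale0r add0r scaleNr.
have a4 : Q2 *m sb = - (y' * g) *: s by rewrite q2 i2 i4 mulr0 add0r scale0r add0r scaleNr.
have a5 : Q2 *m sz = - (x' * g) *: s by rewrite q2 i1 i3 gC mulr0 addr0 scale0r add0r scaleNr.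
have Eu u : u \in V -> B2 *m u - B1 *m u = N1 *m (Q2 *m u) - N2 *m (Q1 *m u).
  move=> uV; have := congr1 (fun M => M *m u) E; rewrite mul0mx /brk.
  rewrite !(mulmxDl, mulNmx, mulmxN) -!mulmxA (k2 _ (n1 u uV)) (k1 _ (n2 u uV)) !oppr0 !addr0.
  move=> e; apply/eqP; rewrite -subr_eq0 -e; apply/eqP/matrixP => i j; rewrite !mxE; ring.
(* Evaluation at [s], which both coefficients of q annihilate: the derivatives of these relations
   express [B1] and [B2] on [s] by [Q1] on [sb] and [Q2] on [sz]. *)
have e1 : x = x'.
  have := Eu s sV; rewrite a1 a2 !mulmx0 subrr => /eqP; rewrite subr_eq0 => /eqP e.
  have : (x' * g) *: s = (x * g) *: s.
    by move: b1 b2; rewrite e a3 a5 !scaleNr => /eqP; rewrite subr_eq0 => /eqP -> /eqP; rewrite subr_eq0 => /eqP ->.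
  move=> /eqP; rewrite -subr_eq0 -scalerBl scaler_eq0 (negbTE s0) orbF subr_eq0 => /eqP.
  by move/(mulIf g0).
(* Pairing with [sz], a vector of V, removes the terms with [N1] and [N2]. *)
have e2 : ip Q sz (B1 *m sb) = ip Q sz (B2 *m sb).
  have /eqP := Eu sb bV; rewrite a3 a4 -!scalemxAr => /eqP e; apply/esym/eqP; rewrite -subr_eq0.
  have -> : ip Q sz (B2 *m sb) - ip Q sz (B1 *m sb) = ip Q sz (B2 *m sb - B1 *m sb) by rewrite ipDr ipNr.
  by rewrite e ipDr ipNr !ipZr ![ip Q sz _]ipC !hp ?n1 ?n2// !mulr0 subrr.
have j1 : ip Q s szb = - g by apply/eqP; rewrite eq_sym -subr_eq0 -opprD oppr_eq0 -d1 gC.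
have j2 : ip Q s sbb = 0 by move: d2; rewrite i4 add0r.
have j3 : ip Q s sbz = - g by apply/eqP; rewrite eq_sym -subr_eq0 -opprD oppr_eq0 -d3.
have j4 : ip Q s szz = 0 by move: d4; rewrite i3 add0r.
have zs : ip Q sz s = 0 by rewrite ipC.
have l1 : ip Q sz (B1 *m sb) = - (x * g ^+ 2).
  move: f1; rewrite a3 ipZr [ip Q szb s]ipC j1 ipDr q1 j2 scale0r add0r ipNr ipZr zs mulr0 oppr0 addr0 => f.
  by apply/eqP; rewrite -subr_eq0 -f; apply/eqP; ring.
have l2 : ip Q sz (B2 *m sb) = x' * g ^+ 2.
  move: f2; rewrite a4 ipZr [ip Q szz s]ipC j4 mulr0 add0r ipDr q2 j3 ipDr ipNr !ipZr zs mulr0 subr0.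
  rewrite ipDr !ipZr i3 -/g mulr0 addr0 => f.
  by apply/eqP; rewrite -subr_eq0 -f; apply/eqP; ring.
have x0 : x = 0.
  have : (2 * g ^+ 2) * x = 0.
    by rewrite mulrC mulrA -[x * 2]mulrC; have := e2; rewrite l1 l2 -e1 => e; rewrite -mulrA mulr2n mulrDl !mul1r {1}e1; rewrite -e1 -{1}e addNr.
  move/eqP; rewrite mulf_eq0 mulf_eq0 (negbTE (two_neq0 R)) /= expf_eq0 (negbTE g0) => /orP[|/eqP //].
  by rewrite andbF.
by rewrite -e1 x0.
Qed.

End ConstrainedWillmore.

Lemma mem_wedgespZ (K : fieldType) (E F : {vspace 'cV[K]_4}) t u v :
  u \in E -> v \in F -> t *: wedge u v \in wedgesp E F.
Proof. by move=> uE vF; rewrite memvZ// mem_wedgesp. Qed.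

Lemma mem_wedgespD (K : fieldType) (E F : {vspace 'cV[K]_4}) t t' u v u' v' :
  u \in E -> v \in F -> u' \in E -> v' \in F -> t *: wedge u v + t' *: wedge u' v' \in wedgesp E F.
Proof. by move=> uE vF uE' vF'; rewrite memvD// mem_wedgespZ. Qed.

Section Multiplier.
Variables (R : realType) (Q : quaternionic R) (Sg : riemannSurface R).
Local Notation C := R[i].
Implicit Types (c : chart Sg).
Variables (S : Sg -> 'M[C]_4) (L : Sg -> {vspace 'cV[C]_4}).
Variables (E10 E1 : Sg -> {vspace 'cV[C]_6}) (N q : form1 Sg 6).
Hypothesis cw : constrained_willmore Q S L E10 E1 N q.
Local Notation Lam := (fun x => wedgesp (L x) (L x)).

Lemma surface_frame p : exists a b,
  [/\ det4 Q a b (qj Q a) (qj Q b) != 0, Sp (S p) = <<[:: a; b]>>%VS, Sm (S p) = <<[:: qj Q a; qj Q b]>>%VS,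
      L p = <<[:: a; qj Q a]>>%VS &
      (L p :&: Sp (S p))%VS = <[a]>%VS /\ (L p :&: Sm (S p))%VS = <[qj Q a]>%VS].
Proof.
have [[[_ SJ] _ SS] _ SL _ _] := cw_sphere cw.
apply: central_frame; [exact: SJ|exact: SS| |exact: (cw_jstable cw)|exact: SL].
have [M [t [_ Mp _ _ bt]]] := cw_bundle cw (I : setT p).
by rewrite (size_basis (bt p Mp)) card_ord.
Qed.

Lemma det4_ip (a b e f : 'cV[C]_4) : det4 Q a b e f = - ip Q (wedge a e) (wedge b f).
Proof. by rewrite ip_wedge !det4E; ring. Qed.

Lemma owedge_lift (a e f : 'cV[C]_4) k m n y :
  y *: owedge Q (k *: wedge a e) (m *: wedge a e + n *: wedge a f) =
  (y * (k * n)) *: owedge Q (wedge a e) (wedge a f).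
Proof.
by rewrite owedgeZl owedgeDr !owedgeZr owedgevv scaler0 add0r !scalerA mulrA.
Qed.

Lemma owedge_lift_swap (a b e : 'cV[C]_4) k m n y :
  y *: owedge Q (k *: wedge a e) (m *: wedge a e + n *: wedge b e) =
  (y * (k * n)) *: owedge Q (wedge e a) (wedge e b).
Proof.
have h (u : 'cV[C]_4) t : t *: wedge u e = (- t) *: wedge e u by rewrite (wedgeC u) scalerN scaleNr.
by rewrite !h owedge_lift mulrNN.
Qed.

Lemma lift_pairings (a b e f : 'cV[C]_4) k m n m' n' (s z w : 'cV[C]_6) : s = k *: wedge a e ->
  z = m *: wedge a e + n *: wedge b e -> w = m' *: wedge a e + n' *: wedge a f ->
  [/\ ip Q s s = 0, ip Q s z = 0, ip Q s w = 0, ip Q z z = 0 & ip Q w w = 0] /\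
  ip Q z w = n * n' * det4 Q a b e f.
Proof.
have l u v : ip Q (wedge a u) (wedge a v) = 0 by rewrite ip_wedge det4E; ring.
have r u v : ip Q (wedge u e) (wedge v e) = 0 by rewrite ip_wedge det4E; ring.
have h : ip Q (wedge b e) (wedge a f) = det4 Q a b e f by rewrite ip_wedge !det4E; ring.
by move=> -> -> ->; rewrite !(ipDl, ipDr, ipZl, ipZr) !l !r h !mulr0 !addr0 !add0r mulrA ?mulr0.
Qed.

Lemma wedge_qj_real (a : 'cV[C]_4) : conj6 Q (wedge a (qj Q a)) = wedge a (qj Q a).
Proof. by rewrite conj6_wedge qjK wedgeNr -wedgeC. Qed.

Lemma local_lift_exists p : exists M s, local_lift Q Lam M s /\ M p.
Proof.
have [M [t [oM Mp _ st bt]]] := cw_bundle cw (I : setT p).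
exists M, (fun x => wedge (t ord0 x) (qj Q (t ord0 x))); split=> //; split=> //.
  exact: (smooth_wedge oM (st ord0) (smooth_qj Q oM (st ord0))).
move=> x Mx; have tm : t ord0 x \in [seq t k x | k : 'I_2] by exact: fintype.image_f.
have tL : t ord0 x \in L x.
  by rewrite -(span_basis (bt x Mx)); exact: (memv_span tm).
have t0 : t ord0 x != 0 := free_not0 (basis_free (bt x Mx)) tm.
split; [|move: t0 tL|exact: wedge_qj_real].
  have h := mem_jimg Q (L x) (qj Q (t ord0 x)); rewrite (cw_jstable cw x) qjK memvN in h.
  by apply: (mem_wedgesp tL); rewrite h; exact: tL.
have [a [b [nz _ _ -> _]]] := surface_frame x.
move: (t ord0 x) => u u0 /mem_span2[m [n eu]].
(* For non-zero u the vector u /\ j u is a positive multiple of the generator of the line, so the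
   lift does not vanish. *)
have -> : wedge u (qj Q u) = (`|m| ^+ 2 + `|n| ^+ 2) *: wedge a (qj Q a).
  rewrite eu qjD !qjZ qjK !(wedgeDl, wedgeDr, wedgeZl, wedgeZr, wedgeNr) !wedgevv (wedgeC (qj Q a) a).
  by rewrite !scaler0 !oppr0 ?scaler0 !scalerN opprK !sqr_normc addr0 add0r scalerDl !scalerA.
rewrite scaler_eq0 negb_or; apply/andP; split.
  rewrite paddr_eq0 ?exprn_ge0// !expf_eq0 /= !normr_eq0; apply: contra u0 => /andP[/eqP m0 /eqP n0].
  by rewrite eu m0 n0 !scale0r addr0.
by apply: contra_neq nz => e; rewrite det4_ip e ip0l oppr0.
Qed.

(* Along a real lift, s_z lies in S^+ /\ L^- and s_zb in L^+ /\ S^-. *)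
Lemma lift_frame M s c x : local_lift Q Lam M s -> M x -> cdom c x -> exists a b m n k,
  [/\ [/\ det4 Q a b (qj Q a) (qj Q b) != 0, Sp (S x) = <<[:: a; b]>>%VS &
        Sm (S x) = <<[:: qj Q a; qj Q b]>>%VS], L x = <<[:: a; qj Q a]>>%VS,
      [/\ s x = k *: wedge a (qj Q a), k != 0 & n != 0],
      wirt wz c s x = m *: wedge a (qj Q a) + n *: wedge b (qj Q a) &
      wirt wzb c s x = conjc m *: wedge a (qj Q a) + conjc n *: wedge a (qj Q b)].
Proof.
move=> ls Mx cx; have [oM /smooth_onP ss sL] := ls; have [sx s0 sr] := sL x Mx.
have [a [b [nz eSp eSm eL [eLp eLm]]]] := surface_frame x.
have [e10 e1] := cw_osc cw ls Mx cx.
have [_ _ _ E10E _] := cw_sphere cw.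
have : dz c s x \in wedgesp (Sp (S x)) <[qj Q a]>%VS.
  have h : E10 x = wedgesp (Sp (S x)) <[qj Q a]>%VS by rewrite E10E eLm.
  by rewrite -h e10 memv_span// !inE eqxx orbT.
have -> : wedgesp (Sp (S x)) <[qj Q a]>%VS = wedgesp <<[:: a; b]>>%VS <[qj Q a]>%VS by rewrite eSp.
have H y : y \in wedgesp <<[:: a; b]>>%VS <[qj Q a]>%VS ->
    exists m n, y = m *: wedge a (qj Q a) + n *: wedge b (qj Q a).
  move: y; apply: wedgesp_ind => [|t _ _ [k1 [l1 ->]] [k2 [l2 ->]]|u y /mem_span2[k [l ->]] /vlineP[t ->]].
  - by exists 0, 0; rewrite !scale0r addr0.
  - by exists (t * k1 + k2), (t * l1 + l2); rewrite scalerDr !scalerDl !scalerA addrACA.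
  by exists (k * t), (l * t); rewrite wedgeDl !wedgeZl !wedgeZr !scalerA.
move=> /H[m [n edz]]; rewrite dzE in edz.
have edzb : wirt wzb c s x = conjc m *: wedge a (qj Q a) + conjc n *: wedge a (qj Q b).
  rewrite (wirt_conj6 (Q := Q) oM Mx cx (ss c)); last by move=> y /sL[].
  rewrite edz conj6D !conj6Z wedge_qj_real (conj6_wedge Q b) qjK wedgeNr.
  exact: (congr1 (fun u : 'cV[C]_6 => conjc m *: wedge a (qj Q a) + conjc n *: u) (esym (wedgeC a (qj Q b)))).
have [k es] : exists k, s x = k *: wedge a (qj Q a).
  have h : wedgesp (L x) (L x) = <[wedge a (qj Q a)]>%VS by rewrite eL wedgesp_sq.
  have sx' : s x \in <[wedge a (qj Q a)]>%VS by rewrite -h.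
  by have /vlineP[k ->] := sx'; exists k.
exists a, b, m, n, k; split; [split; [exact: nz|exact: eSp|exact: eSm]|exact: eL| |exact: edz|exact: edzb].
split; [exact: es| |].
  by apply: contra_neq s0 => k0; rewrite es k0 scale0r.
(* If n vanished, s and both its derivatives would lie in one line, against rank 3. *)
apply/eqP => n0; have [dE _] := cw_immersion cw x.
have ml t : t *: wedge a (qj Q a) \in <[wedge a (qj Q a)]>%VS := memvZ t (memv_line _).
have : (E1 x <= <[wedge a (qj Q a)]>)%VS.
  rewrite e1 dzE dzbE; apply/span_subvP => y; rewrite !inE => /or3P[] /eqP ->.
  - by rewrite es; exact: ml.
  - by rewrite edz n0 scale0r addr0; exact: ml.
  by rewrite edzb n0 conjc0 scale0r addr0; exact: ml.
by move=> /dimvS; rewrite dE dim_vline; case: (_ != 0).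
Qed.

(** With x = x' = 0, the (1,0)-part is along s /\ s_zb and the (0,1)-part along s /\ s_z. In the
    frame of [lift_frame] each becomes a multiple of a wedge of two vectors sharing a factor, the
    shape to which [rank1] applies. *)
Lemma multiplier_type c p : cdom c p -> exists a b y y',
  [/\ [/\ det4 Q a b (qj Q a) (qj Q b) != 0, Sp (S p) = <<[:: a; b]>>%VS &
        Sm (S p) = <<[:: qj Q a; qj Q b]>>%VS],
      (q c p).1 = y *: owedge Q (wedge a (qj Q a)) (wedge a (qj Q b)) &
      (q c p).2 = y' *: owedge Q (wedge (qj Q a) a) (wedge (qj Q a) b)].
Proof.
move=> cp; have [M [s [ls Mp]]] := local_lift_exists p.
have [oM /smooth_onP ss sL] := ls.
pose V := M `&` cdom c; have oV : open V by exact: chart_open.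
have Vp : V p by split.
have sV : smc c V s by rewrite smc_cdom.
have [[sq1 sq2] _] : (smooth_on (setT `&` cdom c) (fun p => (q c p).1) /\ smooth_on (setT `&` cdom c) (fun p => (q c p).2)) /\ True.
  by split=> //; have [h _] := cw_form cw; exact: h.
have subV : V `<=` [set: Sg] `&` cdom c by move=> x [_ cx]; split.
have s1 : smc c V (fun x => (q c x).1) by have /smooth_onP h := sq1; exact: smc_sub (h c).
have s2 : smc c V (fun x => (q c x).2) by have /smooth_onP h := sq2; exact: smc_sub (h c).
pose sz := wirt wz c s; pose sb := wirt wzb c s.
have ssz : smc c V sz by exact: smc_wirt.
have ssb : smc c V sb by exact: smc_wirt.
have nz3 (x t : C) : x != 0 -> t != 0 -> x * conjc x * t != 0 by move=> x0 t0; rewrite !mulf_neq0// conjc_eq0.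
have P x : V x -> [/\ [/\ ip Q (s x) (s x) = 0, ip Q (s x) (sz x) = 0, ip Q (s x) (sb x) = 0,
     ip Q (sz x) (sz x) = 0 & ip Q (sb x) (sb x) = 0], ip Q (sz x) (sb x) != 0,
     (exists u v, (q c x).1 = owedge Q (s x) (u *: sz x + v *: sb x)) &
     (exists u v, (q c x).2 = owedge Q (s x) (u *: sb x + v *: sz x))].
  move=> [Mx cx]; have [a [b [m [n [k [[nz _ _] eL [es k0 n0] ez eb]]]]]] := lift_frame ls Mx cx.
  have [h0 hg] := lift_pairings es ez eb.
  have w3 y : y \in E1 x -> exists u v w, y = w *: s x + u *: sz x + v *: sb x.
    have [_ ->] := cw_osc cw ls Mx cx; rewrite dzE dzbE => /mem_span3[w [u [v e]]]; exists u, v, w; exact: e.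
  have w4 B : B \in owedgesp Q (wedgesp (L x) (L x)) (E1 x) -> exists u v, B = owedge Q (s x) (u *: sz x + v *: sb x).
    have -> : wedgesp (L x) (L x) = <[s x]>%VS.
      by rewrite eL wedgesp_sq; apply: vspace_eq => y; rewrite es; split=> /vlineP[l ->];
        apply/vlineP; [exists (l / k)|exists (l * k)]; rewrite scalerA ?divfK.
    move=> /owedgesp_line[y /w3[u [v [w ->]]] ->]; exists u, v.
    by rewrite -addrA owedgeDr owedgeZr owedgevv scaler0 add0r.
  split; first exact: h0.
  - by rewrite hg; exact: (nz3 _ _ n0 nz).
  - by have [h _] := cw_val cw cx; exact: w4.
  by have [_ /w4[u [v ->]]] := cw_val cw cx; exists v, u; rewrite addrC.
have [a [b [m [n [k [[nz eSp eSm] eL [es k0 n0] ez eb]]]]]] := lift_frame ls Mp cp.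
have [[i0 i1 i2 i3 i4] g0 [x [y eQ1]] [x' [y' eQ2]]] := P p Vp.
have [_ NV _ _] := cw_N cw; have [hN1 hN2] := NV c p cp.
have aS : a \in Sp (S p) by rewrite eSp; apply/mem_span2; exists 1, 0; rewrite scale1r scale0r addr0.
have bS : b \in Sp (S p) by rewrite eSp; apply/mem_span2; exists 0, 1; rewrite scale1r scale0r add0r.
have jaS : qj Q a \in Sm (S p) by rewrite eSm; apply/mem_span2; exists 1, 0; rewrite scale1r scale0r addr0.
have jbS : qj Q b \in Sm (S p) by rewrite eSm; apply/mem_span2; exists 0, 1; rewrite scale1r scale0r add0r.
have sVp : s p \in Vof (S p) by rewrite es; exact: (mem_wedgespZ k aS jaS).
have szV : sz p \in Vof (S p) by rewrite /sz ez; exact: (mem_wedgespD m n aS jaS bS jaS).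
have sbV : sb p \in Vof (S p) by rewrite /sb eb; exact: (mem_wedgespD _ _ aS jaS aS jbS).
have [sx s0 _] := sL p Mp.
(* These four relations hold on the whole neighbourhood and not only at p, so they may be
   differentiated. *)
have q1s z : V z -> (q c z).1 *m s z = 0.
  move=> /P[[j0 j1 j2 _ _] _ [u [v ->]] _]; rewrite owedge_mul j0 ipDl !ipZl [ip Q (sz z) _]ipC [ip Q (sb z) _]ipC j1 j2.
  by rewrite !mulr0 addr0 !scale0r subrr.
have q2s z : V z -> (q c z).2 *m s z = 0.
  move=> /P[[j0 j1 j2 _ _] _ _ [u [v ->]]]; rewrite owedge_mul j0 ipDl !ipZl [ip Q (sz z) _]ipC [ip Q (sb z) _]ipC j1 j2.
  by rewrite !mulr0 addr0 !scale0r subrr.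
have q1z z : V z -> ip Q (sz z) ((q c z).1 *m sb z) = 0.
  move=> /P[[j0 j1 j2 _ _] _ [u [v ->]] _]; rewrite owedge_mul j2 scale0r add0r ipNr ipZr [ip Q (sz z) (s z)]ipC j1.
  by rewrite mulr0 oppr0.
have q2z z : V z -> ip Q (sz z) ((q c z).2 *m sb z) = 0.
  move=> /P[[j0 j1 j2 _ _] _ _ [u [v ->]]]; rewrite owedge_mul j2 scale0r add0r ipNr ipZr [ip Q (sz z) (s z)]ipC j1.
  by rewrite mulr0 oppr0.
have d1 := wirt_ip0 (Q := Q) oV Vp cp wzb sV ssz (fun z Vz => let: And4 (And5 _ h _ _ _) _ _ _ := P z Vz in h).
have d2 := wirt_ip0 (Q := Q) oV Vp cp wzb sV ssb (fun z Vz => let: And4 (And5 _ _ h _ _) _ _ _ := P z Vz in h).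
have d3 := wirt_ip0 (Q := Q) oV Vp cp wz sV ssb (fun z Vz => let: And4 (And5 _ _ h _ _) _ _ _ := P z Vz in h).
have d4 := wirt_ip0 (Q := Q) oV Vp cp wz sV ssz (fun z Vz => let: And4 (And5 _ h _ _ _) _ _ _ := P z Vz in h).
have b1 := wirt_mul0 oV Vp cp wzb s1 sV q1s.
have b2 := wirt_mul0 oV Vp cp wz s2 sV q2s.
have f1 := wirt_ip0 oV Vp cp wzb ssz (smcM oV s1 ssb) q1z.
have f2 := wirt_ip0 oV Vp cp wz ssz (smcM oV s2 ssb) q2z.
rewrite (wirtM oV Vp cp wzb s1 ssb) in f1; rewrite (wirtM oV Vp cp wz s2 ssb) in f2.
have E := cw_closed cw cp; rewrite /dcov dzE dzbE in E.
have [x0 x'0] := multiplier_coefficients sVp szV sbV s0 g0 hN1 hN2 eQ1 eQ2 i0 i1 i2 i3 i4 d1 d2 d3 d4 b1 b2 f1 f2 E.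
exists a, b, (y * (k * conjc n)), (y' * (k * n)); split; first (split; [exact: nz|exact: eSp|exact: eSm]).
  by rewrite eQ1 x0 scale0r add0r owedgeZr es /sb eb; exact: owedge_lift.
by rewrite eQ2 x'0 scale0r add0r owedgeZr es /sz ez; exact: owedge_lift_swap.
Qed.

End Multiplier.

(** * The dressing of a surface on a single fibre *)

Section PointwiseDressing.
Variables (R : realType) (Q : quaternionic R).
Local Notation C := R[i].

Lemma wedgesp_sym (K : fieldType) (E F : {vspace 'cV[K]_4}) : wedgesp E F = wedgesp F E.
Proof.
by apply/eqP; rewrite eqEsubv; apply/andP; split; apply: wedgesp_sub => u v uE vF;
  rewrite wedgeC memvN mem_wedgesp.
Qed.

Lemma mem_span2l (K : fieldType) (vT : vectType K) (u v : vT) : u \in <<[:: u; v]>>%VS.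
Proof. by rewrite memv_span// inE eqxx. Qed.

Lemma mem_span2r (K : fieldType) (vT : vectType K) (u v : vT) : v \in <<[:: u; v]>>%VS.
Proof. by rewrite memv_span// !inE eqxx orbT. Qed.

(** The exterior square scales the inner product by the determinant; one pair of wedges with
    non-zero product fixes the scale. *)
Lemma orth6_scaled (s : C) (Y : 'M[C]_4) a b e f : det4 Q a b e f != 0 -> orth6 Q (s *: wedgemx Y) ->
  s ^+ 2 * \det Y = 1.
Proof.
move=> nz /(_ (wedge a b) (wedge e f)); rewrite -!scalemxAl ipZl ipZr ip_wedgemx ip_wedge.
move: (det4 _ _ _ _ _) (\det Y) nz => t u nz h; apply: (mulIf nz); rewrite mul1r -[RHS]h; ring.
Qed.

Variables (nu : C) (W : {vspace 'cV[C]_4}) (P S X T : 'M[C]_4).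
Hypotheses (nu0 : nu != 0) (nu1 : `|nu| != 1).
Hypothesis hP : splits Q P W (jimg Q W).
Hypotheses (SJ : comm_j Q S) (SS : S *m S = - 1%:M).
Let mu0 : C := 'i%C * ((nu + 1) / (nu - 1)).
Let mu1 : C := 'i%C * ((cstar nu + 1) / (cstar nu - 1)).
Hypothesis hX : X = mu0 *: P + mu1 *: (1%:M - P).
Hypothesis hT : T = X - S.
Hypothesis uT : T \in unitmx.
Local Notation Sh := (T *m S *m invmx T).
Local Notation foo := ((1 - cstar nu) / (1 - nu)).

Lemma scaled_unit (s : C) (Y : 'M[C]_4) : s ^+ 2 * \det Y = 1 -> s != 0 /\ Y \in unitmx.
Proof.
move=> e; split.
  by apply: contra_eq_neq e => ->; rewrite expr0n mul0r eq_sym oner_eq0.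
by rewrite unitmxE unitfE; apply: contra_eq_neq e => ->; rewrite mulr0 eq_sym oner_eq0.
Qed.

(** The gauge at 0 and at infinity is a scaled exterior square of X + i and of X - i. All that is
    retained of the scalar is the normalisation forced by orthogonality. *)
Lemma P_scaled : (exists2 s, gam6 P (fP nu 0) = s *: wedgemx (T + (2 * 'i%C) *: prp S) &
    s ^+ 2 * \det (T + (2 * 'i%C) *: prp S) = 1) /\
  (exists2 s, gam6 P foo = s *: wedgemx (T - (2 * 'i%C) *: (1%:M - prp S)) &
    s ^+ 2 * \det (T - (2 * 'i%C) *: (1%:M - prp S)) = 1).
Proof.
have s0 : (0 : C) != cstar nu by rewrite eq_sym cstar_neq0.
have n0 : (0 : C) != nu by rewrite eq_sym.
have f0 := fP_neq0 nu1 n0 s0; have b0 := betaP_neq0 nu1 s0.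
have g0 : foo != 0 := foo_neq0 nu1.
have [a [b [e [f [_ _ nz _ _]]]]] := hP.
have h s Y z : z != 0 -> gam6 P z = s *: wedgemx Y -> s ^+ 2 * \det Y = 1.
  by move=> z0 E; apply: (orth6_scaled nz); rewrite -E; exact: (gam6_orth hP z0).
split.
  have E : gam6 P (fP nu 0) = ((fP nu 0)^-1 * (betaP nu 0)^-1 ^+ 2) *: wedgemx (T + (2 * 'i%C) *: prp S).
    by rewrite /gam6 (dilat_fP nu1 hX s0) /pz scale0r subr0 (XpE hT) wedgemxZ scalerA.
  by exists ((fP nu 0)^-1 * (betaP nu 0)^-1 ^+ 2); [exact: E|exact: h f0 E].
have E : gam6 P foo = (foo^-1 * ((cstar nu - 1) / (2 * 'i%C)) ^+ 2) *: wedgemx (T - (2 * 'i%C) *: (1%:M - prp S)).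
  by rewrite /gam6 (dilat_foo nu1 hX) (XmE hT) wedgemxZ scalerA.
by exists (foo^-1 * ((cstar nu - 1) / (2 * 'i%C)) ^+ 2); [exact: E|exact: h g0 E].
Qed.

Variables (a b e f : 'cV[C]_4).
Hypotheses (eSp : Sp S = <<[:: a; b]>>%VS) (eSm : Sm S = <<[:: e; f]>>%VS).
Hypothesis nz : det4 Q a b e f != 0.
Local Notation piV := (oproj Q (Vof Sh)).

Lemma prp_frame : [/\ prp S *m a = a, prp S *m b = b, prp S *m e = 0 & prp S *m f = 0].
Proof.
have sS := splits_sphere SJ SS.
have hE v : v \in Sp S -> prp S *m v = v by rewrite (splits_memE sS) => /eqP.
have hF v : v \in Sm S -> prp S *m v = 0 by rewrite (splits_memF sS) => /eqP.
by split; [apply: hE; rewrite eSp; exact: mem_span2l|apply: hE; rewrite eSp; exact: mem_span2r|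
  apply: hF; rewrite eSm; exact: mem_span2l|apply: hF; rewrite eSm; exact: mem_span2r].
Qed.

Lemma prp_Sh (v : 'cV[C]_4) : prp Sh *m (T *m v) = T *m (prp S *m v).
Proof. by rewrite (prpJ S uT) -!mulmxA mulKmx. Qed.

Let hO x y : piV *m wedge x y = wedge (prp Sh *m x) ((1%:M - prp Sh) *m y) + wedge ((1%:M - prp Sh) *m x) (prp Sh *m y).
Proof. exact: (oproj_splits (splits_sphere (Sh_comm_j nu0 nu1 hP SJ hX hT uT) (Sh_sq SS uT))). Qed.

Lemma dressed_pair_infinity :
  mximg (piV *m gam6 P foo) (wedgesp <[a]>%VS <<[:: e; f]>>%VS) = wedgesp <[T *m a]>%VS <<[:: T *m e; T *m f]>>%VS /\
  Adwedge Q (piV *m gam6 P foo) (owedge Q (wedge a e) (wedge a f)) = dwedgemx (T *m rank1 Q a e f *m invmx T).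
Proof.
have [_ [s -> sY]] := P_scaled; have [s0 uY] := scaled_unit sY; have [pa pb pe pf] := prp_frame.
have Pa : prp Sh *m (T *m a) = T *m a by rewrite prp_Sh pa.
have Pb : prp Sh *m (T *m b) = T *m b by rewrite prp_Sh pb.
have Pe : prp Sh *m (T *m e) = 0 by rewrite prp_Sh pe mulmx0.
have Pf : prp Sh *m (T *m f) = 0 by rewrite prp_Sh pf mulmx0.
have Y (v : 'cV[C]_4) : prp S *m v = v -> (T - (2 * 'i%C) *: (1%:M - prp S)) *m v = T *m v.
  by move=> h; rewrite mulmxBl -scalemxAl mulmxBl mul1mx h subrr scaler0 subr0.
split; first exact: (transport_image nz uT uY Pa Pb Pe Pf hO (Y _ pa) (Y _ pb) s0).
exact: (transport_rank1 nz uT Pa Pb Pe Pf hO (Y _ pa) (Y _ pb) sY).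
Qed.

(** The same transport with S^+ and S^- exchanged, possible because the projection onto the dressed
    V is symmetric in the two complementary projections. *)
Lemma dressed_pair_zero :
  mximg (piV *m gam6 P (fP nu 0)) (wedgesp <[e]>%VS <<[:: a; b]>>%VS) = wedgesp <[T *m e]>%VS <<[:: T *m a; T *m b]>>%VS /\
  Adwedge Q (piV *m gam6 P (fP nu 0)) (owedge Q (wedge e a) (wedge e b)) = dwedgemx (T *m rank1 Q e a b *m invmx T).
Proof.
have [[s -> sY] _] := P_scaled; have [s0 uY] := scaled_unit sY; have [pa pb pe pf] := prp_frame.
have c (v : 'cV[C]_4) : (1%:M - prp Sh) *m (T *m v) = T *m (v - prp S *m v) by rewrite mulmxBl mul1mx prp_Sh mulmxBr.
have Pa : (1%:M - prp Sh) *m (T *m a) = 0 by rewrite c pa subrr mulmx0.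
have Pb : (1%:M - prp Sh) *m (T *m b) = 0 by rewrite c pb subrr mulmx0.
have Pe : (1%:M - prp Sh) *m (T *m e) = T *m e by rewrite c pe subr0.
have Pf : (1%:M - prp Sh) *m (T *m f) = T *m f by rewrite c pf subr0.
have Y (v : 'cV[C]_4) : prp S *m v = 0 -> (T + (2 * 'i%C) *: prp S) *m v = T *m v.
  by move=> h; rewrite mulmxDl -scalemxAl h scaler0 addr0.
have hO' x y : piV *m wedge x y = wedge ((1%:M - prp Sh) *m x) ((1%:M - (1%:M - prp Sh)) *m y) +
    wedge ((1%:M - (1%:M - prp Sh)) *m x) ((1%:M - prp Sh) *m y) by rewrite subKr hO addrC.
have nz' : det4 Q e f a b != 0 by rewrite det4_swap.
split; first exact: (transport_image nz' uT uY Pe Pf Pa Pb hO' (Y _ pe) (Y _ pf) s0).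
exact: (transport_rank1 nz' uT Pe Pf Pa Pb hO' (Y _ pe) (Y _ pf) sY).
Qed.

Lemma o2sl_conj_rank1 u v w : o2sl (dwedgemx (T *m rank1 Q u v w *m invmx T)) = T *m rank1 Q u v w *m invmx T.
Proof.
rewrite o2sl_dwedgemx ?two_neq0// mxtrace_mulC mulKmx// rank1_tr mul0r.
by rewrite (_ : 0%:M = 0) ?addr0//; apply/matrixP => i j; rewrite !mxE mul0rn.
Qed.

End PointwiseDressing.

Section DressedSurface.
Variables (R : realType) (Q : quaternionic R) (Sg : riemannSurface R).
Local Notation C := R[i].

Variables (nu : C).
Hypotheses (nu0 : nu != 0) (nu1 : `|nu| != 1).
Variables (W : Sg -> {vspace 'cV[C]_4}) (pr : Sg -> 'M[C]_4).
Hypothesis hpr : forall p, splits Q (pr p) (W p) (jimg Q (W p)).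
Variables (S X T : Sg -> 'M[C]_4).
Local Notation mu0 := ('i%C * ((nu + 1) / (nu - 1))).
Local Notation mu1 := ('i%C * ((cstar nu + 1) / (cstar nu - 1))).
Hypothesis hX : forall p, X p = mu0 *: pr p + mu1 *: (1%:M - pr p).
Hypothesis hT : forall p, T p = X p - S p.
Local Notation U := [set p | T p \in unitmx].
Local Notation Sh := (fun p => T p *m S p *m invmx (T p)).
Local Notation P := (P_gauge Q nu (fun p => wedgesp (W p) (W p))).
Hypotheses (oU : open U) (sT : smooth_on U T).

Variables (L : Sg -> {vspace 'cV[C]_4}) (E10 E1 : Sg -> {vspace 'cV[C]_6}) (N q : form1 Sg 6).
Hypothesis cw : constrained_willmore Q S L E10 E1 N q.

Let SJ p : comm_j Q (S p). Proof. by have [[[_ h] _ _] _ _ _ _] := cw_sphere cw; exact: h. Qed.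
Let SS p : S p *m S p = - 1%:M. Proof. by have [[_ _ h] _ _ _ _] := cw_sphere cw; exact: h. Qed.
Let TJ p : comm_j Q (T p) := T_comm_j nu0 nu1 (hpr p) (@SJ p) (hX p) (hT p).

Lemma dressed_subbundle : subbundle U 2 (fun p => mximg (T p) (L p)).
Proof.
move=> p Up; have [M [t [oM Mp _ st bt]]] := cw_bundle cw (I : setT p).
have oMU : open (M `&` U) by exact: openI.
exists (M `&` U), (fun k x => T x *m t k x); split; [exact: oMU|by split|by move=> x []| |].
  move=> k; apply: (smooth_onM oMU).
    by apply: (smooth_on_sub _ sT) => x [].
  by apply: (smooth_on_sub _ (st k)) => x [].
move=> x [Mx Ux]; have := bt x Mx; rewrite !basisEdim => /andP[Lx dx].
have inj : lker (linfun (mulmx (T x) : 'cV[C]_4 -> 'cV[C]_4)) == 0%VS.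
  apply/lker0P => u v; rewrite !mulmx_lfunE => e.
  by rewrite -[u](mulKmx Ux) e mulKmx.
rewrite size_image card_ord in dx; apply/andP; split; last first.
  have e : \dim (mximg (T x) (L x)) = \dim (L x) by apply: limg_dim_eq; rewrite (eqP inj) capv0.
  by rewrite e size_image card_ord; exact: dx.
apply/subvP => _ /mximgP[v vL ->].
have : T x *m v \in mximg (T x) <<[seq t k x | k : 'I_2]>>%VS.
  by apply: mem_mximg; exact: (subvP Lx).
by rewrite mximg_span -map_comp.
Qed.

Lemma dressed_j_stable p : jimg Q (mximg (T p) (L p)) = mximg (T p) (L p).
Proof.
have jL v : v \in L p -> qj Q v \in L p.
  by have := mem_jimg Q (L p) (qj Q v); rewrite (cw_jstable cw p) qjK memvN => ->.
apply: vspace_eq => v; rewrite mem_jimg; split=> /mximgP[u uL e].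
  have -> : v = T p *m (- qj Q u) by rewrite mulmxN TJ -e qjK opprK.
  by apply: mem_mximg; rewrite memvN jL.
by rewrite e -TJ mem_mximg// jL.
Qed.

Let PE0 p : P (Some 0) p = gam6 (pr p) (fP nu 0).
Proof. by apply: (P_some nu1 hpr); rewrite eq_sym ?cstar_neq0. Qed.

Let PEoo p : P None p = gam6 (pr p) ((1 - cstar nu) / (1 - nu)).
Proof. exact: (P_none nu1 hpr). Qed.

(** In an adapted frame the two images are the planes of T j a wedged with T S^+ and of T a wedged
    with T S^-; they meet in the line of T a /\ T j a, the exterior square of TL. *)
Lemma dressed_surfaceP : dressed_surface Q U Sh P E10 (fun p => mximg (T p) (L p)).
Proof.
split; [exact: dressed_subbundle|by move=> p _; exact: dressed_j_stable|].
move=> p Up /=; rewrite PE0 PEoo.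
have [_ _ _ E10E E01E] := cw_sphere cw.
have [a [b [nz eSp eSm eL [eLp eLm]]]] := surface_frame cw p.
have [h1 _] := dressed_pair_infinity nu0 nu1 (hpr p) (@SJ p) (SS p) (hX p) (hT p) Up eSp eSm nz.
have [h2 _] := dressed_pair_zero nu0 nu1 (hpr p) (@SJ p) (SS p) (hX p) (hT p) Up eSp eSm nz.
have -> : conjsp6 Q (E10 p) = wedgesp <[a]>%VS <<[:: qj Q a; qj Q b]>>%VS by rewrite E01E eLp eSm.
have -> : E10 p = wedgesp <[qj Q a]>%VS <<[:: a; b]>>%VS by rewrite E10E eLm eSp wedgesp_sym.
have nzT : det4 Q (T p *m a) (T p *m b) (T p *m qj Q a) (T p *m qj Q b) != 0.
  by rewrite det4M mulf_neq0// -unitfE -unitmxE.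
have eT : mximg (T p) (L p) = <<[:: T p *m a; T p *m qj Q a]>>%VS.
  exact: (etrans (congr1 (mximg (T p)) eL) (mximg_span (T p) [:: a; qj Q a])).
apply: etrans (congr1 (fun E => wedgesp E E) eT) _; apply: etrans (wedgesp_sq _ _) _.
apply: etrans (esym (wedgesp_meet nzT)) _; apply: etrans (capvC _ _) _.
exact: (congr2 (fun A B => (A :&: B)%VS) (esym h2) (esym h1)).
Qed.

Lemma dressed_multiplierP : form_eq U (form4 (dressed_multiplier Q Sh P q)) (conj_by T (form4 q)).
Proof.
move=> c p Up cp; have [a [b [y [y' [[nz eSp eSm] e1 e2]]]]] := multiplier_type cw cp.
have [_ h1] := dressed_pair_infinity nu0 nu1 (hpr p) (@SJ p) (SS p) (hX p) (hT p) Up eSp eSm nz.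
have [_ h2] := dressed_pair_zero nu0 nu1 (hpr p) (@SJ p) (SS p) (hX p) (hT p) Up eSp eSm nz.
have H A (g : 'M[C]_6) t u v w : Adwedge Q A (owedge Q (wedge u v) (wedge u w)) =
    dwedgemx (T p *m rank1 Q u v w *m invmx (T p)) -> g = t *: owedge Q (wedge u v) (wedge u w) ->
    o2sl (Adwedge Q A g) = T p *m o2sl g *m invmx (T p).
  move=> hA ->; rewrite AdwedgeZ !o2slZ hA o2sl_owedge (o2sl_conj_rank1 Q Up).
  by rewrite -scalemxAr -scalemxAl.
apply: (congr2 pair).
  by apply: etrans (H _ _ _ _ _ _ h1 e1); rewrite -PEoo.
by apply: etrans (H _ _ _ _ _ _ h2 e2); rewrite -PE0.
Qed.

End DressedSurface.

Theorem theorem3p14 (R : realType) (Q : quaternionic R) (Sigma : riemannSurface R)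
  (k : nat) (S : Sigma -> 'M[R[i]]_4) (nabla : R[i] -> form1 Sigma 6)
  (hS : perturbed_harmonic Q setT k S nabla)
  (nu : R[i]) (hnu0 : nu != 0) (hnu1 : `|nu| != 1)
  (W : Sigma -> {vspace 'cV[R[i]]_4})
  (hWbundle : subbundle setT 2 W)
  (hWparallel : parallel setT (form4 (nabla nu)) W)
  (hWsum : forall p, (W p + jimg Q (W p))%VS = fullv)
  (hWcap : forall p, (W p :&: jimg Q (W p))%VS = 0%VS)
  (mu0 mu1 : R[i])
  (hmu0 : mu0 = 'i%C * ((nu + 1) / (nu - 1)))
  (hmu1 : mu1 = 'i%C * ((cstar nu + 1) / (cstar nu - 1)))
  (X : Sigma -> 'M[R[i]]_4)
  (hXW : forall p w, w \in W p -> X p *m w = mu0 *: w)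
  (hXjW : forall p w, w \in jimg Q (W p) -> X p *m w = mu1 *: w)
  (T : Sigma -> 'M[R[i]]_4) (hT : forall p, T p = X p - S p)
  (U : set Sigma) (hU : U = [set p | T p \in unitmx])
  (P : P1 R -> Sigma -> 'M[R[i]]_6)
  (hP : P = P_gauge Q nu (fun p => wedgesp (W p) (W p)))
  (Shat : Sigma -> 'M[R[i]]_4)
  (hShat : forall p, Shat p = T p *m S p *m invmx (T p)) :
  [/\ gl_section Q setT X, gl_section Q setT T & open U] /\
  [/\ is_dressing_gauge Q U S nabla (dom_P nu) P,
      dressed_sphere Q U S P Shat &
      forall hnabla, dressing_gauge Q U S nabla (dom_P nu) P hnabla ->
        perturbed_harmonic Q U k Shat hnabla] /\
  (forall (L : Sigma -> {vspace 'cV[R[i]]_4})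
      (Lam10 Lam1 : Sigma -> {vspace 'cV[R[i]]_6}) (N q : form1 Sigma 6),
    constrained_willmore Q S L Lam10 Lam1 N q ->
    untwisted Q setT S (cw_family N q) nabla ->
    dressed_surface Q U Shat P Lam10 (fun p => mximg (T p) (L p)) /\
    form_eq U (form4 (dressed_multiplier Q Shat P q)) (conj_by T (form4 q))).

Proof.
have [d [hd hn]] := hS.
have n1 : nu - 1 != 0 by rewrite subr_eq0; exact: nu_neq1.
have s1 : cstar nu - 1 != 0 by rewrite subr_eq0; exact: cstar_nu_neq1.
(* The eigenvalues of X differ because nu and nu^* do, so X determines the projection onto W. *)
have mu01 : mu0 - mu1 != 0.
  have ns : cstar nu - nu != 0 by rewrite subr_eq0 eq_sym; exact: nu_neq_cstar.
  have -> : mu0 - mu1 = 2 * 'i%C * (cstar nu - nu) / ((nu - 1) * (cstar nu - 1)).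
    rewrite hmu0 hmu1; move: ('i%C : R[i]) (cstar nu) s1 ns => i s s1 ns; field.
    by rewrite s1 n1.
  by rewrite !mulf_neq0 ?invr_neq0 ?mulf_neq0 ?two_neq0 ?i_neq0.
(* The projection onto W as the polynomial in X with value 1 at mu0 and 0 at mu1. *)
pose pr p := (mu0 - mu1)^-1 *: (X p - mu1%:M).
have hpr p : splits Q (pr p) (W p) (jimg Q (W p)).
  apply: (quaternionic_splits (hWsum p) (hWcap p)) => v vW;
    rewrite /pr -scalemxAl mulmxBl mul_scalar_mx.
    by rewrite (hXW p v vW) -scalerBl scalerA mulVf// scale1r.
  by rewrite (hXjW p v vW) subrr scaler0.
have spr : smooth_on setT pr := projection_smooth hWbundle hWsum hpr.
have hX p : X p = 'i%C * ((nu + 1) / (nu - 1)) *: pr p + 'i%C * ((cstar nu + 1) / (cstar nu - 1)) *: (1%:M - pr p).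
  rewrite -hmu0 -hmu1 scalerBr addrCA -scalerBl /pr scalerA mulfV// scale1r scalemx1.
  by rewrite addrC subrK.
have eS : Shat = fun p => T p *m S p *m invmx (T p) by apply/funext.
subst U P.
have TS := T_section hd hnu0 hnu1 spr hpr hX hT.
split; first by split; [exact: (X_section hnu0 hnu1 spr hpr hX)|exact: TS|exact: (U_open hd hnu0 hnu1 spr hpr hX hT)].
rewrite eS; split.
  have [h1 h2] := dressed_harmonic hd hn hnu0 hnu1 spr hpr hWparallel hX hT.
  split; [exact: h1| |exact: h2].
  exact: (P_dressed_sphere hd hnu0 hnu1 spr hpr hX hT (fun p => erefl _)).
move=> L Lam10 Lam1 N q cw _.
have sT : smooth_on [set p | T p \in unitmx] T.
  by apply: (smooth_on_sub _ TS.1) => x _.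
split; first exact: (dressed_surfaceP hnu0 hnu1 hpr hX hT (U_open hd hnu0 hnu1 spr hpr hX hT) sT cw).
exact: (dressed_multiplierP hnu0 hnu1 hpr hX hT cw).
Qed.
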